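(* For any $0\le s<3/2$ and any $\epsilon>0$, the perturbed 2D Euler system around the Couette flow on $\mathbb{T}\times\mathbb{R}$ admits a nontrivial traveling wave solution $\omega$ satisfying $$\|w+1\|_{H^s(\mathbb{T}\times\mathbb{R})}\equiv\|\omega\|_{H^s(\mathbb{T}\times\mathbb{R})}<\epsilon,$$ with $\omega\in C^\infty(\mathbb{T}\times\mathbb{R})$ compactly supported, and whose speed is of order $1$ with respect to $\epsilon$.
   Context: $\mathbb{T}=\mathbb{R}/2\pi\mathbb{Z}$. The perturbed 2D Euler system around the Couette flow (velocity $(y,0)$, vorticity $-1$) is: for the perturbation vorticity $\omega(x,y,t)$ on $\mathbb{T}\times\mathbb{R}$, $$\partial_t\omega+y\,\partial_x\omega+\mathbf u\cdot\nabla\omega=0,\qquad \mathbf u=\nabla^\perp\psi=(-\partial_y\psi,\partial_x\psi),$$ where $\psi(x,y,t)=\frac{1}{4\pi}\int_{\mathbb{T}\times\mathbb{R}}\log\big(\cosh(y-\bar y)-\cos(x-\bar x)\big)\,\omega(\bar x,\bar y,t)\,d\bar x\,d\bar y$ (so $\Delta\psi=\omega$); the total vorticity is $w=-1+\omega$. A traveling wave is a solution of the form $\omega(x,y,t)=\Omega(x+\lambda t,y)$ for a fixed profile $\Omega$ and speed $\lambda\in\mathbb{R}$; it is nontrivial if $\Omega$ depends on $x$. *)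

(* Defs.v *)
From HB Require Import structures.
From mathcomp Require Import all_boot all_order all_algebra.
From mathcomp Require Import all_classical all_reals all_analysis.
Set Implicit Arguments. Unset Strict Implicit. Unset Printing Implicit Defensive.
Import Order.TTheory GRing.Theory Num.Theory.
Import numFieldNormedType.Exports.
Local Open Scope classical_set_scope.
Local Open Scope ring_scope.

Section Defs.
Variable R : realType.

Local Notation leb := (@lebesgue_measure R).
Local Notation leb2 := (leb \x leb)%E.

Definition TR : set (R * R) := `[0, 2 * pi[%classic `*` setT.

(** functions on T x R, seen as 2pi-periodic functions in x on R x R *)
Definition periodic_x (f : R -> R -> R) : Prop :=
  forall x y, f (x + 2 * pi) y = f x y.

Definition dx (f : R -> R -> R) (x y : R) : R := derive1 (fun t => f t y) x.
Definition dy (f : R -> R -> R) (x y : R) : R := derive1 (fun t => f x t) y.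

Fixpoint iter_partial (l : seq bool) (f : R -> R -> R) : R -> R -> R :=
  match l with
  | [::] => f
  | b :: l' => if b then dx (iter_partial l' f) else dy (iter_partial l' f)
  end.

Definition smooth2 (f : R -> R -> R) : Prop :=
  forall (l : seq bool) (x y : R),
    derivable (fun t => iter_partial l f t y) x 1 /\
    derivable (fun t => iter_partial l f x t) y 1 /\
    {for (x, y), continuous (fun p : R * R => iter_partial l f p.1 p.2)}.

(** compact support in T x R (f periodic in x) *)
Definition compact_support_y (f : R -> R -> R) : Prop :=
  exists M : R, forall x y, M < `|y| -> f x y = 0.

Definition cosh (a : R) : R := (expR a + expR (- a)) / 2.

Definition stream (w : R -> R -> R) (x y : R) : R :=
  (4 * pi)^-1 * Rintegral leb2 TR
     (fun z : R * R => ln (cosh (y - z.2) - cos (x - z.1)) * w z.1 z.2).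

Definition euler_couette_solution (W : R -> R -> R -> R) : Prop :=
  let psi := fun t => stream (W t) in
  forall x y t,
    derivable (fun s => W s x y) t 1 /\
    derivable (fun s => W t s y) x 1 /\
    derivable (fun s => W t x s) y 1 /\
    derivable (fun s => psi t s y) x 1 /\
    derivable (fun s => psi t x s) y 1 /\
    derive1 (fun s => W s x y) t + y * dx (W t) x y
      + (- dy (psi t) x y) * dx (W t) x y + dx (psi t) x y * dy (W t) x y = 0.

Definition traveling (Om : R -> R -> R) (lam : R) : R -> R -> R -> R :=
  fun t x y => Om (x + lam * t) y.

(** Fourier coefficients on T x R:
    hat f(k, xi) = (2 pi)^-1 \int_{T x R} e^{-i (k x + xi y)} f(x,y) dx dy,
    given by its real part and (minus) imaginary part *)
Definition fourier_re (f : R -> R -> R) (k : int) (xi : R) : R :=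
  (2 * pi)^-1 * Rintegral leb2 TR (fun z : R * R => cos (k%:~R * z.1 + xi * z.2) * f z.1 z.2).
Definition fourier_im (f : R -> R -> R) (k : int) (xi : R) : R :=
  (2 * pi)^-1 * Rintegral leb2 TR (fun z : R * R => sin (k%:~R * z.1 + xi * z.2) * f z.1 z.2).

Definition Hs_mode (s : R) (f : R -> R -> R) (k : int) : \bar R :=
  (\int[leb]_(xi in setT)
     ((1 + k%:~R ^+ 2 + xi ^+ 2) `^ s * (fourier_re f k xi ^+ 2 + fourier_im f k xi ^+ 2))%:E)%E.

Definition Hs_norm2 (s : R) (f : R -> R -> R) : \bar R :=
  (\sum_(0 <= n <oo) Hs_mode s f (n%:Z) + \sum_(0 <= n <oo) Hs_mode s f (- (n.+1)%:Z))%E.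

End Defs.

(* Main.v *)
Require Import Defs.
From HB Require Import structures.
From mathcomp Require Import all_boot all_order all_algebra.
From mathcomp Require Import all_classical all_reals all_analysis.
From mathcomp Require Import measurable_realfun ring lra.
Import Order.TTheory GRing.Theory Num.Theory.
Import numFieldNormedType.Exports.
Local Open Scope classical_set_scope.
Local Open Scope ring_scope.

(** A traveling wave of speed 1 is sought in the form Om = - al d F(P), where F(t) = e^{-1/t} for t > 0 and
    F = 0 otherwise, and P = (psi - (y+1)^2/2) / d^2 up to a constant is the rescaled stream function seen
    from the moving frame; since Om is a function of P, the transport equation holds identically.  The
    equation stream(- al d F(P)) = d^2 P + (y+1)^2/2 + cst is solved by a contraction for the correction q
    in P = 1 + a cos x - (y+1)^2/(2 d^2) + q on the strip |y+1| <= 2 d, where for small d the kernel is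
    close to its trace - ln(2 - 2 cos x)/(4 pi).  The free parameters (the factor al and an additive
    constant) remove the neutral mode cos x and lower the norm of the kernel below 1, uniformly in d.
    Convolution with the kernel gains a derivative, so the solution is smooth, and d/dx, d d/dy cost at
    most an arbitrarily small negative power of d.  Hence |Om^(k,xi)|^2 (1 + k^6)(1 + (d xi)^4) is bounded
    by d^(4-), and for s < 3/2 the squared H^s norm is bounded by a positive power of d. *)

(** The exponent 3/2 is a matter of scaling: a vorticity of height d on a strip of width d has
    squared H^s norm of order d^(3 - 2 s). In the limit d -> 0 the equation lives on the circle: the
    trace kernel multiplies cos k x by 1/(2 k), the linearised bump contributes its mass n, and al n
    / 2 = 1 is the bifurcation condition for k = 1. As in a Lyapunov-Schmidt reduction the amplitude
    a is prescribed, independently of d, and al is solved for as a function of q. The modes k >= 2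
    are multiplied by 1/k <= 1/2, a contraction in L^2; but the nonlinearity acts pointwise and q
    has to be bounded, so the iteration runs in the sup norm, where the L^1 norm of the kernel
    divided by pi counts. Shifting - ell - cos by 1/2 makes it nonnegative, with L^1 norm exactly
    pi; a slightly smaller shift brings the norm below pi. All later constants must be uniform in d,
    since eps is reached through d alone: hence the families indexed by the width, and the kernel
    bounds with separated variables, whose exponents remain free. *)

Section IntReal.
Context {d} {T : measurableType d} {R : realType} {mu : {measure set T -> \bar R}} {D : set T}.
Hypothesis mD : measurable D.
Implicit Types f g : T -> R.
Lemma integrable_addR f g : mu.-integrable D (EFin \o f) -> mu.-integrable D (EFin \o g) ->
  mu.-integrable D (EFin \o (fun u => f u + g u)).
Proof.
move=> h1 h2; have -> : EFin \o (fun u => f u + g u) = ((EFin \o f) \+ (EFin \o g))%E by apply/funext.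
exact: integrableD.
Qed.
Lemma integrable_subR f g : mu.-integrable D (EFin \o f) -> mu.-integrable D (EFin \o g) ->
  mu.-integrable D (EFin \o (fun u => f u - g u)).
Proof.
move=> h1 h2; have -> : EFin \o (fun u => f u - g u) = ((EFin \o f) \- (EFin \o g))%E by apply/funext.
exact: integrableB.
Qed.
Lemma integrable_mulR (c : R) f : mu.-integrable D (EFin \o f) ->
  mu.-integrable D (EFin \o (fun u => c * f u)).
Proof.
move=> h1; have -> : EFin \o (fun u => c * f u) = (fun u => c%:E * (EFin \o f) u)%E by apply/funext.
exact: integrableZl.
Qed.
Lemma integrable_oppR f : mu.-integrable D (EFin \o f) ->
  mu.-integrable D (EFin \o (fun u => - f u)).
Proof.
move=> h1; have -> : EFin \o (fun u => - f u) = (\- (EFin \o f))%E by apply/funext.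
exact: integrableN.
Qed.
End IntReal.

Set Implicit Arguments.
Unset Strict Implicit.

(** * Differentiation rules in the form of [is_derive] *)

Section Dv.
Context {R : realType}.
Implicit Types (f g : R -> R) (x a b c : R).
Lemma isd_eq f x a b : is_derive x 1 f a -> a = b -> is_derive x 1 f b.
Proof. by move=> h <-. Qed.
Lemma isd_id x : is_derive x 1 (fun t : R => t) 1.
Proof. exact: is_derive_id. Qed.
Lemma isd_cst c x : is_derive x 1 (fun=> c : R) 0.
Proof. exact: is_derive_cst. Qed.
Lemma isdD f g x a b : is_derive x 1 f a -> is_derive x 1 g b ->
  is_derive x 1 (fun t => f t + g t) (a + b).
Proof. by move=> h1 h2; exact: (@is_deriveD _ _ _ f g). Qed.
Lemma isdN f x a : is_derive x 1 f a -> is_derive x 1 (fun t => - f t) (- a).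
Proof. by move=> h1; exact: (@is_deriveN _ _ _ f). Qed.
Lemma isdB f g x a b : is_derive x 1 f a -> is_derive x 1 g b ->
  is_derive x 1 (fun t => f t - g t) (a - b).
Proof. by move=> h1 h2; exact: (@is_deriveB _ _ _ f g). Qed.
Lemma isdM f g x a b : is_derive x 1 f a -> is_derive x 1 g b ->
  is_derive x 1 (fun t => f t * g t) (a * g x + f x * b).
Proof.
move=> h1 h2; apply: (@isd_eq _ _ (f x *: b + g x *: a)).
by rewrite /GRing.scale/= addrC (mulrC a).
Qed.
Lemma isdZ c f x a : is_derive x 1 f a -> is_derive x 1 (fun t => c * f t) (c * a).
Proof. by move=> h1; exact: (@is_deriveZ _ _ _ f). Qed.
Lemma isdZr c f x a : is_derive x 1 f a -> is_derive x 1 (fun t => f t * c) (a * c).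
Proof.
move=> h1; rewrite (_ : (fun t => f t * c) = (fun t => c * f t)); last first.
  by apply/funext => t; rewrite mulrC.
by rewrite mulrC; exact: isdZ.
Qed.
Lemma isd_comp f g x a b : is_derive (g x) 1 f a -> is_derive x 1 g b ->
  is_derive x 1 (fun t => f (g t)) (a * b).
Proof. by move=> h1 h2; exact: (@is_derive1_comp R f g x _ _ h1 h2). Qed.
Lemma isdV f x a : f x != 0 -> is_derive x 1 f a ->
  is_derive x 1 (fun t => (f t)^-1) (- (f x)^-2 * a).
Proof.
move=> f0 [h1 h2]; apply: DeriveDef; first exact: derivableV.
by rewrite deriveV// h2.
Qed.
Lemma isd_near f g x a : (\forall t \near x, f t = g t) -> is_derive x 1 f a -> is_derive x 1 g a.
Proof. exact: near_eq_is_derive. Qed.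
Lemma isd_derive1 f x a : is_derive x 1 f a -> derive1 f x = a.
Proof. by move=> h; rewrite derive1E; exact: (@derive_val _ _ _ _ _ _ _ h). Qed.
Lemma isd_derivable f x a : is_derive x 1 f a -> derivable f x 1.
Proof. by move=> h; exact: (@ex_derive _ _ _ _ _ _ _ h). Qed.
Lemma derivable_isd f x : derivable f x 1 -> is_derive x 1 f (derive1 f x).
Proof. by move=> h; rewrite derive1E; exact: derivableP. Qed.
Lemma near_dist x a : 0 < a -> \forall t \near x, `|t - x| < a.
Proof. by move=> a0; exists a => //= t /=; rewrite distrC. Qed.
Lemma near_lt x b : x < b -> \forall t \near x, t < b.
Proof.
move=> xb; have : 0 < b - x by rewrite subr_gt0.
by move=> /(near_dist x); apply: filterS => t; rewrite ltr_norml; lra.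
Qed.
Lemma near_gt x b : b < x -> \forall t \near x, b < t.
Proof.
move=> xb; have : 0 < x - b by rewrite subr_gt0.
by move=> /(near_dist x); apply: filterS => t; rewrite ltr_norml; lra.
Qed.
End Dv.
Unset Implicit Arguments.
Set Strict Implicit.

(** * Lebesgue integrals of periodic functions *)

Section LebAffine.
Context {R : realType}.
Local Notation leb := (@lebesgue_measure R).
Local Open Scope ereal_scope.

Lemma measurable_affine (a b : R) :
  measurable_fun setT ((fun t : R => (a * t + b)%R) : measurableTypeR R -> measurableTypeR R).
Proof. by apply: measurable_funD => //; exact: measurable_funM. Qed.

(** Uniqueness of Lebesgue measure: [a] times the pushforward under the affine map gives every
    interval []u, v]] its length. *)
Lemma ge0_integral_affine (a b : R) (f : R -> \bar R) : (0 < a)%R ->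
  measurable_fun setT f -> (forall t, 0 <= f t) ->
  a%:E * \int[leb]_t f (a * t + b)%R = \int[leb]_t f t.
Proof.
move=> a0 mf f0.
pose phi : measurableTypeR R -> measurableTypeR R := fun t => (a * t + b)%R.
have mphi : measurable_fun setT phi by exact: measurable_affine.
have a0' : (0 <= a)%R by exact: ltW.
pose nu' : {measure set (measurableTypeR R) -> \bar R} := mscale (NngNum a0') (pushforward leb phi).
pose nu := nu' mphi.
have E A : measurable A -> leb A = nu A.
  apply: lebesgue_measure_unique => _ [[u v]] _ <-/=.
  rewrite /mscale/= /pushforward.
  have -> : phi @^-1` [set` `]u, v]] = [set` `](u - b) / a, (v - b) / a]]%R.
    apply/seteqP; split => t /=; rewrite !in_itv/= /phi;
    by rewrite ltr_pdivrMr// ler_pdivlMr// (mulrC t) ltrBlDr lerBrDr.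
  rewrite !lebesgue_measure_itv/= !lte_fin ltr_pM2r ?invr_gt0// ltrD2r.
  case: ifPn => uv; last by rewrite mule0.
  by rewrite -!EFinB -EFinM; congr EFin; field; rewrite gt_eqF.
transitivity (\int[nu]_t f t); last first.
  by apply: eq_measure_integral => A mA _; exact/esym/E.
rewrite ge0_integral_mscale//=.
by rewrite ge0_integral_pushforward.
Qed.

Lemma ge0_integral_flip (c : R) (f : R -> \bar R) :
  measurable_fun setT f -> (forall t, 0 <= f t) ->
  \int[leb]_t f (c - t)%R = \int[leb]_t f t.
Proof.
move=> mf f0.
have mf2 : measurable_fun setT (fun t : R => f (1 * t + c)%R).
  by apply: measurableT_comp => //; exact: measurable_affine.
rewrite -(@ge0_integral_affine 1 c f)//= mul1e.
transitivity (\int[pushforward leb (-%R : _ -> measurableTypeR R)]_t f (1 * t + c)%R).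
  rewrite ge0_integral_pushforward//=.
  by apply: eq_integral => t _; rewrite /= mul1r addrC.
by apply: eq_measure_integral => A mA _; exact: lebesgue_measureN.
Qed.

Lemma ge0_integral_shift_itv (s u v : R) (f : R -> \bar R) :
  measurable_fun setT f -> (forall t, 0 <= f t) ->
  \int[leb]_(t in `[u, v[) f (t + s)%R = \int[leb]_(t in `[(u + s)%R, (v + s)%R[) f t.
Proof.
move=> mf f0; rewrite integral_mkcond [RHS]integral_mkcond.
rewrite -(@ge0_integral_affine 1 s (f \_ `[(u + s)%R, (v + s)%R[))//=; last 2 first.
- by apply/(measurable_restrictT f) => //; exact: measurable_funTS.
- by move=> t; rewrite patchE; case: ifP.
rewrite mul1e; apply: eq_integral => t _; rewrite !patchE mul1r.
suff -> : (t \in `[u, v[%classic) = ((t + s)%R \in `[(u + s)%R, (v + s)%R[%classic) by [].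
apply/idP/idP; rewrite !inE/= !in_itv/= lerD2r ltrD2r //.
Qed.

Lemma periodic_int (T : R) (f : R -> \bar R) :
  (forall t, f (t + T)%R = f t) -> forall (k : int) t, f (t + k%:~R * T)%R = f t.
Proof.
move=> fT.
have P (n : nat) t : f (t + n%:R * T)%R = f t.
  elim: n t => [|n IH] t; first by rewrite mul0r addr0.
  by rewrite -natr1 mulrDl mul1r addrA fT.
case=> n t; first exact: P.
by rewrite -(P n.+1 (t + _)%R) NegzE mulrNz mulNr subrK.
Qed.

(** Subtracting whole periods reduces to 0 <= c < T; the interval is then cut at T, and the piece
    beyond T is moved back by one period to fill the gap before c. *)
Lemma ge0_integral_period (T c : R) (f : R -> \bar R) : (0 < T)%R ->
  measurable_fun setT f -> (forall t, 0 <= f t) ->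
  (forall t, f (t + T)%R = f t) ->
  \int[leb]_(t in `[c, (c + T)%R[) f t = \int[leb]_(t in `[0%R, T[) f t.
Proof.
move=> T0 mf f0 fT.
pose k := Num.floor (c / T).
pose c' := (c - k%:~R * T)%R.
have cE : c = (c' + k%:~R * T)%R by rewrite /c' subrK.
have c'0 : (0 <= c')%R.
  by rewrite /c' subr_ge0 -ler_pdivlMr// /k; exact: floor_le.
have c'T : (c' < T)%R.
  have := floorD1_gt (c / T); rewrite -/k ltr_pdivrMr// intrD mulrDl mul1r => h.
  by rewrite /c' ltrBlDr addrC.
have E2 : (c + T = c' + T + k%:~R * T)%R by rewrite /c'; ring.
rewrite E2 [X in `[X, _[]cE -(@ge0_integral_shift_itv (k%:~R * T)%R c' (c' + T)%R f)//.
under eq_integral do rewrite periodic_int//.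
rewrite (@itv_bndbnd_setU _ _ (BLeft c') (BLeft T)) ?bnd_simp ?lerDr//; last exact: ltW.
rewrite ge0_integral_setU//=; last 2 first.
- exact: measurable_funTS.
- apply/disj_setPS => t [/=]; rewrite !in_itv/= => /andP[_ h1] /andP[h2 _].
  by move: (lt_le_trans h1 h2); rewrite ltxx.
rewrite -[X in `[X, (c' + T)%R[]add0r -ge0_integral_shift_itv//.
under [X in _ + X]eq_integral do rewrite fT.
rewrite addeC -ge0_integral_setU//=; last 2 first.
- exact: measurable_funTS.
- apply/disj_setPS => t [/=]; rewrite !in_itv/= => /andP[_ h1] /andP[h2 _].
  by move: (lt_le_trans h1 h2); rewrite ltxx.
by rewrite -itv_bndbnd_setU// ?bnd_simp// ltW.
Qed.

Lemma ge0_integral_period_flip (T x : R) (f : R -> \bar R) : (0 < T)%R ->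
  measurable_fun setT f -> (forall t, 0 <= f t) ->
  (forall t, f (t + T)%R = f t) ->
  \int[leb]_(t in `[0%R, T[) f (x - t)%R = \int[leb]_(t in `[0%R, T[) f t.
Proof.
move=> T0 mf f0 fT.
rewrite -(@ge0_integral_period T (x - T)%R f)// subrK.
(* The reflection exchanges the open and the closed end of the interval; the two boundary points are
   null. *)
rewrite [RHS]integral_itv_bndo_bndc; last exact: measurable_funTS.
rewrite -[RHS]integral_itv_obnd_cbnd; last exact: measurable_funTS.
rewrite integral_mkcond [RHS]integral_mkcond.
rewrite -[RHS](@ge0_integral_flip x)//=; last 2 first.
- by apply/(measurable_restrictT f) => //; exact: measurable_funTS.
- by move=> t; rewrite patchE; case: ifP.
apply: eq_integral => t _; rewrite !patchE.
suff -> : (t \in `[0%R, T[%classic) = ((x - t)%R \in `](x - T)%R, x]%classic) by [].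
by apply/idP/idP; rewrite !inE/= !in_itv/= ltrD2l ltrN2 gerBl => /andP[-> ->].
Qed.
End LebAffine.

Section Int2.
Context {R : realType}.
Local Notation leb := (@lebesgue_measure R).
Local Notation leb2 := (leb \x leb)%E.
Local Notation TRR := (@TR R).
Local Notation tpi := (2 * pi : R).
Local Notation I0 := (`[0%R, tpi[%classic : set R).

Lemma tpi_gt0 : 0 < tpi. Proof. by rewrite mulr_gt0// pi_gt0. Qed.

Lemma measurable_TR : measurable TRR.
Proof. by rewrite /TR; apply: measurableX. Qed.

Local Open Scope ereal_scope.

Lemma ge0_int_TR2 (f : R * R -> \bar R) : measurable_fun setT f ->
  (forall z, 0 <= f z) ->
  \int[leb2]_(z in TRR) f z = \int[leb]_y \int[leb]_(x in I0) f (x, y).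
Proof.
move=> mf f0.
have mg : measurable_fun setT (f \_ TRR).
  by apply/(measurable_restrictT f); [exact: measurable_TR|exact: measurable_funTS].
have g0 z : 0 <= (f \_ TRR) z by rewrite patchE; case: ifP.
rewrite integral_mkcond; apply: (etrans (@fubini_tonelli2 _ _ _ _ R leb leb (f \_ TRR) mg g0)).
apply: eq_integral => y _; rewrite /fubini_G [RHS]integral_mkcond.
apply: eq_integral => x _; rewrite !patchE.
suff -> : ((x, y) \in TRR) = (x \in I0) by [].
by apply/idP/idP; rewrite !inE /TR/= => // -[].
Qed.

Lemma ge0_flip2 (x y : R) (f : R * R -> \bar R) : measurable_fun setT f ->
  (forall z, 0 <= f z) -> (forall u w, f (u + tpi, w)%R = f (u, w)) ->
  \int[leb2]_(z in TRR) f (x - z.1, y - z.2)%R = \int[leb2]_(z in TRR) f z.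
Proof.
move=> mf f0 fp.
have mF : measurable_fun setT (fun z : R * R => f (x - z.1, y - z.2)%R).
  apply: measurableT_comp => //; apply/measurable_fun_pairP; split => /=.
    by apply: measurable_funB => //; exact: measurable_fst.
  by apply: measurable_funB => //; exact: measurable_snd.
rewrite ge0_int_TR2// ge0_int_TR2//=.
under eq_integral => w _.
  rewrite (@ge0_integral_period_flip _ tpi x (fun t => f (t, (y - w)%R)))//.
    over.
  exact: tpi_gt0.
  exact: measurableT_comp.
rewrite (@ge0_integral_flip _ y (fun w => \int[leb]_(t in I0) f (t, w)))//.
  under eq_fun do rewrite integral_mkcond.
  have := @measurable_fun_fubini_tonelli_G _ _ _ _ R leb (f \_ TRR).
  rewrite /fubini_G => /(_ _ _) h.
  rewrite (_ : (fun _ => _) = (fun y : R => \int[leb]_x (f \_ TRR) (x, y))).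
    apply: h.
      by apply/(measurable_restrictT f); [exact: measurable_TR|exact: measurable_funTS].
    by move=> z; rewrite patchE; case: ifP.
  apply/funext => w; apply: eq_integral => t _; rewrite !patchE.
  suff -> : ((t, w) \in TRR) = (t \in I0) by [].
  by apply/idP/idP; rewrite !inE /TR/= => // -[].
by move=> w; exact: integral_ge0.
Qed.

Lemma flip2 (x y : R) (f : R * R -> R) : measurable_fun setT f ->
  (forall u w, f (u + tpi, w)%R = f (u, w)) ->
  Rintegral leb2 TRR (fun z => f (x - z.1, y - z.2)%R) = Rintegral leb2 TRR f.
Proof.
move=> mf fp; rewrite /Rintegral; congr fine.
rewrite integralE [RHS]integralE; congr (_ - _).
- rewrite -(@ge0_flip2 x y (EFin \o f)^\+)//.
  + by apply: eq_integral => z _; rewrite !funeposE.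
  + by apply: measurable_funepos; exact/measurable_EFinP.
  + by move=> u w; rewrite !funeposE /= fp.
- rewrite -(@ge0_flip2 x y (EFin \o f)^\-)//.
  + by apply: eq_integral => z _; rewrite !funenegE.
  + by apply: measurable_funeneg; exact/measurable_EFinP.
  + by move=> u w; rewrite !funenegE /= fp.
Qed.

End Int2.

Section Dom2.
Context {R : realType}.
Local Notation leb := (@lebesgue_measure R).
Local Notation leb2 := (leb \x leb)%E.
Local Notation TRR := (@TR R).
Local Notation tpi := (2 * pi : R).
Local Notation I0 := (`[0%R, tpi[%classic : set R).

(** The square of the sine has period pi, so [a] can be reduced modulo pi; inside []0, pi[] the sine
    is positive. *)
Lemma sin_eq0_int (a : R) : sin a = 0 -> exists k : int, a = k%:~R * pi.
Proof.
move=> a0; exists (Num.floor (a / pi)); set k := Num.floor _.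
pose b := a - k%:~R * pi.
have b0 : 0 <= b.
  by rewrite /b subr_ge0 -ler_pdivlMr ?pi_gt0// /k; exact: floor_le.
have bp : b < pi.
  have := floorD1_gt (a / pi); rewrite -/k ltr_pdivrMr ?pi_gt0// intrD mulrDl mul1r => h.
  by rewrite /b ltrBlDr addrC.
have sb : sin b = 0.
  have h (t : R) : (sin (t + pi) ^+ 2)%:E = (sin t ^+ 2)%:E by rewrite sinDpi sqrrN.
  have := @periodic_int R pi (fun t => (sin t ^+ 2)%:E) h k b.
  rewrite /b subrK a0 expr0n/= => -[].
  by move/esym/eqP; rewrite sqrf_eq0 => /eqP.
have [b1|b1] := eqVneq b 0; first by move/eqP: b1; rewrite /b subr_eq0 => /eqP.
have : 0 < sin b by apply: sin_gt0_pi; rewrite bp lt_neqAle eq_sym b1 b0.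
by rewrite sb ltxx.
Qed.

Lemma null_sin_half (x : R) : leb [set t | sin ((x - t) / 2) = 0] = 0%E.
Proof.
apply: countable_lebesgue_measure0.
apply: (@sub_countable _ _ _ (range (fun k : int => x - 2 * (k%:~R * pi)))); last first.
  by apply: (card_le_trans (card_image_le _ _)); exact: countableP.
apply: subset_card_le => t /= /sin_eq0_int[k ek]; exists k => //.
by rewrite -ek; field.
Qed.

Lemma measurable_sin_half (x : R) : measurable [set t : R | sin ((x - t) / 2) = 0].
Proof.
rewrite (_ : [set _ | _] = (fun t : R => sin ((x - t) / 2)) @^-1` [set 0%R]) //.
rewrite -[X in measurable X]setTI; suff h : measurable_fun setT (fun t : R => sin ((x - t) / 2)) by exact: h.
apply: (measurableT_comp (f := @sin R)); first by apply: continuous_measurable_fun; exact: continuous_sin.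
by apply: measurable_funM => //; exact: measurable_funB.
Qed.

(** The kernel bounds with separated variables degenerate on whole lines through the pole, vertical
    and horizontal, and not only at the pole; these lines are null. *)
Lemma ae_off_lines (x y : R) (P : R * R -> Prop) :
  (forall z, sin ((x - z.1) / 2) != 0 -> z.2 != y -> P z) ->
  {ae leb2, forall z, P z}.
Proof.
move=> HP.
apply: (@negligibleS _ _ _ leb2 ([set t | sin ((x - t) / 2) = 0] `*` setT `|` setT `*` [set y])).
  move=> z /= nP; have [s0|s0] := eqVneq (sin ((x - z.1) / 2)) 0; first by left.
  have [s1|s1] := eqVneq z.2 y; first by right.
  by exfalso; apply: nP; exact: HP.
apply: negligibleU.
- exists ([set t | sin ((x - t) / 2) = 0] `*` setT); split => //.
  + by apply: measurableX => //; exact: measurable_sin_half.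
  + rewrite [LHS]product_measure1E//; last exact: measurable_sin_half.
    by rewrite [X in (X * _)%E](null_sin_half x) mul0e.
- exists (setT `*` [set y]); split => //.
  + exact: measurableX.
  + by rewrite [LHS]product_measure1E// [X in (_ * X)%E]lebesgue_measure_set1 mule0.
Qed.

Lemma ge0_integral_prod (f H : R -> R) : measurable_fun setT f -> measurable_fun setT H ->
  (forall t, 0 <= f t) -> (forall t, 0 <= H t) ->
  (\int[leb2]_(z in TRR) (f z.1 * H z.2)%:E =
   (\int[leb]_(t in I0) (f t)%:E) * \int[leb]_w (H w)%:E)%E.
Proof.
move=> mf mH f0 H0.
rewrite (@ge0_int_TR2 R (fun z => (f z.1 * H z.2)%:E))/=; last 2 first.
- apply/measurable_EFinP; apply: measurable_funM.
    by apply: (measurableT_comp mf); exact: measurable_fst.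
  by apply: (measurableT_comp mH); exact: measurable_snd.
- by move=> z; rewrite lee_fin mulr_ge0.
under eq_integral => w _.
  under eq_integral => t _ do rewrite EFinM.
  rewrite ge0_integralZr//=; last 3 first.
  - by apply/measurable_EFinP; exact: measurable_funTS.
  - by move=> t _; rewrite lee_fin.
  - by rewrite lee_fin.
  over.
rewrite ge0_integralZl//=.
- exact/measurable_EFinP.
- by move=> t _; rewrite lee_fin.
- by apply: integral_ge0 => t _; rewrite lee_fin.
Qed.

(** The workhorse for every double integral with the kernel: against a dominating product Tonelli
    factors the integral, and periodicity absorbs the reflection t -> x - t. Integrability and the
    size come out together. *)
Lemma dom2 (Phi : R * R -> R) (x y : R) (f H : R -> R) (A B : R) :
  measurable_fun setT Phi -> measurable_fun setT f -> measurable_fun setT H ->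
  (forall t, 0 <= f t) -> (forall t, 0 <= H t) ->
  (forall t, f (t + tpi) = f t) ->
  (\int[leb]_(t in I0) (f t)%:E <= A%:E)%E ->
  (\int[leb]_w (H w)%:E <= B%:E)%E ->
  (forall z, sin ((x - z.1) / 2) != 0 -> z.2 != y ->
     `|Phi z| <= f (x - z.1) * H z.2) ->
  leb2.-integrable TRR (EFin \o Phi) /\
  `|Rintegral leb2 TRR Phi| <= A * B.
Proof.
move=> mP mf mH f0 H0 fp fA HB PH.
have mfx : measurable_fun setT (fun t : R => f (x - t)).
  by apply: (measurableT_comp mf); exact: measurable_funB.
have le1 : (\int[leb2]_(z in TRR) `|(EFin \o Phi) z| <= (A * B)%:E)%E.
  apply: (@le_trans _ _ (\int[leb2]_(z in TRR) (f (x - z.1) * H z.2)%:E)%E).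
    apply: ae_ge0_le_integral => //=.
    - exact: measurable_TR.
    - by apply/measurable_EFinP; apply: measurable_funTS; exact: measurableT_comp.
    - by move=> z _; rewrite lee_fin mulr_ge0.
    - apply/measurable_EFinP; apply: measurable_funTS; apply: measurable_funM.
        by apply: (measurableT_comp mfx); exact: measurable_fst.
      by apply: (measurableT_comp mH); exact: measurable_snd.
    - by apply: (@ae_off_lines x y) => z s1 s2 _; rewrite lee_fin PH.
  rewrite (@ge0_integral_prod (fun t => f (x - t)))//.
  have mEf : measurable_fun setT (EFin \o f) by exact/measurable_EFinP.
  have -> := @ge0_integral_period_flip _ tpi x (EFin \o f) tpi_gt0 mEf.
  - rewrite EFinM lee_pmul//.
    + by apply: integral_ge0 => t _; rewrite lee_fin.
    + by apply: integral_ge0 => t _; rewrite lee_fin.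
  - by move=> t; rewrite lee_fin.
  - by move=> t /=; rewrite fp.
have iP : leb2.-integrable TRR (EFin \o Phi).
  apply/integrableP; split; first by apply/measurable_EFinP; exact: measurable_funTS.
  by apply: le_lt_trans le1 _; rewrite ltry.
split=> //.
rewrite -lee_fin EFin_normr_Rintegral//; last exact: measurable_TR.
apply: le_trans le1; apply: le_abse_integral; first exact: measurable_TR.
by apply/measurable_EFinP; exact: measurable_funTS.
Qed.

Lemma I2_prod (f H : R -> R) : leb.-integrable I0 (EFin \o f) ->
  measurable_fun setT f ->
  leb.-integrable setT (EFin \o H) ->
  Rintegral leb2 TRR (fun z => f z.1 * H z.2) = Rintegral leb I0 f * Rintegral leb setT H.
Proof.
move=> iF mf iH.
have mH : measurable_fun setT H by apply/measurable_EFinP; exact: measurable_int iH.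
have mfH : measurable_fun setT (fun z : R * R => f z.1 * H z.2).
  apply: measurable_funM.
    by apply: (measurableT_comp mf); exact: measurable_fst.
  by apply: (measurableT_comp mH); exact: measurable_snd.
have i1 : leb2.-integrable TRR (fun z => (f z.1 * H z.2)%:E).
  apply/integrableP; split; first by apply/measurable_EFinP; exact: measurable_funTS.
  under eq_integral do rewrite /= normrM.
  rewrite (@ge0_integral_prod (fun t => `|f t|) (fun t => `|H t|))//.
  - move/integrableP: iF => [_ h1]; move/integrableP: iH => [_ h2].
    apply: lte_mul_pinfty => //; first by apply: integral_ge0 => t _; rewrite lee_fin.
    by rewrite ge0_fin_numE//; apply: integral_ge0 => t _; rewrite lee_fin.
  - exact: measurableT_comp.
  - exact: measurableT_comp.
rewrite /Rintegral.
have i2 : leb2.-integrable setT ((fun z => (f z.1 * H z.2)%:E) \_ TRR).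
  by move: i1; rewrite integrable_mkcond//; exact: measurable_TR.
rewrite integral_mkcond -(integral21_prod_meas1 i2) /fubini_G.
transitivity (fine (\int[leb]_y ((Rintegral leb I0 f)%:E * (H y)%:E))%E).
  congr fine; apply: eq_integral => y _.
  rewrite /Rintegral fineK; last exact: integrable_fin_num.
  rewrite -integralZr//.
  rewrite [RHS]integral_mkcond; apply: eq_integral => t _; rewrite !patchE.
  suff -> : ((t, y) \in TRR) = (t \in I0) by [].
  by apply/idP/idP; rewrite !inE /TR/= => // -[].
rewrite integralZl// fineM//.
exact: integrable_fin_num.
Qed.

End Dom2.

(** * Lipschitz bounds, estimates of the sine, the fundamental theorem of calculus *)

Section Calc.
Context {R : realType}.
Local Notation leb := (@lebesgue_measure R).
Local Notation tpi := (2 * pi : R).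
Local Notation I0 := (`[0%R, tpi[%classic : set R).

Lemma derivable_continuous (f : R -> R) x : derivable f x 1 -> {for x, continuous f}.
Proof. by move=> /derivable1_diffP /differentiable_continuous. Qed.

Lemma lipschitz_itv (f : R -> R) (a b L : R) :
  (forall t, a <= t <= b -> derivable f t 1) ->
  (forall t, a <= t <= b -> `|derive1 f t| <= L) ->
  forall s t, a <= s <= b -> a <= t <= b -> `|f s - f t| <= L * `|s - t|.
Proof.
move=> df Lf.
have W s t : a <= s <= b -> a <= t <= b -> s <= t -> `|f t - f s| <= L * `|t - s|.
  move=> /andP[s1 s2] /andP[t1 t2] st.
  have [||c] := @MVT_segment R f (derive1 f) s t st.
  - move=> u /[!in_itv]/= /andP[h1 h2]; rewrite derive1E; apply: derivableP.
    by apply: df; rewrite (le_trans s1 (ltW h1)) (le_trans (ltW h2) t2).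
  - apply: derivable_within_continuous => u /[!in_itv]/= /andP[h1 h2].
    by apply: df; rewrite (le_trans s1 h1) (le_trans h2 t2).
  rewrite in_itv/= => /andP[h1 h2] ->; rewrite normrM ler_wpM2r//.
  by apply: Lf; rewrite (le_trans s1 h1) (le_trans h2 t2).
move=> s t sb tb; have [st|/ltW ts] := leP s t; last exact: W.
by rewrite distrC [`|s - t|]distrC; exact: W.
Qed.

Lemma lipschitz_derive (f : R -> R) (L : R) :
  (forall t, derivable f t 1) -> (forall t, `|derive1 f t| <= L) ->
  forall s t, `|f s - f t| <= L * `|s - t|.
Proof.
move=> df Lf s t.
apply: (@lipschitz_itv f (Num.min s t) (Num.max s t)) => //.
- by rewrite ge_min le_max lexx.
- by rewrite ge_min le_max lexx !orbT.
Qed.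

Lemma derive1_sin (t : R) : derive1 (@sin R) t = cos t.
Proof. by rewrite derive1E; apply: derive_val. Qed.
Lemma sin_lip (s t : R) : `|sin s - sin t| <= `|s - t|.
Proof.
rewrite -[leRHS]mul1r; apply: lipschitz_derive => u; first by [].
by rewrite derive1_sin ler_norml cos_geN1 cos_le1.
Qed.

Lemma norm_sin_le (t : R) : `|sin t| <= `|t|.
Proof. by have := sin_lip t 0; rewrite sin0 !subr0. Qed.

Lemma one_minus_cos (t : R) : 1 - cos t = 2 * sin (t / 2) ^+ 2.
Proof.
have -> : cos t = cos (t / 2 + t / 2) by congr cos; field.
by rewrite cosD; have := cos2Dsin2 (t / 2); rewrite !expr2; lra.
Qed.

Lemma cos_ge_quad (t : R) : 1 - t ^+ 2 / 2 <= cos t.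
Proof.
have := norm_sin_le (t / 2); rewrite -(ler_sqr (x := `|_|)) ?nnegrE// !real_normK ?num_real//.
by have := one_minus_cos t; rewrite expr_div_n; lra.
Qed.

(** On [[0, 1]] the mean value theorem with cos >= 1/2 gives t / 2; beyond 1 monotonicity keeps the
    sine above 1/2, while t / 4 < 1/2 because pi / 2 < 2. *)
Lemma sin_ge_quarter (t : R) : 0 <= t <= pi / 2 -> t / 4 <= sin t.
Proof.
have S1 (u : R) : 0 <= u <= 1 -> u / 2 <= sin u.
  move=> /andP[u0 u1].
  have [|c] := @MVT_segment R sin cos 0 u u0 (fun v _ => is_derive_sin v).
    by apply: continuous_subspaceT; exact: continuous_sin.
  rewrite in_itv/= sin0 !subr0 => /andP[c0 cu] ->.
  rewrite mulrC ler_wpM2r//; have := cos_ge_quad c.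
  suff : c ^+ 2 <= 1 by lra.
  by rewrite expr_le1// (le_trans cu).
move=> /andP[t0 tp]; have [t1|t1] := leP t 1.
  by have := S1 t; rewrite t0 t1 => /(_ isT); lra.
have p1 := pihalf_ge1 R; have p2 := pihalf_lt2 R.
have h : sin 1 <= sin t.
  rewrite ltW// ltr_sin// in_itv/=; apply/andP; split; lra.
by have := S1 1; rewrite lexx ler01 => /(_ isT); lra.
Qed.

Lemma sin_half_ge (t : R) : 0 <= t <= tpi -> Num.min t (tpi - t) / 8 <= sin (t / 2).
Proof.
move=> /andP[t0 t1]; have [h|h] := leP t pi.
  have : t / 2 / 4 <= sin (t / 2) by apply: sin_ge_quarter; lra.
  suff : Num.min t (tpi - t) <= t by lra.
  by rewrite ge_min lexx.
have -> : sin (t / 2) = sin ((tpi - t) / 2).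
  have -> : (tpi - t) / 2 = - (t / 2) + pi by field.
  by rewrite sinDpi sinN opprK.
have : (tpi - t) / 2 / 4 <= sin ((tpi - t) / 2) by apply: sin_ge_quarter; lra.
suff : Num.min t (tpi - t) <= (tpi - t) by lra.
by rewrite ge_min lexx orbT.
Qed.

Lemma FTC2_within (f F : R -> R) (a b : R) : a <= b ->
  (forall t, a <= t <= b -> derivable F t 1) ->
  (forall t, a <= t <= b -> derive1 F t = f t) ->
  (forall t, a <= t <= b -> {for t, continuous f}) ->
  (\int[leb]_(x in `[a, b]) (f x)%:E = (F b - F a)%:E)%E.
Proof.
rewrite le_eqVlt => /predU1P[<-|ab] dF F' cf.
  by rewrite set_itv1 integral_set1 subrr.
have cF t : a <= t <= b -> {for t, continuous F} by move=> h; exact/derivable_continuous/dF.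
rewrite EFinB; apply: continuous_FTC2 => //.
- by apply: continuous_subspace_itv => t /[!in_itv]/=; exact: cf.
- split.
  + by move=> t /[!in_itv]/= /andP[h1 h2]; apply: dF; rewrite !ltW.
  + by apply: cvg_at_right_filter; apply: cF; rewrite lexx ltW.
  + by apply: cvg_at_left_filter; apply: cF; rewrite lexx ltW.
- by move=> t /[!in_itv]/= /andP[h1 h2]; apply: F'; rewrite !ltW.
Qed.

(** The integrand may blow up at [a]: the fundamental theorem is applied on [[u n, b]] with [u n]
    decreasing to [a], and monotone convergence passes to the limit. *)
Lemma ge0_FTC_bound (f F : R -> R) (a b C : R) : a < b ->
  measurable_fun setT f -> (forall t, 0 <= f t) ->
  (forall t, a < t <= b -> derivable F t 1) ->
  (forall t, a < t <= b -> derive1 F t = f t) ->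
  (forall t, a < t <= b -> {for t, continuous f}) ->
  (forall t, a < t <= b -> F b - F t <= C) ->
  (\int[leb]_(x in `]a, b]) (f x)%:E <= C%:E)%E.
Proof.
move=> ab mf f0 dF F' cf FC.
pose u (n : nat) : R := a + (b - a) / n.+1%:R.
have u1 n : a < u n by rewrite /u ltrDl divr_gt0// subr_gt0.
have u2 n : u n <= b.
  by rewrite /u -lerBrDl ler_pdivrMr// ler_peMr ?ler1n// subr_ge0 ltW.
pose g n := (EFin \o f) \_ `[u n, b].
have mg n : measurable_fun setT (g n).
  by apply/(measurable_restrictT (EFin \o f)) => //; apply: measurable_funTS; exact/measurable_EFinP.
have g0 n x : (0 <= g n x)%E by rewrite /g patchE; case: ifP => // _; rewrite lee_fin.
have ug n m : (n <= m)%N -> u m <= u n.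
  by move=> nm; rewrite /u lerD2l ler_pM2l ?subr_gt0// lef_pV2 ?posrE// ler_nat.
have := @cvg_monotone_convergence _ _ _ leb setT measurableT g mg (fun n x _ => g0 n x).
have nd x : setT x -> {homo g ^~ x : n m / (n <= m)%N >-> (n <= m)%E}.
  move=> _ n m nm /=; rewrite /g !patchE.
  case: ifPn => h; last by case: ifPn => // _; rewrite lee_fin.
  rewrite ifT//; move: h; rewrite !inE/= !in_itv/= => /andP[h1 h2].
  by rewrite h2 (le_trans (ug _ _ nm)).
move=> /(_ nd) cvg.
have -> : (\int[leb]_(x in `]a, b]) (f x)%:E = \int[leb]_x limn (g ^~ x))%E.
  rewrite integral_mkcond; apply: eq_integral => x _; apply/esym/cvg_lim => //.
  rewrite patchE; case: ifPn => h.
    move: h; rewrite inE/= in_itv/= => /andP[h1 h2].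
    apply: cvg_near_cst; near=> n; rewrite /g patchE ifT//.
    rewrite inE/= in_itv/= h2 andbT /u.
    rewrite -lerBrDl ler_pdivrMr// mulrC -ler_pdivrMr ?subr_gt0//.
    have : (b - a) / (x - a) <= n%:R.
      by near: n; exact: nbhs_infty_ger.
    by move=> /le_trans; apply; rewrite ler_nat.
  apply: cvg_near_cst; near=> n; rewrite /g patchE ifF//.
  apply/negbTE; apply: contra h; rewrite !inE/= !in_itv/= => /andP[h1 ->].
  by rewrite (lt_le_trans (u1 n)).
move/cvg_lim: cvg => <-//.
apply: lime_le; first by apply/cvg_ex; eexists; exact: (@cvg_monotone_convergence _ _ _ leb setT measurableT g mg (fun n x _ => g0 n x) nd).
apply: nearW => n; rewrite -integral_mkcond.
rewrite (@FTC2_within f F)//.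
- by rewrite lee_fin FC// u1 u2.
- by move=> t /andP[h1 h2]; apply: dF; rewrite h2 (lt_le_trans (u1 n)).
- by move=> t /andP[h1 h2]; apply: F'; rewrite h2 (lt_le_trans (u1 n)).
- by move=> t /andP[h1 h2]; apply: cf; rewrite h2 (lt_le_trans (u1 n)).
Unshelve. all: by end_near. Qed.

End Calc.

(** * Integrable power singularities *)

Section Pow.
Context {R : realType}.
Local Notation leb := (@lebesgue_measure R).
Local Notation tpi := (2 * pi : R).
Local Notation I0 := (`[0%R, tpi[%classic : set R).

Lemma integral_powRN (p b : R) : 0 < p < 1 -> 0 < b ->
  (\int[leb]_(t in `]0%R, b]) (t `^ (- p))%:E <= (b `^ (1 - p) / (1 - p))%:E)%E.
Proof.
move=> /andP[p0 p1] b0; have p1' : 0 < 1 - p by rewrite subr_gt0.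
have dp (t : R) : 0 < t -> is_derive t 1 (fun t => t `^ (1 - p) / (1 - p)) (t `^ (- p)).
  move=> t0; have h := is_derive1_powR (1 - p) t0.
  have -> : t `^ (- p) = (1 - p)^-1 *: ((1 - p) * t `^ (1 - p - 1)).
    rewrite /GRing.scale/= mulrA mulVf ?gt_eqF// mul1r; congr (_ `^ _); lra.
  have E : (fun t : R => t `^ (1 - p) / (1 - p)) = (1 - p)^-1 \*: (fun t : R => t `^ (1 - p)).
    by apply/funext => u; rewrite /= mulrC.
  by rewrite E; exact: is_deriveZ.
apply: (@ge0_FTC_bound R (fun t => t `^ (- p)) (fun t => t `^ (1 - p) / (1 - p))) => //.
- by move=> t; exact: powR_ge0.
- by move=> t /andP[t0 _]; have h := dp t t0; apply: (@ex_derive _ _ _ _ _ _ _ h).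
- by move=> t /andP[t0 _]; rewrite derive1E; have h := dp t t0; apply: (@derive_val _ _ _ _ _ _ _ h).
- move=> t /andP[t0 _]; apply: derivable_continuous.
  by have h := is_derive1_powR (- p) t0; apply: (@ex_derive _ _ _ _ _ _ _ h).
- by move=> t _; rewrite lerBlDr lerDl divr_ge0// ?powR_ge0// ltW.
Qed.

Lemma integral_powRN_sym (p b : R) : 0 < p < 1 -> 0 < b ->
  (\int[leb]_t (`|t| `^ (- p) * \1_(`[(- b)%R, b]) t)%:E <= (2 * (b `^ (1 - p) / (1 - p)))%:E)%E.
Proof.
move=> p01 b0.
have mg : measurable_fun setT (fun t : R => `|t| `^ (- p)).
  by apply: (measurableT_comp (f := fun t : R => t `^ (- p))) => //; exact: measurableT_comp.
rewrite (_ : (fun t : R => _) = ((fun t : R => (`|t| `^ (- p))%:E) \_ `[(- b)%R, b])); last first.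
  apply/funext => t; rewrite patchE indicE; case: ifPn => _; by rewrite ?mulr1 ?mulr0.
rewrite -integral_mkcond (@itv_bndbnd_setU _ _ (BLeft (- b)) (BLeft 0)) ?bnd_simp ?oppr_le0 ?(ltW b0)//.
rewrite ge0_integral_setU; [|by []|by []| | |]; last 3 first.
- by apply/measurable_EFinP; exact: measurable_funTS.
- by move=> t _; rewrite lee_fin powR_ge0.
- apply/disj_setPS => t [/=]; rewrite !in_itv/= => /andP[_ h1] /andP[h2 _].
  by move: (lt_le_trans h1 h2); rewrite ltxx.
have E2 : (\int[leb]_(t in `[0%R, b]) (`|t| `^ (- p))%:E <= (b `^ (1 - p) / (1 - p))%:E)%E.
  rewrite -integral_itv_obnd_cbnd; last by apply/measurable_EFinP; exact: measurable_funTS.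
  have -> : (\int[leb]_(t in `]0%R, b]) (`|t| `^ (- p))%:E = \int[leb]_(t in `]0%R, b]) (t `^ (- p))%:E)%E.
    apply: eq_integral => t.
    by rewrite inE/= in_itv/= => /andP[t0 _]; rewrite gtr0_norm.
  exact: integral_powRN.
rewrite mulrDl mul1r EFinD leeD//.
apply: le_trans E2; rewrite le_eqVlt; apply/orP; left; apply/eqP.
rewrite integral_mkcond [RHS]integral_mkcond/=.
rewrite -[RHS](@ge0_integral_flip _ 0)//=; last 2 first.
- by apply/(measurable_restrictT (fun t : R => (`|t| `^ (- p))%:E)) => //;apply: measurable_funTS; apply/measurable_EFinP.
- by move=> t; rewrite patchE; case: ifP => // _; rewrite lee_fin powR_ge0.
apply: eq_integral => t _; rewrite !patchE sub0r normrN.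
(* At 0 the two half-lines disagree, but a nonzero power of 0 is 0 by convention, so both sides
   vanish there. *)
have [->|t0] := eqVneq t 0.
  by rewrite oppr0 normr0 powR0 ?if_same// oppr_eq0 gt_eqF//; case/andP: p01.
suff -> : (t \in `[(- b)%R, 0%R[%classic) = ((- t)%R \in `[0%R, b]%classic) by [].
apply/idP/idP; rewrite !inE/= !in_itv/= oppr_ge0 lerNl => /andP[h1 h2].
  by rewrite h1 ltW.
by rewrite h2 lt_neqAle t0 h1.
Qed.

Lemma integrable_le (D : set R) (f g : R -> R) : measurable D ->
  measurable_fun setT f -> measurable_fun setT g -> (forall t, D t -> `|f t| <= g t) ->
  (\int[leb]_(t in D) (g t)%:E < +oo)%E -> leb.-integrable D (EFin \o f).
Proof.
move=> mD mf mg fg gi; apply/integrableP; split.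
  by apply/measurable_EFinP; exact: measurable_funTS.
apply: le_lt_trans gi; apply: ge0_le_integral => //=.
- by apply/measurable_EFinP; apply: measurable_funTS; exact: measurableT_comp.
- by apply/measurable_EFinP; exact: measurable_funTS.
Qed.

(** The periodic counterpart of |t|^(-p); the singular bounds of the kernel in its first variable
    are stated with it. *)
Definition sinp (p t : R) : R := `|sin (t / 2)| `^ (- p).

Lemma measurable_sinp p : measurable_fun setT (sinp p).
Proof.
apply: (measurableT_comp (f := fun t : R => t `^ (- p))) => //; apply: measurableT_comp => //.
apply: (measurableT_comp (f := @sin R)); first by apply: continuous_measurable_fun; exact: continuous_sin.
exact: measurable_funM.
Qed.

Lemma sinp_ge0 p t : 0 <= sinp p t. Proof. exact: powR_ge0. Qed.

Lemma sin_half_period (t : R) : `|sin ((t + tpi) / 2)| = `|sin (t / 2)|.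
Proof.
have -> : (t + tpi) / 2 = t / 2 + pi by field.
by rewrite sinDpi normrN.
Qed.

Lemma sinp_period p t : sinp p (t + tpi) = sinp p t.
Proof. by rewrite /sinp sin_half_period. Qed.

(** There is a singularity at each end of the period: the bound of [sin_half_ge] by the distance to
    the nearer end, divided by 8, costs the factor 8^p and dominates the integrand by a power and
    its reflection. *)
Lemma sinp_bound p : 0 < p < 1 -> exists2 A : R, 0 < A & (\int[leb]_(t in I0) (sinp p t)%:E <= A%:E)%E.
Proof.
move=> p01; have /andP[p0 p1] := p01.
pose B : R := 2 * (tpi `^ (1 - p) / (1 - p)).
have B0 : 0 < B by rewrite /B mulr_gt0// divr_gt0 ?subr_gt0// powR_gt0// tpi_gt0.
pose c : R := 8 `^ p.
have c0 : 0 < c by rewrite powR_gt0.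
pose h (t : R) := `|t| `^ (- p) * \1_(`[(- tpi)%R, tpi]) t.
have mh : measurable_fun setT h.
  apply: measurable_funM => //.
  by apply: (measurableT_comp (f := fun t : R => t `^ (- p))) => //; exact: measurableT_comp.
have h0 t : 0 <= h t by rewrite /h mulr_ge0// powR_ge0.
have hB := integral_powRN_sym p _ p01 tpi_gt0.
exists (c * (B + B)); first by rewrite mulr_gt0// addr_gt0.
have mh2 : measurable_fun setT (fun t : R => h (tpi - t)).
  by apply: measurableT_comp => //; exact: measurable_funB.
rewrite -integral_itv_obnd_cbnd; last first.
  by apply/measurable_EFinP; apply: measurable_funTS; exact: measurable_sinp.
apply: (@le_trans _ _ (\int[leb]_(t in `]0%R, tpi[) (c%:E * ((h t)%:E + (h (tpi - t))%:E)))%E).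
  apply: ge0_le_integral.
  - by [].
  - by move=> t _; rewrite lee_fin sinp_ge0.
  - by apply/measurable_EFinP; apply: measurable_funTS; exact: measurable_sinp.
  - apply/measurable_EFinP; apply: measurable_funTS; apply: measurable_funM => //.
    exact: measurable_funD.
  - move=> t; rewrite /= in_itv/= => /andP[t0 t1]; rewrite lee_fin.
    have t2 : 0 < tpi - t by rewrite subr_gt0.
    have hm : 0 < Num.min t (tpi - t) by rewrite lt_min t0.
    have sg : Num.min t (tpi - t) / 8 <= sin (t / 2) by apply: sin_half_ge; rewrite !ltW.
    have s0 : 0 < sin (t / 2) by apply: lt_le_trans sg; rewrite divr_gt0.
    rewrite /sinp gtr0_norm// powRN.
    apply: (@le_trans _ _ (c * Num.min t (tpi - t) `^ (- p))).
      rewrite /c powRN -[8 `^ p]invrK -invfM lef_pV2 ?posrE ?powR_gt0//; last first.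
        by rewrite mulr_gt0 ?invr_gt0 ?powR_gt0.
      rewrite -powRN -[8]invrK -powR_inv1 ?invr_ge0// -powRrM mulN1r opprK.
      rewrite -powRM ?invr_ge0// ?(ltW hm)//.
      apply: ge0_ler_powR; rewrite ?nnegrE ?(ltW p0) ?(ltW s0)//.
        by rewrite mulr_ge0 ?invr_ge0 ?(ltW hm).
      by rewrite mulrC.
    rewrite ler_pM2l// /h /Num.min; case: ifPn => _.
      rewrite [X in _ <= X + _](_ : _ = t `^ (- p)) ?lerDl ?h0//.
      rewrite gtr0_norm// indicE mem_set ?mulr1//= in_itv/= (ltW t1) andbT.
      by rewrite (le_trans _ (ltW t0))// oppr_le0 ltW// tpi_gt0.
    rewrite [X in _ <= _ + X](_ : _ = (tpi - t) `^ (- p)) ?lerDr ?h0//.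
    rewrite gtr0_norm// indicE mem_set ?mulr1//= in_itv/= gerBl (ltW t0) andbT.
    by rewrite (le_trans _ (ltW t2))// oppr_le0 ltW// tpi_gt0.
rewrite ge0_integralZl; [|by []| | |]; last 3 first.
- by apply/measurable_EFinP; apply: measurable_funTS; exact: measurable_funD.
- by move=> t _; rewrite lee_fin addr_ge0.
- by rewrite lee_fin ltW.
rewrite EFinM lee_wpmul2l// ?lee_fin ?(ltW c0)//.
have i0 (g : R -> R) : measurable_fun setT g -> (forall t, 0 <= g t) ->
   (\int[leb]_(t in `]0%R, tpi[) (g t)%:E <= \int[leb]_t (g t)%:E)%E.
  move=> mg g0; apply: ge0_subset_integral => //=.
  - exact/measurable_EFinP.
  - by move=> t _; rewrite lee_fin.
rewrite ge0_integralD; [|by []| | | |]; last 4 first.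
- by move=> t _; rewrite lee_fin.
- by apply/measurable_EFinP; apply: measurable_funTS.
- by move=> t _; rewrite lee_fin.
- by apply/measurable_EFinP; apply: measurable_funTS.
rewrite EFinD; apply: leeD.
  by apply: le_trans hB; exact: i0.
apply: (le_trans (i0 _ mh2 _)); first by move=> t.
rewrite (@ge0_integral_flip _ tpi (EFin \o h)).
- exact: hB.
- exact/measurable_EFinP.
- by move=> t; rewrite lee_fin.
Qed.

Lemma FTC2_integrable (f F : R -> R) (a b : R) : a < b ->
  leb.-integrable `[a, b] (EFin \o f) ->
  (forall t, a < t < b -> derivable F t 1) ->
  (forall t, a < t < b -> derive1 F t = f t) ->
  (forall t, a < t < b -> {for t, continuous f}) ->
  {for a, continuous F} -> {for b, continuous F} ->
  Rintegral leb `[a, b] f = F b - F a.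
Proof.
move=> ab intf dF F' cf Fa Fb.
have /continuous_within_itvP := parameterized_integral_continuous (ltW ab) intf.
move=> /(_ ab); pose G := (fun x => parameterized_integral leb a x f); move=> [_ Ga Gb].
have inS u v : a <= u -> v <= b -> leb.-integrable `[u, v] (EFin \o f).
  move=> au vb; apply: integrableS intf => //.
  by apply: subset_itv; rewrite bnd_simp.
have GF u v : a < u -> u <= v -> v < b -> G v - F v = G u - F u.
  move=> au uv vb.
  have e1 := @FTC2_within R f F u v uv.
  have : Rintegral leb `[u, v] f = F v - F u.
    rewrite /Rintegral e1// => t /andP[t1 t2].
    - by apply: dF; rewrite (lt_le_trans au) ?(le_lt_trans t2).
    - by apply: F'; rewrite (lt_le_trans au) ?(le_lt_trans t2).
    - by apply: cf; rewrite (lt_le_trans au) ?(le_lt_trans t2).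
  suff -> : Rintegral leb `[u, v] f = G v - G u by lra.
  rewrite /G /parameterized_integral Rintegral_itvB.
  - rewrite Rintegral_itv_obnd_cbnd//.
    by apply: integrableS (inS u v (ltW au) (ltW vb)) => //; apply: subset_itv; rewrite bnd_simp.
  - exact: inS (lexx a) (ltW vb).
  - by rewrite bnd_simp ltW.
  - by rewrite bnd_simp.
pose m := (a + b) / 2.
have am : a < m by rewrite /m; lra.
have mb : m < b by rewrite /m; lra.
pose K := G m - F m.
have Ka : G a - F a = K.
  have h1 : (fun t => G t - F t) t @[t --> a^'+] --> G a - F a.
    by apply: cvgB => //; exact: cvg_at_right_filter.
  have h2 : (fun t => G t - F t) t @[t --> a^'+] --> K.
    apply: cvg_near_cst; near=> t.
    apply/esym/GF => //; by near: t; exact: nbhs_right_le.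
  exact: (cvg_unique _ h1 h2).
have Kb : G b - F b = K.
  have h1 : (fun t => G t - F t) t @[t --> b^'-] --> G b - F b.
    by apply: cvgB => //; exact: cvg_at_left_filter.
  have h2 : (fun t => G t - F t) t @[t --> b^'-] --> K.
    apply: cvg_near_cst; near=> t.
    by apply: GF => //; near: t; exact: nbhs_left_ge.
  exact: (cvg_unique _ h1 h2).
have Ga0 : G a = 0 by rewrite /G /parameterized_integral set_itv1 Rintegral_set1.
have -> : Rintegral leb `[a, b] f = G b by [].
lra.
Unshelve. all: by end_near. Qed.
End Pow.

(** * The logarithmic kernel on the circle and its first Fourier coefficients *)

Section Ell.
Context {R : realType}.
Local Notation leb := (@lebesgue_measure R).
Local Notation tpi := (2 * pi : R).
Local Notation I0 := (`[0%R, tpi[%classic : set R).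

Lemma ln_le_sub1 (t : R) : 0 < t -> ln t <= t - 1.
Proof. by move=> t0; have := @le_ln1Dx R (t - 1); rewrite addrCA subrr addr0 => -> //; lra. Qed.

(* Equal to (1/2) ln (2 - 2 cos u): the trace on w = 0 of the kernel kap, up to a factor. *)
Definition ell (u : R) : R := ln (2 * `|sin (u / 2)|).

Lemma measurable_sinhalf : measurable_fun setT (fun u : R => sin (u / 2)).
Proof.
apply: (measurableT_comp (f := @sin R)); first by apply: continuous_measurable_fun; exact: continuous_sin.
exact: measurable_funM.
Qed.

Lemma measurable_ell : measurable_fun setT ell.
Proof.
apply: (measurableT_comp (f := @ln R)) => //; apply: measurable_funM => //.
by apply: measurableT_comp => //; exact: measurable_sinhalf.
Qed.

Lemma ell_period u : ell (u + tpi) = ell u.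
Proof. by rewrite /ell sin_half_period. Qed.

Lemma norm_sin_le1 (t : R) : `|sin t| <= 1.
Proof. by rewrite ler_norml sin_geN1 sin_le1. Qed.
Lemma norm_cos_le1 (t : R) : `|cos t| <= 1.
Proof. by rewrite ler_norml cos_geN1 cos_le1. Qed.

Lemma sinp_half_sqrt (u : R) : sinp 2^-1 u = (Num.sqrt `|sin (u / 2)|)^-1.
Proof. by rewrite /sinp powRN powR12_sqrt. Qed.

(** With s = |sin (u / 2)|, the inequality ln t <= t - 1 at t = s^(-1/2) turns the logarithm into an
    integrable power. *)
Lemma ell_bound u : `|ell u| <= 2 * sinp 2^-1 u.
Proof.
have [s0|s0] := eqVneq (sin (u / 2)) 0.
  by rewrite /ell s0 normr0 mulr0 ln0// normr0 mulr_ge0// sinp_ge0.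
have p0 : 0 < `|sin (u / 2)| by rewrite normr_gt0.
rewrite sinp_half_sqrt; set s := `|sin (u / 2)| in p0 *.
have q0 : 0 < Num.sqrt s by rewrite sqrtr_gt0.
have fixpt : s = Num.sqrt s ^+ 2 by rewrite sqr_sqrtr// ltW.
have s1 : s <= 1 by exact: norm_sin_le1.
have q1 : Num.sqrt s <= 1 by rewrite -sqrtr1 ler_sqrt.
have v1 : 1 <= (Num.sqrt s)^-1 by rewrite invf_ge1.
rewrite /ell -/s ler_norml; apply/andP; split.
  have h : - ln s <= 2 * ((Num.sqrt s)^-1 - 1).
    have := ln_le_sub1 (Num.sqrt s)^-1; rewrite invr_gt0 => /(_ q0).
    rewrite lnV ?posrE// => h.
    by rewrite {1}fixpt lnXn// mulr2n; lra.
  rewrite lnM ?posrE//.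
  have : 0 <= ln (2 : R) by rewrite ln_ge0// ler1n.
  lra.
apply: (@le_trans _ _ (ln 2)); first by rewrite ler_ln ?posrE ?mulr_gt0// ler_piMr.
by have := ln_le_sub1 2 (ltr0n _ 2); lra.
Qed.

Lemma sinp_lty p : 0 < p < 1 -> (\int[leb]_(t in I0) (sinp p t)%:E < +oo)%E.
Proof. by move=> /sinp_bound[A A0] h; exact: le_lt_trans h (ltry _). Qed.

Lemma half01 : 0 < (2^-1 : R) < 1. Proof. by lra. Qed.

Lemma integrable_ellM (f : R -> R) : measurable_fun setT f -> (forall t, `|f t| <= 1) ->
  leb.-integrable I0 (EFin \o (fun u => ell u * f u)).
Proof.
move=> mf f1; apply: (@integrable_le R I0 _ (fun u => 2 * sinp 2^-1 u)) => //.
- by apply: measurable_funM => //; exact: measurable_ell.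
- by apply: measurable_funM => //; exact: measurable_sinp.
- move=> t _; rewrite normrM -[leRHS]mulr1 ler_pM//; exact: ell_bound.
- under eq_integral do rewrite EFinM.
  rewrite ge0_integralZl; [|by []| | |].
  + by apply: lte_mul_pinfty => //; exact: sinp_lty half01.
  + by apply/measurable_EFinP; apply: measurable_funTS; exact: measurable_sinp.
  + by move=> t _; rewrite lee_fin sinp_ge0.
  + by rewrite lee_fin.
Qed.

Lemma integrable_ell : leb.-integrable I0 (EFin \o ell).
Proof.
have := integrable_ellM (cst 1) (measurable_cst _).
rewrite (_ : (fun u => _) = ell); first by apply=> t; rewrite normr1.
by apply/funext => u; rewrite mulr1.
Qed.

Lemma Rintegral_shift_period (f : R -> R) s : measurable_fun setT f ->
  (forall t, f (t + tpi) = f t) ->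
  Rintegral leb I0 (fun t => f (t + s)) = Rintegral leb I0 f.
Proof.
move=> mf fp; rewrite /Rintegral; congr fine.
have G (g : R -> \bar R) : measurable_fun setT g -> (forall t, (0 <= g t)%E) ->
    (forall t, g (t + tpi) = g t) ->
    (\int[leb]_(t in I0) g (t + s)%R = \int[leb]_(t in I0) g t)%E.
  move=> mg g0 gp; rewrite ge0_integral_shift_itv// add0r addrC ge0_integral_period//.
  exact: tpi_gt0.
rewrite integralE [RHS]integralE; congr (_ - _)%E.
- rewrite -(G (EFin \o f)^\+%E)//.
  + by apply: eq_integral => z _; rewrite !funeposE.
  + by apply: measurable_funepos; exact/measurable_EFinP.
  + by move=> t; rewrite !funeposE /= fp.
- rewrite -(G (EFin \o f)^\-%E)//.
  + by apply: eq_integral => z _; rewrite !funenegE.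
  + by apply: measurable_funeneg; exact/measurable_EFinP.
  + by move=> t; rewrite !funenegE /= fp.
Qed.

Lemma Rintegral_double_period (f : R -> R) : measurable_fun setT f ->
  (forall t, f (t + tpi) = f t) ->
  Rintegral leb I0 (fun t => f (2 * t)) = Rintegral leb I0 f.
Proof.
move=> mf fp; rewrite /Rintegral; congr fine.
have G (g : R -> \bar R) : measurable_fun setT g -> (forall t, (0 <= g t)%E) ->
    (forall t, g (t + tpi) = g t) ->
    (\int[leb]_(t in I0) g (2 * t)%R = \int[leb]_(t in I0) g t)%E.
  move=> mg g0 gp.
  have E1 : ((2 : R)%:E * \int[leb]_(t in I0) g (2 * t)%R = \int[leb]_(t in `[0%R, (tpi + tpi)%R[) g t)%E.
    rewrite integral_mkcond [RHS]integral_mkcond.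
    rewrite -[RHS](@ge0_integral_affine _ 2 0)//=; last 2 first.
    - by apply/(measurable_restrictT g) => //; exact: measurable_funTS.
    - by move=> t; rewrite patchE; case: ifP.
    congr (_ * _)%E; apply: eq_integral => t _; rewrite !patchE addr0.
    suff -> : (t \in I0) = (2 * t \in `[0%R, (tpi + tpi)%R[%classic) by [].
    apply/idP/idP; rewrite !inE/= !in_itv/= => /andP[h1 h2]; apply/andP; split; lra.
  have E2 : (\int[leb]_(t in `[0%R, (tpi + tpi)%R[) g t = (2 : R)%:E * \int[leb]_(t in I0) g t)%E.
    have t0 := @tpi_gt0 R.
    rewrite (@itv_bndbnd_setU _ _ (BLeft 0) (BLeft tpi)) ?bnd_simp ?lerDl ?(ltW t0)//.
    rewrite ge0_integral_setU; [|by []|by []| | |].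
    - by rewrite ge0_integral_period// mule_natl mule2n.
    - exact: measurable_funTS.
    - by move=> t _.
    - apply/disj_setPS => t [/=]; rewrite !in_itv/= => /andP[_ h1] /andP[h2 _].
      by move: (lt_le_trans h1 h2); rewrite ltxx.
  move: E1; rewrite E2.
  move/(congr1 (fun x => (2^-1 : R)%:E * x)%E).
  by rewrite !muleA -!EFinM mulVf ?pnatr_eq0// !mul1e.
rewrite integralE [RHS]integralE; congr (_ - _)%E.
- rewrite -(G (EFin \o f)^\+%E)//.
  + by apply: eq_integral => z _; rewrite !funeposE.
  + by apply: measurable_funepos; exact/measurable_EFinP.
  + by move=> t; rewrite !funeposE /= fp.
- rewrite -(G (EFin \o f)^\-%E)//.
  + by apply: eq_integral => z _; rewrite !funenegE.
  + by apply: measurable_funeneg; exact/measurable_EFinP.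
  + by move=> t; rewrite !funenegE /= fp.
Qed.

Lemma ell_double u : sin u != 0 -> ell (2 * u) = ell u + ell (u + pi).
Proof.
move=> s0.
have E : sin u = 2 * sin (u / 2) * cos (u / 2).
  have -> : sin u = sin (u / 2 + u / 2) by congr sin; field.
  by rewrite sinD; ring.
have [s1 s2] : sin (u / 2) != 0 /\ cos (u / 2) != 0.
  by move: s0; rewrite E !mulf_eq0 !negb_or => /andP[/andP[_ ->] ->].
rewrite /ell -lnM ?posrE ?mulr_gt0 ?normr_gt0//; last first.
  have -> : (u + pi) / 2 = u / 2 + pi / 2 by field.
  by rewrite sinDpihalf.
congr ln.
have -> : (u + pi) / 2 = u / 2 + pi / 2 by field.
have -> : 2 * u / 2 = u by field.
rewrite sinDpihalf E !normrM ger0_norm//; ring.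
Qed.

(** Euler's trick: the duplication formula and periodicity give J = J + J for the finite integral
    J. *)
Lemma Rintegral_ell : Rintegral leb I0 ell = 0.
Proof.
set J := Rintegral leb I0 ell.
have mp : measurable_fun setT (fun t : R => ell (t + pi)).
  by apply: (measurableT_comp measurable_ell); exact: measurable_funD.
have ip : leb.-integrable I0 (EFin \o (fun t => ell (t + pi))).
  apply/integrableP; split; first by apply/measurable_EFinP; exact: measurable_funTS.
  have -> : (\int[leb]_(t in I0) `|(EFin \o (fun t : R => ell (t + pi)%R)) t| = \int[leb]_(t in I0) `|(ell t)%:E|)%E.
    have h := @ge0_integral_shift_itv R pi 0 tpi (fun t => `|(ell t)%:E|)%E.
    rewrite h//; last first.
      by apply: measurableT_comp => //; apply/measurable_EFinP; exact: measurable_ell.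
    rewrite add0r addrC ge0_integral_period//; first exact: tpi_gt0.
      by apply: measurableT_comp => //; apply/measurable_EFinP; exact: measurable_ell.
    by move=> t; rewrite ell_period.
  by have /integrableP[] := integrable_ell.
have J2 : J = Rintegral leb I0 (fun t => ell (2 * t)).
  by rewrite Rintegral_double_period//; [exact: measurable_ell|exact: ell_period].
have J3 : J = J + J.
  rewrite {1}J2.
  transitivity (Rintegral leb I0 (fun t => ell t + ell (t + pi))).
    rewrite /Rintegral; congr fine; apply: ae_eq_integral => //.
    - apply/measurable_EFinP; apply: measurable_funTS.
      by apply: (measurableT_comp measurable_ell); exact: measurable_funM.
    - apply/measurable_EFinP; apply: measurable_funTS.
      by apply: measurable_funD => //; exact: measurable_ell.
    (* The duplication formula is available where sin t != 0, that is off the zeros of sin (t / 2)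
       and of cos (t / 2), which are null sets. *)
    - exists [set t | sin ((0 - t) / 2) = 0 \/ sin ((pi - t) / 2) = 0]; split.
      + rewrite (_ : [set _ | _] = [set t | sin ((0 - t) / 2) = 0] `|` [set t | sin ((pi - t) / 2) = 0])//.
        by apply: measurableU; exact: measurable_sin_half.
      + rewrite (_ : [set _ | _] = [set t | sin ((0 - t) / 2) = 0] `|` [set t | sin ((pi - t) / 2) = 0])//.
        by apply/null_set_setU => //; try exact: measurable_sin_half; exact: null_sin_half.
      + move=> t /= /not_implyP[_ nE].
        apply: contra_notP nE => /not_orP[n1 n2]; rewrite ell_double//.
        have -> : sin t = sin (t / 2 + t / 2) by congr sin; field.
        rewrite sinD.
        have e1 : sin ((0 - t) / 2) = - sin (t / 2).
          by rewrite -sinN; congr sin; field.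
        have e2 : sin ((pi - t) / 2) = cos (t / 2).
          have -> : (pi - t) / 2 = - (t / 2) + pi / 2 by field.
          by rewrite sinDpihalf cosN.
        have m1 : sin (t / 2) != 0.
          by apply/eqP => h; apply: n1; rewrite e1 h oppr0.
        have m2 : cos (t / 2) != 0.
          by apply/eqP => h; apply: n2; rewrite e2.
        rewrite (_ : _ + _ = 2 * (sin (t / 2) * cos (t / 2))); last by ring.
        by rewrite !mulf_neq0.
  rewrite RintegralD//; last exact: integrable_ell.
  by rewrite Rintegral_shift_period//; [exact: measurable_ell|exact: ell_period].
by lra.
Qed.

End Ell.

Section EllCos.
Context {R : realType}.
Local Notation leb := (@lebesgue_measure R).
Local Notation tpi := (2 * pi : R).
Local Notation I0 := (`[0%R, tpi[%classic : set R).

Lemma measurable_cosR : measurable_fun setT (@cos R).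
Proof. by apply: continuous_measurable_fun; exact: continuous_cos. Qed.
Lemma measurable_sinR : measurable_fun setT (@sin R).
Proof. by apply: continuous_measurable_fun; exact: continuous_sin. Qed.

Lemma cos_period (t : R) : cos (t + tpi) = cos t.
Proof. by rewrite mulrC mulr_natr cosD2pi. Qed.
Lemma sin_period (t : R) : sin (t + tpi) = sin t.
Proof. by rewrite mulrC mulr_natr sinD2pi. Qed.
Lemma sin_tpi : sin tpi = 0.
Proof. by rewrite -[tpi]add0r sin_period sin0. Qed.

Lemma Rintegral_cos : Rintegral leb I0 cos = 0.
Proof.
rewrite Rintegral_itv_bndo_bndc; last first.
  apply: (@integrable_le R _ _ (cst 1)) => //=; first exact: measurable_cosR.
    by move=> t _; exact: norm_cos_le1.
  rewrite integral_cst//= mul1e lebesgue_measure_itv/=; case: ifP => _; by rewrite ?ltry// -EFinB ltry.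
rewrite /Rintegral (@FTC2_within R cos sin)//.
- by rewrite sin_tpi sin0 subrr.
- by rewrite ltW// tpi_gt0.
- by move=> t _; exact: derive1_sin.
- by move=> t _; exact: continuous_cos.
Qed.

Lemma Rintegral_cos2 : Rintegral leb I0 (fun t => cos t ^+ 2) = pi.
Proof.
have mc : measurable_fun setT (fun t : R => cos t ^+ 2).
  by apply: measurable_funX; exact: measurable_cosR.
rewrite Rintegral_itv_bndo_bndc; last first.
  apply: (@integrable_le R _ _ (cst 1)) => //=.
    by move=> t _; rewrite normrX expr_le1// norm_cos_le1.
  rewrite integral_cst//= mul1e lebesgue_measure_itv/=; case: ifP => _; by rewrite ?ltry// -EFinB ltry.
pose F := fun t : R => (t + sin t * cos t) / 2.
have dF (t : R) : is_derive t 1 F (cos t ^+ 2).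
  have := isdZr 2^-1 (isdD (isd_id t) (isdM (is_derive_sin t) (is_derive_cos t))).
  move=> /isd_eq; apply; have := cos2Dsin2 t; rewrite !expr2; lra.
rewrite /Rintegral (@FTC2_within R (fun t => cos t ^+ 2) F)//.
- by rewrite /F/= sin_tpi sin0 !mul0r !addr0; lra.
- by rewrite ltW// tpi_gt0.
- by move=> t _; rewrite derive1E; exact: derive_val.
- move=> t _; have -> : (fun t : R => cos t ^+ 2) = (fun t => cos t * cos t) by [].
  by apply: cvgM; exact: continuous_cos.
Qed.

Lemma ell_sin_bound (u : R) : `|ell u * sin u| <= 4 * Num.sqrt `|sin (u / 2)|.
Proof.
rewrite normrM; have := ell_bound u; rewrite sinp_half_sqrt.
set s := `|sin (u / 2)|.
have -> : `|sin u| = 2 * s * `|cos (u / 2)|.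
  have -> : sin u = sin (u / 2 + u / 2) by congr sin; field.
  rewrite sinD (_ : _ + _ = 2 * sin (u / 2) * cos (u / 2)); last by ring.
  by rewrite !normrM ger0_norm.
have c1 := norm_cos_le1 (u / 2).
have [s0|s0] := eqVneq s 0.
  by rewrite s0 sqrtr0 !mulr0 mul0r mulr0.
have sp : 0 < s by rewrite lt_neqAle eq_sym s0 /s normr_ge0.
have q0 : 0 < Num.sqrt s by rewrite sqrtr_gt0.
have fixpt : s = Num.sqrt s ^+ 2 by rewrite sqr_sqrtr// ltW.
move=> h; apply: (@le_trans _ _ (2 * (Num.sqrt s)^-1 * (2 * s * 1))).
  apply: ler_pM => //; first by rewrite !mulr_ge0// ltW.
  by apply: ler_wpM2l => //; rewrite mulr_ge0// ltW.
move: {h} (Num.sqrt s) q0 fixpt => q q0 ->.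
by rewrite le_eqVlt; apply/orP; left; apply/eqP; field; rewrite gt_eqF.
Qed.

(** The primitive of [ell u * cos u] on []0, 2 pi[] found by integration by parts; the factor
    [sin u] tames the logarithm, so that it is continuous at the ends as well. *)
Definition ellF (u : R) : R := ell u * sin u - (u + sin u) / 2.

Lemma ellF_cont0 (a : R) : sin (a / 2) = 0 -> {for a, continuous ellF}.
Proof.
move=> a0; rewrite /ellF; apply: cvgB; last first.
  apply: cvgMl; apply: cvgD; first exact: cvg_id.
  exact: continuous_sin.
have sa : sin a = 0.
  have -> : sin a = sin (a / 2 + a / 2) by congr sin; field.
  by rewrite sinD a0 mul0r mulr0 addr0.
rewrite sa mulr0.
apply/norm_cvg0P => //.
have h0 : (fun u : R => 4 * Num.sqrt `|sin (u / 2)|) u @[u --> a] --> 0.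
  rewrite -[X in _ --> X](_ : 4 * Num.sqrt `|sin (a / 2)| = 0); last first.
    by rewrite a0 normr0 sqrtr0 mulr0.
  apply: cvgMr.
  apply: (@cvg_comp _ _ _ (fun u : R => `|sin (u / 2)|) (@Num.sqrt R) _ (nbhs `|sin (a / 2)|)).
    apply: cvg_norm; apply: (@cvg_comp _ _ _ (fun u : R => u / 2) (@sin R) _ (nbhs (a / 2))).
      by apply: cvgMl; exact: cvg_id.
    exact: continuous_sin.
  exact: sqrt_continuous.
apply: (squeeze_cvgr _ (cvg_cst 0) h0).
by apply: nearW => u; rewrite normr_ge0 ell_sin_bound.
Qed.

Lemma sin_half_gt0 (t : R) : 0 < t < tpi -> 0 < sin (t / 2).
Proof. by move=> /andP[t0 t1]; apply: sin_gt0_pi; apply/andP; split; lra. Qed.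

Lemma is_derive_ell (t : R) : 0 < t < tpi -> is_derive t 1 ell (cos (t / 2) / (2 * sin (t / 2))).
Proof.
move=> tI; have s0 := sin_half_gt0 t tI.
pose g (u : R) := ln (2 * sin (u / 2)).
have p0 : 0 < 2 * sin (t / 2) by rewrite mulr_gt0.
have dg : is_derive t 1 g (cos (t / 2) / (2 * sin (t / 2))).
  have h1 := isdZ 2 (isd_comp (g := fun u => u / 2) (is_derive_sin (t / 2)) (isdZr 2^-1 (isd_id t))).
  have h4 := isd_comp (g := fun u => 2 * sin (u / 2)) (is_derive1_ln p0) h1.
  by apply: (isd_eq h4); rewrite /g; field; rewrite gt_eqF.
apply: (isd_near (f := g)) dg; near=> u; rewrite /ell /g gtr0_norm// sin_half_gt0//.
suff : u \in `]0, tpi[ by rewrite in_itv.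
by near: u; exact: near_in_itvoo.
Unshelve. all: by end_near. Qed.

(** This coefficient gives convolution with [kap0] the eigenvalue 1/2 on the cosine. The derivative
    of [ellF] is computed from ell' sin = cos^2 (u / 2) = (1 + cos u) / 2. *)
Lemma Rintegral_ell_cos : Rintegral leb I0 (fun u => ell u * cos u) = - pi.
Proof.
have ii := integrable_ellM cos measurable_cosR norm_cos_le1.
have mm : measurable_fun setT (fun u : R => ell u * cos u).
  by apply: measurable_funM; [exact: measurable_ell|exact: measurable_cosR].
rewrite Rintegral_itv_bndo_bndc//.
have dF (t : R) : 0 < t < tpi -> is_derive t 1 ellF (ell t * cos t).
  move=> tI; have s0 := sin_half_gt0 t tI.
  have h := isdB (isdM (is_derive_ell t tI) (is_derive_sin t))
     (isdZr 2^-1 (isdD (isd_id t) (is_derive_sin t))).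
  apply: (isd_eq h).
  have -> : sin t = 2 * sin (t / 2) * cos (t / 2).
    have -> : sin t = sin (t / 2 + t / 2) by congr sin; field.
    by rewrite sinD; ring.
  have := one_minus_cos t; have := cos2Dsin2 (t / 2).
  rewrite (_ : cos (t / 2) / (2 * sin (t / 2)) * (2 * sin (t / 2) * cos (t / 2)) = cos (t / 2) ^+ 2); last first.
    by field; rewrite gt_eqF.
  lra.
rewrite (@FTC2_integrable R _ ellF)//.
- by rewrite /ellF sin_tpi sin0; lra.
- exact: tpi_gt0.
- rewrite -(setDUK (A:=`[0%R,tpi[) (B:=`[0%R,tpi])).
    apply/integrableP; split.
      by apply/measurable_EFinP; apply: measurable_funTS.
    rewrite setDUK; last by apply: subset_itvl; rewrite bnd_simp.
    rewrite -integral_itv_bndo_bndc; last first.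
      by apply: measurableT_comp => //; apply/measurable_EFinP; apply: measurable_funTS.
    by case/integrableP: ii.
  by apply: subset_itvl; rewrite bnd_simp.
- by move=> t /dF; exact: isd_derivable.
- by move=> t /dF; exact: isd_derive1.
- move=> t tI; apply: cvgM; last exact: continuous_cos.
  by apply: derivable_continuous; exact: isd_derivable (is_derive_ell t tI).
- by apply: ellF_cont0; rewrite mul0r sin0.
- by apply: ellF_cont0; rewrite mulrC mulKf// sinpi.
Qed.
End EllCos.

(** * A shifted kernel of L^1 norm below pi *)

Section Theta.
Context {R : realType}.
Local Notation leb := (@lebesgue_measure R).
Local Notation tpi := (2 * pi : R).
Local Notation I0 := (`[0%R, tpi[%classic : set R).

Lemma leb_I0 : leb I0 = tpi%:E.
Proof. by rewrite lebesgue_measure_itv/= lte_fin tpi_gt0 -EFinB subr0. Qed.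

Lemma integrable_I0_bounded (f : R -> R) (C : R) : measurable_fun setT f ->
  (forall t, `|f t| <= C) -> leb.-integrable I0 (EFin \o f).
Proof.
move=> mf fC; apply: (@integrable_le R _ _ (cst C)) => //.
rewrite /= integral_cst//= leb_I0 -EFinM ltry//.
Qed.

Lemma Rintegral_I0_cst (c : R) : Rintegral leb I0 (cst c) = c * tpi.
Proof. by rewrite Rintegral_cst// [X in fine X]leb_I0. Qed.

(** With s = sin (u / 2), the bounds - ln (2 s) >= 1 - 2 s and - cos u = 2 s^2 - 1 add up to this
    square, which vanishes at u = pi / 3 and 5 pi / 3 only. *)
Lemma gker_pos (u : R) : 0 < u < tpi ->
  2^-1 * (2 * sin (u / 2) - 1) ^+ 2 <= - ell u - cos u + 2^-1.
Proof.
move=> uI; have s0 := sin_half_gt0 u uI.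
have := ln_le_sub1 (2 * sin (u / 2)); rewrite mulr_gt0// => /(_ isT).
rewrite /ell gtr0_norm//; have := one_minus_cos u; rewrite !expr2; nra.
Qed.

(** [B1] and [B2] surround the zeros pi / 3 and 5 pi / 3 of the square in [gker_pos]; [e] is a crude
    lower bound of the shifted kernel away from them. *)
Let e : R := 1 / 50.
Let B1 : set R := `]1 / 2, pi / 2[.
Let B2 : set R := `]3 * pi / 2, tpi[.

Lemma gker_far (u : R) : 0 < u < tpi -> ~ B1 u -> ~ B2 u -> e <= - ell u - cos u + 2^-1.
Proof.
move=> uI n1 n2; apply: le_trans (gker_pos u uI).
have s0 := sin_half_gt0 u uI; have /andP[u0 u1] := uI.
have [h|h] := leP u (1 / 2).
  have : sin (u / 2) <= 1 / 4.
    have := norm_sin_le (u / 2); rewrite gtr0_norm// gtr0_norm; last by lra.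
    by move=> /le_trans; apply; lra.
  rewrite /e expr2; nra.
have h2 : pi / 2 <= u.
  by rewrite leNgt; apply/negP => h2; apply: n1; rewrite /B1/= in_itv/= h.
have h3 : u <= 3 * pi / 2.
  by rewrite leNgt; apply/negP => h3; apply: n2; rewrite /B2/= in_itv/= h3.
have c0 : cos u <= 0.
  have -> : cos u = - cos (u - pi) by rewrite -[in LHS](subrK pi u) cosDpi.
  by rewrite oppr_le0; apply: cos_ge0_pihalf; lra.
have : 7 / 10 <= sin (u / 2).
  rewrite leNgt; apply/negP => hs.
  have := one_minus_cos u; rewrite !expr2; nra.
rewrite /e expr2; nra.
Qed.

(* The mean-zero kernel -ell - cos has a negative part, but adding the constant d0 makes its L^1 norm
   strictly smaller than pi: by ln t <= t - 1 it is bounded below by a square minus 1/2. *)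
Lemma theta_kernel : exists d0 theta : R, [/\ 0 <= d0 <= 1, 0 <= theta < 1 &
  (\int[leb]_(u in I0) `|- ell u - cos u + d0|%:E <= (pi * theta)%:E)%E].
Proof.
(* The shift 1/2 would give a nonnegative kernel of integral exactly pi. With the shift lowered by
   [e] it can be negative only on [B1] and [B2], whose total length pi - 1/2 is less than half the
   period, so the L^1 norm decreases: by 2 pi e, minus at most 2 e (pi - 1/2). *)
exists (2^-1 - e), (1 - e / pi).
have p2 := @pi_ge2 R; have p0 := @pi_gt0 R.
have e0 : 0 < e by rewrite /e; lra.
split.
  by apply/andP; split; rewrite /e; lra.
  rewrite subr_ge0 ler_pdivrMr// mul1r ltrBlDr ltrDl divr_gt0// andbT.
  by rewrite /e; lra.
(* [h] dominates the absolute value: |X - e| <= X + e for X >= 0 on [B1] and [B2], and X - e >= 0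
   elsewhere, where X is the kernel shifted by 1/2. *)
pose h (u : R) := (- ell u - cos u) + ((2^-1 - e) + 2 * e * (\1_B1 u + \1_B2 u)).
have mB1 : measurable B1 by rewrite /B1; exact: measurable_itv.
have mB2 : measurable B2 by rewrite /B2; exact: measurable_itv.
have mind (B : set R) : measurable B -> measurable_fun setT (\1_B : R -> R).
  by move=> mB; exact: measurable_indic.
have m1 : measurable_fun setT (fun u : R => - ell u - cos u).
  by apply: measurable_funB; [apply: measurableT_comp => //; exact: measurable_ell|exact: measurable_cosR].
have i1 : leb.-integrable I0 (EFin \o (fun u : R => - ell u - cos u)).
  apply: integrable_subR => //; last first.
    by apply: (integrable_I0_bounded _ 1); [exact: measurable_cosR|exact: norm_cos_le1].
  by apply: integrable_oppR => //; exact: integrable_ell.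
have m2 : measurable_fun setT (fun u : R => (2^-1 - e) + 2 * e * (\1_B1 u + \1_B2 u)).
  apply: measurable_funD => //; apply: measurable_funM => //.
  by apply: measurable_funD; exact: mind.
have i2 : leb.-integrable I0 (EFin \o (fun u : R => (2^-1 - e) + 2 * e * (\1_B1 u + \1_B2 u))).
  apply: (integrable_I0_bounded _ 1) => // t; rewrite !indicE /e.
  by case: (t \in B1); case: (t \in B2); rewrite /= ger0_norm; lra.
have ih : leb.-integrable I0 (EFin \o h).
  exact: integrable_addR.
have Eh : Rintegral leb I0 h = pi - e.
  rewrite /h RintegralD// RintegralB//; last 2 first.
  - by apply: integrable_oppR => //; exact: integrable_ell.
  - by apply: (integrable_I0_bounded _ 1); [exact: measurable_cosR|exact: norm_cos_le1].
  rewrite Rintegral_cos.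
  under eq_Rintegral do rewrite -mulN1r.
  rewrite RintegralZl//; last exact: integrable_ell.
  rewrite Rintegral_ell mulr0 subr0 add0r.
  have ib (B : set R) : measurable B -> leb.-integrable I0 (EFin \o (\1_B : R -> R)).
    move=> mB; apply: (integrable_I0_bounded _ 1); first exact: mind.
    by move=> t; rewrite indicE; case: (t \in B); rewrite ?normr1 ?normr0.
  have ibb : leb.-integrable I0 (EFin \o (fun u : R => \1_B1 u + \1_B2 u)).
    by apply: integrable_addR => //; exact: ib.
  rewrite RintegralD//; last 2 first.
  - by apply: (integrable_I0_bounded _ (2^-1 - e)) => // t; rewrite ger0_norm// /e; lra.
  - exact: integrable_mulR.
  rewrite RintegralZl; [|by []|exact: ibb].
  have E1 : Rintegral leb I0 \1_B1 = pi / 2 - 1 / 2.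
    rewrite /Rintegral integral_indic// setIidl.
      by rewrite [X in fine X]lebesgue_measure_itv/= lte_fin ifT/=; lra.
    by move=> t; rewrite /B1/= !in_itv/= => /andP[h1 h2]; apply/andP; split; lra.
  have E2 : Rintegral leb I0 \1_B2 = pi / 2.
    rewrite /Rintegral integral_indic// setIidl.
      by rewrite [X in fine X]lebesgue_measure_itv/= lte_fin ifT/=; lra.
    by move=> t; rewrite /B2/= !in_itv/= => /andP[h1 h2]; apply/andP; split; lra.
  have E12 : Rintegral leb I0 (fun u : R => \1_B1 u + \1_B2 u) = pi - 1 / 2.
    by rewrite RintegralD; [rewrite E1 E2; lra|by []|exact: ib|exact: ib].
  by rewrite E12 (Rintegral_I0_cst (2^-1 - e)) /e; field.
apply: (@le_trans _ _ (pi - e)%:E); last first.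
  by rewrite lee_fin mulrBr mulr1 [_ * (e / _)]mulrC divfK// gt_eqF.
rewrite -Eh /Rintegral fineK; last exact: integrable_fin_num.
rewrite -[leLHS]integral_itv_obnd_cbnd; last first.
  apply/measurable_EFinP; apply: measurable_funTS; apply: measurableT_comp => //.
  exact: measurable_funD.
rewrite -[leRHS]integral_itv_obnd_cbnd; last first.
  by apply/measurable_EFinP; apply: measurable_funTS; exact: measurable_funD.
have mh : measurable_fun setT h by exact: measurable_funD.
have key u : 0 < u < tpi -> `|- ell u - cos u + (2^-1 - e)| <= h u.
  move=> uI; have kp : 0 <= - ell u - cos u + 2^-1.
    by apply: le_trans (gker_pos u uI); rewrite mulr_ge0// sqr_ge0.
  rewrite /h !indicE.
  have [hb|hb] := pselect (B1 u \/ B2 u).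
    suff : 1 <= (u \in B1)%:R + (u \in B2)%:R :> R.
      by rewrite ler_norml; nra.
    by case: hb => hb; rewrite (mem_set hb) ?lerDl ?lerDr ler0n.
  move/not_orP: hb => [hb1 hb2].
  have := gker_far u uI hb1 hb2.
  rewrite (memNset hb1) (memNset hb2) /= !mulr0n addr0 mulr0 addr0 => kf.
  by rewrite ger0_norm//; lra.
apply: ge0_le_integral.
- by [].
- by move=> t _; rewrite lee_fin.
- apply/measurable_EFinP; apply: measurable_funTS; apply: measurableT_comp => //.
  exact: measurable_funD.
- by apply/measurable_EFinP; apply: measurable_funTS.
- by move=> t; rewrite /= in_itv/= => tI; rewrite lee_fin key.
Qed.
End Theta.

(** * The kernel of the stream function *)

Section Kernel.
Context {R : realType}.
Local Notation tpi := (2 * pi : R).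

(* kap is minus the kernel of the stream function, shifted by a constant so that it has mean zero on
   the line w = 0; shh w = sinh^2 (w / 2). *)
Definition shh (w : R) : R := (cosh w - 1) / 2.
Definition sinhR (w : R) : R := (expR w - expR (- w)) / 2.
Definition kap (u w : R) : R := - (4 * pi)^-1 * (ln (cosh w - cos u) + ln 2).
Definition kap0 (u : R) : R := - (2 * pi)^-1 * ell u.
Definition kapx (u w : R) : R := - (4 * pi)^-1 * (sin u / (cosh w - cos u)).
Definition kapy (u w : R) : R := - (4 * pi)^-1 * (sinhR w / (cosh w - cos u)).

Lemma inv4pi_ge0 : 0 <= (4 * pi : R)^-1.
Proof. by rewrite invr_ge0 mulr_ge0// pi_ge0. Qed.
Lemma inv4pi_le1 : (4 * pi : R)^-1 <= 1.
Proof. by have h := @pi_ge2 R; rewrite invf_le1//; lra. Qed.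
Lemma inv2pi_ge0 : 0 <= (2 * pi : R)^-1.
Proof. by rewrite invr_ge0 mulr_ge0// pi_ge0. Qed.

(** The half-angle formulas make the argument of the logarithm a sum of two squares, one in each
    variable; all bounds with separated variables start from here. *)
Lemma cosh_sub (u w : R) : cosh w - cos u = 2 * (shh w + sin (u / 2) ^+ 2).
Proof. by rewrite /shh; have := one_minus_cos u; lra. Qed.

Lemma coshN (w : R) : cosh (- w) = cosh w.
Proof. by rewrite /cosh opprK addrC. Qed.

Lemma cosh_norm (w : R) : cosh `|w| = cosh w.
Proof. by case: (ger0P w) => // _; rewrite coshN. Qed.

Lemma cosh_le (a b : R) : `|a| <= `|b| -> cosh a <= cosh b.
Proof.
rewrite -(cosh_norm a) -(cosh_norm b); move: (`|a|) (`|b|) (normr_ge0 a) => {}a {}b a0 ab.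
have h1 : expR a <= expR b by rewrite ler_expR.
have h2 : expR (- a) * expR (- b) <= 1.
  by rewrite -expRD -expR0 ler_expR; lra.
have e1 : expR a * expR (- a) = 1 by rewrite -expRD subrr expR0.
have e2 : expR b * expR (- b) = 1 by rewrite -expRD subrr expR0.
have p1 := expR_gt0 a; have p2 := expR_gt0 b.
have p3 := expR_gt0 (- a); have p4 := expR_gt0 (- b).
rewrite /cosh.
(* This product equals 2 (cosh b - cosh a). *)
have : 0 <= (expR b - expR a) * (1 - expR (- a) * expR (- b)) by rewrite mulr_ge0 ?subr_ge0.
nra.
Qed.

Lemma shh_sq (w : R) : shh w = ((expR (w / 2) - expR (- (w / 2))) / 2) ^+ 2.
Proof.
have e0 : expR (w / 2) * expR (- (w / 2)) = 1 by rewrite -expRD subrr expR0.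
have e1 : expR w = expR (w / 2) ^+ 2 by rewrite expr2 -expRD; congr expR; field.
have e2 : expR (- w) = expR (- (w / 2)) ^+ 2 by rewrite expr2 -expRD; congr expR; field.
by rewrite /shh /cosh e1 e2; rewrite !expr2; lra.
Qed.

Lemma shh_ge0 w : 0 <= shh w. Proof. by rewrite shh_sq sqr_ge0. Qed.

Lemma shh_norm (w : R) : shh `|w| = shh w. Proof. by rewrite /shh cosh_norm. Qed.

Lemma shh_le (a b : R) : `|a| <= `|b| -> shh a <= shh b.
Proof. by move=> /cosh_le h; rewrite /shh; lra. Qed.

Lemma shh_ge (w : R) : (`|w| / 4) ^+ 2 <= shh w.
Proof.
rewrite -shh_norm; move: (`|w|) (normr_ge0 w) => {}w w0.
have h1 := expR_ge1Dx (w / 2).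
have h2 : expR (- (w / 2)) <= 1 by rewrite -[X in _ <= X]expR0 ler_expR; lra.
rewrite shh_sq ler_pXn2r ?nnegrE//; lra.
Qed.

Lemma shh_gt0 (w : R) : w != 0 -> 0 < shh w.
Proof. by move=> w0; apply: lt_le_trans (shh_ge w); rewrite exprn_gt0// divr_gt0// normr_gt0. Qed.

Lemma shh_small (w : R) : `|w| <= 1 -> shh w <= w ^+ 2.
Proof.
rewrite -shh_norm -(real_normK (num_real w)); move: (`|w|) (normr_ge0 w) => {}w w0 w1.
have h1 := expR_ge1Dx (- (w / 2)).
have e0 : expR (w / 2) * expR (- (w / 2)) = 1 by rewrite -expRD subrr expR0.
have p1 := expR_gt0 (w / 2).
have p2 := expR_gt0 (- (w / 2)).
have h3 : expR (w / 2) <= 2 by nra.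
have h4 : 1 <= expR (w / 2) by rewrite -[X in X <= _]expR0 ler_expR; lra.
have h5 : expR (w / 2) - 1 <= w by nra.
rewrite shh_sq ler_pXn2r ?nnegrE//; nra.
Qed.

Lemma kap_arg_gt0 (u w : R) : w != 0 \/ sin (u / 2) != 0 -> 0 < cosh w - cos u.
Proof.
rewrite cosh_sub => -[w0|s0]; rewrite mulr_gt0//.
  by rewrite ltr_wpDr ?shh_gt0// sqr_ge0.
by rewrite ltr_wpDl ?shh_ge0// exprn_even_gt0.
Qed.

Lemma kap_period u w : kap (u + tpi) w = kap u w.
Proof. by rewrite /kap cos_period. Qed.
Lemma kap0_period u : kap0 (u + tpi) = kap0 u.
Proof. by rewrite /kap0 ell_period. Qed.
Lemma kapN u w : kap (- u) w = kap u w.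
Proof. by rewrite /kap cosN. Qed.

Lemma kap_dec u a b : sin (u / 2) != 0 -> `|a| <= `|b| -> kap u b <= kap u a.
Proof.
move=> s0 ab; rewrite /kap !mulNr lerN2 ler_pM2l ?invr_gt0 ?mulr_gt0 ?pi_gt0//.
rewrite lerD2r ler_ln ?posrE ?kap_arg_gt0//; [|by right|by right].
by rewrite lerD2r cosh_le.
Qed.

Lemma ln1D_quartic (x : R) : 0 <= x -> ln (1 + x ^+ 4) <= 4 * x.
Proof.
move=> x0; apply: (@le_trans _ _ (ln ((1 + x) ^+ 4))).
  rewrite ler_ln ?posrE ?exprn_gt0//; [|by rewrite ltr_pwDl// exprn_ge0|by rewrite ltr_pwDl].
  have x2 : 0 <= x ^+ 2 by rewrite exprn_ge0.
  have x3 : 0 <= x ^+ 3 by rewrite exprn_ge0.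
  have -> : (1 + x) ^+ 4 = 1 + x ^+ 4 + (4 * x + 6 * x ^+ 2 + 4 * x ^+ 3) by ring.
  by rewrite lerDl; lra.
rewrite lnXn; last by rewrite ltr_pwDl.
have : ln (1 + x) <= x by apply: le_ln1Dx; lra.
by rewrite -mulr_natl; lra.
Qed.

(** The difference is - ln (1 + x^4) / (4 pi) with x^4 = shh w / sin^2 (u / 2). Bounding the
    logarithm linearly in x, the fourth root, separates a small factor of order |w|^(1/2) from an
    integrable power of the sine. *)
Lemma kap_kap0 u w : sin (u / 2) != 0 ->
  `|kap u w - kap0 u| <= Num.sqrt (Num.sqrt (shh w)) * sinp 2^-1 u.
Proof.
move=> s0; set s := `|sin (u / 2)|.
have sp : 0 < s by rewrite normr_gt0.
have s2 : sin (u / 2) ^+ 2 = s ^+ 2 by rewrite /s real_normK// num_real.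
have ap : 0 < shh w + s ^+ 2 by rewrite ltr_wpDl ?shh_ge0// exprn_gt0.
have p0 := @pi_gt0 R; have p2 := @pi_ge2 R.
set x := Num.sqrt (Num.sqrt (shh w)) * sinp 2^-1 u.
have x0 : 0 <= x by rewrite mulr_ge0 ?sqrtr_ge0 ?sinp_ge0.
have x4 : x ^+ 4 = shh w / s ^+ 2.
  rewrite /x sinp_half_sqrt -/s.
  have b2 : Num.sqrt s ^+ 2 = s by rewrite sqr_sqrtr// ltW.
  have a2 : Num.sqrt (Num.sqrt (shh w)) ^+ 2 = Num.sqrt (shh w) by rewrite sqr_sqrtr// sqrtr_ge0.
  have a4 : Num.sqrt (shh w) ^+ 2 = shh w by rewrite sqr_sqrtr// shh_ge0.
  have q0 : Num.sqrt s != 0 by rewrite gt_eqF// sqrtr_gt0.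
  rewrite -[in RHS]a4 -[in RHS]a2 -[in RHS]b2.
  by move: (Num.sqrt s) (Num.sqrt (Num.sqrt (shh w))) q0 => q r q0; field.
have E : kap u w - kap0 u = - (4 * pi)^-1 * ln (1 + x ^+ 4).
  rewrite /kap /kap0 /ell -/s cosh_sub s2 x4.
  have -> : 1 + shh w / s ^+ 2 = (shh w + s ^+ 2) / s ^+ 2.
    by field; rewrite gt_eqF.
  rewrite !lnM ?posrE ?invr_gt0 ?exprn_gt0//.
  rewrite lnV ?posrE ?exprn_gt0// lnXn// mulr2n.
  have pn : pi != 0 :> R by rewrite gt_eqF.
  by move: (pi : R) pn => P pn; field.
have l0 : 0 <= ln (1 + x ^+ 4) by rewrite ln_ge0// lerDl exprn_ge0.
rewrite E normrM normrN (ger0_norm inv4pi_ge0) ger0_norm//.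
rewrite mulrC ler_pdivrMr ?mulr_gt0//.
have := ln1D_quartic x x0 => h.
apply: (le_trans h).
have : 0 <= x * (pi - 1) by rewrite mulr_ge0//; lra.
nra.
Qed.

Lemma kap_kap0_small u w h : sin (u / 2) != 0 -> `|w| <= h -> h <= 1 ->
  `|kap u w - kap0 u| <= Num.sqrt h * sinp 2^-1 u.
Proof.
move=> s0 wh h1; apply: le_trans (kap_kap0 u w s0) _.
have h0 : 0 <= h by exact: le_trans (normr_ge0 w) wh.
have hE : h = Num.sqrt (h ^+ 2) by rewrite sqrtr_sqr ger0_norm.
apply: ler_wpM2r; first exact: sinp_ge0.
rewrite ler_sqrt// {1}hE ler_sqrt ?sqr_ge0//.
apply: le_trans (shh_small w _) _; first exact: le_trans wh h1.
by rewrite -(real_normK (num_real w)) ler_pXn2r ?nnegrE.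
Qed.

Lemma kap0_bound u : `|kap0 u| <= sinp 2^-1 u.
Proof.
have p0 := @pi_gt0 R; have p2 := @pi_ge2 R.
rewrite /kap0 normrM normrN (ger0_norm inv2pi_ge0).
rewrite mulrC ler_pdivrMr ?mulr_gt0//.
apply: (le_trans (ell_bound u)).
have := sinp_ge0 2^-1 u => h.
have : 0 <= sinp 2^-1 u * (pi - 1) by rewrite mulr_ge0//; lra.
nra.
Qed.

Lemma kap_bound u w M : sin (u / 2) != 0 -> `|w| <= M ->
  `|kap u w| <= (1 + Num.sqrt (Num.sqrt (shh M))) * sinp 2^-1 u.
Proof.
move=> s0 wM; have h1 := kap_kap0 u w s0; have h2 := kap0_bound u.
have -> : kap u w = kap0 u + (kap u w - kap0 u) by rewrite addrCA subrr addr0.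
apply: (le_trans (ler_normD _ _)); rewrite mulrDl mul1r lerD//.
apply: (le_trans h1); rewrite ler_wpM2r ?sinp_ge0//.
rewrite ler_sqrt ?sqrtr_ge0// ler_sqrt ?shh_ge0//; apply: shh_le.
by rewrite (le_trans wM)// ler_norm.
Qed.

Lemma powR_young (a b p : R) : 0 < a -> 0 < b -> 0 <= p <= 2 ->
  b `^ (2 - p) * a `^ p <= a ^+ 2 + b ^+ 2.
Proof.
move=> a0 b0 /andP[p0 p2].
have [h|h] := leP a b.
  apply: (@le_trans _ _ (b `^ (2 - p) * b `^ p)).
    by rewrite ler_pM2l ?powR_gt0// ge0_ler_powR// nnegrE ltW.
  rewrite -powRD; last by rewrite (gt_eqF b0) implybT.
  by rewrite subrK powR_mulrn ?(ltW b0)// lerDr sqr_ge0.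
apply: (@le_trans _ _ (a `^ (2 - p) * a `^ p)).
  by rewrite ler_pM2r ?powR_gt0// ge0_ler_powR ?nnegrE ?subr_ge0 ?(ltW a0) ?(ltW b0) ?(ltW h).
rewrite -powRD; last by rewrite (gt_eqF a0) implybT.
by rewrite subrK powR_mulrn ?(ltW a0)// lerDl sqr_ge0.
Qed.

(** Interpolation through [powR_young]: the singularity is shared between the two variables in a
    proportion [p] that stays free. *)
Lemma ratio_bound (a b S p : R) : 0 < a -> 0 < b -> 0 <= p <= 2 -> a ^+ 2 <= S ->
  b / (S + b ^+ 2) <= b `^ (- (1 - p)) * a `^ (- p).
Proof.
move=> a0 b0 p02 aS.
have Sp : 0 < S + b ^+ 2 by rewrite ltr_wpDl ?exprn_gt0// (le_trans _ aS)// sqr_ge0.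
rewrite ler_pdivrMr// powRN.
have E : b = b `^ (- (1 - p)) / a `^ p * (b `^ (2 - p) * a `^ p).
  have e1 : b `^ (- (1 - p)) * b `^ (2 - p) = b.
    rewrite -powRD; last by rewrite (gt_eqF b0) implybT.
    by rewrite (_ : - (1 - p) + (2 - p) = 1) ?powRr1 ?ltW//; lra.
  rewrite mulrACA e1 mulVf ?mulr1// gt_eqF// powR_gt0//.
rewrite {1}E ler_pM2l; last by rewrite mulr_gt0 ?invr_gt0 ?powR_gt0.
apply: le_trans (powR_young a b p a0 b0 p02) _.
by rewrite lerD2r.
Qed.

(** A small [p] makes the w-integral over the strip nearly of order d, at the price of a stronger
    but still integrable singularity in u; p = 1 gives a bound uniform in u. *)
Lemma kapx_bound u w p : sin (u / 2) != 0 -> w != 0 -> 0 <= p <= 1 ->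
  `|kapx u w| <= 4 * (sinp (1 - p) u * `|w| `^ (- p)).
Proof.
move=> s0 w0 /andP[p0 p1]; set s := `|sin (u / 2)|.
have sp : 0 < s by rewrite normr_gt0.
have wp : 0 < `|w| by rewrite normr_gt0.
have s2 : sin (u / 2) ^+ 2 = s ^+ 2 by rewrite /s real_normK// num_real.
have ap : 0 < shh w + s ^+ 2 by rewrite ltr_wpDl ?shh_ge0// exprn_gt0.
have q0 := @pi_gt0 R; have q2 := @pi_ge2 R.
have su : `|sin u| <= 2 * s.
  have -> : sin u = 2 * (sin (u / 2) * cos (u / 2)).
    have -> : sin u = sin (u / 2 + u / 2) by congr sin; field.
    by rewrite sinD; ring.
  rewrite !normrM ger0_norm// ler_pM2l// -/s ler_piMr ?(ltW sp)//; exact: norm_cos_le1.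
have := ratio_bound (`|w| / 4) s (shh w) p.
rewrite divr_gt0// => /(_ isT sp); rewrite p0 (le_trans p1 (ler1n _ 2)) => /(_ isT (shh_ge w)) h.
rewrite /kapx cosh_sub s2 normrM normrN normf_div.
have ap2 : 0 <= 2 * (shh w + s ^+ 2) by rewrite mulr_ge0// ltW.
rewrite (ger0_norm inv4pi_ge0) (ger0_norm ap2).
apply: (@le_trans _ _ (s / (shh w + s ^+ 2))).
  apply: (@le_trans _ _ (1 * (2 * s / (2 * (shh w + s ^+ 2))))).
    apply: ler_pM; [exact: inv4pi_ge0|by rewrite divr_ge0|exact: inv4pi_le1|].
    by rewrite ler_wpM2r// invr_ge0.
  by rewrite mul1r -mulf_div divff// mul1r.
apply: (le_trans h); rewrite /sinp -/s mulrCA ler_pM2l ?powR_gt0//.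
rewrite powRM ?normr_ge0 ?invr_ge0// mulrC ler_wpM2r ?powR_ge0//.
rewrite -powR_inv1// -powRrM mulN1r opprK.
apply: (@le_trans _ _ (4 `^ 1)); last by rewrite powRr1.
by rewrite ler_powR// ler1n.
Qed.

Lemma sinhR_sq w : sinhR w ^+ 2 = 4 * (shh w * (shh w + 1)).
Proof.
have e0 : expR w * expR (- w) = 1 by rewrite -expRD subrr expR0.
rewrite /sinhR /shh /cosh !expr2; nra.
Qed.

(** Equal exponents suffice here, because d/dy always comes with a factor d. Since sinh w is of
    order sqrt (shh w) for bounded w, this square root takes the place of the sine in
    [ratio_bound]. *)
Lemma kapy_bound u w M : sin (u / 2) != 0 -> w != 0 -> `|w| <= M ->
  `|kapy u w| <= (2 * Num.sqrt (shh M + 1)) * (sinp 2^-1 u * `|w| `^ (- 2^-1)).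
Proof.
move=> s0 w0 wM; set s := `|sin (u / 2)|.
have sp : 0 < s by rewrite normr_gt0.
have wp : 0 < `|w| by rewrite normr_gt0.
have s2 : sin (u / 2) ^+ 2 = s ^+ 2 by rewrite /s real_normK// num_real.
have ap : 0 < shh w + s ^+ 2 by rewrite ltr_wpDl ?shh_ge0// exprn_gt0.
have q0 := @pi_gt0 R; have q2 := @pi_ge2 R.
pose b := Num.sqrt (shh w).
have b0 : 0 < b by rewrite sqrtr_gt0 shh_gt0.
have b2 : b ^+ 2 = shh w by rewrite sqr_sqrtr// shh_ge0.
have bw : `|w| / 4 <= b.
  rewrite -(ler_pXn2r (n := 2)) ?nnegrE ?divr_ge0 ?(ltW b0)// b2; exact: shh_ge.
pose c := Num.sqrt (shh M + 1).
have c0 : 0 <= c by rewrite sqrtr_ge0.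
have sw : `|sinhR w| <= 2 * b * c.
  rewrite -(ler_pXn2r (n := 2)) ?nnegrE ?mulr_ge0 ?(ltW b0)//.
  rewrite real_normK ?num_real// sinhR_sq !exprMn b2 sqr_sqrtr; last by rewrite addr_ge0 ?shh_ge0.
  rewrite -mulrA (_ : 2 ^+ 2 = 4); last by rewrite expr2; lra.
  rewrite ler_pM2l// ler_wpM2l ?shh_ge0// lerD2r shh_le//.
  by rewrite (le_trans wM)// ler_norm.
have h : b / (s ^+ 2 + b ^+ 2) <= b `^ (- (1 - 2^-1)) * s `^ (- 2^-1).
  by apply: ratio_bound => //; lra.
rewrite /kapy cosh_sub s2 normrM normrN normf_div.
have ap2 : 0 <= 2 * (shh w + s ^+ 2) by rewrite mulr_ge0// ltW.
rewrite (ger0_norm inv4pi_ge0) (ger0_norm ap2).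
apply: (@le_trans _ _ (1 * (2 * b * c / (2 * (shh w + s ^+ 2))))).
  apply: ler_pM; [exact: inv4pi_ge0|by rewrite divr_ge0|exact: inv4pi_le1|].
  by rewrite ler_wpM2r// invr_ge0.
have -> : 1 * (2 * b * c / (2 * (shh w + s ^+ 2))) = c * (b / (s ^+ 2 + b ^+ 2)).
  by rewrite b2; field; rewrite gt_eqF// addrC.
rewrite -/c [2 * c]mulrC -mulrA ler_wpM2l//.
apply: (le_trans h); rewrite /sinp -/s mulrC mulrCA ler_pM2l ?powR_gt0//.
rewrite (_ : 1 - 2^-1 = 2^-1 :> R); last by lra.
rewrite !powRN !powR12_sqrt// ?(ltW b0)//.
rewrite -[2]invrK -invfM lef_pV2 ?posrE ?mulr_gt0 ?invr_gt0 ?sqrtr_gt0//.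
have -> : (2^-1 : R) = Num.sqrt (4^-1).
  by rewrite (_ : 4^-1 = (2^-1) ^+ 2 :> R) ?sqrtr_sqr ?ger0_norm// expr2; lra.
  by rewrite -sqrtrM// ler_sqrt// ?(ltW b0)// mulrC.
exact: shh_gt0.
Qed.

End Kernel.

Section KernelDiff.
Context {R : realType}.

Lemma isd_kap_u (u w : R) : w != 0 -> is_derive u 1 (fun u => kap u w) (kapx u w).
Proof.
move=> w0; have a0 : 0 < cosh w - cos u by apply: kap_arg_gt0; left.
have h1 : is_derive u 1 (fun u : R => cosh w - cos u) (sin u).
  by apply: (isd_eq (isdB (isd_cst (cosh w) u) (is_derive_cos u))); rewrite sub0r opprK.
have h2 := isd_comp (g := fun u => cosh w - cos u) (is_derive1_ln a0) h1.
have h3 := isdZ (- (4 * pi)^-1) (isdD h2 (isd_cst (ln 2) u)).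
by apply: (isd_eq h3); rewrite /kapx addr0 [_^-1 * sin u]mulrC.
Qed.

Lemma isd_cosh (w : R) : is_derive w 1 (@cosh R) (sinhR w).
Proof.
have h := isdZr 2^-1 (isdD (is_derive_expR w) (isd_comp (g := fun u => - u) (is_derive_expR (- w)) (isdN (isd_id w)))).
by apply: (isd_eq h); rewrite /sinhR mulrN1.
Qed.

Lemma isd_kap_w (u w : R) : sin (u / 2) != 0 -> is_derive w 1 (kap u) (kapy u w).
Proof.
move=> s0; have a0 : 0 < cosh w - cos u by apply: kap_arg_gt0; right.
have h1 : is_derive w 1 (fun w : R => cosh w - cos u) (sinhR w).
  by apply: (isd_eq (isdB (isd_cosh w) (isd_cst (cos u) w))); rewrite subr0.
have h2 := isd_comp (g := fun w => cosh w - cos u) (is_derive1_ln a0) h1.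
have h3 := isdZ (- (4 * pi)^-1) (isdD h2 (isd_cst (ln 2) w)).
by apply: (isd_eq h3); rewrite /kapy addr0 [_^-1 * sinhR w]mulrC.
Qed.

Lemma measurable_cosh : measurable_fun setT (@cosh R).
Proof.
apply: continuous_measurable_fun => w; apply: derivable_continuous.
exact: isd_derivable (isd_cosh w).
Qed.

Lemma measurable_fst1 (f : R -> R) : measurable_fun setT f -> measurable_fun setT (fun z : R * R => f z.1).
Proof. by move=> mf; apply: (measurableT_comp mf); exact: measurable_fst. Qed.
Lemma measurable_snd1 (f : R -> R) : measurable_fun setT f -> measurable_fun setT (fun z : R * R => f z.2).
Proof. by move=> mf; apply: (measurableT_comp mf); exact: measurable_snd. Qed.

Lemma measurable_kap : measurable_fun setT (fun z : R * R => kap z.1 z.2).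
Proof.
apply: measurable_funM => //; apply: measurable_funD => //.
apply: (measurableT_comp (f := @ln R)) => //; apply: measurable_funB.
  by apply: measurable_snd1; exact: measurable_cosh.
by apply: measurable_fst1; exact: measurable_cosR.
Qed.

Lemma measurable_kap_sub (x y : R) : measurable_fun setT (fun z : R * R => kap (x - z.1) (y - z.2)).
Proof.
apply: (measurableT_comp (f := fun z : R * R => kap z.1 z.2) (g := fun z : R * R => (x - z.1, y - z.2))).
  exact: measurable_kap.
apply/measurable_fun_pairP; split => /=.
  by apply: (measurable_fst1 (fun t => x - t)); exact: measurable_funB.
by apply: (measurable_snd1 (fun t => y - t)); exact: measurable_funB.
Qed.

Lemma measurable_kap0 : measurable_fun setT (@kap0 R).
Proof. by apply: measurable_funM => //; exact: measurable_ell. Qed.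

End KernelDiff.

(** * The bump profile and its derivatives *)

Section Bump.
Context {R : realType}.
Implicit Types (m : nat) (t : R).

(* ff 0 is the bump profile e^{-1/t}; the family ff m is closed under differentiation, with ff 0' = ff 2. *)
Definition ff m t : R := if 0 < t then t ^- m * expR (- t^-1) else 0.

Lemma ff_ge0 m t : 0 <= ff m t.
Proof. by rewrite /ff; case: ifPn => // t0; rewrite mulr_ge0 ?invr_ge0 ?exprn_ge0 ?expR_ge0// ltW. Qed.

(** One term of the exponential series: x^m / m! <= e^x at x = 1 / t. *)
Lemma ff_le m t : ff m t <= m`!%:R.
Proof.
rewrite /ff; case: ifPn => // t0.
have x0 : 0 < t^-1 by rewrite invr_gt0.
rewrite -exprVn; move: (t^-1) x0 => x x0 {t t0}.
rewrite expRN ler_pdivrMr ?expR_gt0//.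
case: m => [|m].
  by rewrite expr0 fact0 mul1r -[X in X <= _]expR0 ler_expR ltW.
have := expR_ge1Dxn m (ltW x0).
rewrite -ler_pdivrMl ?ltr0n ?fact_gt0// mulrC => h.
by apply: le_trans h; rewrite lerDr.
Qed.

Lemma ff_out m t : t <= 0 -> ff m t = 0.
Proof. by move=> t0; rewrite /ff ltNge t0. Qed.

Lemma ff_shift m t : 0 < t -> ff m t = t ^+ 2 * ff m.+2 t.
Proof.
move=> t0; rewrite /ff t0 mulrA; congr (_ * _).
by rewrite -(addn2 m) exprD invfM [t ^- m * _]mulrC mulrA divff ?mul1r// expf_neq0// gt_eqF.
Qed.

Lemma isd_sq0 (f : R -> R) (C : R) : f 0 = 0 -> (forall t, `|f t| <= C * t ^+ 2) ->
  is_derive (0 : R) (1 : R) f (0 : R).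
Proof.
move=> f0 fC.
have C0 : 0 <= C by have := fC 1; rewrite expr1n mulr1; exact: le_trans.
have cvg0 : h^-1 *: (f (h *: 1 + 0) - f 0) @[h --> (0 : R)^'] --> (0 : R).
  apply/norm_cvg0P.
  have h0 : (fun h : R => C * `|h|) h @[h --> (0 : R)^'] --> (0 : R).
    rewrite -[X in _ --> X](mulr0 C); apply: cvgMr.
    rewrite -[X in _ --> X](@normr0 R R); apply: cvg_norm.
    by apply: cvg_within.
  apply: (squeeze_cvgr _ (cvg_cst 0) h0).
  near=> h; rewrite normr_ge0/= f0 subr0 addr0 /GRing.scale/= mulr1 normrM normfV.
  have hn : h != 0 by near: h; exact: nbhs_dnbhs_neq.
  rewrite mulrC ler_pdivrMr ?normr_gt0// -mulrA -expr2 real_normK ?num_real//.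
apply: DeriveDef; first by apply/cvg_ex; exists 0.
exact/cvg_lim.
Unshelve. all: by end_near. Qed.

Lemma isd_ff m t : is_derive t 1 (ff m) (- m%:R * ff m.+1 t + ff m.+2 t).
Proof.
have [t0|t0|t0] := ltgtP t 0.
- rewrite !ff_out ?ltW// mulr0 addr0.
  apply: (isd_near (f := fun=> 0)) (isd_cst 0 t).
  by apply: filterS (near_lt t0) => u u0; rewrite ff_out// ltW.
- have tn : t != 0 by rewrite gt_eqF.
  have h1 : is_derive t 1 (fun t : R => - t^-1) (t ^- 2).
    by apply: (isd_eq (isdN (isdV (f := fun u => u) tn (isd_id t)))); rewrite mulr1 opprK.
  have h2 := isd_comp (g := fun t => - t^-1) (is_derive_expR (- t^-1)) h1.
  have h3 : is_derive t 1 (fun t : R => t ^- m) (- m%:R * t ^- m.+1).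
    have hV := isdV (f := fun u => u) tn (isd_id t).
    elim: m => [|k IH].
      apply: (isd_eq (f := fun t : R => t ^- 0)); last by rewrite oppr0 mul0r.
      by rewrite (_ : (fun t : R => t ^- 0) = (fun=> 1)); [exact: isd_cst|apply/funext => u; rewrite expr0 invr1].
    rewrite (_ : (fun t : R => t ^- k.+1) = (fun t => t ^- k * t^-1)); last first.
      by apply/funext => u; rewrite exprSr invfM.
    apply: (isd_eq (isdM IH hV)).
    rewrite mulr1 !exprS !invfM -natr1; field; rewrite ?expf_neq0//.
  have h4 := isdM h3 h2.
  have h5 : is_derive t 1 (fun t : R => t ^- m * expR (- t^-1)) (- m%:R * ff m.+1 t + ff m.+2 t).
    have e2 : t ^- m.+2 = t ^- m * t ^- 2 by rewrite -(addn2 m) exprD invfM.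
    apply: (isd_eq h4); rewrite /ff t0 e2.
    by move: (t ^- m) (t ^- 2) (t ^- m.+1) (expR _) => A B C D; ring.
  by apply: (isd_near _ h5); apply: filterS (near_gt t0) => u u0; rewrite /ff u0.
- rewrite t0 !(ff_out _ 0)// mulr0 addr0.
  (* By [ff_shift] the function is at most (m + 2)! u^2 near 0, so its derivative at 0 vanishes. *)
  apply: (@isd_sq0 _ (m.+2)`!%:R); first exact: ff_out.
  move=> u; have [u0|u0] := leP u 0; first by rewrite ff_out// normr0 mulr_ge0// sqr_ge0.
  rewrite ff_shift// ger0_norm; last by rewrite mulr_ge0 ?sqr_ge0 ?ff_ge0.
  rewrite mulrC; apply: ler_wpM2r; [exact: sqr_ge0|exact: ff_le].
Qed.
End Bump.

Section FF.
Context {R : realType}.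

Lemma derivable_ff m (t : R) : derivable (ff m) t 1.
Proof. exact: isd_derivable (isd_ff m t). Qed.

Lemma measurable_ff m : measurable_fun setT (@ff R m).
Proof. by apply: continuous_measurable_fun => t; apply: derivable_continuous; exact: derivable_ff. Qed.

Lemma derive1_ff0 (t : R) : derive1 (ff 0) t = ff 2 t.
Proof. by rewrite (isd_derive1 (isd_ff 0 t)) oppr0 mul0r add0r. Qed.

Lemma ff_le1 (t : R) : ff 0 t <= 1. Proof. exact: ff_le. Qed.
Lemma ff2_le (t : R) : ff 2 t <= 2. Proof. by have := ff_le 2 t. Qed.

(** The derivative - 2 [ff 3] + [ff 4] is at most 2 * 3! + 4! = 36 in absolute value. The constants
    108 = 3 * 36 and 144 = 4 * 36 below come from here. *)
Lemma ff2_lip (s t : R) : `|ff 2 s - ff 2 t| <= 36 * `|s - t|.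
Proof.
apply: lipschitz_derive => u; first exact: derivable_ff.
rewrite (isd_derive1 (isd_ff 2 u)).
have h3 := ff_le 3 u; have h4 := ff_le 4 u; have g3 := ff_ge0 3 u; have g4 := ff_ge0 4 u.
move: h3 h4; rewrite (_ : (3`! = 6)%N)// (_ : (4`! = 24)%N)// => h3 h4.
by rewrite ler_norml; apply/andP; split; lra.
Qed.

Lemma ff0_mvt (s t : R) : exists c : R, (`|c - s| <= `|t - s|) /\ (`|c - t| <= `|t - s|) /\
  (ff 0 t - ff 0 s = ff 2 c * (t - s)).
Proof.
have W (x y : R) : x <= y -> exists2 c, x <= c <= y & ff 0 y - ff 0 x = ff 2 c * (y - x).
  move=> xy; have [||c] := @MVT_segment R (ff 0) (ff 2) x y xy.
  - by move=> u _; rewrite -derive1_ff0; apply: derivable_isd; exact: derivable_ff.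
  - by apply: derivable_within_continuous => u _; exact: derivable_ff.
  by rewrite in_itv/= => h E; exists c.
have [st|/ltW ts] := leP s t.
  have [c /andP[h1 h2] E] := W s t st; exists c; split; last split => //.
    by rewrite !ger0_norm ?subr_ge0// lerD2r.
  by rewrite distrC !ger0_norm ?subr_ge0// lerD2l lerN2.
have [c /andP[h1 h2] E] := W t s ts; exists c; split; last split.
- by rewrite distrC [`|t - s|]distrC !ger0_norm ?subr_ge0// lerD2l lerN2.
- by rewrite [`|t - s|]distrC !ger0_norm ?subr_ge0// lerD2r.
- by rewrite -opprB E -mulrN opprB.
Qed.

Lemma ff0_taylor (t h : R) : `|ff 0 (t + h) - ff 0 t - ff 2 t * h| <= 36 * h ^+ 2.
Proof.
have [c [c1 [_ ->]]] := ff0_mvt t (t + h).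
rewrite (addrC t h) addrK in c1 *.
rewrite -mulrBl normrM; apply: (@le_trans _ _ (36 * `|c - t| * `|h|)).
  by rewrite ler_wpM2r// ff2_lip.
by rewrite -mulrA ler_pM2l// -(real_normK (num_real h)) expr2 ler_wpM2r.
Qed.

(** The intermediate point lies within |h1 - h2| + |h2| <= 3 B of [p], where [ff 2] has moved by at
    most 36 * 3 B. Keeping [ff 2 p] as the leading factor preserves the sharp weight. *)
Lemma ff0_diff (p h1 h2 B : R) : `|h1| <= B -> `|h2| <= B ->
  `|ff 0 (p + h1) - ff 0 (p + h2)| <= (ff 2 p + 108 * B) * `|h1 - h2|.
Proof.
move=> b1 b2; have [c [c1 [c2 ->]]] := ff0_mvt (p + h2) (p + h1).
have E : p + h1 - (p + h2) = h1 - h2 by ring.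
rewrite E in c1 c2 *; rewrite normrM ler_wpM2r// ger0_norm ?ff_ge0//.
have h : `|c - p| <= 3 * B.
  have -> : c - p = (c - (p + h2)) + h2 by ring.
  apply: (le_trans (ler_normD _ _)).
  have := ler_normB h1 h2; lra.
have := ff2_lip c p; rewrite ler_norml => /andP[_ k]; lra.
Qed.

Lemma ff0_lt (s t : R) : 0 < s -> s < t -> ff 0 s < ff 0 t.
Proof.
move=> s0 st; have t0 := lt_trans s0 st.
rewrite /ff s0 t0 !expr0 invr1 !mul1r ltr_expR ltrN2 ltf_pV2 ?posrE//.
Qed.

Lemma expR2_le16 : expR (2 : R) <= 16.
Proof.
have h1 := expR_ge1Dx (- (1 / 2) : R).
have e0 : expR (1 / 2 : R) * expR (- (1 / 2)) = 1 by rewrite -expRD subrr expR0.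
have p1 := expR_gt0 (1 / 2 : R).
have h2 : expR (1 / 2 : R) <= 2 by nra.
have -> : expR (2 : R) = expR (1 / 2) ^+ 4.
  by rewrite -expRM_natr; congr expR; lra.
have -> : 16 = 2 ^+ 4 :> R by ring.
by rewrite ler_pXn2r// nnegrE ?ltW.
Qed.

Lemma ff2_lower (t : R) : 1 / 2 <= t <= 1 -> 1 / 16 <= ff 2 t.
Proof.
move=> /andP[h1 h2]; have t0 : 0 < t by lra.
rewrite /ff t0.
have a1 : 1 <= t ^- 2 by rewrite invf_ge1 ?exprn_gt0// expr_le1// ltW.
have a2 : 1 / 16 <= expR (- t^-1).
  rewrite div1r expRN lef_pV2 ?posrE ?expR_gt0//; apply: le_trans expR2_le16.
  by rewrite ler_expR -[2]invrK lef_pV2 ?posrE//; lra.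
by apply: (le_trans a2); rewrite ler_peMl ?expR_ge0.
Qed.
End FF.

(** * Convolution with the trace kernel on the circle *)

Section Conv1.
Context {R : realType}.
Local Notation leb := (@lebesgue_measure R).
Local Notation tpi := (2 * pi : R).
Local Notation I0 := (`[0%R, tpi[%classic : set R).

Lemma Rintegral_flip_period (f : R -> R) (x : R) : measurable_fun setT f ->
  (forall t, f (t + tpi) = f t) ->
  Rintegral leb I0 (fun t => f (x - t)) = Rintegral leb I0 f.
Proof.
move=> mf fp; rewrite /Rintegral; congr fine.
rewrite integralE [RHS]integralE; congr (_ - _)%E.
- rewrite -[RHS](@ge0_integral_period_flip R tpi x (EFin \o f)^\+%E)//.
  + by apply: eq_integral => z _; rewrite !funeposE.
  + exact: tpi_gt0.
  + by apply: measurable_funepos; exact/measurable_EFinP.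
  + by move=> t; rewrite !funeposE /= fp.
- rewrite -[RHS](@ge0_integral_period_flip R tpi x (EFin \o f)^\-%E)//.
  + by apply: eq_integral => z _; rewrite !funenegE.
  + exact: tpi_gt0.
  + by apply: measurable_funeneg; exact/measurable_EFinP.
  + by move=> t; rewrite !funenegE /= fp.
Qed.

Lemma integrable_flip_period (f : R -> R) (x : R) : measurable_fun setT f ->
  (forall t, f (t + tpi) = f t) -> leb.-integrable I0 (EFin \o f) ->
  leb.-integrable I0 (EFin \o (fun t => f (x - t))).
Proof.
move=> mf fp /integrableP[_ fi]; apply/integrableP; split.
  apply/measurable_EFinP; apply: measurable_funTS; apply: (measurableT_comp mf).
  exact: measurable_funB.
rewrite (_ : (\int[leb]_(t in I0) _ = \int[leb]_(t in I0) `|(EFin \o f) t|)%E)//.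
have := @ge0_integral_period_flip R tpi x (fun t => `|(EFin \o f) t|)%E tpi_gt0.
apply=> //.
  by apply: measurableT_comp => //; exact/measurable_EFinP.
by move=> t /=; rewrite fp.
Qed.

Lemma ellN (u : R) : ell (- u) = ell u.
Proof. by rewrite /ell mulNr sinN normrN. Qed.

Lemma Rintegral_ell_sin : Rintegral leb I0 (fun u => ell u * sin u) = 0.
Proof.
have mf : measurable_fun setT (fun u : R => ell u * sin u).
  by apply: measurable_funM; [exact: measurable_ell|exact: measurable_sinR].
have E := Rintegral_flip_period (fun u => ell u * sin u) 0 mf (fun t => _).
have ii := integrable_ellM sin measurable_sinR norm_sin_le1.
have : Rintegral leb I0 (fun u => ell u * sin u) = - Rintegral leb I0 (fun u => ell u * sin u).
  rewrite -[in LHS]E; last by move=> t; rewrite ell_period sin_period.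
  rewrite -mulN1r -RintegralZl//.
  by apply: eq_Rintegral => t _; rewrite sub0r ellN sinN mulrN mulN1r.
by lra.
Qed.

Lemma integrable_kap0 : leb.-integrable I0 (EFin \o @kap0 R).
Proof. by apply: integrable_mulR => //; exact: integrable_ell. Qed.

Lemma Rintegral_kap0_flip (x : R) : Rintegral leb I0 (fun t => kap0 (x - t)) = 0.
Proof.
rewrite (Rintegral_flip_period kap0); [|exact: measurable_kap0|exact: kap0_period].
by rewrite /kap0 RintegralZl//; [rewrite Rintegral_ell mulr0|exact: integrable_ell].
Qed.

(** The kernel is even, so only the cosine part of cos (x - u) survives. The eigenvalue 1/2 is the
    reason why the factor al has to be close to 2 / n. *)
Lemma Rintegral_kap0_cos (x : R) : Rintegral leb I0 (fun t => kap0 (x - t) * cos t) = cos x / 2.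
Proof.
pose f := fun u : R => kap0 u * cos (x - u).
have mc : measurable_fun setT (fun u : R => cos (x - u)).
  by apply: (measurableT_comp measurable_cosR); exact: measurable_funB.
have mf : measurable_fun setT f by apply: measurable_funM => //; exact: measurable_kap0.
have -> : (fun t => kap0 (x - t) * cos t) = (fun t => f (x - t)).
  by apply/funext => t; rewrite /f; congr (_ * cos _); ring.
rewrite Rintegral_flip_period//; last first.
  move=> t; rewrite /f kap0_period; congr (_ * _).
  by rewrite -[LHS]cos_period; congr cos; rewrite opprD addrA subrK.
have E1 := integrable_ellM cos measurable_cosR norm_cos_le1.
have E2 := integrable_ellM sin measurable_sinR norm_sin_le1.
have -> : f = (fun u => (- (2 * pi)^-1 * cos x) * (ell u * cos u) + (- (2 * pi)^-1 * sin x) * (ell u * sin u)).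
  apply/funext => u; rewrite /f /kap0 cosB; by move: ((2 * pi)^-1 : R) => P; ring.
rewrite RintegralD//; [|exact: integrable_mulR|exact: integrable_mulR].
rewrite !RintegralZl// Rintegral_ell_cos Rintegral_ell_sin.
have : pi != 0 :> R by rewrite gt_eqF// pi_gt0.
by move: (pi : R) => P P0; field.
Qed.

Lemma integrable_kap0_cos (x : R) : leb.-integrable I0 (EFin \o (fun t => kap0 (x - t) * cos t)).
Proof.
apply: (@integrable_le R I0 _ (fun t => sinp 2^-1 (x - t))) => //.
- apply: measurable_funM; last exact: measurable_cosR.
  by apply: (measurableT_comp measurable_kap0); exact: measurable_funB.
- by apply: (measurableT_comp (measurable_sinp 2^-1)); exact: measurable_funB.
- move=> t _; rewrite normrM -[leRHS]mulr1 ler_pM//; [exact: kap0_bound|exact: norm_cos_le1].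
- rewrite (@ge0_integral_period_flip R tpi x (EFin \o sinp 2^-1)); first exact: sinp_lty half01.
  + exact: tpi_gt0.
  + by apply/measurable_EFinP; exact: measurable_sinp.
  + by move=> t; rewrite lee_fin sinp_ge0.
  + by move=> t /=; rewrite sinp_period.
Qed.
End Conv1.

(** * The strip, the unperturbed profile and its mass *)

Section Strip.
Context {R : realType}.
Local Notation leb := (@lebesgue_measure R).
Local Notation leb2 := (leb \x leb)%E.
Local Notation TRR := (@TR R).
Local Notation tpi := (2 * pi : R).
Local Notation I0 := (`[0%R, tpi[%classic : set R).
Variable d : R.
Hypothesis d0 : 0 < d.

(* The vorticity lives in the strip |y + 1| <= 2 d; centring it at y = -1 makes the wave speed 1. *)
Definition strip : set R := [set y : R | `|y + 1| <= 2 * d].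
Definition sI (y : R) : R := \1_strip y.
(** The x-independent part of the argument of the bump: it falls from 1 at the centre of the strip
    to -1 at its edges. [rho] is the derivative of the bump along it, the weight of the linearised
    equation, and [nn] is the mass of this weight in units of d. *)
Definition par (y : R) : R := 1 - (y + 1) ^+ 2 / (2 * d ^+ 2).
Definition rho (y : R) : R := ff 2 (par y) * sI y.
Definition nn : R := d^-1 * Rintegral leb setT rho.

Lemma stripE : strip = `[-1 - 2 * d, -1 + 2 * d]%classic.
Proof.
apply/seteqP; split => y; rewrite /strip/= in_itv/= ler_norml => /andP[h1 h2];
  apply/andP; split; lra.
Qed.

Lemma measurable_strip : measurable strip.
Proof. by rewrite stripE. Qed.

Lemma sI_in y : `|y + 1| <= 2 * d -> sI y = 1.
Proof. by move=> h; rewrite /sI indicE mem_set. Qed.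
Lemma sI_out y : 2 * d < `|y + 1| -> sI y = 0.
Proof. by move=> h; rewrite /sI indicE memNset// /strip/=; apply/negP; rewrite -ltNge. Qed.
Lemma sI_ge0 y : 0 <= sI y. Proof. by rewrite /sI indicE ler0n. Qed.

Lemma measurable_sI : measurable_fun setT sI.
Proof. by apply: measurable_indic; exact: measurable_strip. Qed.

Lemma measurable_par : measurable_fun setT par.
Proof.
apply: measurable_funB => //; apply: measurable_funM => //; apply: measurable_funX.
exact: measurable_funD.
Qed.

Lemma measurable_rho : measurable_fun setT rho.
Proof.
apply: measurable_funM; last exact: measurable_sI.
by apply: (measurableT_comp (measurable_ff 2)); exact: measurable_par.
Qed.

Lemma rho_ge0 y : 0 <= rho y.
Proof. by rewrite mulr_ge0 ?ff_ge0 ?sI_ge0. Qed.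

Lemma integral_sI : (\int[leb]_y (sI y)%:E = (4 * d)%:E)%E.
Proof.
rewrite integral_indic//; last exact: measurable_strip.
rewrite setIT stripE.
rewrite [LHS]lebesgue_measure_itv/= lte_fin ifT; last by have := d0; lra.
by rewrite -EFinB; congr EFin; lra.
Qed.

Lemma integrable_sI : leb.-integrable setT (EFin \o sI).
Proof.
apply: (@integrable_le R setT _ sI) => //; [exact: measurable_sI|exact: measurable_sI| |].
  by move=> t _; rewrite ger0_norm// sI_ge0.
by rewrite integral_sI ltry.
Qed.

Lemma integrable_strip (f : R -> R) (C : R) : measurable_fun setT f ->
  (forall t, `|f t| <= C) -> leb.-integrable setT (EFin \o (fun y => f y * sI y)).
Proof.
move=> mf fC; apply: (@integrable_le R setT _ (fun y => C * sI y)) => //.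
- by apply: measurable_funM => //; exact: measurable_sI.
- by apply: measurable_funM => //; exact: measurable_sI.
- by move=> t _; rewrite normrM (ger0_norm (sI_ge0 t)) ler_wpM2r ?sI_ge0.
- have C0 : 0 <= C by exact: le_trans (fC 0).
  under eq_integral do rewrite EFinM.
  rewrite ge0_integralZl; [|by []|by apply/measurable_EFinP; exact: measurable_sI|
    by move=> t _; rewrite lee_fin sI_ge0|by rewrite lee_fin].
  by rewrite integral_sI -EFinM ltry.
Qed.

Lemma integrable_rho : leb.-integrable setT (EFin \o rho).
Proof.
apply: (integrable_strip (fun y => ff 2 (par y)) 2).
  by apply: (measurableT_comp (measurable_ff 2)); exact: measurable_par.
by move=> t; rewrite ger0_norm ?ff_ge0// ff2_le.
Qed.

Lemma nnE : Rintegral leb setT rho = d * nn.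
Proof. by rewrite /nn mulrA divff ?mul1r// gt_eqF. Qed.

(** On the inner half |y + 1| <= d the parabola stays above 1/2 and [ff 2] above 1/16; this interval
    has length 2 d. *)
Lemma nn_lower : 1 / 8 <= nn.
Proof.
rewrite -(ler_pM2l d0) -nnE.
pose J : set R := `[-1 - d, -1 + d]%classic.
have mJ : measurable J by rewrite /J.
have EJ : (\int[leb]_y (\1_J y : R)%:E = (2 * d)%:E)%E.
  rewrite integral_indic// setIT [LHS]lebesgue_measure_itv/= lte_fin ifT; last by have := d0; lra.
  by rewrite -EFinB; congr EFin; lra.
have iJ : leb.-integrable setT (EFin \o (\1_J : R -> R)).
  apply: (@integrable_le R setT _ (\1_J : R -> R)) => //.
    by move=> t _; rewrite ger0_norm.
  by rewrite EJ ltry.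
apply: (@le_trans _ _ (Rintegral leb setT (fun y => 1 / 16 * (\1_J y : R)))).
  rewrite RintegralZl// /Rintegral EJ/=; lra.
apply: le_Rintegral => //; [by apply: integrable_mulR|exact: integrable_rho|].
move=> y _; rewrite indicE; have [h|h] := boolP (y \in J); last by rewrite mulr0 rho_ge0.
move: h; rewrite inE /J/= in_itv/= => /andP[h1 h2]; have dp := d0.
have ay : `|y + 1| <= d by rewrite ler_norml; apply/andP; split; lra.
rewrite mulr1 /rho sI_in ?mulr1; last by apply: (le_trans ay); lra.
apply: ff2_lower; rewrite /par.
have : (y + 1) ^+ 2 <= d ^+ 2.
  by rewrite -(real_normK (num_real (y + 1))) ler_pXn2r// nnegrE ltW.
have d2 : 0 < d ^+ 2 by rewrite exprn_gt0.
have y2 : 0 <= (y + 1) ^+ 2 by rewrite sqr_ge0.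
move=> h3; have : 0 <= (y + 1) ^+ 2 / (2 * d ^+ 2) <= 1 / 2.
  apply/andP; split; first by rewrite divr_ge0// mulr_ge0// ltW.
  by rewrite ler_pdivrMr; [lra|rewrite mulr_gt0].
by move=> /andP[h4 h5]; apply/andP; split; lra.
Qed.

(** Two weights in y: the linear part keeps the exact weight [rho], because the contraction constant
    has no room to lose a factor there, while for quadratic errors the indicator of the strip, of
    mass 4 d, is good enough. *)
Lemma dom_strip (Phi : R * R -> R) (x y : R) (f : R -> R) (A b K : R) :
  measurable_fun setT Phi -> measurable_fun setT f ->
  (forall t, 0 <= f t) -> (forall t, f (t + tpi) = f t) ->
  (\int[leb]_(t in I0) (f t)%:E <= A%:E)%E -> 0 <= b -> 0 <= K ->
  (forall z, sin ((x - z.1) / 2) != 0 -> z.2 != y ->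
     `|Phi z| <= f (x - z.1) * (b * rho z.2 + K * sI z.2)) ->
  leb2.-integrable TRR (EFin \o Phi) /\
  `|Rintegral leb2 TRR Phi| <= A * (d * (b * nn + 4 * K)).
Proof.
move=> mP mf f0 fp fA b0 K0 H.
apply: (dom2 Phi x y f (fun w => b * rho w + K * sI w)) => //.
- apply: measurable_funD; apply: measurable_funM => //; [exact: measurable_rho|exact: measurable_sI].
- by move=> t; rewrite addr_ge0// mulr_ge0 ?rho_ge0 ?sI_ge0.
- have i1 : leb.-integrable setT (EFin \o (fun w => b * rho w)).
    by apply: integrable_mulR => //; exact: integrable_rho.
  have i2 : leb.-integrable setT (EFin \o (fun w => K * sI w)).
    by apply: integrable_mulR => //; exact: integrable_sI.
  have i3 := integrable_addR measurableT _ _ i1 i2.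
  rewrite -[leLHS]fineK; last exact: integrable_fin_num i3.
  rewrite lee_fin -[leLHS]/(Rintegral leb setT (fun w => b * rho w + K * sI w)).
  rewrite RintegralD// !RintegralZl//; [|exact: integrable_sI|exact: integrable_rho].
  have E4 : Rintegral leb setT sI = 4 * d by rewrite /Rintegral integral_sI.
  rewrite nnE E4.
  by rewrite le_eqVlt; apply/orP; left; apply/eqP; ring.
Qed.
End Strip.

(** * The fixed point equation *)

Section Maps.
Context {R : realType}.
Local Notation leb := (@lebesgue_measure R).
Local Notation leb2 := (leb \x leb)%E.
Local Notation TRR := (@TR R).
Local Notation tpi := (2 * pi : R).
Local Notation I0 := (`[0%R, tpi[%classic : set R).
Local Notation I2 := (Rintegral leb2 TRR).
Local Notation int2 f := (leb2.-integrable TRR (EFin \o f)).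

Variables d a A : R.
Hypothesis d0 : 0 < d.
Hypothesis d4 : 4 * d <= 1.
Hypothesis a0 : 0 < a.
Hypothesis A0 : 0 < A.
Hypothesis HA : (\int[leb]_(t in I0) (sinp 2^-1 t)%:E <= A%:E)%E.

(* q is the unknown correction to the explicit argument 1 + a cos x - (y+1)^2/(2 d^2) of the bump;
   vq is the resulting density, cq its first cosine coefficient, Yq the rescaled potential, Mq its mass. *)
Definition Pq (q : R -> R -> R) (x y : R) : R := par d y + a * cos x + q x y.
Definition vq (q : R -> R -> R) (z : R * R) : R := ff 0 (Pq q z.1 z.2) * sI d z.2.
Definition cq q : R := (2 * pi * d)^-1 * I2 (fun z => cos z.1 * vq q z).
Definition Yq q x y : R := d^-1 * I2 (fun z => kap (x - z.1) (y - z.2) * vq q z).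
Definition Mq q : R := d^-1 * I2 (vq q).

(** The ball of the contraction. The bound is asked only on the strip, where the density lives;
    evenness fixes the translation in x and thereby excludes the neutral mode sin x. *)
Record admissible (r : R) (q : R -> R -> R) : Prop := Adm {
  adm_meas : measurable_fun setT (fun z : R * R => q z.1 z.2) ;
  adm_even : forall x y, q (- x) y = q x y ;
  adm_per : forall x y, q (x + tpi) y = q x y ;
  adm_bnd : forall x y, `|y + 1| <= 2 * d -> `|q x y| <= r }.

Lemma measurable_vq q : measurable_fun setT (fun z : R * R => q z.1 z.2) -> measurable_fun setT (vq q).
Proof.
move=> mq; apply: measurable_funM; last by apply: measurable_snd1; exact: measurable_sI.
apply: (measurableT_comp (measurable_ff 0)); apply: measurable_funD => //.
apply: measurable_funD; first by apply: measurable_snd1; exact: measurable_par.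
by apply: measurable_funM => //; apply: measurable_fst1; exact: measurable_cosR.
Qed.

Lemma vq_ge0 q z : 0 <= vq q z. Proof. by rewrite mulr_ge0 ?ff_ge0 ?sI_ge0. Qed.
Lemma vq_le q z : vq q z <= sI d z.2.
Proof. by rewrite /vq -[leRHS]mul1r ler_wpM2r ?sI_ge0 ?ff_le1. Qed.
Lemma vq_even r q : admissible r q -> forall x y, vq q (- x, y) = vq q (x, y).
Proof. by move=> aq x y; rewrite /vq /Pq/= cosN (adm_even _ _ aq). Qed.
Lemma vq_per r q : admissible r q -> forall x y, vq q (x + tpi, y) = vq q (x, y).
Proof. by move=> aq x y; rewrite /vq /Pq/= cos_period (adm_per _ _ aq). Qed.

Lemma dom_bounded (Phi : R * R -> R) (b K : R) : measurable_fun setT Phi -> 0 <= b -> 0 <= K ->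
  (forall z, `|Phi z| <= b * rho d z.2 + K * sI d z.2) ->
  int2 Phi /\ `|I2 Phi| <= tpi * (d * (b * nn d + 4 * K)).
Proof.
move=> mP b0 K0 H; apply: (dom_strip d d0 Phi 0 0 (cst 1)) => //.
- rewrite (_ : (fun t => _) = cst 1%:E)%E; last by apply/funext.
  by rewrite integral_cst//= leb_I0 mul1e.
- by move=> z _ _; rewrite mul1r.
Qed.

Lemma dom_sinp (Phi : R * R -> R) (x y b K : R) : measurable_fun setT Phi -> 0 <= b -> 0 <= K ->
  (forall z, sin ((x - z.1) / 2) != 0 -> `|Phi z| <= sinp 2^-1 (x - z.1) * (b * rho d z.2 + K * sI d z.2)) ->
  int2 Phi /\ `|I2 Phi| <= A * (d * (b * nn d + 4 * K)).
Proof.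
move=> mP b0 K0 H; apply: (dom_strip d d0 Phi x y (sinp 2^-1)) => //.
- exact: measurable_sinp.
- by move=> t; exact: sinp_ge0.
- by move=> t; exact: sinp_period.
- by move=> z h _; exact: H.
Qed.

(** Taylor expansion of the bump at [par]: the linear term in q is bounded with the weight [rho],
    the quadratic remainder by 36 times the squared size a + r of the perturbation. *)
Lemma vq_decomp r q : admissible r q -> forall z,
  `|vq q z - (ff 0 (par d z.2) * sI d z.2 + a * cos z.1 * rho d z.2)| <=
  r * rho d z.2 + 36 * (a + r) ^+ 2 * sI d z.2.
Proof.
move=> aq [x y] /=; have [h|h] := leP `|y + 1| (2 * d); last first.
  by rewrite /vq /rho /= sI_out// !mulr0 !addr0 subr0 normr0.
rewrite /vq /rho /= sI_in// !mulr1 /Pq/=.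
have qr := adm_bnd _ _ aq x y h.
set p := par d y; set qq := q x y in qr *.
have E : ff 0 (p + a * cos x + qq) - (ff 0 p + a * cos x * ff 2 p) =
   (ff 0 (p + (a * cos x + qq)) - ff 0 p - ff 2 p * (a * cos x + qq)) + ff 2 p * qq.
  by rewrite addrA; ring.
rewrite E; apply: (le_trans (ler_normD _ _)); rewrite addrC; apply: lerD.
  by rewrite normrM (ger0_norm (ff_ge0 _ _)) mulrC ler_wpM2r ?ff_ge0.
apply: (le_trans (ff0_taylor _ _)); rewrite ler_pM2l//.
rewrite -(real_normK (num_real (a * cos x + qq))) ler_pXn2r ?nnegrE//; last first.
  by rewrite addr_ge0 ?(ltW a0)// (le_trans _ qr).
apply: (le_trans (ler_normD _ _)); rewrite lerD// normrM (gtr0_norm a0) ler_piMr ?(ltW a0)//.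
exact: norm_cos_le1.
Qed.

Lemma measurable_F0 : measurable_fun setT (fun y : R => ff 0 (par d y) * sI d y).
Proof.
apply: measurable_funM; last exact: measurable_sI.
by apply: (measurableT_comp (measurable_ff 0)); exact: measurable_par.
Qed.
Lemma integrable_F0 : leb.-integrable setT (EFin \o (fun y : R => ff 0 (par d y) * sI d y)).
Proof.
apply: (integrable_strip d d0 (fun y => ff 0 (par d y)) 1).
  by apply: (measurableT_comp (measurable_ff 0)); exact: measurable_par.
by move=> t; rewrite ger0_norm ?ff_ge0// ff_le1.
Qed.
Lemma F0_le y : `|ff 0 (par d y) * sI d y| <= sI d y.
Proof. by rewrite normrM !ger0_norm ?ff_ge0 ?sI_ge0// -[leRHS]mul1r ler_wpM2r ?sI_ge0 ?ff_le1. Qed.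

(** Tested against cos, the x-independent part of [vq_decomp] vanishes, a cos x gives n a / 2
    through the mean of cos^2, and the remainder is the error; 144 is 36 times the mass 4 of the
    strip. *)
Lemma cq_est r q : admissible r q -> 0 <= r -> `|cq q - nn d * a / 2| <= nn d * r + 144 * (a + r) ^+ 2.
Proof.
move=> aq r0.
have mv := measurable_vq q (adm_meas _ _ aq).
have mcos : measurable_fun setT (fun z : R * R => cos z.1) by apply: measurable_fst1; exact: measurable_cosR.
pose P1 (z : R * R) := cos z.1 * (ff 0 (par d z.2) * sI d z.2).
pose P2 (z : R * R) := cos z.1 ^+ 2 * rho d z.2.
pose P3 (z : R * R) := cos z.1 * (vq q z - (ff 0 (par d z.2) * sI d z.2 + a * cos z.1 * rho d z.2)).
have mF := measurable_snd1 _ measurable_F0.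
have mr := measurable_snd1 _ (measurable_rho d).
have mP1 : measurable_fun setT P1 by apply: measurable_funM.
have mP2 : measurable_fun setT P2 by apply: measurable_funM => //; exact: measurable_funX.
have mP3 : measurable_fun setT P3.
  apply: measurable_funM => //; apply: measurable_funB => //; apply: measurable_funD => //.
  by apply: measurable_funM => //; apply: measurable_funM.
have [i1 _] : int2 P1 /\ `|I2 P1| <= tpi * (d * (0 * nn d + 4 * 1)).
  apply: dom_bounded => // z; rewrite mul0r add0r mul1r /P1 normrM -[leRHS]mul1r.
  by apply: ler_pM => //; [exact: norm_cos_le1|exact: F0_le].
have [i2 _] : int2 P2 /\ `|I2 P2| <= tpi * (d * (1 * nn d + 4 * 0)).
  apply: dom_bounded => // z; rewrite mul0r addr0 /P2 normrM (ger0_norm (rho_ge0 _ _)).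
  by rewrite ler_wpM2r ?rho_ge0// normrX expr_le1// norm_cos_le1.
have [i3 b3] : int2 P3 /\ `|I2 P3| <= tpi * (d * (r * nn d + 4 * (36 * (a + r) ^+ 2))).
  apply: dom_bounded => //; first by rewrite mulr_ge0// sqr_ge0.
  move=> z; rewrite /P3 normrM -[leRHS]mul1r; apply: ler_pM => //; first exact: norm_cos_le1.
  exact: vq_decomp.
have E1 : I2 P1 = 0.
  rewrite /P1 (I2_prod cos (fun y => ff 0 (par d y) * sI d y)).
  - by rewrite Rintegral_cos mul0r.
  - by apply: (integrable_I0_bounded _ 1); [exact: measurable_cosR|exact: norm_cos_le1].
  - exact: measurable_cosR.
  - exact: integrable_F0.
have E2 : I2 P2 = pi * (d * nn d).
  rewrite /P2 (I2_prod (fun t => cos t ^+ 2) (rho d)).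
  - by rewrite Rintegral_cos2 nnE.
  - apply: (integrable_I0_bounded _ 1); first by apply: measurable_funX; exact: measurable_cosR.
    by move=> t; rewrite normrX expr_le1// norm_cos_le1.
  - by apply: measurable_funX; exact: measurable_cosR.
  - exact: integrable_rho.
have E : I2 (fun z => cos z.1 * vq q z) = a * (pi * (d * nn d)) + I2 P3.
  have -> : (fun z => cos z.1 * vq q z) = (fun z => (P1 z + a * P2 z) + P3 z).
    by apply/funext => z; rewrite /P1 /P2 /P3; ring.
  have mT := @measurable_TR R.
  have ia : int2 (fun z => a * P2 z) by apply: integrable_mulR.
  rewrite RintegralD//; last by apply: integrable_addR.
  by rewrite RintegralD// RintegralZl// E1 E2 add0r.
have p0 := @pi_gt0 R.
have -> : cq q - nn d * a / 2 = (2 * pi * d)^-1 * I2 P3.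
  rewrite /cq E.
  have : pi != 0 :> R by rewrite gt_eqF.
  have dn : d != 0 by rewrite gt_eqF.
  by move: (I2 P3) (pi : R) => X P Pn; field; rewrite Pn dn.
have q0 : 0 < 2 * pi * d by rewrite !mulr_gt0.
rewrite normrM (gtr0_norm (x := _^-1)) ?invr_gt0// mulrC ler_pdivrMr//.
apply: (le_trans b3); rewrite le_eqVlt; apply/orP; left; apply/eqP.
by move: (pi : R) => P; ring.
Qed.

Lemma q0_adm : admissible 0 (fun _ _ => 0).
Proof. by split => //; move=> x y _; rewrite normr0. Qed.

(** Four pieces: replacing the kernel by its trace costs sqrt (4 d); the trace kills the
    x-independent density, since [kap0] has mean zero; it maps a cos x to half of it; the Taylor
    remainder is quadratic in a. *)
Lemma Y0_est x y : `|y + 1| <= 2 * d ->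
  `|Yq (fun _ _ => 0) x y - nn d * a / 2 * cos x| <= 8 * A * Num.sqrt d + 144 * A * a ^+ 2.
Proof.
move=> hy; set q := (fun _ _ => 0); have aq : admissible 0 q := q0_adm.
have mv := measurable_vq q (adm_meas _ _ aq).
have mF := measurable_snd1 _ measurable_F0.
have mr := measurable_snd1 _ (measurable_rho d).
have mk := measurable_kap_sub x y.
have mk0 : measurable_fun setT (fun z : R * R => kap0 (x - z.1)).
  by apply: (measurable_fst1 (fun t => kap0 (x - t))); apply: (measurableT_comp measurable_kap0); exact: measurable_funB.
have mcos : measurable_fun setT (fun z : R * R => cos z.1) by apply: measurable_fst1; exact: measurable_cosR.
pose P1 (z : R * R) := (kap (x - z.1) (y - z.2) - kap0 (x - z.1)) * vq q z.
pose P2 (z : R * R) := kap0 (x - z.1) * (ff 0 (par d z.2) * sI d z.2).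
pose P3 (z : R * R) := (kap0 (x - z.1) * cos z.1) * rho d z.2.
pose P4 (z : R * R) := kap0 (x - z.1) * (vq q z - (ff 0 (par d z.2) * sI d z.2 + a * cos z.1 * rho d z.2)).
have mP1 : measurable_fun setT P1 by apply: measurable_funM => //; exact: measurable_funB.
have mP2 : measurable_fun setT P2 by exact: measurable_funM.
have mP3 : measurable_fun setT P3 by apply: measurable_funM => //; exact: measurable_funM.
have mP4 : measurable_fun setT P4.
  apply: measurable_funM => //; apply: measurable_funB => //; apply: measurable_funD => //.
  by apply: measurable_funM => //; apply: measurable_funM.
have [i1 b1] : int2 P1 /\ `|I2 P1| <= A * (d * (0 * nn d + 4 * Num.sqrt (4 * d))).
  apply: (dom_sinp P1 x y) => // z s0.
  rewrite mul0r add0r /P1 normrM (ger0_norm (vq_ge0 _ _)).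
  have [h|h] := leP `|z.2 + 1| (2 * d); last first.
    by rewrite /vq sI_out// !mulr0.
  rewrite mulrA; apply: ler_pM => //; first exact: vq_ge0; last exact: vq_le.
  rewrite mulrC; apply: kap_kap0_small => //.
  have -> : y - z.2 = (y + 1) - (z.2 + 1) by ring.
  by apply: (le_trans (ler_normB _ _)); lra.
have [i2 _] : int2 P2 /\ `|I2 P2| <= A * (d * (0 * nn d + 4 * 1)).
  apply: (dom_sinp P2 x y) => // z _; rewrite mul0r add0r mul1r /P2 normrM.
  by apply: ler_pM => //; [exact: kap0_bound|exact: F0_le].
have [i3 _] : int2 P3 /\ `|I2 P3| <= A * (d * (1 * nn d + 4 * 0)).
  apply: (dom_sinp P3 x y) => // z _; rewrite mul0r addr0 mul1r /P3 normrM (ger0_norm (rho_ge0 _ _)).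
  rewrite ler_wpM2r ?rho_ge0// normrM -[leRHS]mulr1.
  by apply: ler_pM => //; [exact: kap0_bound|exact: norm_cos_le1].
have [i4 b4] : int2 P4 /\ `|I2 P4| <= A * (d * (0 * nn d + 4 * (36 * a ^+ 2))).
  apply: (dom_sinp P4 x y) => // [|z _]; first by rewrite mulr_ge0// sqr_ge0.
  rewrite /P4 normrM; apply: ler_pM => //; first exact: kap0_bound.
  by have := vq_decomp 0 q aq z; rewrite addr0.
have E2 : I2 P2 = 0.
  rewrite /P2 (I2_prod (fun t => kap0 (x - t)) (fun y => ff 0 (par d y) * sI d y)).
  - by rewrite Rintegral_kap0_flip mul0r.
  - by apply: integrable_flip_period; [exact: measurable_kap0|exact: kap0_period|exact: integrable_kap0].
  - by apply: (measurableT_comp measurable_kap0); exact: measurable_funB.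
  - exact: integrable_F0.
have E3 : I2 P3 = cos x / 2 * (d * nn d).
  rewrite /P3 (I2_prod (fun t => kap0 (x - t) * cos t) (rho d)).
  - by rewrite Rintegral_kap0_cos nnE.
  - exact: integrable_kap0_cos.
  - apply: measurable_funM; last exact: measurable_cosR.
    by apply: (measurableT_comp measurable_kap0); exact: measurable_funB.
  - exact: integrable_rho.
have E : I2 (fun z => kap (x - z.1) (y - z.2) * vq q z) = I2 P1 + (a * (cos x / 2 * (d * nn d)) + I2 P4).
  have -> : (fun z => kap (x - z.1) (y - z.2) * vq q z) = (fun z => (P1 z + P2 z) + (a * P3 z + P4 z)).
    by apply/funext => z; rewrite /P1 /P2 /P3 /P4; ring.
  have mT := @measurable_TR R.
  have ia : int2 (fun z => a * P3 z) by apply: integrable_mulR.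
  rewrite RintegralD//; [|by apply: integrable_addR|by apply: integrable_addR].
  rewrite RintegralD// RintegralD// RintegralZl// E2 E3 addr0//.
have dn : d != 0 by rewrite gt_eqF.
have -> : Yq q x y - nn d * a / 2 * cos x = d^-1 * (I2 P1 + I2 P4).
  by rewrite /Yq E; move: (I2 P1) (I2 P4) => X1 X4; field.
rewrite normrM (gtr0_norm (x := _^-1)) ?invr_gt0// mulrC ler_pdivrMr//.
apply: (le_trans (ler_normD _ _)); apply: (le_trans (lerD b1 b4)).
have -> : Num.sqrt (4 * d) = 2 * Num.sqrt d.
  rewrite sqrtrM//; congr (_ * _).
  by rewrite (_ : 4 = 2 ^+ 2 :> R) ?sqrtr_sqr ?ger0_norm//; ring.
by rewrite le_eqVlt; apply/orP; left; apply/eqP; ring.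
Qed.

End Maps.

(** * Reflections and parameters in double integrals *)

Section Aux2.
Context {R : realType}.
Local Notation leb := (@lebesgue_measure R).
Local Notation leb2 := (leb \x leb)%E.
Local Notation TRR := (@TR R).
Local Notation tpi := (2 * pi : R).
Local Notation I0 := (`[0%R, tpi[%classic : set R).
Local Notation I2 := (Rintegral leb2 TRR).
Local Notation int2 f := (leb2.-integrable TRR (EFin \o f)).

Lemma ge0_flipx (x : R) (f : R * R -> \bar R) : measurable_fun setT f ->
  (forall z, (0 <= f z)%E) -> (forall u w, f (u + tpi, w) = f (u, w)) ->
  (\int[leb2]_(z in TRR) f ((x - z.1)%R, z.2) = \int[leb2]_(z in TRR) f z)%E.
Proof.
move=> mf f0 fp.
have mF : measurable_fun setT (fun z : R * R => f (x - z.1, z.2)).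
  apply: measurableT_comp => //; apply/measurable_fun_pairP; split => /=.
    by apply: measurable_funB => //; exact: measurable_fst.
  exact: measurable_snd.
rewrite ge0_int_TR2// ge0_int_TR2//=.
apply: eq_integral => w _.
rewrite (@ge0_integral_period_flip _ tpi x (fun t => f (t, w)))//.
  exact: tpi_gt0.
exact: measurableT_comp.
Qed.

Lemma flipx (x : R) (f : R * R -> R) : measurable_fun setT f ->
  (forall u w, f (u + tpi, w) = f (u, w)) ->
  I2 (fun z => f (x - z.1, z.2)) = I2 f.
Proof.
move=> mf fp; rewrite /Rintegral; congr fine.
rewrite integralE [RHS]integralE; congr (_ - _)%E.
- rewrite -(@ge0_flipx x (EFin \o f)^\+%E)//.
  + by apply: eq_integral => z _; rewrite !funeposE.
  + by apply: measurable_funepos; exact/measurable_EFinP.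
  + by move=> u w; rewrite !funeposE /= fp.
- rewrite -(@ge0_flipx x (EFin \o f)^\-%E)//.
  + by apply: eq_integral => z _; rewrite !funenegE.
  + by apply: measurable_funeneg; exact/measurable_EFinP.
  + by move=> u w; rewrite !funenegE /= fp.
Qed.

Lemma measurable_param1 (dT : measure_display) (T : measurableType dT) (D : set R)
   (g : T * R -> \bar R) : measurable D ->
   measurable_fun setT g -> (forall z, (0 <= g z)%E) ->
   measurable_fun setT (fun p : T => \int[leb]_(t in D) g (p, t))%E.
Proof.
move=> mD mg g0.
have mE : measurable (setT `*` D : set (T * R)) by apply: measurableX.
have := @measurable_fun_fubini_tonelli_F _ _ _ _ R leb (g \_ (setT `*` D)).
rewrite /fubini_F => /(_ _ _) h.
rewrite (_ : (fun p => _) = (fun p : T => \int[leb]_z (g \_ (setT `*` D)) (p, z))%E).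
  apply: h.
    by apply/(measurable_restrictT g) => //; exact: measurable_funTS.
  by move=> z; rewrite patchE; case: ifP.
apply/funext => p; rewrite integral_mkcond; apply: eq_integral => z _; rewrite !patchE.
suff -> : ((p, z) \in setT `*` D) = (z \in D) by [].
by apply/idP/idP; rewrite !inE/= => // -[].
Qed.

Lemma measurable_param (Phi : (R * R) * (R * R) -> R) : measurable_fun setT Phi ->
  measurable_fun setT (fun p : R * R => I2 (fun z => Phi (p, z))).
Proof.
move=> mP.
have G (g : (R * R) * (R * R) -> \bar R) : measurable_fun setT g -> (forall z, (0 <= g z)%E) ->
    measurable_fun setT (fun p : R * R => \int[leb2]_(z in TRR) g (p, z))%E.
  move=> mg g0.
  rewrite (_ : (fun p => _) = (fun p : R * R => \int[leb]_w \int[leb]_(t in I0) g (p, (t, w)))%E); last first.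
    apply/funext => p; rewrite (ge0_int_TR2 (fun z => g (p, z)))//.
    by apply: measurableT_comp.
  apply: (measurable_param1 _ _ setT (fun pw : (R * R) * R => \int[leb]_(t in I0) g (pw.1, (t, pw.2)))%E) => //; last first.
    by move=> z; apply: integral_ge0.
  apply: (measurable_param1 _ _ I0 (fun pwt : ((R * R) * R) * R => g (pwt.1.1, (pwt.2, pwt.1.2)))) => //.
  apply: (measurableT_comp mg); apply/measurable_fun_pairP; split => /=.
    exact: (measurableT_comp measurable_fst measurable_fst).
  apply/measurable_fun_pairP; split => /=; first exact: measurable_snd.
  exact: (measurableT_comp measurable_snd measurable_fst).
apply: (measurableT_comp (f := @fine R)) => //.
rewrite (_ : (fun p => _) = (fun p => (\int[leb2]_(z in TRR) (EFin \o Phi)^\+ (p, z) -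
   \int[leb2]_(z in TRR) (EFin \o Phi)^\- (p, z))))%E.
  apply: emeasurable_funB.
    by apply: G => //; apply: measurable_funepos; exact/measurable_EFinP.
  by apply: G => //; apply: measurable_funeneg; exact/measurable_EFinP.
apply/funext => p; rewrite integralE; congr (_ - _)%E; apply: eq_integral => z _.
  by rewrite !funeposE.
by rewrite !funenegE.
Qed.

Lemma measurable_conv (k v : R * R -> R) : measurable_fun setT k -> measurable_fun setT v ->
  measurable_fun setT (fun p : R * R => I2 (fun z => k (p.1 - z.1, p.2 - z.2) * v z)).
Proof.
move=> mk mv.
apply: (measurable_param (fun pz => k (pz.1.1 - pz.2.1, pz.1.2 - pz.2.2) * v pz.2)).
apply: measurable_funM; last by apply: (measurableT_comp mv); exact: measurable_snd.
apply: (measurableT_comp mk); apply/measurable_fun_pairP; split => /=; apply: measurable_funB.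
- exact: (measurableT_comp measurable_fst measurable_fst).
- exact: (measurableT_comp measurable_fst measurable_snd).
- exact: (measurableT_comp measurable_snd measurable_fst).
- exact: (measurableT_comp measurable_snd measurable_snd).
Qed.

(** With this, subtracting the convolution with cos (x - u) from the kernel removes the cosine
    coefficient alone, so the single parameter al suffices. *)
Lemma I2_sin_even (v : R * R -> R) : measurable_fun setT v ->
  (forall x y, v (x + tpi, y) = v (x, y)) -> (forall x y, v (- x, y) = v (x, y)) ->
  int2 (fun z => sin z.1 * v z) ->
  I2 (fun z => sin z.1 * v z) = 0.
Proof.
move=> mv vp ve ii.
have mf : measurable_fun setT (fun z : R * R => sin z.1 * v z).
  by apply: measurable_funM => //; apply: measurable_fst1; exact: measurable_sinR.
have E := flipx 0 (fun z => sin z.1 * v z) mf.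
have : I2 (fun z => sin z.1 * v z) = - I2 (fun z => sin z.1 * v z).
  rewrite -[in LHS]E; last by move=> u w /=; rewrite sin_period vp.
  rewrite -mulN1r -RintegralZl//; last exact: measurable_TR.
  by apply: eq_Rintegral => z _ /=; rewrite sub0r sinN ve mulN1r mulNr; case: z.
by lra.
Qed.
End Aux2.

Section IntLin.
Context {R : realType}.
Local Notation leb := (@lebesgue_measure R).
Lemma int_lin2 (D : set R) (f1 f2 : R -> R) (A1 A2 c1 c2 : R) : measurable D ->
  measurable_fun setT f1 -> measurable_fun setT f2 ->
  (forall t, 0 <= f1 t) -> (forall t, 0 <= f2 t) -> 0 <= c1 -> 0 <= c2 ->
  (\int[leb]_(t in D) (f1 t)%:E <= A1%:E)%E -> (\int[leb]_(t in D) (f2 t)%:E <= A2%:E)%E ->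
  (\int[leb]_(t in D) (c1 * f1 t + c2 * f2 t)%:E <= (c1 * A1 + c2 * A2)%:E)%E.
Proof.
move=> mD m1 m2 p1 p2 k1 k2 h1 h2.
have me (g : R -> R) : measurable_fun setT g -> measurable_fun D (fun t => (g t)%:E).
  by move=> mg; apply/measurable_EFinP; exact: measurable_funTS.
under eq_integral do rewrite EFinD !EFinM.
rewrite ge0_integralD//; last 4 first.
- by move=> t _; rewrite mule_ge0// lee_fin.
- by apply: emeasurable_funM => //; exact: me.
- by move=> t _; rewrite mule_ge0// lee_fin.
- by apply: emeasurable_funM => //; exact: me.
rewrite !ge0_integralZl//; first last.
all: try by [exact: me|move=> t _; rewrite lee_fin|rewrite lee_fin].
by rewrite EFinD !EFinM; apply: leeD; apply: lee_wpmul2l => //; rewrite lee_fin.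
Qed.
End IntLin.

Section Int2.
Context {R : realType}.
Local Notation leb := (@lebesgue_measure R).
Local Notation leb2 := (leb \x leb)%E.
Local Notation TRR := (@TR R).
Local Notation int2 f := (leb2.-integrable TRR (EFin \o f)).
Lemma int2D (f g : R * R -> R) : int2 f -> int2 g -> int2 (fun z => f z + g z).
Proof. by apply: integrable_addR; exact: measurable_TR. Qed.
Lemma int2B (f g : R * R -> R) : int2 f -> int2 g -> int2 (fun z => f z - g z).
Proof. by apply: integrable_subR; exact: measurable_TR. Qed.
Lemma int2Z (c : R) (f : R * R -> R) : int2 f -> int2 (fun z => c * f z).
Proof. by apply: integrable_mulR; exact: measurable_TR. Qed.
End Int2.

(** * The contraction estimate *)

Section Contr.
Context {R : realType}.
Local Notation leb := (@lebesgue_measure R).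
Local Notation leb2 := (leb \x leb)%E.
Local Notation TRR := (@TR R).
Local Notation tpi := (2 * pi : R).
Local Notation I0 := (`[0%R, tpi[%classic : set R).
Local Notation I2 := (Rintegral leb2 TRR).
Local Notation int2 f := (leb2.-integrable TRR (EFin \o f)).

Variables d a A eta dd th : R.
Hypothesis d0 : 0 < d.
Hypothesis d4 : 4 * d <= 1.
Hypothesis a0 : 0 < a.
Hypothesis A0 : 0 < A.
Hypothesis HA : (\int[leb]_(t in I0) (sinp 2^-1 t)%:E <= A%:E)%E.
Hypothesis eta0 : 0 <= eta.
Hypothesis small1 : eta + 72 * (64 * a) <= 1 / 4.
Hypothesis small2 : 108 * (64 * a) <= 1.
Hypothesis dd01 : 0 <= dd <= 1.
Hypothesis th01 : 0 <= th < 1.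
Hypothesis Hth : (\int[leb]_(u in I0) `|- ell u - cos u + dd|%:E <= (pi * th)%:E)%E.

Local Notation n := (nn d).
Local Notation t1 := (eta + 72 * (64 * a)).
Local Notation r := (eta * a).

Let n8 : 1 / 8 <= n. Proof. exact: nn_lower. Qed.
Let n0 : 0 < n. Proof. by apply: lt_le_trans n8; lra. Qed.
Let r0 : 0 <= r. Proof. by rewrite mulr_ge0// ltW. Qed.
Let ra : r <= a. Proof. by rewrite ler_piMl ?(ltW a0)//; have := small1; have := a0; lra. Qed.
Let t1_ge0 : 0 <= t1. Proof. by rewrite addr_ge0// !mulr_ge0// ltW. Qed.
Let pi0 : 0 < pi :> R. Proof. exact: pi_gt0. Qed.

Definition Dc : R := dd / (pi * n).
(* Dividing by cq kills the neutral direction cos x, and the multiple Dc of the mass replaces the main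
   kernel by the one of theta_kernel; the constant it adds is absorbed in the free constant of the wave. *)
Definition fixmap (q : R -> R -> R) (x y : R) : R :=
  a / cq d a q * Yq d a q x y - a * cos x + Dc * (Mq d a q - Mq d a (fun _ _ => 0)).

Lemma alpha_bounds q : admissible d r q ->
  [/\ n * a / 4 <= cq d a q, 0 < a / cq d a q <= 4 / n &
      `|a / cq d a q - 2 / n| <= 8 * t1 / n].
Proof.
move=> aq; have := cq_est d a d0 a0 r q aq r0; set c := cq d a q => h.
have h1 : `|c - n * a / 2| <= n * a * t1.
  apply: (le_trans h).
  have e1 : 144 * (a + r) ^+ 2 <= 144 * (2 * a) ^+ 2.
    rewrite ler_pM2l// ler_pXn2r ?nnegrE ?addr_ge0 ?mulr_ge0 ?(ltW a0)//.
    by have := ra; lra.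
  (* Equality at n = 1/8, as 144 * 4 = 72 * 64 / 8. The relative error of the cosine coefficient is
     thus [t1], which is where this expression in eta and a comes from. *)
  have e2 : 144 * (2 * a) ^+ 2 <= n * a * (72 * (64 * a)).
    have : 0 <= a * a * (n - 1 / 8) by rewrite !mulr_ge0 ?(ltW a0)// subr_ge0.
    rewrite expr2; lra.
  by move: e1 e2; rewrite mulrDr; lra.
have na : 0 < n * a by rewrite mulr_gt0.
have h2 : n * a * t1 <= n * a * (1 / 4) by rewrite ler_pM2l.
have cl : n * a / 4 <= c by move: h1; rewrite ler_norml => /andP[h3 _]; lra.
have c0 : 0 < c by apply: lt_le_trans cl; rewrite divr_gt0.
split=> //.
  rewrite divr_gt0//= ler_pdivrMr// mulrAC ler_pdivlMr//; lra.
have -> : a / c - 2 / n = 2 / n * ((n * a / 2 - c) / c).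
  by field; rewrite !gt_eqF.
rewrite normrM (ger0_norm (x := 2 / n)); last by rewrite divr_ge0// ltW.
have -> : 8 * t1 / n = 2 / n * (4 * t1) by field; rewrite gt_eqF.
apply: ler_wpM2l; first by rewrite divr_ge0// ltW.
rewrite normrM normfV (gtr0_norm c0) ler_pdivrMr// distrC; apply: (le_trans h1).
have t0 := t1_ge0.
have : 0 <= t1 * (c - n * a / 4) by rewrite mulr_ge0// subr_ge0.
lra.
Qed.

(** The Lipschitz factor of the bump is kept as its derivative at the unperturbed argument plus
    O(a): only the mass n of that weight, combined with the kernel of [theta_kernel], yields a
    constant below 1. *)
Lemma w_bound q1 q2 e : admissible d r q1 -> admissible d r q2 -> 0 <= e ->
  (forall x y, `|y + 1| <= 2 * d -> `|q1 x y - q2 x y| <= e) ->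
  forall z, `|vq d a q1 z - vq d a q2 z| <= e * rho d z.2 + (108 * (2 * a) * e) * sI d z.2.
Proof.
move=> aq1 aq2 e0 H [x y] /=; have [h|h] := leP `|y + 1| (2 * d); last first.
  by rewrite /vq /rho /= sI_out// !mulr0 subr0 normr0 addr0.
rewrite /vq /rho /= sI_in// !mulr1 /Pq; set p := par d y; rewrite -(addrA p) -(addrA p).
have b q : admissible d r q -> `|a * cos x + q x y| <= 2 * a.
  move=> aq; apply: (le_trans (ler_normD _ _)).
  have h1 : `|a * cos x| <= a.
    by rewrite normrM (gtr0_norm a0) ler_piMr ?(ltW a0)//; exact: norm_cos_le1.
  have h2 := adm_bnd _ _ _ aq x y h; have := ra; lra.
have := ff0_diff p (a * cos x + q1 x y) (a * cos x + q2 x y) (2 * a) (b _ aq1) (b _ aq2).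
move=> /le_trans; apply.
have -> : a * cos x + q1 x y - (a * cos x + q2 x y) = q1 x y - q2 x y by ring.
have -> : e * ff 2 p + 108 * (2 * a) * e = (ff 2 p + 108 * (2 * a)) * e by ring.
apply: ler_wpM2l; last exact: H.
by rewrite addr_ge0 ?ff_ge0// !mulr_ge0// ltW.
Qed.

Let n_a : n + 8 * (108 * a) <= n * (1 + 108 * (64 * a)).
Proof.
have : 0 <= a * (n - 1 / 8) by rewrite mulr_ge0 ?(ltW a0)// subr_ge0.
lra.
Qed.

Lemma I2_sub (f g : R * R -> R) : int2 f -> int2 g -> I2 (fun z => f z - g z) = I2 f - I2 g.
Proof. by move=> h1 h2; rewrite RintegralB//; exact: measurable_TR. Qed.

Lemma int2_v q : measurable_fun setT (fun z : R * R => q z.1 z.2) -> int2 (vq d a q).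
Proof.
move=> mq; have [] // := dom_bounded d d0 (vq d a q) 0 1 (measurable_vq d a q mq) (lexx 0) ler01.
move=> z; rewrite mul0r add0r mul1r ger0_norm ?vq_ge0//; exact: vq_le.
Qed.

Lemma int2_cosv q : measurable_fun setT (fun z : R * R => q z.1 z.2) -> int2 (fun z => cos z.1 * vq d a q z).
Proof.
move=> mq; have mv := measurable_vq d a q mq.
have [] // := dom_bounded d d0 (fun z => cos z.1 * vq d a q z) 0 1 _ (lexx 0) ler01.
  by apply: measurable_funM => //; apply: measurable_fst1; exact: measurable_cosR.
move=> z; rewrite mul0r add0r mul1r normrM (ger0_norm (vq_ge0 _ _ _ _)).
rewrite -[leRHS]mul1r; apply: ler_pM; rewrite ?vq_ge0 ?vq_le//; exact: norm_cos_le1.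
Qed.

Lemma int2_kv q x y : measurable_fun setT (fun z : R * R => q z.1 z.2) ->
  int2 (fun z => kap (x - z.1) (y - z.2) * vq d a q z).
Proof.
move=> mq; have mv := measurable_vq d a q mq.
pose M := `|y| + 3.
pose K := 1 + Num.sqrt (Num.sqrt (shh M)).
have K0 : 0 <= K by rewrite addr_ge0// sqrtr_ge0.
have [] // := dom_sinp d A d0 HA (fun z => kap (x - z.1) (y - z.2) * vq d a q z) x y 0 K _ (lexx 0) K0.
  by apply: measurable_funM => //; exact: measurable_kap_sub.
move=> z s0; rewrite mul0r add0r normrM (ger0_norm (vq_ge0 _ _ _ _)).
have [h|h] := leP `|z.2 + 1| (2 * d); last by rewrite /vq sI_out// !mulr0.
rewrite mulrA; apply: ler_pM; rewrite ?vq_ge0 ?vq_le//.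
rewrite mulrC; apply: kap_bound => //.
rewrite /M; have -> : y - z.2 = y - (z.2 + 1) + 1 by ring.
apply: (le_trans (ler_normD _ _)); rewrite normr1.
have := ler_normB y (z.2 + 1); have := d4; lra.
Qed.

Lemma M_diff q1 q2 e : admissible d r q1 -> admissible d r q2 -> 0 <= e ->
  (forall x y, `|y + 1| <= 2 * d -> `|q1 x y - q2 x y| <= e) ->
  `|Mq d a q1 - Mq d a q2| <= tpi * (2 * n * e).
Proof.
move=> aq1 aq2 e0 H.
have mv1 := measurable_vq d a q1 (adm_meas _ _ _ aq1).
have mv2 := measurable_vq d a q2 (adm_meas _ _ _ aq2).
have K0 : 0 <= 108 * (2 * a) * e by rewrite !mulr_ge0// ltW.
have [_ h] := dom_bounded d d0 (fun z => vq d a q1 z - vq d a q2 z) e _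
  (measurable_funB mv1 mv2) e0 K0 (w_bound q1 q2 e aq1 aq2 e0 H).
rewrite /Mq -mulrBr -I2_sub; [|exact: int2_v (adm_meas _ _ _ aq1)|exact: int2_v (adm_meas _ _ _ aq2)].
rewrite normrM (gtr0_norm (x := d^-1)) ?invr_gt0// mulrC ler_pdivrMr//.
apply: (le_trans h).
have -> : tpi * (2 * n * e) * d = tpi * (d * (2 * n * e)) by move: (pi : R) => P; ring.
rewrite ler_pM2l ?tpi_gt0// ler_pM2l//.
have -> : e * n + 4 * (108 * (2 * a) * e) = e * (n + 8 * (108 * a)) by ring.
rewrite [leRHS]mulrC; apply: ler_wpM2l => //.
apply: (le_trans n_a); rewrite mulrC ler_pM2r//.
by have := small2; lra.
Qed.

Lemma c_diff q1 q2 e : admissible d r q1 -> admissible d r q2 -> 0 <= e ->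
  (forall x y, `|y + 1| <= 2 * d -> `|q1 x y - q2 x y| <= e) ->
  `|cq d a q1 - cq d a q2| <= 2 * n * e.
Proof.
move=> aq1 aq2 e0 H.
have mv1 := measurable_vq d a q1 (adm_meas _ _ _ aq1).
have mv2 := measurable_vq d a q2 (adm_meas _ _ _ aq2).
have K0 : 0 <= 108 * (2 * a) * e by rewrite !mulr_ge0// ltW.
have mcos : measurable_fun setT (fun z : R * R => cos z.1) by apply: measurable_fst1; exact: measurable_cosR.
have bw z : `|cos z.1 * vq d a q1 z - cos z.1 * vq d a q2 z| <= e * rho d z.2 + (108 * (2 * a) * e) * sI d z.2.
  rewrite -mulrBr normrM -[leRHS]mul1r; apply: ler_pM => //; first exact: norm_cos_le1.
  exact: w_bound.
have [_ h] := dom_bounded d d0 (fun z => cos z.1 * vq d a q1 z - cos z.1 * vq d a q2 z) e _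
  (measurable_funB (measurable_funM mcos mv1) (measurable_funM mcos mv2)) e0 K0 bw.
rewrite /cq -mulrBr -I2_sub; [|exact: int2_cosv (adm_meas _ _ _ aq1)|exact: int2_cosv (adm_meas _ _ _ aq2)].
have q0 : 0 < 2 * pi * d by rewrite !mulr_gt0.
rewrite normrM (gtr0_norm (x := _^-1)) ?invr_gt0// mulrC ler_pdivrMr//.
apply: (le_trans h).
have -> : 2 * n * e * (2 * pi * d) = tpi * (d * (2 * n * e)) by move: (pi : R) => P; ring.
rewrite ler_pM2l ?tpi_gt0// ler_pM2l//.
have -> : e * n + 4 * (108 * (2 * a) * e) = e * (n + 8 * (108 * a)) by ring.
rewrite [leRHS]mulrC; apply: ler_wpM2l => //.
apply: (le_trans n_a); rewrite mulrC ler_pM2r//.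
by have := small2; lra.
Qed.

(** The change of the factor a / cq, multiplied by a cos x, is exactly what subtracting cos (x - u)
    / (2 pi) from the kernel produces; the sine part drops out by evenness. What remains of the
    change of this factor multiplies the small quantity [fixmap q2], up to the mass term. *)
Lemma fixmap_diffE q1 q2 x y : admissible d r q1 -> admissible d r q2 ->
  fixmap q1 x y - fixmap q2 x y =
  d^-1 * I2 (fun z => (a / cq d a q1 * (kap (x - z.1) (y - z.2) - (2 * pi)^-1 * cos (x - z.1)) + Dc)
     * (vq d a q1 z - vq d a q2 z))
  - (cq d a q1 - cq d a q2) / cq d a q1 * (fixmap q2 x y - Dc * (Mq d a q2 - Mq d a (fun _ _ => 0))).
Proof.
move=> aq1 aq2.
have [cl1 _ _] := alpha_bounds q1 aq1; have [cl2 _ _] := alpha_bounds q2 aq2.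
have na : 0 < n * a / 4 by apply: divr_gt0 => //; apply: mulr_gt0.
have m1 := adm_meas _ _ _ aq1; have m2 := adm_meas _ _ _ aq2.
have mv1 := measurable_vq d a q1 m1; have mv2 := measurable_vq d a q2 m2.
have ik1 := int2_kv q1 x y m1; have ik2 := int2_kv q2 x y m2.
have ic1 := int2_cosv q1 m1; have ic2 := int2_cosv q2 m2.
have iv1 := int2_v q1 m1; have iv2 := int2_v q2 m2.
have mT := @measurable_TR R.
have is_ q : measurable_fun setT (fun z : R * R => q z.1 z.2) -> int2 (fun z => sin z.1 * vq d a q z).
  move=> mq; have mv := measurable_vq d a q mq.
  have [] // := dom_bounded d d0 (fun z => sin z.1 * vq d a q z) 0 1 _ (lexx 0) ler01.
    by apply: measurable_funM => //; apply: measurable_fst1; exact: measurable_sinR.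
  move=> z; rewrite mul0r add0r mul1r normrM (ger0_norm (vq_ge0 _ _ _ _)).
  rewrite -[leRHS]mul1r; apply: ler_pM; rewrite ?vq_ge0 ?vq_le//; exact: norm_sin_le1.
have is1 := is_ q1 m1; have is2 := is_ q2 m2.
have S1 := I2_sin_even (vq d a q1) mv1 (vq_per d a r q1 aq1) (vq_even d a r q1 aq1) is1.
have S2 := I2_sin_even (vq d a q2) mv2 (vq_per d a r q2 aq2) (vq_even d a r q2 aq2) is2.
set al := a / cq d a q1; set P := (2 * pi)^-1.
have E : I2 (fun z => (al * (kap (x - z.1) (y - z.2) - P * cos (x - z.1)) + Dc) * (vq d a q1 z - vq d a q2 z)) =
  al * (I2 (fun z => kap (x - z.1) (y - z.2) * vq d a q1 z) - I2 (fun z => kap (x - z.1) (y - z.2) * vq d a q2 z))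
  - al * P * cos x * (I2 (fun z => cos z.1 * vq d a q1 z) - I2 (fun z => cos z.1 * vq d a q2 z))
  + Dc * (I2 (vq d a q1) - I2 (vq d a q2)).
  have -> : (fun z => (al * (kap (x - z.1) (y - z.2) - P * cos (x - z.1)) + Dc) * (vq d a q1 z - vq d a q2 z)) =
    (fun z => (al * (kap (x - z.1) (y - z.2) * vq d a q1 z - kap (x - z.1) (y - z.2) * vq d a q2 z)
     - (al * P * cos x * (cos z.1 * vq d a q1 z - cos z.1 * vq d a q2 z)
     + al * P * sin x * (sin z.1 * vq d a q1 z - sin z.1 * vq d a q2 z)))
     + Dc * (vq d a q1 z - vq d a q2 z)).
    apply/funext => z; rewrite cosB; move: (vq d a q1 z) (vq d a q2 z) (kap _ _) => V1 V2 K; ring.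
  have jk := int2Z al _ (int2B _ _ ik1 ik2).
  have jc := int2Z (al * P * cos x) _ (int2B _ _ ic1 ic2).
  have js := int2Z (al * P * sin x) _ (int2B _ _ is1 is2).
  have jv := int2Z Dc _ (int2B _ _ iv1 iv2).
  have jcs := int2D _ _ jc js.
  rewrite RintegralD//; last exact: int2B.
  rewrite RintegralB// RintegralD// !RintegralZl//; try exact: int2B.
  by rewrite !RintegralB// S1 S2 subrr mulr0 addr0.
rewrite E /fixmap /Yq /Mq.
have ec q : I2 (fun z => cos z.1 * vq d a q z) = 2 * pi * d * cq d a q.
  rewrite /cq mulrA divff ?mul1r//; rewrite !mulf_neq0 ?gt_eqF//.
rewrite !ec /al /P.
have c1n : cq d a q1 != 0 := lt0r_neq0 (lt_le_trans na cl1).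
have c2n : cq d a q2 != 0 := lt0r_neq0 (lt_le_trans na cl2).
have dn : d != 0 by rewrite gt_eqF.
have pn : pi != 0 :> R by rewrite gt_eqF.
move: (I2 _) (I2 _) (I2 _) (I2 _) (I2 _) => X1 X2 X3 X4 X5.
move: (cq d a q1) (cq d a q2) (pi : R) c1n c2n pn Dc => C1 C2 Q C1n C2n Qn DD.
by field; rewrite ?C1n ?C2n ?Qn ?dn.
Qed.

(** [th] is the norm of the main kernel, the next two terms are the errors of replacing al by 2 / n
    and the kernel by its trace, the factor is the nonlinearity of the bump through n >= 1/8, and 40
    eta is (8 / a) * 5 r, from the variation of al. *)
Definition contraction_rate : R := (th + 8 * t1 * (A + tpi) + 8 * Num.sqrt d * A) * (1 + 108 * (64 * a)) + 40 * eta.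

Lemma fixmap_contraction q1 q2 e x y : admissible d r q1 -> admissible d r q2 -> 0 <= e ->
  (forall x y, `|y + 1| <= 2 * d -> `|q1 x y - q2 x y| <= e) ->
  `|y + 1| <= 2 * d -> `|fixmap q2 x y| <= r ->
  `|fixmap q1 x y - fixmap q2 x y| <= contraction_rate * e.
Proof.
move=> aq1 aq2 e0 H hy S2r.
have [cl1 /andP[al0 al4] al2] := alpha_bounds q1 aq1.
have na : 0 < n * a / 4 by apply: divr_gt0 => //; apply: mulr_gt0.
have c10 : 0 < cq d a q1 by apply: lt_le_trans cl1.
have m1 := adm_meas _ _ _ aq1; have m2 := adm_meas _ _ _ aq2.
have mv1 := measurable_vq d a q1 m1; have mv2 := measurable_vq d a q2 m2.
have t0 := t1_ge0.
have s0 := sqrtr_ge0 d.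
have K0 : 0 <= 108 * (2 * a) * e by rewrite !mulr_ge0// ltW.
rewrite fixmap_diffE//; set al := a / cq d a q1 in al0 al4 al2 *.
set Phi := (fun z : R * R => _).
pose f u := (pi * n)^-1 * `|- ell u - cos u + dd| + 1 * (8 * t1 / n * (sinp 2^-1 u + 1) + 8 * Num.sqrt d / n * sinp 2^-1 u).
have pn0 : 0 < pi * n by rewrite mulr_gt0.
have tn0 : 0 <= 8 * t1 / n by apply: divr_ge0; [exact: mulr_ge0|exact: ltW].
have sn0 : 0 <= 8 * Num.sqrt d / n by apply: divr_ge0; [exact: mulr_ge0|exact: ltW].
have me : measurable_fun setT (fun u : R => `|- ell u - cos u + dd|).
  apply: measurableT_comp => //; apply: measurable_funD => //; apply: measurable_funB; last exact: measurable_cosR.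
  by apply: measurableT_comp => //; exact: measurable_ell.
have ms := measurable_sinp (R := R) 2^-1.
have ms1 : measurable_fun setT (fun u : R => sinp 2^-1 u + 1) by exact: measurable_funD.
have mg : measurable_fun setT (fun u : R => 8 * t1 / n * (sinp 2^-1 u + 1) + 8 * Num.sqrt d / n * sinp 2^-1 u).
  by apply: measurable_funD; exact: measurable_funM.
have mf : measurable_fun setT f by apply: measurable_funD; exact: measurable_funM.
have sp := sinp_ge0 (R := R) 2^-1.
have f0 u : 0 <= f u.
  by rewrite /f addr_ge0// mulr_ge0 ?invr_ge0 ?(ltW pn0)// addr_ge0// mulr_ge0// addr_ge0.
have fp u : f (u + tpi) = f u by rewrite /f ell_period cos_period sinp_period.
pose Af := (pi * n)^-1 * (pi * th) + 1 * (8 * t1 / n * (A + tpi) + 8 * Num.sqrt d / n * A).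
have fA : (\int[leb]_(t in I0) (f t)%:E <= Af%:E)%E.
  apply: int_lin2 => //.
  - by move=> t; rewrite addr_ge0// mulr_ge0// addr_ge0.
  - by rewrite invr_ge0 ltW.
  apply: int_lin2 => //; first by move=> t; rewrite addr_ge0.
  have h1 := int_lin2 I0 (sinp 2^-1) (cst 1) A tpi 1 1 (measurable_itv _) ms (measurable_cst _) sp (fun=> ler01) ler01 ler01 HA.
  under eq_integral do rewrite -[sinp _ _]mul1r -[X in _ + X]mul1r.
  rewrite -[A]mul1r -[X in (_ + X)%:E]mul1r; apply: h1.
  rewrite (_ : (fun t => _) = cst 1%:E)%E; last by apply/funext.
  by rewrite integral_cst//= leb_I0 mul1e.
have mPhi : measurable_fun setT Phi.
  apply: measurable_funM; last exact: measurable_funB.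
  apply: measurable_funD => //; apply: measurable_funM => //; apply: measurable_funB; first exact: measurable_kap_sub.
  apply: measurable_funM => //.
  apply: (measurable_fst1 (fun t => cos (x - t))).
  by apply: (measurableT_comp measurable_cosR); exact: measurable_funB.
have [_ bPhi] : int2 Phi /\ `|I2 Phi| <= Af * (d * (e * n + 4 * (108 * (2 * a) * e))).
  apply: (dom_strip d d0 Phi x y f) => // z sz _.
  have [h|h] := leP `|z.2 + 1| (2 * d); last first.
    by rewrite /Phi /vq /rho sI_out// !mulr0 subr0 mulr0 normr0 addr0 mulr0.
  rewrite /Phi normrM; apply: ler_pM => //; last exact: w_bound.
  set u := x - z.1 in sz *; set w := y - z.2.
  have hw : `|w| <= 4 * d.
    rewrite /w; have -> : y - z.2 = (y + 1) - (z.2 + 1) by ring.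
    by apply: (le_trans (ler_normB _ _)); lra.
  have kk := kap_kap0_small u w (4 * d) sz hw d4.
  have k0 := kap0_bound u.
  have s4 : Num.sqrt (4 * d) = 2 * Num.sqrt d.
    rewrite sqrtrM//; congr (_ * _).
    by rewrite (_ : 4 = 2 ^+ 2 :> R) ?sqrtr_sqr ?ger0_norm//; ring.
  (* The kernel of [theta_kernel] divided by pi n, plus the two errors: al against 2 / n, and [kap]
     against [kap0]. *)
  have E : al * (kap u w - (2 * pi)^-1 * cos u) + Dc =
     (pi * n)^-1 * (- ell u - cos u + dd) + ((al - 2 / n) * (kap0 u - (2 * pi)^-1 * cos u) + al * (kap u w - kap0 u)).
    rewrite /kap0 /Dc.
    have nn0 : n != 0 by rewrite gt_eqF.
    have pn : pi != 0 :> R by rewrite gt_eqF.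
    move: (kap u w) (ell u) (pi : R) pn => K L Q Qn.
    by field; rewrite Qn nn0.
  rewrite E /f; apply: (le_trans (ler_normD _ _)); apply: lerD.
    by rewrite normrM ger0_norm// invr_ge0 ltW.
  rewrite mul1r; apply: (le_trans (ler_normD _ _)); apply: lerD.
    rewrite normrM; apply: ler_pM => //.
    apply: (le_trans (ler_normB _ _)); apply: lerD => //.
    rewrite normrM (ger0_norm inv2pi_ge0) -[leRHS]mul1r; apply: ler_pM => //; first exact: inv2pi_ge0.
      have := @pi_ge2 R => p2; rewrite invf_le1; lra.
    exact: norm_cos_le1.
  rewrite normrM (gtr0_norm al0).
  have -> : 8 * Num.sqrt d / n * sinp 2^-1 u = 4 / n * (2 * Num.sqrt d * sinp 2^-1 u) by ring.
  apply: ler_pM => //; first exact: ltW.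
  by rewrite -s4.
apply: (le_trans (ler_normB _ _)); rewrite /contraction_rate [leRHS]mulrDl; apply: lerD.
  rewrite normrM (gtr0_norm (x := d^-1)) ?invr_gt0// mulrC ler_pdivrMr//.
  apply: (le_trans bPhi).
  have AfE : Af = n^-1 * (th + 8 * t1 * (A + tpi) + 8 * Num.sqrt d * A).
    rewrite /Af.
    have nn0 : n != 0 by rewrite gt_eqF.
    have pn : pi != 0 :> R by rewrite gt_eqF.
    move: (pi : R) pn => Q Qn; field; rewrite Qn nn0//.
  rewrite AfE.
  have B0 : 0 <= th + 8 * t1 * (A + tpi) + 8 * Num.sqrt d * A.
    have [h _] := andP th01.
    by rewrite !addr_ge0// !mulr_ge0// ?addr_ge0// ?mulr_ge0// ?(ltW A0) ?(ltW pi0).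
  move: (th + _ + _) B0 => B B0.
  have -> : n^-1 * B * (d * (e * n + 4 * (108 * (2 * a) * e))) = (B * e * d) * (n^-1 * (n + 8 * (108 * a))) by ring.
  have -> : B * (1 + 108 * (64 * a)) * e * d = (B * e * d) * (1 + 108 * (64 * a)) by ring.
  apply: ler_wpM2l; first by rewrite !mulr_ge0// ltW.
  by rewrite [leLHS]mulrC ler_pdivrMr// [leRHS]mulrC.
have cd := c_diff q1 q2 e aq1 aq2 e0 H.
have a00 : admissible d r (fun _ _ => 0).
  by case: (q0_adm d) => h1 h2 h3 _; split => // u w _; rewrite normr0.
have md : `|Mq d a q2 - Mq d a (fun _ _ => 0)| <= tpi * (2 * n * r).
  by apply: M_diff => // u w hw; rewrite subr0; exact: adm_bnd aq2 _ _ hw.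
have [dd0 dd1] := andP dd01.
have Dm : `|Dc * (Mq d a q2 - Mq d a (fun _ _ => 0))| <= 4 * r.
  rewrite normrM ger0_norm; last by rewrite /Dc divr_ge0// ltW.
  apply: (@le_trans _ _ ((pi * n)^-1 * (tpi * (2 * n * r)))).
    apply: ler_pM => //; first by rewrite /Dc divr_ge0// ltW.
    by rewrite /Dc ler_piMl// invr_ge0 ltW.
  have nn0 : n != 0 by rewrite gt_eqF.
  have pn : pi != 0 :> R by rewrite gt_eqF.
  rewrite le_eqVlt; apply/orP; left; apply/eqP.
  by move: (pi : R) pn => Q Qn; field; rewrite Qn nn0.
rewrite normrM normf_div (gtr0_norm c10).
have h5 : `|fixmap q2 x y - Dc * (Mq d a q2 - Mq d a (fun _ _ => 0))| <= 5 * r.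
  by apply: (le_trans (ler_normB _ _)); lra.
have h6 : `|cq d a q1 - cq d a q2| / cq d a q1 <= 8 * e / a.
  rewrite ler_pdivrMr//; apply: (le_trans cd).
  rewrite [leRHS]mulrAC ler_pdivlMr//.
  have := ler_wpM2l (mulr_ge0 (ler0n _ 8) e0) cl1; lra.
apply: (le_trans (ler_pM _ _ h6 h5)) => //; first by rewrite divr_ge0// ltW.
rewrite le_eqVlt; apply/orP; left; apply/eqP; field; rewrite gt_eqF//.
Qed.

(** At q = 0 the terms linear in a cancel for al = 2 / n; there remain the error of [Y0_est],
    multiplied by al <= 4 / n <= 32, and the deviation of al. *)
Lemma fixmap0_bound x y : `|y + 1| <= 2 * d ->
  `|fixmap (fun _ _ => 0) x y| <= 32 * (8 * A * Num.sqrt d + 144 * A * a ^+ 2) + 4 * t1 * a.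
Proof.
move=> hy; have a00 : admissible d r (fun _ _ => 0).
  by case: (q0_adm d) => h1 h2 h3 _; split => // u w _; rewrite normr0.
have [cl1 /andP[al0 al4] al2] := alpha_bounds _ a00.
have h := Y0_est d a A d0 d4 a0 HA x y hy.
rewrite /fixmap subrr mulr0 addr0; set al := a / _ in al0 al4 al2 *.
have -> : al * Yq d a (fun _ _ => 0) x y - a * cos x =
   al * (Yq d a (fun _ _ => 0) x y - n * a / 2 * cos x) + (al - 2 / n) * (n * a / 2 * cos x).
  have nn0 : n != 0 by rewrite gt_eqF.
  by move: (Yq _ _ _ _ _) (cos x) (al) (n) nn0 => Y C L N Nn; field.
apply: (le_trans (ler_normD _ _)); apply: lerD.
  rewrite normrM (gtr0_norm al0); apply: ler_pM => //; first exact: ltW.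
  apply: (le_trans al4); rewrite ler_pdivrMr//; have := n8; lra.
have t0 := t1_ge0.
rewrite normrM; apply: (@le_trans _ _ (8 * t1 / n * (n * a / 2))).
  apply: ler_pM => //; rewrite normrM ger0_norm; last by rewrite divr_ge0// mulr_ge0// ltW.
  by rewrite ler_piMr ?norm_cos_le1// divr_ge0// mulr_ge0// ltW.
have nn0 : n != 0 by rewrite gt_eqF.
rewrite le_eqVlt; apply/orP; left; apply/eqP.
by move: (n) nn0 t1 => N Nn T; field.
Qed.

End Contr.

(** * Iteration to the fixed point *)

Section Geom.
Context {R : realType}.

(** With B = r / (1 - l), B l^k is the tail of the geometric series: u k + B l^k is nonincreasing
    and u k - B l^k nondecreasing, and squeezing gives both the limit and the rate. *)
Lemma geom_limit (u : nat -> R) (r l : R) : 0 <= r -> 0 <= l < 1 ->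
  (forall k, `|u k.+1 - u k| <= r * l ^+ k) ->
  exists2 L, u @ \oo --> L & forall k, `|L - u k| <= r / (1 - l) * l ^+ k.
Proof.
move=> r0 /andP[l0 l1] H; have l1' : 0 < 1 - l by rewrite subr_gt0.
pose B := r / (1 - l).
have B0 : 0 <= B by rewrite divr_ge0// ltW.
have lk : (fun k => B * l ^+ k) @ \oo --> 0.
  rewrite -[X in _ --> X](mulr0 B); apply: cvgMr; apply: cvg_expr.
  by rewrite ger0_norm.
have step k : B * l ^+ k.+1 = B * l ^+ k - r * l ^+ k.
  rewrite /B exprSr; field; rewrite gt_eqF//.
pose up k := u k + B * l ^+ k.
pose lo k := u k - B * l ^+ k.
have upd : nonincreasing_seq up.
  apply/nonincreasing_seqP => k; rewrite /up step.
  by have := H k; rewrite ler_norml => /andP[h1 h2]; lra.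
have lod : nondecreasing_seq lo.
  apply/nondecreasing_seqP => k; rewrite /lo step.
  by have := H k; rewrite ler_norml => /andP[h1 h2]; lra.
have lk0 k : 0 <= B * l ^+ k by rewrite mulr_ge0// exprn_ge0.
have lolb k : lo 0%N <= up k.
  apply: (@le_trans _ _ (lo k)); first exact: lod.
  by rewrite /lo /up; have := lk0 k; lra.
have cu : cvgn up.
  apply: nonincreasing_is_cvgn => //.
  by exists (lo 0%N) => _ [k _ <-].
set L := limn up.
have cL : u @ \oo --> L.
  have -> : u = (fun k => up k - B * l ^+ k) by apply/funext => k; rewrite /up addrK.
  by rewrite -[X in _ --> X]subr0; apply: cvgB.
exists L => // k.
have cl : lo @ \oo --> L.
  by rewrite /lo -[X in _ --> X]subr0; apply: cvgB.
have h1 : L <= up k by exact: nonincreasing_cvgn_ge.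
have h2 : lo k <= L.
  have -> : L = limn lo by apply/esym/cvg_lim.
  by apply: nondecreasing_cvgn_le => //; apply/cvg_ex; exists L.
rewrite -/B; move: h1 h2; rewrite /up /lo => h1 h2.
by rewrite ler_norml; apply/andP; split; lra.
Qed.

Lemma le_geom0 (x C l : R) : 0 <= l < 1 -> (forall k : nat, x <= C * l ^+ k) -> x <= 0.
Proof.
move=> /andP[l0 l1] H.
have lk : (fun k => C * l ^+ k) @ \oo --> 0.
  rewrite -[X in _ --> X](mulr0 C); apply: cvgMr; apply: cvg_expr.
  by rewrite ger0_norm.
rewrite -(cvg_lim _ lk)//.
apply: limr_ge; first by apply/cvg_ex; exists 0.
exact: nearW.
Qed.
End Geom.

Section Fix.
Context {R : realType}.
Local Notation leb := (@lebesgue_measure R).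
Local Notation leb2 := (leb \x leb)%E.
Local Notation TRR := (@TR R).
Local Notation tpi := (2 * pi : R).
Local Notation I0 := (`[0%R, tpi[%classic : set R).
Local Notation I2 := (Rintegral leb2 TRR).
Local Notation int2 f := (leb2.-integrable TRR (EFin \o f)).

Variables d a A eta dd th l : R.
Hypothesis d0 : 0 < d.
Hypothesis d4 : 4 * d <= 1.
Hypothesis a0 : 0 < a.
Hypothesis A0 : 0 < A.
Hypothesis HA : (\int[leb]_(t in I0) (sinp 2^-1 t)%:E <= A%:E)%E.
Hypothesis eta0 : 0 <= eta.
Hypothesis small1 : eta + 72 * (64 * a) <= 1 / 4.
Hypothesis small2 : 108 * (64 * a) <= 1.
Hypothesis dd01 : 0 <= dd <= 1.
Hypothesis th01 : 0 <= th < 1.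
Hypothesis Hth : (\int[leb]_(u in I0) `|- ell u - cos u + dd|%:E <= (pi * th)%:E)%E.
Local Notation r := (eta * a).
Hypothesis l01 : 0 <= l < 1.
Hypothesis Ll : contraction_rate d a A eta th <= l.
Hypothesis HS0 : forall x y, `|y + 1| <= 2 * d -> `|fixmap d a dd (fun _ _ => 0) x y| <= (1 - l) * r.

Local Notation S := (fixmap d a dd).

Let r0 : 0 <= r. Proof. by rewrite mulr_ge0// ltW. Qed.
Let a00 : admissible d r (fun _ _ => 0).
Proof. by case: (q0_adm d) => h1 h2 h3 _; split => // u w _; rewrite normr0. Qed.
Let l0 : 0 <= l. Proof. by have /andP[] := l01. Qed.
Let l1 : l < 1. Proof. by have /andP[] := l01. Qed.

Let ctr q1 q2 e x y : admissible d r q1 -> admissible d r q2 -> 0 <= e ->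
  (forall x y, `|y + 1| <= 2 * d -> `|q1 x y - q2 x y| <= e) ->
  `|y + 1| <= 2 * d -> `|S q2 x y| <= r -> `|S q1 x y - S q2 x y| <= l * e.
Proof.
move=> h1 h2 e0 h3 h4 h5.
apply: (@le_trans _ _ (contraction_rate d a A eta th * e)); first exact: fixmap_contraction.
by rewrite ler_wpM2r.
Qed.

Lemma fixmap_bound q : admissible d r q -> forall x y, `|y + 1| <= 2 * d -> `|S q x y| <= r.
Proof.
move=> aq x y hy.
have h0 := HS0 x y hy.
have h1 : `|S (fun _ _ => 0) x y| <= r.
  by apply: (le_trans h0); rewrite ler_piMl//; have := l0; lra.
have h2 : `|S q x y - S (fun _ _ => 0) x y| <= l * r.
  by apply: ctr => // u w hw; rewrite subr0; exact: adm_bnd aq _ _ hw.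
have -> : S q x y = (S q x y - S (fun _ _ => 0) x y) + S (fun _ _ => 0) x y by rewrite subrK.
by apply: (le_trans (ler_normD _ _)); lra.
Qed.

Lemma Y_even q : admissible d r q -> forall x y, Yq d a q (- x) y = Yq d a q x y.
Proof.
move=> aq x y; rewrite /Yq; congr (_ * _).
have mv := measurable_vq d a q (adm_meas _ _ _ aq).
rewrite -[RHS](flipx 0 (fun z => kap (x - z.1) (y - z.2) * vq d a q z)).
- apply: eq_Rintegral => -[u w] _ /=; rewrite sub0r opprK (vq_even d a r q aq).
  by rewrite -[kap (x + u) _]kapN opprD.
- by apply: measurable_funM => //; exact: measurable_kap_sub.
- move=> u w /=; rewrite (vq_per d a r q aq); congr (_ * _).
  by rewrite -[LHS]kap_period; congr kap; rewrite opprD addrA subrK.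
Qed.

Lemma Y_per q : forall x y, Yq d a q (x + tpi) y = Yq d a q x y.
Proof.
move=> x y; rewrite /Yq; congr (_ * _); apply: eq_Rintegral => -[u w] _ /=.
by rewrite addrAC kap_period.
Qed.

Lemma measurable_Y q : measurable_fun setT (fun z : R * R => q z.1 z.2) ->
  measurable_fun setT (fun z : R * R => Yq d a q z.1 z.2).
Proof.
move=> mq; apply: measurable_funM => //.
apply: (measurable_conv (fun z => kap z.1 z.2) (vq d a q)); first exact: measurable_kap.
exact: measurable_vq.
Qed.

Lemma fixmap_admissible q : admissible d r q -> admissible d r (S q).
Proof.
move=> aq; split.
- rewrite /fixmap; apply: measurable_funD => //; apply: measurable_funB.
    by apply: measurable_funM => //; apply: measurable_Y; exact: adm_meas aq.
  by apply: measurable_funM => //; apply: measurable_fst1; exact: measurable_cosR.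
- by move=> x y; rewrite /fixmap Y_even// cosN.
- by move=> x y; rewrite /fixmap Y_per cos_period.
- exact: fixmap_bound.
Qed.

Fixpoint iterate (k : nat) : R -> R -> R := if k is k'.+1 then S (iterate k') else (fun _ _ => 0).

Lemma iterate_admissible k : admissible d r (iterate k).
Proof. by elim: k => [|k IH]; [exact: a00|exact: fixmap_admissible]. Qed.

Lemma iterate_diff k x y : `|y + 1| <= 2 * d -> `|iterate k.+1 x y - iterate k x y| <= r * l ^+ k.
Proof.
elim: k x y => [|k IH] x y hy.
  by rewrite expr0 mulr1 /= subr0; exact: fixmap_bound.
have -> : r * l ^+ k.+1 = l * (r * l ^+ k) by rewrite exprS; ring.
apply: (ctr (iterate k.+1) (iterate k) _ x y (iterate_admissible k.+1) (iterate_admissible k)) => //.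
  by rewrite mulr_ge0// exprn_ge0.
exact: fixmap_bound (iterate_admissible k) _ _ hy.
Qed.

(** Off the strip the iterates are not controlled; the factor [sI] makes the sequence converge at
    every point, as the measurability of the limit requires. *)
Definition fixpt (x y : R) : R := limn (fun k => iterate k x y * sI d y).

Lemma fixpt_cvg x y : (fun k => iterate k x y * sI d y) @ \oo --> fixpt x y /\
  (`|y + 1| <= 2 * d -> forall k, `|fixpt x y - iterate k x y| <= r / (1 - l) * l ^+ k).
Proof.
have [h|h] := leP `|y + 1| (2 * d); last first.
  have E : (fun k => iterate k x y * sI d y) = (fun=> 0) by apply/funext => k; rewrite sI_out// mulr0.
  split=> //; rewrite /fixpt E; first by rewrite lim_cst//; exact: cvg_cst.
have E : (fun k => iterate k x y * sI d y) = (fun k => iterate k x y) by apply/funext => k; rewrite sI_in// mulr1.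
have [L cL HL] := geom_limit (fun k => iterate k x y) r l r0 l01 (fun k => iterate_diff k x y h).
have qL : fixpt x y = L by rewrite /fixpt E; exact/cvg_lim.
by rewrite qL E; split.
Qed.

Lemma fixpt_admissible : admissible d r fixpt.
Proof.
split.
- apply: (@measurable_fun_cvg _ _ R setT (fun k (z : R * R) => iterate k z.1 z.2 * sI d z.2)).
    move=> k; apply: measurable_funM; first exact: adm_meas (iterate_admissible k).
    by apply: measurable_snd1; exact: measurable_sI.
  by move=> z _; have [] := fixpt_cvg z.1 z.2.
- move=> x y; rewrite /fixpt; congr (limn _); apply/funext => k.
  by rewrite (adm_even _ _ _ (iterate_admissible k)).
- move=> x y; rewrite /fixpt; congr (limn _); apply/funext => k.
  by rewrite (adm_per _ _ _ (iterate_admissible k)).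
- move=> x y hy; have [cv H] := fixpt_cvg x y.
  suff : `|fixpt x y| - r <= 0 by rewrite subr_le0.
  apply: (le_geom0 _ (r / (1 - l)) l l01) => k; rewrite lerBlDr.
  have -> : fixpt x y = (fixpt x y - iterate k x y) + iterate k x y by rewrite subrK.
  apply: (le_trans (ler_normD _ _)); apply: lerD; first exact: H.
  exact: adm_bnd (iterate_admissible k) _ _ hy.
Qed.

Lemma fixpt_fixed x y : `|y + 1| <= 2 * d -> S fixpt x y = fixpt x y.
Proof.
move=> hy; apply/eqP; rewrite -subr_eq0 -normr_le0.
have B0 : 0 <= r / (1 - l) by rewrite divr_ge0// subr_ge0 ltW.
apply: (le_geom0 _ (2 * (r / (1 - l))) l l01) => k.
have h1 : `|S fixpt x y - S (iterate k) x y| <= l * (r / (1 - l) * l ^+ k).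
  apply: (ctr fixpt (iterate k) _ x y fixpt_admissible (iterate_admissible k)) => //.
  - by apply: mulr_ge0 => //; rewrite exprn_ge0.

    by move=> u w hw; have [_ H] := fixpt_cvg u w; exact: H.
  exact: fixmap_bound (iterate_admissible k) _ _ hy.
have [_ H] := fixpt_cvg x y; have h2 := H hy k.+1.
have -> : S fixpt x y - fixpt x y = (S fixpt x y - S (iterate k) x y) - (fixpt x y - iterate k.+1 x y).
  rewrite (_ : iterate k.+1 x y = S (iterate k) x y)//.
  by move: (S fixpt x y) (fixpt x y) (S (iterate k) x y) => a1 a2 a3; rewrite opprB addrA subrK.
apply: (le_trans (ler_normB _ _)).
have h3 : 0 <= r / (1 - l) * l ^+ k by rewrite mulr_ge0// exprn_ge0.
have h4 : l * (r / (1 - l) * l ^+ k) <= r / (1 - l) * l ^+ k by rewrite ler_piMl// ltW.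
have h5 : r / (1 - l) * l ^+ k.+1 = l * (r / (1 - l) * l ^+ k) by rewrite exprS; ring.
by move: h1 h2 h4; rewrite h5 -mulrA; lra.
Qed.
End Fix.

(** * Choice of the small parameters *)

Section Params.
Context {R : realFieldType}.
(** A hierarchy: eta is small against 1 - th, because the rate loses 40 eta; a is small against eta
    and sqrt d against a, because the first iterate is of order sqrt d + a^2 and must be small
    against the radius eta a. Only [sd], standing for sqrt d, varies afterwards, so eta, a and l do
    not depend on d. *)
Lemma contraction_params (A P th : R) : 0 < A -> 0 < P -> 0 <= th < 1 ->
  exists eta a s l : R, [/\ [/\ 0 < eta, 0 < a & 0 < s <= 1 / 2], 0 <= l < 1,
    eta + 72 * (64 * a) <= 1 / 4, 108 * (64 * a) <= 1 &
    forall sd, 0 <= sd <= s ->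
      (th + 8 * (eta + 72 * (64 * a)) * (A + P) + 8 * sd * A) * (1 + 108 * (64 * a)) + 40 * eta <= l /\
      32 * (8 * A * sd + 144 * A * a ^+ 2) + 4 * (72 * (64 * a)) * a <= (1 - l) * (eta * a)].
Proof.
move=> A0 P0 /andP[th0 th1].
pose mu := 1 - th; have mu0 : 0 < mu by rewrite subr_gt0.
have mu1 : mu <= 1 by rewrite /mu; lra.
pose B := A + P + 1; have B1 : 1 <= B by rewrite /B; lra.
have B0 : 0 < B by lra.
pose eta := mu / (20 * (20 * B)).
have eB : eta * B = mu / (20 * 20) by rewrite /eta; field; rewrite gt_eqF.
have eta0 : 0 < eta by apply: divr_gt0; rewrite ?mulr_gt0.
have etas : eta <= mu / (20 * 20) by rewrite -eB ler_peMr// ltW.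
clearbody eta.
pose a := mu * eta / (72 * (64 * (64 * B))).
have a0 : 0 < a by apply: divr_gt0; rewrite ?mulr_gt0.
have aB : 72 * (64 * a) * B = mu * eta / 64 by rewrite /a; field; rewrite gt_eqF.
clearbody a.
have T0 : 0 < 72 * (64 * a) by rewrite !mulr_gt0.
have Ts : 72 * (64 * a) <= mu * eta / 64 by rewrite -aB ler_peMr// ltW.
pose s := mu * eta * a / (32 * (64 * B)).
have s0 : 0 < s by apply: divr_gt0; rewrite ?mulr_gt0.
have sB : s * B = mu * eta * a / (32 * 64) by rewrite /s; field; rewrite gt_eqF.
clearbody s.
have ss : s <= mu * eta * a / (32 * 64) by rewrite -sB ler_peMr// ltW.
have me : mu * eta <= mu / (20 * 20).
  by apply: (le_trans _ etas); rewrite ler_piMl// ltW.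
have me0 : 0 < mu * eta by rewrite mulr_gt0.
have a1 : a <= 1 by lra.
have mea : mu * eta * a <= mu * eta by rewrite ler_piMr// ltW.
exists eta, a, s, (1 - mu / 2); split.
- split=> //; rewrite s0/=; lra.
- by apply/andP; split; lra.
- by lra.
- by lra.
move=> sd /andP[sd0 sds].
have AP : A + P <= B by rewrite /B; lra.
have AB : A <= B by rewrite /B; lra.
set T := 72 * (64 * a) in aB T0 Ts *.
have X1 : 8 * (eta + T) * (A + P) <= 8 * (eta * B + T * B).
  by rewrite -mulrDl -mulrA ler_pM2l// ler_pM2l// addr_gt0.
have X2 : sd * A <= s * B by apply: ler_pM => //; exact: ltW.
have X20 : 0 <= sd * A by rewrite mulr_ge0// ltW.
have X10 : 0 <= 8 * (eta + T) * (A + P).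
  by rewrite !mulr_ge0 ?addr_ge0 ?(ltW eta0) ?(ltW T0) ?(ltW A0) ?(ltW P0).
set X := 8 * (eta + T) * (A + P) in X1 X10 *.
split.
  have H : 108 * (64 * a) <= mu / 8 by move: Ts; rewrite /T; lra.
  have H0 : 0 <= 108 * (64 * a) by move: T0; rewrite /T; lra.
  move: (108 * (64 * a)) H H0 => h H H0.
  have Y : X + 8 * sd * A <= mu / 8 by lra.
  have Y0 : 0 <= X + 8 * sd * A by rewrite addr_ge0// -mulrA mulr_ge0.
  have -> : th + X + 8 * sd * A = th + (X + 8 * sd * A) by rewrite addrA.
  move: (X + 8 * sd * A) Y Y0 => Z Y Y0.
  have q1 : (th + Z) * h <= h by rewrite ler_piMl//; rewrite /mu in Y mu1; lra.
  rewrite mulrDr mulr1 /mu in q1 *; rewrite /mu in Y H etas; lra.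
have -> : (1 - (1 - mu / 2)) * (eta * a) = mu * eta * a / 2 by ring.
have q1 : 32 * (144 * A * a ^+ 2) = T * A * a by rewrite /T; ring.
have q2 : T * A * a <= mu * eta / 64 * a by rewrite ler_pM2r// -aB ler_pM2l.
have q3 : 4 * T * a <= 4 * (mu * eta / 64) * a by rewrite ler_pM2r// ler_pM2l.
rewrite mulrDr q1; have -> : 32 * (8 * A * sd) = 256 * (sd * A) by ring.
have m0 : 0 <= mu * eta * a by rewrite mulr_ge0// ltW.
lra.
Qed.
(** The arithmetic of dropping the cut-off: [X] and [X'] are the potential off the strip and at the
    nearest edge. At the edge X' + e <= 2 a, so off the strip the argument is at most 2 a - 1 <
    0. *)
Lemma edge_neg (X X' e p p' c1 c2 a : R) : X <= X' -> X' + e + p' = p' + c1 + c2 ->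
  c1 + c2 <= 2 * a -> p <= -1 -> 108 * (64 * a) <= 1 -> X + e + p <= 0.
Proof. by lra. Qed.

Lemma edge_dist (d y z : R) : 2 * d < `|y + 1| -> `|z + 1| <= 2 * d ->
  `|(if 0 <= y + 1 then -1 + 2 * d else -1 - 2 * d) - z| <= `|y - z|.
Proof.
move=> hy; rewrite ler_norml => /andP[z1 z2]; case: ifPn => y1.
  by move: hy; rewrite ger0_norm// => hy; rewrite !ger0_norm; lra.
by move: y1; rewrite -ltNge => y1; move: hy; rewrite ltr0_norm// => hy; rewrite !ler0_norm; lra.
Qed.

Lemma quarter_le (a : R) : 0 <= a -> a / 4 <= a.
Proof. by lra. Qed.

Lemma bump_arith (a r q1 q2 : R) : 0 < a -> r <= a / 4 -> 108 * (64 * a) <= 1 ->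
  `|q1| <= r -> `|q2| <= r -> 0 < 1 + a * -1 + q2 /\ 1 + a * -1 + q2 < 1 + a * 1 + q1.
Proof. by rewrite !ler_norml => ? ? ? /andP[? ?] /andP[? ?]; split; lra. Qed.
End Params.

(** * Profiles: the equation without cut-off *)

Section Profile.
Context {R : realType}.
Local Notation leb := (@lebesgue_measure R).
Local Notation leb2 := (leb \x leb)%E.
Local Notation TRR := (@TR R).
Local Notation tpi := (2 * pi : R).
Local Notation I0 := (`[0%R, tpi[%classic : set R).
Local Notation I2 := (Rintegral leb2 TRR).
Local Notation int2 f := (leb2.-integrable TRR (EFin \o f)).

Definition conv (v : R -> R -> R) (x y : R) : R := I2 (fun z => kap (x - z.1) (y - z.2) * v z.1 z.2).

(** All that later parts use of the fixed point. [pf_eq] holds at every point of the plane, which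
    gives both the bootstrap for smoothness and the transport equation; the bounds 32 and 3 do not
    depend on d, and [pf_bnd] will recover the size of [e0]. *)
Record profile (d : R) (v : R -> R -> R) (al e0 : R) : Prop := Profile {
  pf_meas : measurable_fun setT (fun z : R * R => v z.1 z.2) ;
  pf_per : periodic_x v ;
  pf_out : forall x y, 2 * d < `|y + 1| -> v x y = 0 ;
  pf_al : 0 < al <= 32 ;
  pf_eq : forall x y, v x y = ff 0 (al * (d^-1 * conv v x y) + e0 + par d y) ;
  pf_bnd : forall x y, `|y + 1| <= 2 * d -> `|al * (d^-1 * conv v x y) + e0 + par d y| <= 3 ;
  pf_nt : v 0 (-1) <> v pi (-1) }.

Lemma I2_ae_ge0 (h : R * R -> R) (x y : R) : measurable_fun setT h ->
  (forall z, sin ((x - z.1) / 2) != 0 -> z.2 != y -> 0 <= h z) -> 0 <= I2 h.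
Proof.
move=> mh H; rewrite /Rintegral fine_ge0//.
have -> : (\int[leb2]_(z in TRR) (h z)%:E = \int[leb2]_(z in TRR) `|h z|%:E)%E; last first.
  by apply: integral_ge0 => z _; rewrite lee_fin.
apply: ae_eq_integral.
- exact: measurable_TR.
- by apply/measurable_EFinP; exact: measurable_funTS.
- by apply/measurable_EFinP; apply: measurable_funTS; exact: measurableT_comp.
- by apply: (@ae_off_lines _ x y) => z s1 s2 _; rewrite ger0_norm// H.
Qed.

Lemma par_edge (d y : R) : 0 < d -> 2 * d <= `|y + 1| -> par d y <= -1.
Proof.
move=> d0 h; rewrite /par.
have : 2 <= (y + 1) ^+ 2 / (2 * d ^+ 2).
  rewrite ler_pdivlMr ?mulr_gt0 ?exprn_gt0//.
  have -> : 2 * (2 * d ^+ 2) = (2 * d) ^+ 2 by ring.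
  by rewrite -[leRHS]real_normK ?num_real// ler_pXn2r ?nnegrE// mulr_ge0// ltW.
lra.
Qed.

Lemma par_in (d y : R) : 0 < d -> `|y + 1| <= 2 * d -> -1 <= par d y <= 1.
Proof.
move=> d0 h; rewrite /par.
have d2 : 0 < 2 * d ^+ 2 by rewrite mulr_gt0// exprn_gt0.
have : (y + 1) ^+ 2 / (2 * d ^+ 2) <= 2.
  rewrite ler_pdivrMr//.
  have -> : 2 * (2 * d ^+ 2) = (2 * d) ^+ 2 by ring.
  by rewrite -[leLHS]real_normK ?num_real// ler_pXn2r ?nnegrE// mulr_ge0// ltW.
have : 0 <= (y + 1) ^+ 2 / (2 * d ^+ 2) by rewrite divr_ge0 ?sqr_ge0// ltW.
by move=> h1 h2; apply/andP; split; lra.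
Qed.

(* Off the strip the argument of the bump is negative since kap decreases in |w|, so the cut-off can be
   dropped from the fixed point equation. *)
Lemma exists_profile : exists d1 : R, 0 < d1 <= 1 / 4 /\
  forall d, 0 < d <= d1 -> exists v al e0, profile d v al e0.
Proof.
have [A A0 HA] := sinp_bound (R := R) 2^-1 half01.
have [dd [th [dd01 th01 Hth]]] := @theta_kernel R.
have [eta [a [s [l [[eta0 a0 /andP[s0 s2]] l01 sm1 sm2 H]]]]] := contraction_params A tpi th A0 tpi_gt0 th01.
(* The smallness condition is on sqrt d <= s; s <= 1/2 also yields 4 d <= 1. *)
exists (s ^+ 2); split.
  rewrite exprn_gt0//= expr2; have : s * s <= (1 / 2) * (1 / 2) by apply: ler_pM => //; exact: ltW.
  by lra.
move=> d /andP[d0 ds].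
have sds : 0 <= Num.sqrt d <= s.
  rewrite sqrtr_ge0/= -(ger0_norm (ltW s0)) -sqrtr_sqr ler_wsqrtr//.
have [HL HS] := H _ sds.
have d4 : 4 * d <= 1.
  have : s ^+ 2 <= (1 / 2) ^+ 2 by rewrite ler_pXn2r ?nnegrE ?(ltW s0).
  by rewrite (_ : (1 / 2) ^+ 2 = 1 / 4) => [|]; [lra|field].
have eta00 := ltW eta0.
have HS0 x y : `|y + 1| <= 2 * d -> `|fixmap d a dd (fun _ _ => 0) x y| <= (1 - l) * (eta * a).
  move=> hy; apply: le_trans HS.
  have sm1' : 0 + 72 * (64 * a) <= 1 / 4 by lra.
  (* Applied with radius 0, in which q = 0 is admissible: with the radius eta a there would be a
     term 4 eta a, too large for the target (1 - l) eta a. *)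
  have := fixmap0_bound d a A 0 dd d0 d4 a0 HA (lexx 0) sm1' x y hy.
  by rewrite add0r.
have ea : eta * a <= a / 4.
  rewrite (_ : a / 4 = 1 / 4 * a) ?ler_pM2r//; last by rewrite mul1r mulrC.
  by apply: le_trans sm1; rewrite lerDl; do 2 (apply: mulr_ge0 => //); exact: ltW.
have ra : eta * a <= a by apply: le_trans ea _; exact: quarter_le (ltW a0).
have qadm := fixpt_admissible d a A eta dd th l d0 d4 a0 A0 HA eta00 sm1 sm2 dd01 th01 Hth l01 HL HS0.
have qfix := fixpt_fixed d a A eta dd th l d0 d4 a0 A0 HA eta00 sm1 sm2 dd01 th01 Hth l01 HL HS0.
set q := fixpt d a dd in qadm qfix.
have [cl /andP[al0 al4] _] := alpha_bounds d a eta d0 a0 eta00 sm1 q qadm.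
set al := a / cq d a q in al0 al4.
pose e0 := Dc d dd * (Mq d a q - Mq d a (fun _ _ => 0)).
pose v x y := vq d a q (x, y).
have Yv x y : Yq d a q x y = d^-1 * conv v x y.
  by rewrite /Yq /conv; congr (_ * _); apply: eq_Rintegral => -[].
have P_in x y : `|y + 1| <= 2 * d -> al * (d^-1 * conv v x y) + e0 + par d y = Pq d a q x y.
  move=> hy; rewrite /Pq -qfix// /fixmap -/al -/e0 Yv; ring.
have mq := adm_meas _ _ _ qadm.
have mv := measurable_vq d a q mq.
have Pb x y : `|y + 1| <= 2 * d -> `|a * cos x + q x y| <= 2 * a.
  move=> hy; apply: (le_trans (ler_normD _ _)).
  have h1 : `|a * cos x| <= a.
    by rewrite normrM (gtr0_norm a0) ler_piMr ?(ltW a0)//; exact: norm_cos_le1.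
  rewrite mulr_natl mulr2n; apply: lerD => //.
  exact: le_trans (adm_bnd _ _ _ qadm x y hy) ra.
have P_out x y : 2 * d < `|y + 1| -> al * (d^-1 * conv v x y) + e0 + par d y <= 0.
  move=> hy.
  pose ye := if 0 <= y + 1 then -1 + 2 * d else -1 - 2 * d.
  have yeE : `|ye + 1| = 2 * d.
    have h2 : 0 <= 2 * d by rewrite mulr_ge0// ltW.
    rewrite /ye; case: ifP => _.
      by rewrite (_ : _ + 1 = 2 * d) ?ger0_norm//; ring.
    by rewrite (_ : _ + 1 = - (2 * d)) ?normrN ?ger0_norm//; ring.
  have cle : conv v x y <= conv v x ye.
    rewrite -subr_ge0 /conv.
    have ik w : int2 (fun z => kap (x - z.1) (w - z.2) * v z.1 z.2).
      have := int2_kv d a A d0 d4 HA q x w mq.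
      by congr (leb2.-integrable TRR _); apply/funext => -[].
    rewrite -I2_sub//; apply: (I2_ae_ge0 _ x y).
      apply: measurable_funB; apply: measurable_funM; try exact: measurable_kap_sub.
        by rewrite (_ : (fun z => _) = vq d a q)//; apply/funext => -[].
      by rewrite (_ : (fun z => _) = vq d a q)//; apply/funext => -[].
    move=> z sz _; rewrite -mulrBl.
    have [hz|hz] := leP `|z.2 + 1| (2 * d); last first.
      by rewrite /v /vq/= sI_out// !mulr0.
    rewrite mulr_ge0//; last exact: vq_ge0.
    rewrite subr_ge0; apply: kap_dec => //.
    exact: edge_dist.
  have pe := par_edge d y d0 (ltW hy).
  have := P_in x ye; rewrite yeE => /(_ (lexx _)) E.
  have := Pb x ye; rewrite yeE => /(_ (lexx _)); rewrite ler_norml => /andP[_ b2].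
  have pe2 : par d ye <= -1 by apply: par_edge => //; rewrite yeE.
  have iv : 0 <= d^-1 by rewrite invr_ge0 (ltW d0).
  exact: edge_neg (ler_wpM2l (ltW al0) (ler_wpM2l iv cle)) E b2 pe sm2.
exists v, al, e0; split.
- by rewrite (_ : (fun z => _) = vq d a q)//; apply/funext => -[].
- by move=> x y; rewrite /v (vq_per d a (eta * a) q qadm).
- by move=> x y hy; rewrite /v /vq/= sI_out// mulr0.
- rewrite al0/=; apply: (le_trans al4); have n8 := nn_lower d d0.
  rewrite ler_pdivrMr; lra.
- move=> x y; have [hy|hy] := leP `|y + 1| (2 * d).
    by rewrite P_in// /v /vq/= sI_in// mulr1.
  by rewrite /v /vq/= sI_out// mulr0 ff_out// P_out.
- move=> x y hy; rewrite P_in// /Pq -addrA; apply: (le_trans (ler_normD _ _)).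
  have := Pb x y hy; have := par_in d y d0 hy; rewrite -ler_norml; lra.
- rewrite /v /vq/=.
  have y1 : `|-1 + 1| <= 2 * d by rewrite addNr normr0 mulr_ge0// ltW.
  rewrite sI_in// !mulr1 /Pq cos0 cospi.
  have p1 : par d (-1) = 1 by rewrite /par addNr expr0n/= mul0r subr0.
  rewrite p1.
  (* The correction is at most a / 4, so a cos x decides: the arguments at x = pi and x = 0 are
     positive and strictly ordered, and the bump is strictly increasing there. *)
  have [g1 g2] := bump_arith _ _ _ _ a0 ea sm2 (adm_bnd _ _ _ qadm 0 (-1) y1) (adm_bnd _ _ _ qadm pi (-1) y1).
  by apply/eqP; rewrite gt_eqF//; exact: ff0_lt g1 g2.
Qed.
End Profile.

(** * Differentiation of the convolution *)

Section Under.
Context {R : realType}.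
Local Notation leb := (@lebesgue_measure R).
Local Notation leb2 := (leb \x leb)%E.
Local Notation TRR := (@TR R).
Local Notation tpi := (2 * pi : R).
Local Notation I0 := (`[0%R, tpi[%classic : set R).
Local Notation I2 := (Rintegral leb2 TRR).
Local Notation int2 f := (leb2.-integrable TRR (EFin \o f)).

Lemma isd_under_int (dY : measure_display) (Y : measurableType dY) (mu : {measure set Y -> \bar R})
    (B : set Y) (f fx : R -> Y -> R) (G : Y -> R) (a r : R) :
  measurable B -> 0 < r ->
  (forall x, `|x - a| < r -> mu.-integrable B (EFin \o f x)) ->
  (forall x y, `|x - a| < r -> B y -> is_derive x 1 (f ^~ y) (fx x y)) ->
  (forall y, 0 <= G y) -> mu.-integrable B (EFin \o G) ->
  (forall x y, `|x - a| < r -> B y -> `|fx x y| <= G y) ->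
  is_derive a 1 (fun x => Rintegral mu B (f x)) (Rintegral mu B (fx a)).
Proof.
move=> mB r0 fi fd G0 Gi fG.
have Ix (x : R) : (`]a - r, a + r[%classic : set R) x -> `|x - a| < r.
  by rewrite /= in_itv/= => /andP[h1 h2]; rewrite ltr_norml; apply/andP; split; lra.
have Ia : (`]a - r, a + r[%classic : set R) a.
  by rewrite /= in_itv/=; apply/andP; split; lra.
have i1 x : (`]a - r, a + r[%classic : set R) x -> mu.-integrable B (EFin \o f x) by move/Ix; exact: fi.
have i2 x y : (`]a - r, a + r[%classic : set R) x -> B y -> derivable (f ^~ y) x 1.
  by move=> /Ix h By; exact: isd_derivable (fd x y h By).
have i3 x y : (`]a - r, a + r[%classic : set R) x -> B y -> `|partial1of2 f x y| <= G y.
  by move=> /Ix h By; rewrite /partial1of2 (isd_derive1 (fd x y h By)); exact: fG.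
have D1 := @derivable_under_integral R _ Y mu f B mB a (a - r) (a + r) Ia i1 i2 G G0 Gi i3.
have D2 := @differentiation_under_integral R _ Y mu f B mB a (a - r) (a + r) Ia i1 i2 G G0 Gi i3.
apply: (isd_eq (derivable_isd D1)); rewrite D2; apply: eq_Rintegral => y; rewrite inE => By.
rewrite /partial1of2 (isd_derive1 (fd a y _ By))//.
by rewrite subrr normr0.
Qed.

Lemma Rint_bound (D : set R) (f g : R -> R) (B : R) : measurable D ->
  measurable_fun setT f -> measurable_fun setT g -> (forall t, D t -> `|f t| <= g t) ->
  (\int[leb]_(t in D) (g t)%:E <= B%:E)%E ->
  leb.-integrable D (EFin \o f) /\ `|Rintegral leb D f| <= B.
Proof.
move=> mD mf mg fg gB.
have fi : leb.-integrable D (EFin \o f).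
  by apply: (@integrable_le R D f g) => //; exact: le_lt_trans gB (ltry _).
split=> //.
rewrite -lee_fin EFin_normr_Rintegral//; apply: le_trans gB.
apply: (@le_trans _ _ (\int[leb]_(t in D) `|(EFin \o f) t|)%E).
  by apply: le_abse_integral => //; apply/measurable_EFinP; exact: measurable_funTS.
apply: ge0_le_integral => //.
- by apply/measurable_EFinP; apply: measurable_funTS; exact: measurableT_comp.
- by apply/measurable_EFinP; exact: measurable_funTS.
Qed.

Lemma measurable_Rparam (dT : measure_display) (T : measurableType dT) (D : set R) (g : T * R -> R) :
  measurable D -> measurable_fun setT g ->
  measurable_fun setT (fun p : T => Rintegral leb D (fun t => g (p, t))).
Proof.
move=> mD mg; apply: (measurableT_comp (f := @fine R)) => //.
rewrite (_ : (fun p => _) = (fun p => (\int[leb]_(t in D) (EFin \o g)^\+ (p, t) -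
   \int[leb]_(t in D) (EFin \o g)^\- (p, t))))%E.
  apply: emeasurable_funB.
    by apply: measurable_param1 => //; apply: measurable_funepos; exact/measurable_EFinP.
  by apply: measurable_param1 => //; apply: measurable_funeneg; exact/measurable_EFinP.
apply/funext => p; rewrite integralE; congr (_ - _)%E; apply: eq_integral => z _.
  by rewrite !funeposE.
by rewrite !funenegE.
Qed.

(** Both orders of integration are used: u inside for derivatives in x, w inside for derivatives in
    y. *)
Lemma fubTR (f : R * R -> R) : measurable_fun setT f -> int2 f ->
  ((\int[leb2]_(z in TRR) (f z)%:E = \int[leb]_w \int[leb]_(u in I0) (f (u, w))%:E) /\
   (\int[leb2]_(z in TRR) (f z)%:E = \int[leb]_(u in I0) \int[leb]_w (f (u, w))%:E))%E.
Proof.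
move=> mf fi.
have fi' : leb2.-integrable setT ((EFin \o f) \_ TRR).
  by move: fi; rewrite -integrable_mkcond//; exact: measurable_TR.
split.
  rewrite integral_mkcond -(integral21_prod_meas1 fi') /fubini_G.
  apply: eq_integral => w _; rewrite [RHS]integral_mkcond; apply: eq_integral => u _.
  rewrite !patchE; suff -> : ((u, w) \in TRR) = (u \in I0) by [].
  by apply/idP/idP; rewrite !inE /TR/= => //; case.
rewrite integral_mkcond -(integral12_prod_meas1 fi') /fubini_F [RHS]integral_mkcond.
apply: eq_integral => u _; rewrite patchE; case: ifPn => hu.
  apply: eq_integral => w _; rewrite patchE; suff -> : ((u, w) \in TRR) by [].
  by move: hu; rewrite !inE /TR/=.
rewrite integral0_eq// => w _; rewrite patchE; case: ifPn => // h.
by move: hu; rewrite notin_setE/=; move: h; rewrite inE /TR/= => -[].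
Qed.

Lemma I2_iter_w (f : R * R -> R) : measurable_fun setT f -> int2 f ->
  (forall w, leb.-integrable I0 (fun u => (f (u, w))%:E)) ->
  I2 f = Rintegral leb setT (fun w => Rintegral leb I0 (fun u => f (u, w))).
Proof.
move=> mf fi fw; rewrite {1}/Rintegral (fubTR f mf fi).1 /Rintegral; congr fine.
by apply: eq_integral => w _; rewrite fineK//; exact: integrable_fin_num (fw w).
Qed.

Lemma I2_iter_u (f : R * R -> R) : measurable_fun setT f -> int2 f ->
  (forall u, leb.-integrable setT (fun w => (f (u, w))%:E)) ->
  I2 f = Rintegral leb I0 (fun u => Rintegral leb setT (fun w => f (u, w))).
Proof.
move=> mf fi fu; rewrite {1}/Rintegral (fubTR f mf fi).2 /Rintegral; congr fine.
by apply: eq_integral => u _; rewrite fineK//; exact: integrable_fin_num (fu u).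
Qed.

Lemma I2_ae_eq (f g : R * R -> R) (x y : R) : measurable_fun setT f -> measurable_fun setT g ->
  (forall z, sin ((x - z.1) / 2) != 0 -> z.2 != y -> f z = g z) -> I2 f = I2 g.
Proof.
move=> mf mg H; rewrite /Rintegral; congr fine; apply: ae_eq_integral.
- exact: measurable_TR.
- by apply/measurable_EFinP; exact: measurable_funTS.
- by apply/measurable_EFinP; exact: measurable_funTS.
- by apply: (@ae_off_lines _ x y) => z s1 s2 _; rewrite H.
Qed.

Lemma kapx_sin0 (u w : R) : sin (u / 2) = 0 -> kapx u w = 0.
Proof.
move=> s0; rewrite /kapx (_ : sin u = 0) ?mul0r ?mulr0//.
have -> : u = u / 2 + u / 2 by field.
by rewrite sinD s0 mul0r mulr0 addr0.
Qed.

Lemma kapx_bound_all (u w p : R) : w != 0 -> 0 <= p <= 1 ->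
  `|kapx u w| <= 4 * (sinp (1 - p) u * `|w| `^ (- p)).
Proof.
move=> w0 p01; have [s0|s0] := eqVneq (sin (u / 2)) 0; last exact: kapx_bound.
by rewrite kapx_sin0// normr0 mulr_ge0// mulr_ge0 ?sinp_ge0 ?powR_ge0.
Qed.

Lemma kapy_bound_all (u w M : R) : sin (u / 2) != 0 -> `|w| <= M ->
  `|kapy u w| <= (2 * Num.sqrt (shh M + 1)) * (sinp 2^-1 u * `|w| `^ (- 2^-1)).
Proof.
move=> s0 wM; have [w0|w0] := eqVneq w 0; last exact: kapy_bound.
rewrite w0 /kapy /sinhR oppr0 subrr !mul0r mulr0 normr0.
by rewrite !mulr_ge0 ?sqrtr_ge0 ?sinp_ge0 ?powR_ge0.
Qed.

(* Contrary to kap_bound, valid also on the lines where sin (u / 2) = 0. *)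
Lemma kap_bound_w (u w L : R) : w != 0 -> `|w| <= L ->
  `|kap u w| <= (4 * (shh L + 1) * L `^ 2^-1 + 8) * `|w| `^ (- 2^-1).
Proof.
move=> w0 wL; have aw : 0 < `|w| by rewrite normr_gt0.
have L0 : 0 <= L by apply: le_trans wL.
have X0 : 0 < cosh w - cos u by apply: kap_arg_gt0; left.
have XE := cosh_sub u w.
have sh := shh_ge w.
have s2 : 0 <= sin (u / 2) ^+ 2 by rewrite sqr_ge0.
have s1 : sin (u / 2) ^+ 2 <= 1.
  by rewrite -[leLHS]real_normK ?num_real// expr_le1// norm_sin_le1.
have shL : shh w <= shh L by apply: shh_le; rewrite (ger0_norm L0).
rewrite /kap normrM normrN (ger0_norm inv4pi_ge0) -lnM ?posrE//.
set X := (cosh w - cos u) * 2.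
have Xp : 0 < X by rewrite mulr_gt0.
have Xu : X <= 4 * (shh L + 1) by rewrite /X XE; lra.
have Xl : (`|w| / 2) ^+ 2 <= X.
  by rewrite /X XE; move: sh; rewrite !expr_div_n; lra.
have w2 : 0 < `|w| / 2 by rewrite divr_gt0.
have up : ln X <= 4 * (shh L + 1) by apply: le_trans Xu; have := ln_le_sub1 X Xp; lra.
have pw0 : 0 < (`|w| / 2) `^ (- 2^-1) by rewrite powR_gt0.
have lo : - (4 * (`|w| / 2) `^ (- 2^-1)) <= ln X.
  apply: (@le_trans _ _ (ln ((`|w| / 2) ^+ 2))); last by rewrite ler_ln ?posrE ?exprn_gt0.
  have := ln_le_sub1 _ pw0; rewrite ln_powR lnXn// -mulr_natr; lra.
have pe : (`|w| / 2) `^ (- 2^-1) <= 2 * `|w| `^ (- 2^-1).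
  rewrite powRM ?invr_ge0// mulrC ler_wpM2r ?powR_ge0//.
  rewrite powRN powR12_sqrt ?invr_ge0// invf_ple ?posrE ?sqrtr_gt0 ?invr_gt0//.
  rewrite -[leLHS]ger0_norm ?invr_ge0// -sqrtr_sqr ler_wsqrtr// expr2; lra.
have one : 1 <= L `^ 2^-1 * `|w| `^ (- 2^-1).
  rewrite powRN -ler_pdivrMr ?invr_gt0 ?powR_gt0// invrK mul1r.
  by rewrite ge0_ler_powR ?nnegrE//.
apply: (@le_trans _ _ `|ln X|).
  by rewrite ler_piMl// inv4pi_le1.
have C0 : 0 <= 4 * (shh L + 1) by rewrite mulr_ge0// addr_ge0// shh_ge0.
have one' : 4 * (shh L + 1) <= 4 * (shh L + 1) * (L `^ 2^-1 * `|w| `^ (- 2^-1)) by rewrite ler_peMr.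
have wp : 0 <= `|w| `^ (- 2^-1) by rewrite powR_ge0.
rewrite mulrDl -mulrA ler_norml; apply/andP; split; lra.
Qed.

Lemma measurable_kap_den : measurable_fun setT (fun z : R * R => (cosh z.2 - cos z.1)^-1).
Proof.
rewrite (_ : (fun z => _) = (fun z : R * R => (cosh z.2 - cos z.1) `^ (-1))); last first.
  apply/funext => z; rewrite powR_inv1// cosh_sub mulr_ge0// addr_ge0 ?sqr_ge0//; exact: shh_ge0.
apply: (measurableT_comp (f := fun t : R => t `^ (-1))) => //; apply: measurable_funB.
  by apply: measurable_snd1; exact: measurable_cosh.
by apply: measurable_fst1; exact: measurable_cosR.
Qed.

Lemma measurable_kapx : measurable_fun setT (fun z : R * R => kapx z.1 z.2).
Proof.
apply: measurable_funM => //; apply: measurable_funM; first by apply: measurable_fst1; exact: measurable_sinR.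
exact: measurable_kap_den.
Qed.

Lemma measurable_kapy : measurable_fun setT (fun z : R * R => kapy z.1 z.2).
Proof.
apply: measurable_funM => //; apply: measurable_funM.
  apply: measurable_snd1; apply: measurable_funM => //; apply: measurable_funB => //.
  by apply: (measurableT_comp (f := @expR R)).
exact: measurable_kap_den.
Qed.

Lemma strip_pow (d y L p : R) : 0 < d -> 0 < p < 1 -> 0 < L ->
  (forall w, `|w + 1| <= 2 * d -> `|y - w| <= L) ->
  (\int[leb]_w (`|y - w| `^ (- p) * sI d w)%:E <= (2 * (L `^ (1 - p) / (1 - p)))%:E)%E.
Proof.
move=> d0 p01 L0 H.
have mp : measurable_fun setT (fun t : R => `|t| `^ (- p)).
  by apply: (measurableT_comp (f := fun t : R => t `^ (- p))) => //; exact: measurableT_comp.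
have m1 : measurable_fun setT (fun t : R => `|t| `^ (- p) * \1_(`[(- L)%R, L]) t).
  by apply: measurable_funM => //; apply: measurable_indic.
apply: le_trans (integral_powRN_sym p L p01 L0).
rewrite -[leRHS](@ge0_integral_flip _ y)/=; last 2 first.
- exact/measurable_EFinP.
- by move=> t; rewrite lee_fin mulr_ge0 ?powR_ge0// indicE ler0n.
apply: ge0_le_integral => //.
- by move=> t _; rewrite lee_fin mulr_ge0 ?powR_ge0 ?sI_ge0.
- apply/measurable_EFinP; apply: measurable_funM; last exact: measurable_sI.
  by apply: (measurableT_comp mp); exact: measurable_funB.
- apply/measurable_EFinP; apply: (measurableT_comp m1); exact: measurable_funB.
- move=> t _; rewrite lee_fin ler_wpM2l ?powR_ge0//.
  have [h|h] := leP `|t + 1| (2 * d); last by rewrite sI_out// indicE ler0n.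
  by rewrite sI_in// indicE mem_set//= in_itv/= -ler_norml H.
Qed.
End Under.

Section ConvDiff.
Context {R : realType}.
Local Notation leb := (@lebesgue_measure R).
Local Notation leb2 := (leb \x leb)%E.
Local Notation TRR := (@TR R).
Local Notation tpi := (2 * pi : R).
Local Notation I0 := (`[0%R, tpi[%classic : set R).
Local Notation I2 := (Rintegral leb2 TRR).
Local Notation int2 f := (leb2.-integrable TRR (EFin \o f)).

Lemma int_scl (D : set R) (f : R -> R) (A c : R) : measurable D ->
  measurable_fun setT f -> (forall t, 0 <= f t) -> 0 <= c ->
  (\int[leb]_(t in D) (f t)%:E <= A%:E)%E ->
  (\int[leb]_(t in D) (c * f t)%:E <= (c * A)%:E)%E.
Proof.
move=> mD mf f0 c0 h; under eq_integral do rewrite EFinM.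
have me : measurable_fun D (fun t => (f t)%:E) by apply/measurable_EFinP; exact: measurable_funTS.
have fe t : D t -> (0 <= (f t)%:E)%E by rewrite lee_fin.
rewrite ge0_integralZl// EFinM; apply: lee_wpmul2l => //; rewrite lee_fin//.
Qed.

Lemma int_I0_cst (c : R) : (\int[leb]_(t in I0) c%:E = (c * tpi)%:E)%E.
Proof. by rewrite (integral_cst leb (measurable_itv _) c%:E)/= leb_I0. Qed.

Lemma int_sinp_flip (p A x : R) : (\int[leb]_(t in I0) (sinp p t)%:E <= A%:E)%E ->
  (\int[leb]_(t in I0) (sinp p (x - t))%:E <= A%:E)%E.
Proof.
move=> h; rewrite (@ge0_integral_period_flip _ tpi x (EFin \o sinp p))//.
- exact: tpi_gt0.
- by apply/measurable_EFinP; exact: measurable_sinp.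
- by move=> t /=; rewrite lee_fin sinp_ge0.
- by move=> t /=; rewrite sinp_period.
Qed.

Variable d : R.
Hypothesis d0 : 0 < d.
Variables (v : R -> R -> R) (K : R).
Hypothesis mv : measurable_fun setT (fun z : R * R => v z.1 z.2).
Hypothesis K0 : 0 <= K.
Hypothesis vK : forall x y, `|v x y| <= K * sI d y.

Let v_out x y : 2 * d < `|y + 1| -> v x y = 0.
Proof. by move=> h; apply/eqP; rewrite -normr_le0; apply: le_trans (vK x y) _; rewrite sI_out// mulr0. Qed.

Lemma conv_bound (x y L A : R) : (\int[leb]_(t in I0) (sinp 2^-1 t)%:E <= A%:E)%E ->
  (forall w, `|w + 1| <= 2 * d -> `|y - w| <= L) ->
  int2 (fun z => kap (x - z.1) (y - z.2) * v z.1 z.2) /\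
  `|conv v x y| <= A * ((1 + Num.sqrt (Num.sqrt (shh L))) * K * (4 * d)).
Proof.
move=> HA HL; set C := 1 + _; have C0 : 0 <= C by rewrite addr_ge0// sqrtr_ge0.
apply: (dom2 _ x y (sinp 2^-1) (fun w => C * K * sI d w)) => //.
- by apply: measurable_funM => //; exact: measurable_kap_sub.
- exact: measurable_sinp.
- by apply: measurable_funM => //; exact: measurable_sI.
- by move=> t; exact: sinp_ge0.
- by move=> t; rewrite !mulr_ge0// sI_ge0.
- by move=> t; rewrite sinp_period.
- apply: (int_scl setT (sI d) (4 * d) _ measurableT (measurable_sI d) (sI_ge0 d) (mulr_ge0 C0 K0)).
  by rewrite integral_sI.
- move=> z s0 _; rewrite normrM.
  have [h|h] := leP `|z.2 + 1| (2 * d); last by rewrite v_out// normr0 sI_out// !mulr0.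
  have -> : sinp 2^-1 (x - z.1) * (C * K * sI d z.2) = (C * sinp 2^-1 (x - z.1)) * (K * sI d z.2) by ring.
  apply: ler_pM => //; exact: (kap_bound _ _ _ s0 (HL _ h)).
Qed.

Let mpow p y : measurable_fun setT (fun w : R => `|y - w| `^ (- p) * sI d w).
Proof.
apply: measurable_funM; last exact: measurable_sI.
apply: (measurableT_comp (f := fun t : R => t `^ (- p))) => //; apply: measurableT_comp => //.
exact: measurable_funB.
Qed.
Let pow0 p y w : 0 <= `|y - w| `^ (- p) * sI d w.
Proof. by rewrite mulr_ge0 ?powR_ge0 ?sI_ge0. Qed.

(* No domination holds jointly in (u, w): the derivative is first taken under the u-integral for each
   w <> y, where the kernel is smooth, and then under the w-integral, where |w|^(-p) is integrable. *)
Lemma convx_isd (x y L p A : R) : 0 < p < 1 -> 0 < L ->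
  (\int[leb]_(t in I0) (sinp (1 - p) t)%:E <= A%:E)%E ->
  (forall w, `|w + 1| <= 2 * d -> `|y - w| <= L) ->
  exists2 D : R, is_derive x 1 (fun t => conv v t y) D &
    `|D| <= 4 * K * A * (2 * (L `^ (1 - p) / (1 - p))).
Proof.
move=> p01 L0 HA HL; have /andP[p0 p1] := p01.
have A0 : 0 <= A.
  by rewrite -lee_fin; apply: le_trans HA; apply: integral_ge0 => t _; rewrite lee_fin sinp_ge0.
(* Deleting the null line w = y leaves the double integral unchanged and makes every slice in u
   smooth, the slice w = y being identically 0. *)
pose nb : R -> R := \1_(~` [set y]).
have mnb : measurable_fun setT nb by apply: measurable_indic; exact: measurableC.
have nby : nb y = 0 by rewrite /nb indicE memNset//=; exact.
have nb1 w : w != y -> nb w = 1 by move=> /eqP h; rewrite /nb indicE mem_set.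
pose v' (z : R * R) := v z.1 z.2 * nb z.2.
have mv' : measurable_fun setT v' by apply: measurable_funM => //; exact: measurable_snd1.
have vK' u w : `|v' (u, w)| <= K * sI d w.
  rewrite /v'/=; have [->|h] := eqVneq w y; last by rewrite nb1// mulr1.
  by rewrite nby mulr0 normr0 mulr_ge0// sI_ge0.
pose k t (z : R * R) := kap (t - z.1) (y - z.2) * v' z.
pose kx t (z : R * R) := kapx (t - z.1) (y - z.2) * v' z.
have mk t : measurable_fun setT (k t) by apply: measurable_funM => //; exact: measurable_kap_sub.
have mkx t : measurable_fun setT (kx t).
  apply: measurable_funM => //; apply: (measurableT_comp (f := fun z : R * R => kapx z.1 z.2) (g := fun z : R * R => (t - z.1, y - z.2))).
    exact: measurable_kapx.
  apply/measurable_fun_pairP; split => /=.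
    by apply: (measurable_fst1 (fun s => t - s)); exact: measurable_funB.
  by apply: (measurable_snd1 (fun s => y - s)); exact: measurable_funB.
have mku t w : measurable_fun setT (fun u => k t (u, w)) by apply: measurableT_comp.
have mkxu t w : measurable_fun setT (fun u => kx t (u, w)) by apply: measurableT_comp.
have E0 t : conv v t y = I2 (k t).
  apply: (I2_ae_eq _ _ t y) => //.
    by apply: measurable_funM => //; exact: measurable_kap_sub.
  by move=> z _ h; rewrite /k /v' nb1// mulr1.
set C := 4 * (shh L + 1) * L `^ 2^-1 + 8.
have C0 : 0 <= C by rewrite addr_ge0// !mulr_ge0 ?addr_ge0 ?shh_ge0 ?powR_ge0.
have aux t u w (kk : R -> R -> R) (c : R) q : 0 <= c -> (forall s, s != 0 -> `|s| <= L -> `|kk (t - u) s| <= c * `|s| `^ (- q)) ->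
    `|kk (t - u) (y - w) * v' (u, w)| <= c * K * (`|y - w| `^ (- q) * sI d w).
  move=> c0 H; have [->|wy] := eqVneq w y.
    by rewrite /v'/= nby !mulr0 normr0 mulr_ge0 ?mulr_ge0.
  have [h|h] := leP `|w + 1| (2 * d); last by rewrite /v'/= v_out// mul0r mulr0 normr0 sI_out// !mulr0.
  have -> : c * K * (`|y - w| `^ (- q) * sI d w) = (c * `|y - w| `^ (- q)) * (K * sI d w) by ring.
  rewrite normrM; apply: ler_pM => //; apply: H; last exact: HL.
  by rewrite subr_eq0 eq_sym.
have bk t u w : `|k t (u, w)| <= C * K * (`|y - w| `^ (- 2^-1) * sI d w).
  by apply: (aux t u w (@kap R)) => // s s0 sL; exact: kap_bound_w.
have bkx t u w : `|kx t (u, w)| <= 4 * sinp (1 - p) (t - u) * K * (`|y - w| `^ (- p) * sI d w).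
  apply: (aux t u w (@kapx R)); first by rewrite mulr_ge0// sinp_ge0.
  by move=> s s0 sL; rewrite -mulrA; apply: kapx_bound_all => //; rewrite !ltW.
(* The exponent 1 gives a bound free of u, a legitimate dominating constant for the inner derivative
   at fixed w; it is not integrable in w, so the outer derivative uses [bkx] instead. *)
have bkx1 t u w : `|kx t (u, w)| <= 4 * K * (`|y - w| `^ (- 1) * sI d w).
  apply: (aux t u w (@kapx R)) => // s s0 sL.
  have := kapx_bound_all (t - u) s 1 s0; rewrite subrr /sinp oppr0 powRr0 mul1r; apply.
  by rewrite ler01 lexx.
have sp2 := strip_pow d y L 2^-1 d0 half01 L0 HL.
have spp := strip_pow d y L p d0 p01 L0 HL.
have ik t : int2 (k t).
  have [] // := dom2 (k t) 0 y (cst 1) (fun w => C * K * (`|y - w| `^ (- 2^-1) * sI d w)) tpi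
    (C * K * (2 * (L `^ (1 - 2^-1) / (1 - 2^-1)))).
  - exact: measurable_funM.
  - by move=> w; rewrite !mulr_ge0 ?powR_ge0 ?sI_ge0.
  - by rewrite /= int_I0_cst mul1r.
  - by apply: int_scl => //; rewrite mulr_ge0.
  - by move=> [u w] _ _; rewrite mul1r; exact: bk.
have iku t w : leb.-integrable I0 (fun u => (k t (u, w))%:E).
  apply: (integrable_I0_bounded _ (C * K * (`|y - w| `^ (- 2^-1) * sI d w))) => //.
have st1 (t w : R) : is_derive t 1 (fun s => Rintegral leb I0 (fun u => k s (u, w)))
     (Rintegral leb I0 (fun u => kx t (u, w))).
  apply: (isd_under_int _ _ leb I0 (fun s u => k s (u, w)) (fun s u => kx s (u, w))
     (fun=> 4 * K * (`|y - w| `^ (- 1) * sI d w)) t 1) => //.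
  - by move=> s _; exact: iku.
  - move=> s u _ _; have [->|wy] := eqVneq w y.
      rewrite /k /kx /v'/= nby !mulr0.
      have -> : (fun s0 : R => kap (s0 - u) (y - y) * 0) = cst 0 by apply/funext => ?; rewrite mulr0.
      exact: isd_cst.
    rewrite /k /kx /=.
    have yw : y - w != 0 by rewrite subr_eq0 eq_sym.
    have h1 : is_derive s 1 (fun s : R => s - u) 1 by apply: (isd_eq (isdB (isd_id s) (isd_cst u s))); rewrite subr0.
    apply: isdZr; apply: (isd_eq (isd_comp (f := fun a => kap a (y - w)) (g := fun s => s - u) (isd_kap_u (s - u) _ yw) h1)).
    by rewrite mulr1.
  - by move=> u; rewrite mulr_ge0 ?mulr_ge0.
  - apply: (integrable_I0_bounded _ (4 * K * (`|y - w| `^ (- 1) * sI d w))) => // u.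
    by rewrite ger0_norm// mulr_ge0 ?mulr_ge0.
have bD (t w : R) : `|Rintegral leb I0 (fun u => kx t (u, w))| <= 4 * K * A * (`|y - w| `^ (- p) * sI d w).
  have ms : measurable_fun setT (fun u : R => sinp (1 - p) (t - u)).
    by apply: (measurableT_comp (measurable_sinp _)); exact: measurable_funB.
  have c0 : 0 <= 4 * K * (`|y - w| `^ (- p) * sI d w) by rewrite !mulr_ge0 ?powR_ge0 ?sI_ge0.
  have h1 u : I0 u -> `|kx t (u, w)| <= 4 * K * (`|y - w| `^ (- p) * sI d w) * sinp (1 - p) (t - u).
    by move=> _; apply: (le_trans (bkx t u w)); rewrite le_eqVlt; apply/orP; left; apply/eqP; ring.
  have h2 := int_scl I0 _ _ _ (measurable_itv _) ms (fun u => sinp_ge0 _ _) c0 (int_sinp_flip _ _ t HA).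
  have [_] := Rint_bound I0 _ _ _ (measurable_itv _) (mkxu t w) (measurable_funM (measurable_cst _) ms) h1 h2.
  by rewrite mulrAC.
have mRk (t : R) : measurable_fun setT (fun w => Rintegral leb I0 (fun u => k t (u, w))).
  apply: (measurable_Rparam _ _ I0 (fun q : R * R => k t (q.2, q.1))) => //.
  apply: (measurableT_comp (mk t)); apply/measurable_fun_pairP; split => /=; [exact: measurable_snd|exact: measurable_fst].
have mRkx (t : R) : measurable_fun setT (fun w => Rintegral leb I0 (fun u => kx t (u, w))).
  apply: (measurable_Rparam _ _ I0 (fun q : R * R => kx t (q.2, q.1))) => //.
  apply: (measurableT_comp (mkx t)); apply/measurable_fun_pairP; split => /=; [exact: measurable_snd|exact: measurable_fst].
have g0 : 0 <= 4 * K * A by rewrite !mulr_ge0.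
have mG : measurable_fun setT (fun w : R => 4 * K * A * (`|y - w| `^ (- p) * sI d w)) by exact: measurable_funM.
have GA := int_scl setT _ _ _ measurableT (mpow p y) (pow0 p y) g0 spp.
have G1 w : [set: R] w -> `|4 * K * A * (`|y - w| `^ (- p) * sI d w)| <= 4 * K * A * (`|y - w| `^ (- p) * sI d w).
  by move=> _; rewrite ger0_norm// mulr_ge0.
have [iG _] := Rint_bound setT _ _ _ measurableT mG mG G1 GA.
have [_ bb] := Rint_bound setT _ _ _ measurableT (mRkx x) mG (fun w _ => bD x w) GA.
exists (Rintegral leb setT (fun w => Rintegral leb I0 (fun u => kx x (u, w)))); last exact: bb.
rewrite (_ : (fun t => conv v t y) = (fun t => Rintegral leb setT (fun w => Rintegral leb I0 (fun u => k t (u, w))))); last first.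
  by apply/funext => t; rewrite E0 I2_iter_w.
apply: (isd_under_int _ _ leb setT (fun t w => Rintegral leb I0 (fun u => k t (u, w)))
  (fun t w => Rintegral leb I0 (fun u => kx t (u, w))) _ x 1 _ _ _ _ _ iG) => //.
- move=> t _.
  have c0 : 0 <= tpi * (C * K) by rewrite !mulr_ge0// pi_ge0.
  have h1 w : [set: R] w -> `|Rintegral leb I0 (fun u => k t (u, w))| <= tpi * (C * K) * (`|y - w| `^ (- 2^-1) * sI d w).
    move=> _.
    have h3 : (\int[leb]_(u in I0) (C * K * (`|y - w| `^ (- 2^-1) * sI d w))%:E <= (C * K * (`|y - w| `^ (- 2^-1) * sI d w) * tpi)%:E)%E.
      by rewrite int_I0_cst.
    have [_] := Rint_bound I0 _ _ _ (measurable_itv _) (mku t w) (measurable_cst _) (fun u _ => bk t u w) h3.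
    by move=> /le_trans; apply; rewrite le_eqVlt; apply/orP; left; apply/eqP; move: (pi : R) => P; ring.
  by have [] := Rint_bound setT _ _ _ measurableT (mRk t) (measurable_funM (measurable_cst _) (mpow _ _)) h1
    (int_scl setT _ _ _ measurableT (mpow _ y) (pow0 _ y) c0 sp2).
- by move=> w; rewrite mulr_ge0.
Qed.
End ConvDiff.

Section ConvDiffY.
Context {R : realType}.
Local Notation leb := (@lebesgue_measure R).
Local Notation leb2 := (leb \x leb)%E.
Local Notation TRR := (@TR R).
Local Notation tpi := (2 * pi : R).
Local Notation I0 := (`[0%R, tpi[%classic : set R).
Local Notation I2 := (Rintegral leb2 TRR).
Local Notation int2 f := (leb2.-integrable TRR (EFin \o f)).

(** Free of w for fixed u: this dominates the inner derivative, while [kapy_bound] serves the outer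
    one. *)
Lemma kapy_bound_c (u w M : R) : sin (u / 2) != 0 -> `|w| <= M ->
  `|kapy u w| <= cosh M / (2 * sin (u / 2) ^+ 2).
Proof.
move=> s0 wM; have M0 : 0 <= M by apply: le_trans wM.
have s2 : 0 < sin (u / 2) ^+ 2 by rewrite exprn_even_gt0.
have X0 : 0 < cosh w - cos u by apply: kap_arg_gt0; right.
rewrite /kapy normrM normrN (ger0_norm inv4pi_ge0).
apply: (@le_trans _ _ `|sinhR w / (cosh w - cos u)|).
  by rewrite ler_piMl// inv4pi_le1.
rewrite normrM normfV (gtr0_norm X0); apply: ler_pM => //; first by rewrite invr_ge0 ltW.
  apply: (@le_trans _ _ (cosh w)); last by apply: cosh_le; rewrite (ger0_norm M0).
  rewrite /sinhR /cosh ler_norml; have := expR_gt0 w; have := expR_gt0 (- w) => h1 h2.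
  by apply/andP; split; lra.
rewrite lef_pV2 ?posrE//; last by rewrite mulr_gt0.
by rewrite cosh_sub ler_pM2l// lerDr shh_ge0.
Qed.

Variable d : R.
Hypothesis d0 : 0 < d.
Variables (v : R -> R -> R) (K : R).
Hypothesis mv : measurable_fun setT (fun z : R * R => v z.1 z.2).
Hypothesis K0 : 0 <= K.
Hypothesis vK : forall x y, `|v x y| <= K * sI d y.

Let v_out x y : 2 * d < `|y + 1| -> v x y = 0.
Proof. by move=> h; apply/eqP; rewrite -normr_le0; apply: le_trans (vK x y) _; rewrite sI_out// mulr0. Qed.

Let mpow p y : measurable_fun setT (fun w : R => `|y - w| `^ (- p) * sI d w).
Proof.
apply: measurable_funM; last exact: measurable_sI.
apply: (measurableT_comp (f := fun t : R => t `^ (- p))) => //; apply: measurableT_comp => //.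
exact: measurable_funB.
Qed.
Let pow0 p y w : 0 <= `|y - w| `^ (- p) * sI d w.
Proof. by rewrite mulr_ge0 ?powR_ge0 ?sI_ge0. Qed.

(* As for convx_isd with the roles of u and w exchanged. *)
Lemma convy_isd (x y L A : R) : 0 < L ->
  (\int[leb]_(t in I0) (sinp 2^-1 t)%:E <= A%:E)%E ->
  (forall w, `|w + 1| <= 2 * d -> `|y - w| <= L) ->
  exists2 D : R, is_derive y 1 (conv v x) D &
    `|D| <= (2 * Num.sqrt (shh L + 1)) * K * (2 * (L `^ (1 - 2^-1) / (1 - 2^-1))) * A.
Proof.
move=> L0 HA HL.
have L10 : 0 < L + 1 by rewrite addr_gt0.
have A0 : 0 <= A.
  by rewrite -lee_fin; apply: le_trans HA; apply: integral_ge0 => t _; rewrite lee_fin sinp_ge0.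
pose ns : R -> R := \1_(~` [set u : R | sin ((x - u) / 2) = 0]).
have mns : measurable_fun setT ns by apply: measurable_indic; apply: measurableC; exact: measurable_sin_half.
have ns0 u : sin ((x - u) / 2) = 0 -> ns u = 0 by move=> h; rewrite /ns indicE memNset//=; exact.
have ns1 u : sin ((x - u) / 2) != 0 -> ns u = 1 by move=> /eqP h; rewrite /ns indicE mem_set.
pose v' (z : R * R) := v z.1 z.2 * ns z.1.
have mv' : measurable_fun setT v' by apply: measurable_funM => //; exact: measurable_fst1.
have vK' u w : `|v' (u, w)| <= K * sI d w.
  rewrite /v'/=; have [h|h] := eqVneq (sin ((x - u) / 2)) 0; last by rewrite ns1// mulr1.
  by rewrite ns0// mulr0 normr0 mulr_ge0// sI_ge0.
pose k t (z : R * R) := kap (x - z.1) (t - z.2) * v' z.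
pose ky t (z : R * R) := kapy (x - z.1) (t - z.2) * v' z.
have mk t : measurable_fun setT (k t) by apply: measurable_funM => //; exact: measurable_kap_sub.
have mky t : measurable_fun setT (ky t).
  apply: measurable_funM => //; apply: (measurableT_comp (f := fun z : R * R => kapy z.1 z.2) (g := fun z : R * R => (x - z.1, t - z.2))).
    exact: measurable_kapy.
  apply/measurable_fun_pairP; split => /=.
    by apply: (measurable_fst1 (fun s => x - s)); exact: measurable_funB.
  by apply: (measurable_snd1 (fun s => t - s)); exact: measurable_funB.
have mkw t u : measurable_fun setT (fun w => k t (u, w)) by apply: measurableT_comp.
have mkyw t u : measurable_fun setT (fun w => ky t (u, w)) by apply: measurableT_comp.
have E0 t : conv v x t = I2 (k t).
  apply: (I2_ae_eq _ _ x t) => //.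
    by apply: measurable_funM => //; exact: measurable_kap_sub.
  by move=> z h _; rewrite /k /v' ns1// mulr1.
have HL1 t w : `|t - y| < 1 -> `|w + 1| <= 2 * d -> `|t - w| <= L + 1.
  move=> ht hw; have -> : t - w = (y - w) + (t - y) by ring.
  by apply: (le_trans (ler_normD _ _)); apply: lerD; [exact: HL|exact: ltW].
set C := 1 + Num.sqrt (Num.sqrt (shh (L + 1))).
have C0 : 0 <= C by rewrite addr_ge0// sqrtr_ge0.
have aux t u w (kk : R -> R -> R) (c M : R) : 0 <= c -> (forall w, `|w + 1| <= 2 * d -> `|t - w| <= M) ->
    (forall s, sin ((x - u) / 2) != 0 -> `|s| <= M -> `|kk (x - u) s| <= c) ->
    `|kk (x - u) (t - w) * v' (u, w)| <= c * (K * sI d w).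
  move=> c0 ht H; have [su|su] := eqVneq (sin ((x - u) / 2)) 0.
    by rewrite /v'/= ns0// !mulr0 normr0 !mulr_ge0// sI_ge0.
  have [h|h] := leP `|w + 1| (2 * d); last by rewrite /v'/= v_out// mul0r mulr0 normr0 sI_out// !mulr0.
  rewrite normrM; apply: ler_pM => //; apply: H => //; exact: ht.
have bk t u w : `|t - y| < 1 -> `|k t (u, w)| <= C * sinp 2^-1 (x - u) * (K * sI d w).
  move=> ht; apply: (aux t u w (@kap R) _ (L + 1)) => //; first by rewrite mulr_ge0// sinp_ge0.
    by move=> w'; exact: HL1.
  by move=> s su sL; exact: kap_bound.
have bky t u w M : (forall w, `|w + 1| <= 2 * d -> `|t - w| <= M) ->
   `|ky t (u, w)| <= (2 * Num.sqrt (shh M + 1)) * K * sinp 2^-1 (x - u) * (`|t - w| `^ (- 2^-1) * sI d w).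
  move=> hM; have [su|su] := eqVneq (sin ((x - u) / 2)) 0.
    rewrite /ky /v'/= ns0// !mulr0 normr0.
    by apply: mulr_ge0; [rewrite mulr_ge0 ?sinp_ge0// mulr_ge0// mulr_ge0// sqrtr_ge0|exact: pow0].
  have [h|h] := leP `|w + 1| (2 * d); last by rewrite /ky /v'/= v_out// mul0r mulr0 normr0 sI_out// !mulr0.
  rewrite /ky normrM.
  have -> : 2 * Num.sqrt (shh M + 1) * K * sinp 2^-1 (x - u) * (`|t - w| `^ (- 2^-1) * sI d w) =
    (2 * Num.sqrt (shh M + 1) * (sinp 2^-1 (x - u) * `|t - w| `^ (- 2^-1))) * (K * sI d w) by ring.
  apply: ler_pM => //; apply: kapy_bound_all => //; exact: hM.
have ch0 (s : R) : 0 <= cosh (L + 1) / (2 * sin s ^+ 2).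
  by apply: divr_ge0; [rewrite /cosh divr_ge0// addr_ge0 ?expR_ge0|rewrite mulr_ge0// sqr_ge0].
have bky1 t u w : `|t - y| < 1 -> `|ky t (u, w)| <= cosh (L + 1) / (2 * sin ((x - u) / 2) ^+ 2) * (K * sI d w).
  move=> ht; apply: (aux t u w (@kapy R) _ (L + 1)) => //.
  - by move=> w'; exact: HL1.
  - by move=> s su sL; exact: kapy_bound_c.
have isI (c : R) : leb.-integrable setT (EFin \o (fun w : R => c * (K * sI d w))).
  apply: (integrable_mulR measurableT); apply: (integrable_mulR measurableT); exact: integrable_sI.
have KsI0 w : 0 <= K * sI d w by rewrite mulr_ge0// sI_ge0.
have mKsI : measurable_fun setT (fun w : R => K * sI d w) by apply: measurable_funM => //; exact: measurable_sI.
have iKsI : (\int[leb]_w (K * sI d w)%:E <= (K * (4 * d))%:E)%E.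
  by apply: (int_scl setT (sI d) (4 * d) K measurableT (measurable_sI d) (sI_ge0 d) K0); rewrite integral_sI.
have ik t : `|t - y| < 1 -> int2 (k t).
  move=> ht.
  have [] // := dom2 (k t) x y (sinp 2^-1) (fun w => C * (K * sI d w)) A (C * (K * (4 * d))).
  - exact: measurable_sinp.
  - exact: measurable_funM.
  - by move=> w; exact: sinp_ge0.
  - by move=> w; rewrite mulr_ge0.
  - by move=> w; rewrite sinp_period.
  - exact: int_scl.
  - by move=> [u w] _ _; apply: (le_trans (bk t u w ht)); rewrite le_eqVlt; apply/orP; left; apply/eqP => /=; ring.
have ikw t u : `|t - y| < 1 -> leb.-integrable setT (EFin \o (fun w => k t (u, w))).
  move=> ht; have c0 : 0 <= C * sinp 2^-1 (x - u) by rewrite mulr_ge0// sinp_ge0.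
  by have [] := Rint_bound setT _ _ _ measurableT (mkw t u) (measurable_funM (measurable_cst _) mKsI) (fun w _ => bk t u w ht)
    (int_scl setT _ _ _ measurableT mKsI KsI0 c0 iKsI).
have near1 (t : R) : `|t - y| < 1 -> exists2 r : R, 0 < r & forall s, `|s - t| < r -> `|s - y| < 1.
  move=> ht; exists (1 - `|t - y|); first by rewrite subr_gt0.
  move=> s hs; have -> : s - y = (s - t) + (t - y) by ring.
  by apply: (le_lt_trans (ler_normD _ _)); lra.
have st1 (t u : R) : `|t - y| < 1 -> is_derive t 1 (fun s => Rintegral leb setT (fun w => k s (u, w)))
     (Rintegral leb setT (fun w => ky t (u, w))).
  move=> ht; have [r r0 hr] := near1 t ht.
  apply: (isd_under_int _ _ leb setT (fun s w => k s (u, w)) (fun s w => ky s (u, w))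
     (fun w => cosh (L + 1) / (2 * sin ((x - u) / 2) ^+ 2) * (K * sI d w)) t r) => //.
  - by move=> s hs; apply: ikw; exact: hr.
  - move=> s w _ _; have [su|su] := eqVneq (sin ((x - u) / 2)) 0.
      rewrite /k /ky /v'/= ns0// !mulr0.
      have -> : (fun s0 : R => kap (x - u) (s0 - w) * 0) = cst 0 by apply/funext => ?; rewrite mulr0.
      exact: isd_cst.
    rewrite /k /ky /=.
    have h1 : is_derive s 1 (fun s : R => s - w) 1 by apply: (isd_eq (isdB (isd_id s) (isd_cst w s))); rewrite subr0.
    apply: isdZr; apply: (isd_eq (isd_comp (f := kap (x - u)) (g := fun s => s - w) (isd_kap_w _ _ su) h1)).
    by rewrite mulr1.
  - by move=> w; rewrite mulr_ge0.
  - by move=> s w hs _; apply: bky1; exact: hr.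
have bD (t u M : R) : 0 < M -> (forall w, `|w + 1| <= 2 * d -> `|t - w| <= M) ->
   `|Rintegral leb setT (fun w => ky t (u, w))| <=
    (2 * Num.sqrt (shh M + 1)) * K * (2 * (M `^ (1 - 2^-1) / (1 - 2^-1))) * sinp 2^-1 (x - u).
  move=> M0 hM.
  have c0 : 0 <= (2 * Num.sqrt (shh M + 1)) * K * sinp 2^-1 (x - u).
    by rewrite mulr_ge0 ?sinp_ge0// mulr_ge0// mulr_ge0// sqrtr_ge0.
  have [_] := Rint_bound setT _ _ _ measurableT (mkyw t u) (measurable_funM (measurable_cst _) (mpow 2^-1 t)) (fun w _ => bky t u w M hM)
    (int_scl setT _ _ _ measurableT (mpow 2^-1 t) (pow0 2^-1 t) c0 (strip_pow d t M 2^-1 d0 half01 M0 hM)).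
  by rewrite mulrAC.
have mRk (t : R) : measurable_fun setT (fun u => Rintegral leb setT (fun w => k t (u, w))).
  exact: (measurable_Rparam _ _ setT (k t)).
have mRky (t : R) : measurable_fun setT (fun u => Rintegral leb setT (fun w => ky t (u, w))).
  exact: (measurable_Rparam _ _ setT (ky t)).
have ms : measurable_fun setT (fun u : R => sinp 2^-1 (x - u)).
  by apply: (measurableT_comp (measurable_sinp _)); exact: measurable_funB.
have sf := int_sinp_flip 2^-1 A x HA.
have cM0 M : 0 < M -> 0 <= (2 * Num.sqrt (shh M + 1)) * K * (2 * (M `^ (1 - 2^-1) / (1 - 2^-1))).
  move=> M0; rewrite mulr_ge0//; first by rewrite mulr_ge0// mulr_ge0// sqrtr_ge0.
  by rewrite mulr_ge0// divr_ge0 ?powR_ge0//; lra.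
have mG M : measurable_fun setT (fun u : R => (2 * Num.sqrt (shh M + 1)) * K * (2 * (M `^ (1 - 2^-1) / (1 - 2^-1))) * sinp 2^-1 (x - u)).
  exact: measurable_funM.
have GA M M0 := int_scl I0 _ _ _ (measurable_itv _) ms (fun u => sinp_ge0 _ _) (cM0 M M0) sf.
have G0 M (M0 : 0 < M) u : 0 <= (2 * Num.sqrt (shh M + 1)) * K * (2 * (M `^ (1 - 2^-1) / (1 - 2^-1))) * sinp 2^-1 (x - u).
  by rewrite mulr_ge0 ?sinp_ge0// cM0.
have G1 u : I0 u -> `|(2 * Num.sqrt (shh (L + 1) + 1)) * K * (2 * ((L + 1) `^ (1 - 2^-1) / (1 - 2^-1))) * sinp 2^-1 (x - u)|
  <= (2 * Num.sqrt (shh (L + 1) + 1)) * K * (2 * ((L + 1) `^ (1 - 2^-1) / (1 - 2^-1))) * sinp 2^-1 (x - u).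
  by move=> _; rewrite ger0_norm// G0.
have [iG _] := Rint_bound I0 _ _ _ (measurable_itv _) (mG (L + 1)) (mG (L + 1)) G1 (GA (L + 1) L10).
have [_ bb] := Rint_bound I0 _ _ _ (measurable_itv _) (mRky y) (mG L) (fun u _ => bD y u L L0 HL) (GA L L0).
pose F (t : R) : R := Rintegral leb I0 (fun u => Rintegral leb setT (fun w => k t (u, w))).
have nr : \forall t \near y, F t = conv v x t.
  apply: filterS (near_dist y ltr01) => t ht.
  by rewrite E0 (I2_iter_u _ (mk t) (ik t ht) (fun u => ikw t u ht)).
exists (Rintegral leb I0 (fun u => Rintegral leb setT (fun w => ky y (u, w)))); last exact: bb.
have i1 t : `|t - y| < 1 -> leb.-integrable I0 (EFin \o (fun u => Rintegral leb setT (fun w => k t (u, w)))).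
  move=> ht.
  have c0 : 0 <= C * (K * (4 * d)) by rewrite !mulr_ge0// ltW.
  have h1 u : I0 u -> `|Rintegral leb setT (fun w => k t (u, w))| <= C * (K * (4 * d)) * sinp 2^-1 (x - u).
    move=> _; have c1 : 0 <= C * sinp 2^-1 (x - u) by rewrite mulr_ge0// sinp_ge0.
    have [_] := Rint_bound setT _ _ _ measurableT (mkw t u) (measurable_funM (measurable_cst _) mKsI) (fun w _ => bk t u w ht)
      (int_scl setT _ _ _ measurableT mKsI KsI0 c1 iKsI).
    by rewrite mulrAC.
  by have [] := Rint_bound I0 _ _ _ (measurable_itv _) (mRk t) (measurable_funM (measurable_cst _) ms) h1
    (int_scl I0 _ _ _ (measurable_itv _) ms (fun u => sinp_ge0 _ _) c0 sf).
have st1' (t u : R) : `|t - y| < 1 -> I0 u -> _ := fun h _ => st1 t u h.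
have bD' (t u : R) : `|t - y| < 1 -> I0 u -> _ := fun h _ => bD t u (L + 1) L10 (fun w => HL1 t w h).
have H := isd_under_int _ _ leb I0 (fun t u => Rintegral leb setT (fun w => k t (u, w)))
  (fun t u => Rintegral leb setT (fun w => ky t (u, w))) _ y 1 (measurable_itv _) ltr01 i1 st1' (G0 (L + 1) L10) iG bD'.
exact: (isd_near nr H).
Qed.
End ConvDiffY.

(** * Derivatives that fall on the density *)

Section ConvSmooth.
Context {R : realType}.
Local Notation leb := (@lebesgue_measure R).
Local Notation leb2 := (leb \x leb)%E.
Local Notation TRR := (@TR R).
Local Notation tpi := (2 * pi : R).
Local Notation I0 := (`[0%R, tpi[%classic : set R).
Local Notation I2 := (Rintegral leb2 TRR).
Local Notation int2 f := (leb2.-integrable TRR (EFin \o f)).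

Lemma measurable_shift (v : R -> R -> R) (x y : R) : measurable_fun setT (fun z : R * R => v z.1 z.2) ->
  measurable_fun setT (fun z : R * R => v (x - z.1) (y - z.2)).
Proof.
move=> mv; apply: (measurableT_comp (f := fun z : R * R => v z.1 z.2) (g := fun z : R * R => (x - z.1, y - z.2))) => //.
apply/measurable_fun_pairP; split => /=.
  by apply: (measurable_fst1 (fun s => x - s)); exact: measurable_funB.
by apply: (measurable_snd1 (fun s => y - s)); exact: measurable_funB.
Qed.

(** After this change of variables x and y occur only in the density, so its derivatives pass under
    the integral against the integrable kernel itself. *)
Lemma conv_flip (v : R -> R -> R) (x y : R) : measurable_fun setT (fun z : R * R => v z.1 z.2) ->
  periodic_x v -> conv v x y = I2 (fun z => kap z.1 z.2 * v (x - z.1) (y - z.2)).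
Proof.
move=> mv pv; rewrite /conv -(flip2 x y (fun z => kap z.1 z.2 * v (x - z.1) (y - z.2))).
- by apply: eq_Rintegral => z _ /=; rewrite !subKr.
- by apply: measurable_funM; [exact: measurable_kap|exact: measurable_shift].
- by move=> u w /=; rewrite kap_period -(pv (x - (u + tpi))); congr (_ * v _ _); ring.
Qed.

Lemma int2_kap_bdd (g : R * R -> R) (K M : R) : measurable_fun setT g -> 0 <= K -> 0 <= M ->
  (forall z, `|g z| <= K * \1_(`[(- M)%R, M]) z.2) -> int2 (fun z => kap z.1 z.2 * g z).
Proof.
move=> mg K0 M0 gK; have [A A0 HA] := sinp_bound (R := R) 2^-1 half01.
set C := 1 + Num.sqrt (Num.sqrt (shh M)); have C0 : 0 <= C by rewrite addr_ge0// sqrtr_ge0.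
have mI : measurable_fun setT (\1_(`[(- M)%R, M]) : R -> R) by exact: measurable_indic.
have [] // := dom2 (fun z => kap z.1 z.2 * g z) 0 0 (sinp 2^-1) (fun w => C * K * \1_(`[(- M)%R, M]) w) A (C * K * (2 * M)).
- by apply: measurable_funM => //; exact: measurable_kap.
- exact: measurable_sinp.
- exact: measurable_funM.
- by move=> t; exact: sinp_ge0.
- by move=> w; rewrite !mulr_ge0// indicE.
- by move=> t; rewrite sinp_period.
- apply: (int_scl setT _ _ _ measurableT mI _ (mulr_ge0 C0 K0)) => //.
  rewrite integral_indic// setIT [X in (X <= _)%E]lebesgue_measure_itv/=; case: ifPn => _.
    by rewrite -EFinB lee_fin; lra.
  by rewrite lee_fin mulr_ge0.
- move=> z s0 _; have sE : sinp 2^-1 (0 - z.1) = sinp 2^-1 z.1 by rewrite /sinp sub0r mulNr sinN normrN.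
  have s1 : sin (z.1 / 2) != 0 by move: s0; rewrite sub0r mulNr sinN oppr_eq0.
  rewrite sE normrM.
  have -> : sinp 2^-1 z.1 * (C * K * \1_(`[(- M)%R, M]) z.2) = (C * sinp 2^-1 z.1) * (K * \1_(`[(- M)%R, M]) z.2) by ring.
  have [h|h] := boolP (z.2 \in `[(- M)%R, M]); last first.
    have := gK z; rewrite indicE memNset//=; last exact/negP.
    by rewrite mulr0 => h1; rewrite mulr0 (le_trans (ler_wpM2l (normr_ge0 _) h1))// mulr0.
  apply: ler_pM => //; apply: kap_bound => //.
  by move: h; rewrite in_itv/= -ler_norml.
Qed.

Variable d : R.
Hypothesis d0 : 0 < d.
Hypothesis d4 : 4 * d <= 1.
Variables (v : R -> R -> R) (K : R).
Hypothesis mv : measurable_fun setT (fun z : R * R => v z.1 z.2).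
Hypothesis pv : periodic_x v.
Hypothesis K0 : 0 <= K.
Hypothesis vK : forall x y, `|v x y| <= K * sI d y.
Variables (v1 : R -> R -> R) (K1 : R).
Hypothesis mv1 : measurable_fun setT (fun z : R * R => v1 z.1 z.2).
Hypothesis pv1 : periodic_x v1.
Hypothesis K10 : 0 <= K1.
Hypothesis vK1 : forall x y, `|v1 x y| <= K1 * sI d y.

Let dom (w : R -> R -> R) (k x y y' : R) : 0 <= k -> (forall x y, `|w x y| <= k * sI d y) -> `|y' - y| < 1 ->
  forall z : R * R, `|w (x - z.1) (y' - z.2)| <= k * \1_(`[(- (`|y| + 3))%R, `|y| + 3]) z.2.
Proof.
move=> k0 wk hy z; apply: (le_trans (wk _ _)); apply: ler_wpM2l => //.
have [h|h] := leP `|y' - z.2 + 1| (2 * d); last by rewrite sI_out// indicE.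
rewrite sI_in// indicE mem_set//= in_itv/= -ler_norml.
have -> : z.2 = y + (y' - y) + 1 - (y' - z.2 + 1) by ring.
apply: (le_trans (ler_normB _ _)).
have := ler_normD (y + (y' - y)) 1; have := ler_normD y (y' - y); rewrite normr1.
by have := d4; lra.
Qed.

Lemma isd_conv_x (x y : R) : (forall x y : R, is_derive x 1 (fun t => v t y) (v1 x y)) ->
  is_derive x 1 (fun t => conv v t y) (conv v1 x y).
Proof.
move=> H.
have M0 : 0 <= `|y| + 3 by rewrite addr_ge0.
have y1 : `|y - y| < 1 by rewrite subrr normr0.
have E : (fun t => conv v t y) = (fun t => I2 (fun z => kap z.1 z.2 * v (t - z.1) (y - z.2))).
  by apply/funext => t; exact: conv_flip.
pose g (z : R * R) := K1 * \1_(`[(- (`|y| + 3))%R, `|y| + 3]) z.2.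
have g0 z : 0 <= g z by rewrite mulr_ge0// indicE.
have mg : measurable_fun setT g by apply: measurable_funM => //; apply: measurable_snd1; exact: measurable_indic.
have iG : int2 (fun z => `|kap z.1 z.2 * g z|).
  have := int2_kap_bdd g K1 _ mg K10 M0; move=> /(_ _)/integrable_norm; apply.
  by move=> z; rewrite ger0_norm.
have i1 t : `|t - x| < 1 -> int2 (fun z => kap z.1 z.2 * v (t - z.1) (y - z.2)).
  move=> _; apply: (int2_kap_bdd _ K _ _ K0 M0); first exact: measurable_shift.
  exact: dom.
have i2 (t : R) (z : R * R) : `|t - x| < 1 -> TRR z ->
   is_derive t 1 (fun s => kap z.1 z.2 * v (s - z.1) (y - z.2)) (kap z.1 z.2 * v1 (t - z.1) (y - z.2)).
  move=> _ _; apply: isdZ.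
  have h1 : is_derive t 1 (fun s : R => s - z.1) 1 by apply: (isd_eq (isdB (isd_id t) (isd_cst z.1 t))); rewrite subr0.
  apply: (isd_eq (isd_comp (f := fun s => v s (y - z.2)) (g := fun s => s - z.1) (H _ _) h1)).
  by rewrite mulr1.
have i3 (t : R) (z : R * R) : `|t - x| < 1 -> TRR z -> `|kap z.1 z.2 * v1 (t - z.1) (y - z.2)| <= `|kap z.1 z.2 * g z|.
  move=> _ _; rewrite [leLHS]normrM [leRHS]normrM; apply: ler_wpM2l => //; rewrite (ger0_norm (g0 z)); exact: dom.
rewrite E conv_flip//.
exact: (isd_under_int _ _ leb2 TRR (fun t z => kap z.1 z.2 * v (t - z.1) (y - z.2)) (fun t z => kap z.1 z.2 * v1 (t - z.1) (y - z.2)) _ x 1 measurable_TR ltr01 i1 i2 (fun z => normr_ge0 _) iG i3).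
Qed.

Lemma isd_conv_y (x y : R) : (forall x y : R, is_derive y 1 (v x) (v1 x y)) ->
  is_derive y 1 (conv v x) (conv v1 x y).
Proof.
move=> H.
have M0 : 0 <= `|y| + 3 by rewrite addr_ge0.
have E : conv v x = (fun t => I2 (fun z => kap z.1 z.2 * v (x - z.1) (t - z.2))).
  by apply/funext => t; exact: conv_flip.
pose g (z : R * R) := K1 * \1_(`[(- (`|y| + 3))%R, `|y| + 3]) z.2.
have g0 z : 0 <= g z by rewrite mulr_ge0// indicE.
have mg : measurable_fun setT g by apply: measurable_funM => //; apply: measurable_snd1; exact: measurable_indic.
have iG : int2 (fun z => `|kap z.1 z.2 * g z|).
  have := int2_kap_bdd g K1 _ mg K10 M0; move=> /(_ _)/integrable_norm; apply.
  by move=> z; rewrite ger0_norm.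
have i1 t : `|t - y| < 1 -> int2 (fun z => kap z.1 z.2 * v (x - z.1) (t - z.2)).
  move=> ht; apply: (int2_kap_bdd _ K _ _ K0 M0); first exact: measurable_shift.
  exact: dom.
have i2 (t : R) (z : R * R) : `|t - y| < 1 -> TRR z ->
   is_derive t 1 (fun s => kap z.1 z.2 * v (x - z.1) (s - z.2)) (kap z.1 z.2 * v1 (x - z.1) (t - z.2)).
  move=> _ _; apply: isdZ.
  have h1 : is_derive t 1 (fun s : R => s - z.2) 1 by apply: (isd_eq (isdB (isd_id t) (isd_cst z.2 t))); rewrite subr0.
  apply: (isd_eq (isd_comp (f := v (x - z.1)) (g := fun s => s - z.2) (H _ _) h1)).
  by rewrite mulr1.
have i3 (t : R) (z : R * R) : `|t - y| < 1 -> TRR z -> `|kap z.1 z.2 * v1 (x - z.1) (t - z.2)| <= `|kap z.1 z.2 * g z|.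
  move=> ht _; rewrite [leLHS]normrM [leRHS]normrM; apply: ler_wpM2l => //; rewrite (ger0_norm (g0 z)); exact: dom.
rewrite E conv_flip//.
exact: (isd_under_int _ _ leb2 TRR (fun t z => kap z.1 z.2 * v (x - z.1) (t - z.2)) (fun t z => kap z.1 z.2 * v1 (x - z.1) (t - z.2)) _ y 1 measurable_TR ltr01 i1 i2 (fun z => normr_ge0 _) iG i3).
Qed.
End ConvSmooth.

(** * Measurability of partial derivatives *)

Section MeasDer.
Context {R : realType}.

(** Difference quotients along a sequence of steps: a derivative becomes a countable pointwise
    limit, hence is measurable. *)
Lemma derivable_seq_cvg (f : R -> R) (x : R) : derivable f x 1 ->
  (fun n : nat => n.+1%:R * (f (x + n.+1%:R^-1) - f x)) @ \oo --> derive1 f x.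
Proof.
move=> df; have := df => /cvg_ex[/= l fl].
have dl : derive1 f x = l.
  by apply/cvg_lim => //; move: fl; under eq_fun do rewrite scaler1.
rewrite dl.
have h0 : (forall n : nat, (n.+1%:R^-1 : R) != 0) /\ (fun n : nat => (n.+1%:R^-1 : R)) @ \oo --> (0 : R).
  by split=> [n|]; [rewrite invr_eq0|exact: cvg_harmonic].
move: fl => /cvgr_dnbhsP/(_ _ h0).
have -> : (fun n : nat => n.+1%:R * (f (x + n.+1%:R^-1) - f x)) =
   (fun n : nat => (n.+1%:R^-1)^-1 *: (f (n.+1%:R^-1 *: 1 + x) - f x)).
  by apply/funext => n; rewrite invrK scaler1 (addrC x).
by [].
Qed.

Lemma measurable_dx (f : R -> R -> R) : measurable_fun setT (fun z : R * R => f z.1 z.2) ->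
  (forall x y, derivable (fun t => f t y) x 1) -> measurable_fun setT (fun z : R * R => dx f z.1 z.2).
Proof.
move=> mf df.
apply: (@measurable_fun_cvg _ _ R setT (fun n (z : R * R) => n.+1%:R * (f (z.1 + n.+1%:R^-1) z.2 - f z.1 z.2))).
  move=> n; apply: measurable_funM => //; apply: measurable_funB => //.
  apply: (measurableT_comp (f := fun z : R * R => f z.1 z.2) (g := fun z : R * R => (z.1 + n.+1%:R^-1, z.2))) => //.
  apply/measurable_fun_pairP; split => /=; last exact: measurable_snd.
  by apply: (measurable_fst1 (fun s => s + _)); exact: measurable_funD.
by move=> z _; exact: (derivable_seq_cvg (fun t => f t z.2)).
Qed.

Lemma measurable_dy (f : R -> R -> R) : measurable_fun setT (fun z : R * R => f z.1 z.2) ->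
  (forall x y, derivable (f x) y 1) -> measurable_fun setT (fun z : R * R => dy f z.1 z.2).
Proof.
move=> mf df.
apply: (@measurable_fun_cvg _ _ R setT (fun n (z : R * R) => n.+1%:R * (f z.1 (z.2 + n.+1%:R^-1) - f z.1 z.2))).
  move=> n; apply: measurable_funM => //; apply: measurable_funB => //.
  apply: (measurableT_comp (f := fun z : R * R => f z.1 z.2) (g := fun z : R * R => (z.1, z.2 + n.+1%:R^-1))) => //.
  apply/measurable_fun_pairP; split => /=; first exact: measurable_fst.
  by apply: (measurable_snd1 (fun s => s + _)); exact: measurable_funD.
by move=> z _; exact: (derivable_seq_cvg (f z.1)).
Qed.
End MeasDer.

(** * Tame families *)

Section Tame.
Context {R : realType} {I : Type}.
Variable dl : I -> R.
Hypothesis dl0 : forall i, 0 < dl i.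
Hypothesis dl4 : forall i, 4 * dl i <= 1.
Local Notation fam := (I -> R -> R -> R).
Local Notation tpi := (2 * pi : R).
Implicit Types f g : I -> R -> R -> R.

Lemma pow_ge1 (d e : R) : 0 < d <= 1 -> 0 <= e -> 1 <= d `^ (- e).
Proof.
move=> d01 e0; have /andP[d0 d1] := d01.
by rewrite -[leLHS](powRr0 d); apply: (ger_powR d01); rewrite oppr_le0.
Qed.

Let dl1 i : 0 < dl i <= 1. Proof. by rewrite dl0/=; have := dl4 i; have := dl0 i; lra. Qed.

(* Families indexed by i with width dl i: on the strip the functions, and their iterated derivatives
   in x and dl * d/dy, may grow at most like any negative power of the width. *)
Definition slow f := forall e : R, 0 < e -> exists2 C : R, 0 <= C &
  forall i x y, `|y + 1| <= 2 * dl i -> `|f i x y| <= C * dl i `^ (- e).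

(** [W0_lb] controls each single member off the strip too, without uniformity in i; it serves joint
    continuity, whereas [W0_slow] carries the quantitative information. *)
Record W0 f : Prop := MkW0 {
  W0_meas : forall i, measurable_fun setT (fun z : R * R => f i z.1 z.2) ;
  W0_per : forall i, periodic_x (f i) ;
  W0_lb : forall i (M : R), exists C : R, forall x y, `|y| <= M -> `|f i x y| <= C ;
  W0_slow : slow f }.

Fixpoint W (n : nat) f : Prop :=
  W0 f /\ if n is n'.+1 then
    (forall i (x y : R), derivable (fun t => f i t y) x 1 /\ derivable (f i x) y 1) /\
    W n' (fun i => dx (f i)) /\ W n' (fun i x y => dl i * dy (f i) x y)
  else True.

Lemma WW0 n f : W n f -> W0 f. Proof. by case: n => [|n] []. Qed.

Lemma W_pred n f : W n.+1 f -> W n f.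
Proof.
elim: n f => [|n IH] f [h0 [hd [hx hy]]]; first by [].
by split=> //; split=> //; split; exact: IH.
Qed.

Lemma slow_bounded f (C : R) : (forall i x y, `|y + 1| <= 2 * dl i -> `|f i x y| <= C) -> slow f.
Proof.
move=> H e e0; exists `|C| => // i x y hy; apply: (le_trans (H i x y hy)).
apply: (le_trans (ler_norm C)); rewrite ler_peMr//; apply: pow_ge1 => //; exact: ltW.
Qed.

Lemma W0_add f g : W0 f -> W0 g -> W0 (fun i x y => f i x y + g i x y).
Proof.
move=> [mf pf lf sf] [mg pg lg sg]; split.
- by move=> i; exact: measurable_funD.
- by move=> i x y; rewrite pf pg.
- move=> i M; have [C HC] := lf i M; have [D HD] := lg i M; exists (C + D) => x y h.
  by apply: (le_trans (ler_normD _ _)); apply: lerD; [exact: HC|exact: HD].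
- move=> e e0; have [C C0 HC] := sf e e0; have [D D0 HD] := sg e e0; exists (C + D); first exact: addr_ge0.
  move=> i x y h; rewrite mulrDl; apply: (le_trans (ler_normD _ _)); apply: lerD; [exact: HC|exact: HD].
Qed.

Lemma W0_mul f g : W0 f -> W0 g -> W0 (fun i x y => f i x y * g i x y).
Proof.
move=> [mf pf lf sf] [mg pg lg sg]; split.
- by move=> i; exact: measurable_funM.
- by move=> i x y; rewrite pf pg.
- move=> i M; have [C HC] := lf i M; have [D HD] := lg i M; exists (C * D) => x y h.
  by rewrite normrM; apply: ler_pM => //; [exact: HC|exact: HD].
- move=> e e0; have e2 : 0 < e / 2 by rewrite divr_gt0.
  have [C C0 HC] := sf _ e2; have [D D0 HD] := sg _ e2; exists (C * D); first exact: mulr_ge0.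
  move=> i x y h; rewrite normrM.
  have -> : dl i `^ (- e) = dl i `^ (- (e / 2)) * dl i `^ (- (e / 2)).
    rewrite -powRD; last by rewrite (gt_eqF (dl0 i)) implybT.
    by congr (_ `^ _); field.
  by rewrite mulrACA; apply: ler_pM => //; [exact: HC|exact: HD].
Qed.

Lemma W0_cst (c : I -> R) : slow (fun i _ _ => c i) -> W0 (fun i _ _ => c i).
Proof. by move=> sc; split => // i; exists `|c i|. Qed.

Lemma W0_ff m f : W0 f -> W0 (fun i x y => ff m (f i x y)).
Proof.
have b (t : R) : `|ff m t| <= m`!%:R by rewrite ger0_norm ?ff_ge0// ff_le.
move=> [mf pf lf sf]; split.
- by move=> i; exact: (measurableT_comp (measurable_ff m)).
- by move=> i x y; rewrite pf.
- by move=> i M; exists m`!%:R.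
- by apply: (slow_bounded _ m`!%:R).
Qed.

Lemma dxE (f : R -> R -> R) (x y a : R) : is_derive x 1 (fun t => f t y) a -> dx f x y = a.
Proof. by move=> h; exact: isd_derive1. Qed.
Lemma dyE (f : R -> R -> R) (x y a : R) : is_derive y 1 (f x) a -> dy f x y = a.
Proof. by move=> h; exact: (isd_derive1 h). Qed.

Lemma W_add n f g : W n f -> W n g -> W n (fun i x y => f i x y + g i x y).
Proof.
elim: n f g => [|n IH] f g; first by move=> [hf _] [hg _]; split => //; exact: W0_add.
move=> [hf [df [fx fy]]] [hg [dg [gx gy]]]; split; first exact: W0_add.
have ix i (x y : R) := isdD (derivable_isd (df i x y).1) (derivable_isd (dg i x y).1).
have iy i (x y : R) := isdD (derivable_isd (df i x y).2) (derivable_isd (dg i x y).2).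
split.
  by move=> i x y; split; [exact: isd_derivable (ix i x y)|exact: isd_derivable (iy i x y)].
split.
  rewrite (_ : (fun i => _) = (fun i x y => dx (f i) x y + dx (g i) x y)); first exact: IH.
  by apply/funext => i; apply/funext => x; apply/funext => y; rewrite (dxE _ _ _ _ (ix i x y)).
rewrite (_ : (fun i => _) = (fun i x y => dl i * dy (f i) x y + dl i * dy (g i) x y)); first exact: IH.
by apply/funext => i; apply/funext => x; apply/funext => y; rewrite (dyE _ _ _ _ (iy i x y)) -mulrDr.
Qed.

Lemma W_mul n f g : W n f -> W n g -> W n (fun i x y => f i x y * g i x y).
Proof.
elim: n f g => [|n IH] f g; first by move=> [hf _] [hg _]; split => //; exact: W0_mul.
move=> Wf Wg; have Wf' := W_pred _ _ Wf; have Wg' := W_pred _ _ Wg.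
case: Wf => [hf [df [fx fy]]]; case: Wg => [hg [dg [gx gy]]]; split; first exact: W0_mul.
have ix i (x y : R) := isdM (derivable_isd (df i x y).1) (derivable_isd (dg i x y).1).
have iy i (x y : R) := isdM (derivable_isd (df i x y).2) (derivable_isd (dg i x y).2).
split.
  by move=> i x y; split; [exact: isd_derivable (ix i x y)|exact: isd_derivable (iy i x y)].
split.
  rewrite (_ : (fun i => _) = (fun i x y => dx (f i) x y * g i x y + f i x y * dx (g i) x y)).
    by apply: W_add; exact: IH.
  by apply/funext => i; apply/funext => x; apply/funext => y; rewrite (dxE _ _ _ _ (ix i x y)).
rewrite (_ : (fun i => _) = (fun i x y => (dl i * dy (f i) x y) * g i x y + f i x y * (dl i * dy (g i) x y))).
  by apply: W_add; exact: IH.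
apply/funext => i; apply/funext => x; apply/funext => y; rewrite (dyE _ _ _ _ (iy i x y)) /dy.
by move: (derive1 _ _) (derive1 _ _) => a b; ring.
Qed.

Lemma W_cst n (c : I -> R) : slow (fun i _ _ => c i) -> W n (fun i _ _ => c i).
Proof.
elim: n c => [|n IH] c sc; split => //; try exact: W0_cst.
have z : W n (fun _ _ _ => 0).
  by apply: (IH (fun=> 0)); apply: (slow_bounded _ 0) => *; rewrite normr0.
have ix i (x : R) : is_derive x 1 (fun=> c i) 0 := isd_cst (c i) x.
split; first by move=> i x y; split; [exact: isd_derivable (ix i x)|exact: isd_derivable (ix i y)].
split.
  rewrite (_ : (fun i => _) = (fun _ _ _ => 0))//.
  by apply/funext => i; apply/funext => x; apply/funext => y; rewrite (dxE _ _ _ _ (ix i x)).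
rewrite (_ : (fun i => _) = (fun _ _ _ => 0))//.
by apply/funext => i; apply/funext => x; apply/funext => y; rewrite (dyE _ _ _ _ (ix i y)) mulr0.
Qed.

(** The derivative of [ff m] combines [ff m.+1] and [ff m.+2], so the induction on the order runs
    over all m at once; every [ff m] is bounded whatever its argument. *)
Lemma W_ff n m f : W n f -> W n (fun i x y => ff m (f i x y)).
Proof.
elim: n m f => [|n IH] m f; first by move=> [hf _]; split => //; exact: W0_ff.
move=> Wf; have Wf' := W_pred _ _ Wf; case: Wf => [hf [df [fx fy]]]; split; first exact: W0_ff.
have ix i (x y : R) := isd_comp (g := fun t => f i t y) (isd_ff m (f i x y)) (derivable_isd (df i x y).1).
have iy i (x y : R) := isd_comp (g := f i x) (isd_ff m (f i x y)) (derivable_isd (df i x y).2).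
split.
  by move=> i x y; split; [exact: isd_derivable (ix i x y)|exact: isd_derivable (iy i x y)].
have Wd : W n (fun i x y => (- m%:R * ff m.+1 (f i x y) + ff m.+2 (f i x y))).
  apply: W_add; last exact: IH.
  apply: (W_mul n (fun _ _ _ => - m%:R)); last exact: IH.
  by apply: (W_cst n (fun=> - m%:R)); apply: (slow_bounded _ m%:R) => *; rewrite normrN normr_nat.
split.
  rewrite (_ : (fun i => _) = (fun i x y => (- m%:R * ff m.+1 (f i x y) + ff m.+2 (f i x y)) * dx (f i) x y)).
    exact: W_mul.
  by apply/funext => i; apply/funext => x; apply/funext => y; rewrite (dxE _ _ _ _ (ix i x y)).
rewrite (_ : (fun i => _) = (fun i x y => (- m%:R * ff m.+1 (f i x y) + ff m.+2 (f i x y)) * (dl i * dy (f i) x y))).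
  exact: W_mul.
apply/funext => i; apply/funext => x; apply/funext => y; rewrite (dyE _ _ _ _ (iy i x y)) /dy.
by rewrite mulrCA.
Qed.

Lemma W_y n (c : R) (h : I -> R -> R) :
  (forall i, measurable_fun setT (h i)) -> (forall i M, exists C : R, forall y, `|y| <= M -> `|h i y| <= C) ->
  (forall i y, `|y + 1| <= 2 * dl i -> `|h i y| <= c) ->
  (forall i (y : R), derivable (h i) y 1) ->
  W n (fun i _ y => dl i * derive1 (h i) y) -> W n.+1 (fun i _ y => h i y).
Proof.
move=> mh lh bh dh Wh.
have z : W n (fun _ _ _ => 0).
  by apply: (W_cst n (fun=> 0)); apply: (slow_bounded _ 0) => *; rewrite normr0.
split.
  split => //.
  - by move=> i; exact: measurable_snd1.
  - by move=> i M; have [C HC] := lh i M; exists C => x y; exact: HC.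
  - by apply: (slow_bounded _ c) => i x y; exact: bh.
have ix i (x y : R) : is_derive x 1 (fun=> h i y) 0 := isd_cst (h i y) x.
split; first by move=> i x y; split; [exact: isd_derivable (ix i x y)|exact: dh].
split=> //.
rewrite (_ : (fun i => _) = (fun _ _ _ => 0))//.
by apply/funext => i; apply/funext => x; apply/funext => y; rewrite (dxE _ _ _ _ (ix i x y)).
Qed.

Lemma isd_par d (y : R) : d != 0 -> is_derive y 1 (par d) (- ((y + 1) / d ^+ 2)).
Proof.
move=> dn.
have h1 : is_derive y 1 (fun y : R => y + 1) 1 by apply: (isd_eq (isdD (isd_id y) (isd_cst 1 y))); rewrite addr0.
apply: (isd_eq (isdB (isd_cst 1 y) (isdZr (2 * d ^+ 2)^-1 (isdM h1 h1)))).
by rewrite sub0r; congr (- _); field.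
Qed.

(** The scaled derivative suits the parabola: dl d/dy turns it into - (y + 1) / dl, bounded by 2 on
    the strip, then into -1. Starting two orders higher lets [W_y] be applied twice. *)
Lemma W_par n : W n (fun i _ y => par (dl i) y).
Proof.
suff H m : W m.+2 (fun i _ y => par (dl i) y).
  by apply: W_pred; apply: W_pred.
have dn i : dl i != 0 by rewrite gt_eqF.
apply: (W_y m.+1 1).
- by move=> i; exact: measurable_par.
- move=> i M; exists (1 + (`|M| + 1) ^+ 2 / (2 * dl i ^+ 2)) => y yM; rewrite /par.
  apply: (le_trans (ler_normB _ _)); rewrite normr1 lerD2l [leLHS]normrM normrX.
  have i0 : 0 <= (2 * dl i ^+ 2)^-1 by rewrite invr_ge0 mulr_ge0// sqr_ge0.
  rewrite (ger0_norm i0) ler_wpM2r// ler_pXn2r ?nnegrE ?addr_ge0//.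
  apply: (le_trans (ler_normD _ _)); rewrite normr1 lerD2r; apply: (le_trans yM); exact: ler_norm.
- by move=> i y hy; rewrite ler_norml; exact: par_in.
- by move=> i y; exact: isd_derivable (isd_par _ y (dn i)).
rewrite (_ : (fun i => _) = (fun i _ y => - ((y + 1) / dl i))); last first.
  apply/funext => i; apply/funext => x; apply/funext => y; rewrite (isd_derive1 (isd_par _ y (dn i))).
  by have := dn i => h; field.
have h1 i (y : R) : is_derive y 1 (fun y : R => - ((y + 1) / dl i)) (- (dl i)^-1).
  have h : is_derive y 1 (fun y : R => y + 1) 1 by apply: (isd_eq (isdD (isd_id y) (isd_cst 1 y))); rewrite addr0.
  by apply: (isd_eq (isdN (isdZr (dl i)^-1 h))); rewrite mul1r.
apply: (W_y m 2).
- by move=> i; apply: measurableT_comp => //; apply: measurable_funM => //; exact: measurable_funD.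
- move=> i M; exists ((M + 1) / dl i) => y yM; rewrite normrN normrM normfV (gtr0_norm (dl0 i)).
  by rewrite ler_pM2r ?invr_gt0//; apply: (le_trans (ler_normD _ _)); rewrite normr1 lerD2r.
- by move=> i y hy; rewrite normrN normrM normfV (gtr0_norm (dl0 i)) ler_pdivrMr.
- by move=> i y; exact: isd_derivable (h1 i y).
rewrite (_ : (fun i => _) = (fun i _ y => -1)); last first.
  apply/funext => i; apply/funext => x; apply/funext => y; rewrite (isd_derive1 (h1 i y)).
  by have := dn i => h; field.
by apply: (W_cst m (fun=> -1)); apply: (slow_bounded _ 1) => *; rewrite normrN normr1.
Qed.
End Tame.

(** * Gain of one derivative by the convolution *)

Section Gain.
Context {R : realType} {I : Type}.
Variable dl : I -> R.
Hypothesis dl0 : forall i, 0 < dl i.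
Hypothesis dl4 : forall i, 4 * dl i <= 1.
Local Notation leb := (@lebesgue_measure R).
Local Notation leb2 := (leb \x leb)%E.
Local Notation TRR := (@TR R).
Local Notation tpi := (2 * pi : R).
Local Notation I0 := (`[0%R, tpi[%classic : set R).
Local Notation I2 := (Rintegral leb2 TRR).
Local Notation int2 f := (leb2.-integrable TRR (EFin \o f)).
Implicit Types f g : I -> R -> R -> R.
Local Notation slow := (slow dl).
Local Notation W0 := (W0 dl).
Local Notation W := (W dl).

Let dl1 i : 0 < dl i <= 1. Proof. by rewrite dl0/=; have := dl4 i; have := dl0 i; lra. Qed.

Definition supp f := forall i x y, 2 * dl i < `|y + 1| -> f i x y = 0.
Definition rescaled_conv f : I -> R -> R -> R := fun i x y => (dl i)^-1 * conv (f i) x y.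

Lemma supp_bound f : slow f -> supp f -> forall e : R, 0 < e -> exists2 C : R, 0 <= C &
  forall i x y, `|f i x y| <= (C * dl i `^ (- e)) * sI (dl i) y.
Proof.
move=> sf pf e e0; have [C C0 HC] := sf e e0; exists C => // i x y.
have [h|h] := leP `|y + 1| (2 * dl i); first by rewrite sI_in// mulr1; exact: HC.
by rewrite pf// normr0 sI_out// mulr0.
Qed.

Lemma dist_strip (d y w : R) : 4 * d <= 1 -> `|y + 1| <= 2 * d -> `|w + 1| <= 2 * d ->
  `|y - w| <= 4 * d /\ `|y - w| <= 1.
Proof.
move=> h4 h1 h2; have -> : y - w = (y + 1) - (w + 1) by ring.
by have := ler_normB (y + 1) (w + 1); split; lra.
Qed.

Lemma dist_loc (d y w M : R) : 4 * d <= 1 -> `|y| <= M -> `|w + 1| <= 2 * d -> `|y - w| <= `|M| + 2.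
Proof.
move=> h4 h1 h2; have -> : y - w = y - (w + 1) + 1 by ring.
have := ler_normD (y - (w + 1)) 1; have := ler_normB y (w + 1); rewrite normr1.
by have := ler_norm M; lra.
Qed.

Lemma pow_4d (d p e : R) : 0 < d <= 1 -> 0 <= p <= 1 -> p <= e ->
  (4 * d) `^ (1 - p) <= 4 * (d * d `^ (- e)).
Proof.
move=> d01 /andP[p0 p1] pe; have /andP[d0 d1] := d01.
rewrite powRM ?(ltW d0)//; apply: ler_pM; rewrite ?powR_ge0//.
  rewrite -[leRHS]powRr1//; apply: ler_powR; lra.
rewrite powRD ?(gt_eqF d0) ?implybT// powRr1 ?(ltW d0)// ler_pM2l//.
by apply: (ger_powR d01); rewrite lerN2.
Qed.

(** The strip has width of order dl, which compensates the factor 1 / dl for the function itself.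
    For d/dx the bound with exponent p loses dl^(-p), with p as small as desired; for dl d/dy the
    factor dl compensates 1 / dl directly. *)
Lemma gain0 f : W0 f -> supp f -> W 1 (rescaled_conv f).
Proof.
move=> [mf pf lf sf] spf; have SB := supp_bound f sf spf.
have [A A0 HA] := sinp_bound (R := R) 2^-1 half01.
have iv i : 0 <= (dl i)^-1 by rewrite invr_ge0 ltW.
have KC (C e : R) i : 0 <= C -> 0 <= C * dl i `^ (- e) by move=> C0; rewrite mulr_ge0// powR_ge0.
have W0G : W0 (rescaled_conv f).
  split.
  - move=> i; apply: measurable_funM => //.
    by apply: (measurable_conv (fun z => kap z.1 z.2) (fun z => f i z.1 z.2)) => //; exact: measurable_kap.
  - move=> i x y; rewrite /rescaled_conv /conv; congr (_ * _); apply: eq_Rintegral => z _.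
    by rewrite addrAC kap_period.
  - move=> i M; have [C C0 HC] := SB 1 ltr01.
    exists ((dl i)^-1 * (A * ((1 + Num.sqrt (Num.sqrt (shh (`|M| + 2)))) * (C * dl i `^ (- 1)) * (4 * dl i)))) => x y yM.
    rewrite /rescaled_conv normrM (ger0_norm (iv i)); apply: ler_wpM2l => //.
    have HL w : `|w + 1| <= 2 * dl i -> `|y - w| <= `|M| + 2 by exact: dist_loc.
    by have [] := conv_bound (dl i) (dl0 i) (f i) _ (mf i) (KC C 1 i C0) (HC i) x y _ A HA HL.
  - move=> e e0; have [C C0 HC] := SB e e0.
    have s0 : 0 <= 1 + Num.sqrt (Num.sqrt (shh (1 : R))) by rewrite addr_ge0// sqrtr_ge0.
    exists (4 * A * (1 + Num.sqrt (Num.sqrt (shh 1))) * C); first by rewrite !mulr_ge0// ltW.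
    move=> i x y hy; rewrite /rescaled_conv normrM (ger0_norm (iv i)).
    have HL w : `|w + 1| <= 2 * dl i -> `|y - w| <= 1 by move=> hw; have [] := dist_strip (dl i) y w (dl4 i) hy hw.
    have [_ b] := conv_bound (dl i) (dl0 i) (f i) _ (mf i) (KC C e i C0) (HC i) x y _ A HA HL.
    apply: (le_trans (ler_wpM2l (iv i) b)); rewrite le_eqVlt; apply/orP; left; apply/eqP.
    have dn : dl i != 0 by rewrite gt_eqF.
    by move: (powR _ _) (Num.sqrt _) => P S; field.
have bx (C e : R) (C0 : 0 <= C) (HC : forall i x y, `|f i x y| <= (C * dl i `^ (- e)) * sI (dl i) y) i (x y L p Ap : R) :
   0 < p < 1 -> 0 < L -> (\int[leb]_(t in I0) (sinp (1 - p) t)%:E <= Ap%:E)%E ->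
   (forall w, `|w + 1| <= 2 * dl i -> `|y - w| <= L) ->
   derivable (fun t => rescaled_conv f i t y) x 1 /\
   `|dx (rescaled_conv f i) x y| <= (dl i)^-1 * (4 * (C * dl i `^ (- e)) * Ap * (2 * (L `^ (1 - p) / (1 - p)))).
  move=> p01 L0 HAp HL.
  have [D hD bD] := convx_isd (dl i) (dl0 i) (f i) _ (mf i) (KC C e i C0) (HC i) x y L p Ap p01 L0 HAp HL.
  have h := isdZ (dl i)^-1 hD.
  split; first exact: isd_derivable h.
  by rewrite (dxE (rescaled_conv f i) x y _ h) normrM (ger0_norm (iv i)) ler_wpM2l.
have by_ (C e : R) (C0 : 0 <= C) (HC : forall i x y, `|f i x y| <= (C * dl i `^ (- e)) * sI (dl i) y) i (x y L : R) :
   0 < L -> (forall w, `|w + 1| <= 2 * dl i -> `|y - w| <= L) ->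
   derivable (rescaled_conv f i x) y 1 /\
   `|dl i * dy (rescaled_conv f i) x y| <= (2 * Num.sqrt (shh L + 1)) * (C * dl i `^ (- e)) * (2 * (L `^ (1 - 2^-1) / (1 - 2^-1))) * A.
  move=> L0 HL.
  have [D hD bD] := convy_isd (dl i) (dl0 i) (f i) _ (mf i) (KC C e i C0) (HC i) x y L A L0 HA HL.
  have h := isdZ (dl i)^-1 hD.
  split; first exact: isd_derivable h.
  by rewrite (dyE (rescaled_conv f i) x y _ h) mulrA divff ?mul1r// gt_eqF.
have [C1 C10 HC1] := SB 1 ltr01.
have HA2 : (\int[leb]_(t in I0) (sinp (1 - 2^-1) t)%:E <= A%:E)%E.
  by rewrite (_ : 1 - 2^-1 = 2^-1 :> R)//; field.
have Lp (M : R) : 0 < `|M| + 2 by rewrite ltr_wpDl.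
have ddx i (x y : R) : derivable (fun t => rescaled_conv f i t y) x 1.
  pose m : R := `|y|; have HL w : `|w + 1| <= 2 * dl i -> `|y - w| <= `|m| + 2 by exact: dist_loc.
  by have [] := bx C1 1 C10 HC1 i x y _ 2^-1 A half01 (Lp _) HA2 HL.
have ddy i (x y : R) : derivable (rescaled_conv f i x) y 1.
  pose m : R := `|y|; have HL w : `|w + 1| <= 2 * dl i -> `|y - w| <= `|m| + 2 by exact: dist_loc.
  by have [] := by_ C1 1 C10 HC1 i x y _ (Lp _) HL.
have WX : W0 (fun i => dx (rescaled_conv f i)).
  split.
  - by move=> i; apply: measurable_dx => //; exact: W0_meas W0G i.
  - move=> i x y; have h := derivable_isd (ddx i (x + tpi) y).
    have h1 : is_derive x 1 (fun s : R => s + tpi) 1 by apply: (isd_eq (isdD (isd_id x) (isd_cst tpi x))); rewrite addr0.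
    have := isd_comp (f := fun t => rescaled_conv f i t y) (g := fun s => s + tpi) h h1; rewrite mulr1.
    have -> : (fun t : R => rescaled_conv f i (t + tpi) y) = (fun t => rescaled_conv f i t y).
      by apply/funext => t; exact: (W0_per _ _ W0G).
    by move=> h2; rewrite [RHS](dxE (rescaled_conv f i) x y _ h2).
  - move=> i M; eexists => x y yM.
    have HL w : `|w + 1| <= 2 * dl i -> `|y - w| <= `|M| + 2 by exact: dist_loc.
    by have [_] := bx C1 1 C10 HC1 i x y _ 2^-1 A half01 (Lp M) HA2 HL; apply.
  (* Half of [e] pays for the density and half for the kernel; p <= 1/2 keeps 1 / (1 - p) below
     2. *)
  - move=> e e0; pose p := Num.min (e / 2) 2^-1.
    have e2 : 0 < e / 2 by rewrite divr_gt0.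
    have h1 : 2^-1 < 1 :> R by lra.
    have p01 : 0 < p < 1 by apply/andP; split; [rewrite /p lt_min e2 invr_gt0//=|rewrite /p gt_min h1 orbT].
    have p1' : 0 < 1 - p < 1 by have /andP[? ?] := p01; apply/andP; split; lra.
    have [Ap Ap0 HAp] := sinp_bound (R := R) (1 - p) p1'.
    have [C C0 HC] := SB _ e2.
    exists (64 * C * Ap); first by rewrite !mulr_ge0// ltW.
    move=> i x y hy.
    have HL w : `|w + 1| <= 2 * dl i -> `|y - w| <= 4 * dl i by move=> hw; have [] := dist_strip (dl i) y w (dl4 i) hy hw.
    have L0 : 0 < 4 * dl i by rewrite mulr_gt0.
    have [_ b] := bx C _ C0 HC i x y _ p Ap p01 L0 HAp HL; apply: (le_trans b).
    have P1 : (4 * dl i) `^ (1 - p) / (1 - p) <= 4 * (dl i * dl i `^ (- (e / 2))) * 2.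
      have /andP[q0 q1] := p1'.
      apply: ler_pM; rewrite ?powR_ge0 ?invr_ge0 ?(ltW q0)//.
        apply: pow_4d => //; last by rewrite /p ge_min lexx.
        by have /andP[h2 h3] := p01; rewrite !ltW.
      rewrite -[leRHS]invrK lef_pV2 ?posrE ?invr_gt0//.
      have : p <= 2^-1 by rewrite /p ge_min lexx orbT.
      lra.
    have E : dl i `^ (- e) = dl i `^ (- (e / 2)) * dl i `^ (- (e / 2)).
      rewrite -powRD; last by rewrite (gt_eqF (dl0 i)) implybT.
      by congr (_ `^ _); field.
    rewrite E; set P := dl i `^ (- (e / 2)) in P1 *.
    have P0 : 0 <= P by exact: powR_ge0.
    have c0 : 0 <= (dl i)^-1 * (4 * (C * P) * Ap) by rewrite !mulr_ge0// ltW.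
    have -> : (dl i)^-1 * (4 * (C * P) * Ap * (2 * ((4 * dl i) `^ (1 - p) / (1 - p)))) =
      (dl i)^-1 * (4 * (C * P) * Ap) * (2 * ((4 * dl i) `^ (1 - p) / (1 - p))) by exact: mulrA.
    apply: (@le_trans _ _ ((dl i)^-1 * (4 * (C * P) * Ap) * (2 * (4 * (dl i * P) * 2)))).
      by apply: ler_wpM2l => //; rewrite ler_pM2l.
    rewrite le_eqVlt; apply/orP; left; apply/eqP.
    have dn : dl i != 0 by rewrite gt_eqF.
    by field.
have WY : W0 (fun i x y => dl i * dy (rescaled_conv f i) x y).
  split.
  - by move=> i; apply: measurable_funM => //; apply: measurable_dy => //; exact: W0_meas W0G i.
  - move=> i x y.
    have E : (fun t => rescaled_conv f i (x + tpi) t) = (fun t => rescaled_conv f i x t).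
      by apply/funext => t; exact: (W0_per _ _ W0G).
    by rewrite /dy E.
  - move=> i M; eexists => x y yM.
    have HL w : `|w + 1| <= 2 * dl i -> `|y - w| <= `|M| + 2 by exact: dist_loc.
    by have [_] := by_ C1 1 C10 HC1 i x y _ (Lp M) HL; apply.
  - move=> e e0; have [C C0 HC] := SB _ e0.
    pose B : R := 2 * Num.sqrt (shh 1 + 1) * (2 * (1 `^ (1 - 2^-1) / (1 - 2^-1))) * A.
    have B0 : 0 <= B.
      have h2 : 0 <= (1 - 2^-1 : R) by lra.
      by rewrite /B !mulr_ge0 ?sqrtr_ge0 ?powR_ge0 ?invr_ge0// ltW.
    exists (B * C); first exact: mulr_ge0.
    move=> i x y hy.
    have HL w : `|w + 1| <= 2 * dl i -> `|y - w| <= 1 by move=> hw; have [] := dist_strip (dl i) y w (dl4 i) hy hw.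
    have [_ b] := by_ C _ C0 HC i x y _ ltr01 HL; apply: (le_trans b).
    rewrite le_eqVlt; apply/orP; left; apply/eqP; rewrite /B.
    by move: (powR _ _) (powR _ _) (Num.sqrt _) ((1 - 2^-1)^-1) => P S T U; ring.
exact: (conj W0G (conj (fun i x y => conj (ddx i x y) (ddy i x y)) (conj (conj WX Logic.I) (conj WY Logic.I)))).
Qed.
End Gain.

(** * Bootstrap for the family of profiles *)

Section GainN.
Context {R : realType} {I : Type}.
Variable dl : I -> R.
Hypothesis dl0 : forall i, 0 < dl i.
Hypothesis dl4 : forall i, 4 * dl i <= 1.
Local Notation leb := (@lebesgue_measure R).
Local Notation leb2 := (leb \x leb)%E.
Local Notation TRR := (@TR R).
Local Notation tpi := (2 * pi : R).
Local Notation I2 := (Rintegral leb2 TRR).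
Local Notation int2 f := (leb2.-integrable TRR (EFin \o f)).
Implicit Types f g : I -> R -> R -> R.
Local Notation slow := (slow dl).
Local Notation W0 := (W0 dl).
Local Notation W := (W dl).
Local Notation Gd := (rescaled_conv dl).
Local Notation supp := (supp dl).

Lemma supp_dx f : supp f -> supp (fun i => dx (f i)).
Proof.
move=> sf i x y h.
have E : (fun t => f i t y) = (fun=> 0) by apply/funext => t; exact: sf.
by rewrite /dx E; exact: isd_derive1 (isd_cst 0 x).
Qed.

Lemma supp_dy f : supp f -> supp (fun i => dy (f i)).
Proof.
move=> sf i x y h.
have nr : \forall t \near y, (fun=> 0) t = f i x t.
  have h0 : 0 < `|y + 1| - 2 * dl i by rewrite subr_gt0.
  apply: filterS (near_dist y h0) => t ht; rewrite sf//.
  have := ler_normB (t + 1) (t - y); have -> : t + 1 - (t - y) = y + 1 by ring.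
  lra.
exact: isd_derive1 (isd_near nr (isd_cst 0 y)).
Qed.

Lemma supp_scl f (c : I -> R) : supp f -> supp (fun i x y => c i * f i x y).
Proof. by move=> sf i x y h; rewrite sf// mulr0. Qed.

Lemma fixed_bound f : slow f -> supp f -> forall i, exists2 K : R, 0 <= K &
  forall x y, `|f i x y| <= K * sI (dl i) y.
Proof.
move=> sf pf i; have [C C0 HC] := supp_bound dl f sf pf 1 ltr01.
by exists (C * dl i `^ (-1)); [rewrite mulr_ge0// powR_ge0|exact: HC].
Qed.

Lemma conv_scl (c d K : R) (v : R -> R -> R) (x y : R) : 0 < d -> 4 * d <= 1 -> 0 <= K ->
  measurable_fun setT (fun z : R * R => v z.1 z.2) -> (forall x y, `|v x y| <= K * sI d y) ->
  conv (fun x y => c * v x y) x y = c * conv v x y.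
Proof.
move=> d0 d4 K0 mv vK; have [A A0 HA] := sinp_bound (R := R) 2^-1 half01.
have HL w : `|w + 1| <= 2 * d -> `|y - w| <= `|y| + 2.
  by move=> hw; have := dist_loc d y w `|y| d4 (lexx _) hw; rewrite normr_id.
have [ii _] := conv_bound d d0 v K mv K0 vK x y _ A HA HL.
rewrite /conv -RintegralZl//; last exact: measurable_TR.
by apply: eq_Rintegral => z _; rewrite mulrCA.
Qed.

(* Convolution with the kernel gains one derivative, which starts the bootstrap. *)
Lemma gain n f : W n f -> supp f -> W n.+1 (Gd f).
Proof.
elim: n f => [|n IH] f; first by move=> [hf _]; exact: gain0.
move=> [hf [df [fx fy]]] sf; have [G0 [dG _]] := gain0 dl dl0 dl4 f hf sf.
have s1 := supp_dx f sf; have s2 := supp_scl _ dl (supp_dy f sf).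
have A : W n.+1 (fun i => dx (Gd f i)).
  rewrite (_ : (fun i => _) = Gd (fun i => dx (f i))); first exact: IH.
  apply/funext => i; apply/funext => x; apply/funext => y.
  have [K K0 HK] := fixed_bound f (W0_slow _ _ hf) sf i.
  have [K1 K10 HK1] := fixed_bound _ (W0_slow _ _ (WW0 _ _ _ fx)) s1 i.
  apply: dxE; apply: isdZ.
  apply: (isd_conv_x (dl i) (dl4 i) (f i) K (W0_meas _ _ hf i) (W0_per _ _ hf i) K0 HK
    (dx (f i)) K1 (W0_meas _ _ (WW0 _ _ _ fx) i) (W0_per _ _ (WW0 _ _ _ fx) i) K10 HK1 x y) => a b.
  exact: derivable_isd (df i a b).1.
suff B : W n.+1 (fun i x y => dl i * dy (Gd f i) x y) by exact: (conj G0 (conj dG (conj A B))).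
rewrite (_ : (fun i => _) = Gd (fun i x y => dl i * dy (f i) x y)); first exact: IH.
apply/funext => i; apply/funext => x; apply/funext => y.
have [K K0 HK] := fixed_bound f (W0_slow _ _ hf) sf i.
have [K1 K10 HK1] := fixed_bound _ (W0_slow _ _ (WW0 _ _ _ fy)) s2 i.
have dn : dl i != 0 by rewrite gt_eqF.
have iv : 0 <= (dl i)^-1 by rewrite invr_ge0 ltW.
have HK2 a b : `|dy (f i) a b| <= (dl i)^-1 * K1 * sI (dl i) b.
  have -> : dy (f i) a b = (dl i)^-1 * (dl i * dy (f i) a b) by rewrite mulrA mulVf// mul1r.
  by rewrite normrM (ger0_norm iv) -mulrA ler_wpM2l.
have K20 : 0 <= (dl i)^-1 * K1 by rewrite mulr_ge0.
have mdy : measurable_fun setT (fun z : R * R => dy (f i) z.1 z.2).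
  by apply: measurable_dy => [|a b]; [exact: W0_meas hf i|exact: (df i a b).2].
have pdy : periodic_x (dy (f i)).
  move=> a b; have E : (fun t => f i (a + tpi) t) = (fun t => f i a t).
    by apply/funext => t; exact: (W0_per _ _ hf).
  by rewrite /dy E.
have h := isd_conv_y (dl i) (dl4 i) (f i) K (W0_meas _ _ hf i) (W0_per _ _ hf i) K0 HK
    (dy (f i)) _ mdy pdy K20 HK2 x y (fun a b => derivable_isd (df i a b).2).
rewrite (dyE (Gd f i) x y _ (isdZ (dl i)^-1 h)) /rescaled_conv (conv_scl (dl i) (dl i) _ (dy (f i)) x y (dl0 i) (dl4 i) K20 mdy HK2).
by rewrite !mulrA divff// mulVf.
Qed.

Variables (v : I -> R -> R -> R) (al e0 : I -> R).
Hypothesis prof : forall i, profile (dl i) (v i) (al i) (e0 i).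
Definition profile_arg : I -> R -> R -> R := fun i x y => al i * Gd v i x y + e0 i + par (dl i) y.

Lemma v_eq : v = (fun i x y => ff 0 (profile_arg i x y)).
Proof. by apply/funext => i; apply/funext => x; apply/funext => y; exact: (pf_eq _ _ _ _ (prof i)). Qed.

Lemma supp_v : supp v. Proof. by move=> i x y; exact: (pf_out _ _ _ _ (prof i)). Qed.

Lemma v_W0 : W0 v.
Proof.
have b i x y : `|v i x y| <= 1 by rewrite v_eq ger0_norm ?ff_ge0 ?ff_le1.
split.
- by move=> i; exact: (pf_meas _ _ _ _ (prof i)).
- by move=> i; exact: (pf_per _ _ _ _ (prof i)).
- by move=> i M; exists 1.
- exact: (slow_bounded dl dl0 dl4 v 1).
Qed.

Lemma al_slow : slow (fun i _ _ => al i).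
Proof.
apply: (slow_bounded dl dl0 dl4 _ 32) => i x y _; have /andP[h1 h2] := pf_al _ _ _ _ (prof i).
by rewrite gtr0_norm.
Qed.

(** The additive constant is recovered from the other terms at the point (0, -1): the whole argument
    is bounded by 3, the parabola by 1, and the potential is already known to be slow. *)
Lemma e0_slow : slow (fun i _ _ => e0 i).
Proof.
have [G0 _] := gain0 dl dl0 dl4 v v_W0 supp_v.
move=> e ep; have [C C0 HC] := W0_slow _ _ G0 e ep.
exists (4 + 32 * C); first by rewrite addr_ge0// mulr_ge0.
move=> i _ _ _.
have h1 : `|-1 + 1| <= 2 * dl i by rewrite addNr normr0 mulr_ge0// ltW.
have h2 := pf_bnd _ _ _ _ (prof i) 0 (-1) h1.
have h3 := HC i 0 (-1) h1.
have /andP[p1 p2] := par_in (dl i) (-1) (dl0 i) h1.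
have h4 : 1 <= dl i `^ (- e).
  apply: pow_ge1; last exact: ltW.
  by rewrite dl0/=; have := dl4 i; have := dl0 i; lra.
have /andP[a1 a2] := pf_al _ _ _ _ (prof i).
have h5 : `|al i * Gd v i 0 (-1)| <= 32 * (C * dl i `^ (- e)).
  by rewrite normrM (gtr0_norm a1); apply: ler_pM => //; exact: ltW.
move: h2; rewrite -/(Gd v i 0 (-1)) => h2.
have -> : e0 i = (al i * Gd v i 0 (-1) + e0 i + par (dl i) (-1)) - (al i * Gd v i 0 (-1) + par (dl i) (-1)) by ring.
apply: (le_trans (ler_normB _ _)).
have h6 := ler_normD (al i * Gd v i 0 (-1)) (par (dl i) (-1)).
have h7 : `|par (dl i) (-1)| <= 1 by rewrite ler_norml p1 p2.
have h8 : `|al i * Gd v i 0 (-1) + e0 i + par (dl i) (-1)| <= 3 by exact: h2.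
move: (`|_ + _ + _|) (`|_ + _|) (`|_ * _|) (`|par _ _|) (_ `^ _) h4 h5 h6 h7 h8 => *.
lra.
Qed.

(** One turn of the loop: [gain] puts the potential, hence the argument, one order above [v], and
    composing with the bump returns this order to [v]. *)
Lemma profile_W n : W n v /\ W n profile_arg.
Proof.
have step m : W m v -> W m.+1 profile_arg.
  move=> Wv; apply: W_add => //; last exact: W_par.
  apply: W_add => //; last exact: (W_cst dl dl0 dl4 _ e0 e0_slow).
  by apply: W_mul => //; [exact: (W_cst dl dl0 dl4 _ al al_slow)|apply: gain => //; exact: supp_v].
have Wv m : W m v.
  elim: m => [|m IH]; first by split=> //; exact: v_W0.
  by rewrite v_eq; apply: W_ff => //; exact: step.
by split=> //; apply: W_pred; exact: step.
Qed.
End GainN.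

(** * From tame families to smooth functions *)

Section Smooth.
Context {R : realType} {I : Type}.
Variable dl : I -> R.
Hypothesis dl0 : forall i, 0 < dl i.
Hypothesis dl4 : forall i, 4 * dl i <= 1.
Implicit Types f g : I -> R -> R -> R.
Local Notation W := (W dl).

(** Local bounds on both partial derivatives: moving along x at height t, then along y, is Lipschitz
    with constants uniform for t within 1 of y. *)
Lemma W_cont f i (x y : R) : W 1 f -> {for (x, y), continuous (fun p : R * R => f i p.1 p.2)}.
Proof.
move=> [hf [df [[fx _] [fy _]]]].
have [Cx HCx] := W0_lb _ _ fx i (`|y| + 1).
have [Cy HCy] := W0_lb _ _ fy i (`|y| + 1).
pose A := `|Cx|; pose B := `|Cy| / dl i.
have A0 : 0 <= A by exact: normr_ge0.
have B0 : 0 <= B by rewrite divr_ge0// ltW.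
have near1 (t : R) : `|t - y| <= 1 -> `|t| <= `|y| + 1.
  move=> h; have e : y + (t - y) = t by ring.
  by have := ler_normD y (t - y); rewrite e; lra.
have hx (s t : R) : `|t - y| <= 1 -> `|f i s t - f i x t| <= A * `|s - x|.
  move=> ht; apply: (lipschitz_derive (fun u => f i u t)) => [u|u]; first exact: (df i u t).1.
  by apply: le_trans (ler_norm _); exact: (HCx u t (near1 t ht)).
have hy (t : R) : `|t - y| <= 1 -> `|f i x t - f i x y| <= B * `|t - y|.
  move=> ht.
  have yb : y - 1 <= y <= y + 1 by apply/andP; split; lra.
  have tb : y - 1 <= t <= y + 1 by move: ht; rewrite ler_norml => /andP[h1 h2]; apply/andP; split; lra.
  apply: (lipschitz_itv (f i x) (y - 1) (y + 1)) => // [u _|u /andP[u1 u2]]; first exact: (df i x u).2.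
  have hu : `|u - y| <= 1 by rewrite ler_norml; apply/andP; split; lra.
  have := HCy x u (near1 u hu); rewrite normrM (gtr0_norm (dl0 i)) => h.
  rewrite /B ler_pdivlMr// mulrC; exact: (le_trans h (ler_norm _)).
apply/cvgrPdist_le => e e0 /=.
pose r := Num.min 1 (e / (A + B + 1)).
have AB : 0 < A + B + 1 by rewrite ltr_wpDl// addr_ge0.
have r0 : 0 < r by rewrite lt_min ltr01 divr_gt0.
exists ([set s : R | `|s - x| < r], [set t : R | `|t - y| < r]); first by split; exact: near_dist.
move=> -[s t] [/= /ltW h1 /ltW h2].
have t1 : `|t - y| <= 1 by apply: (le_trans h2); rewrite /r ge_min lexx.
rewrite distrC.
have -> : f i s t - f i x y = (f i s t - f i x t) + (f i x t - f i x y) by ring.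
apply: (le_trans (ler_normD _ _)); apply: (le_trans (lerD (hx s t t1) (hy t t1))).
apply: (@le_trans _ _ (A * r + B * r)); first by apply: lerD; exact: ler_wpM2l.
apply: (@le_trans _ _ ((A + B + 1) * r)); first by rewrite !mulrDl mul1r lerDl ltW.
by rewrite mulrC -ler_pdivlMr// /r ge_min lexx orbT.
Qed.

(** The family counts dl d/dy while smoothness asks for d/dy; the scalar [c] collects the inverse
    powers of the fixed width dl i. *)
Lemma iter_partial_W f i (l : seq bool) : (forall n, W n f) ->
  exists (g : I -> R -> R -> R) (c : R), (forall n, W n g) /\ iter_partial l (f i) = (fun x y => c * g i x y).
Proof.
move=> Wf; elim: l => [|b l [g [c [Wg E]]]] /=.
  by exists f, 1; split=> //; apply/funext => x; apply/funext => y; rewrite mul1r.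
rewrite E; have [_ [dg _]] := Wg 1%N.
case: b.
  exists (fun i => dx (g i)), c; split; first by move=> n; have [_ [_ []]] := Wg n.+1.
  apply/funext => x; apply/funext => y.
  exact: (isd_derive1 (isdZ c (derivable_isd (dg i x y).1))).
exists (fun i x y => dl i * dy (g i) x y), (c / dl i); split; first by move=> n; have [_ [_ []]] := Wg n.+1.
apply/funext => x; apply/funext => y.
rewrite mulrA divfK ?gt_eqF//.
exact: (isd_derive1 (isdZ c (derivable_isd (dg i x y).2))).
Qed.

Lemma W_scl n f (c : R) : W n f -> W n (fun i x y => c * f i x y).
Proof.
move=> Wf; apply: (W_mul dl dl0 n (fun _ _ _ => c)) => //.
by apply: (W_cst dl dl0 dl4 n (fun=> c)); apply: (slow_bounded dl dl0 dl4 _ `|c|).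
Qed.

Lemma smooth2_W f i : (forall n, W n f) -> smooth2 (f i).
Proof.
move=> Wf l x y; have [g [c [Wg ->]]] := iter_partial_W f i l Wf.
have Wc n := W_scl n g c (Wg n).
have [_ [dg _]] := Wc 1%N.
by split; [exact: (dg i x y).1|split; [exact: (dg i x y).2|exact: (W_cont _ i x y (Wc 1%N))]].
Qed.
End Smooth.

(** * Integrals of derivatives vanish *)

Section ZeroMean.
Context {R : realType}.
Local Notation leb := (@lebesgue_measure R).
Local Notation leb2 := (leb \x leb)%E.
Local Notation TRR := (@TR R).
Local Notation tpi := (2 * pi : R).
Local Notation I0 := (`[0%R, tpi[%classic : set R).
Local Notation I2 := (Rintegral leb2 TRR).
Local Notation int2 f := (leb2.-integrable TRR (EFin \o f)).
Variables (d K : R).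
Hypothesis d0 : 0 < d.
Hypothesis d4 : 4 * d <= 1.
Hypothesis K0 : 0 <= K.

Lemma int2_strip (h : R * R -> R) (k : R) : 0 <= k -> measurable_fun setT h ->
  (forall z, `|h z| <= k * sI d z.2) ->
  int2 h /\ `|I2 h| <= tpi * (4 * d * k).
Proof.
move=> k0 mh hK; have [] := dom_bounded d d0 h 0 k mh (lexx 0) k0.
  by move=> z; rewrite mul0r add0r.
by move=> h1 h2; split=> //; apply: (le_trans h2); rewrite le_eqVlt; apply/orP; left; apply/eqP; move: (pi : R) => P; ring.
Qed.

Lemma I2_dx0 (h h1 : R -> R -> R) : measurable_fun setT (fun z : R * R => h1 z.1 z.2) ->
  (forall x y, `|h1 x y| <= K * sI d y) ->
  (forall x y : R, is_derive x 1 (fun t => h t y) (h1 x y)) ->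
  (forall x y : R, {for x, continuous (fun t => h1 t y)}) ->
  (forall y, h tpi y = h 0 y) -> I2 (fun z => h1 z.1 z.2) = 0.
Proof.
move=> m1 b1 D1 c1 per.
have [ii _] := int2_strip (fun z => h1 z.1 z.2) K K0 m1 (fun z => b1 z.1 z.2).
have m1w w : measurable_fun setT (fun u => h1 u w) by exact: (measurableT_comp (g := fun u => (u, w)) m1).
have t0 : 0 <= tpi by rewrite ltW// tpi_gt0.
have iw w : leb.-integrable I0 (EFin \o (fun u => h1 u w)).
  exact: (integrable_I0_bounded _ _ (m1w w) (fun u => b1 u w)).
rewrite (I2_iter_w _ m1 ii iw).
rewrite (_ : (fun w => _) = (fun=> 0)); first by rewrite /Rintegral integral0_eq.
apply/funext => w /=.
rewrite Rintegral_itv_bndo_bndc; last first.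
  apply: (@integrable_le R _ _ (cst (K * sI d w))) => //=.
  rewrite (integral_cst leb (measurable_itv _) (K * sI d w)%:E)/= lebesgue_measure_itv/=.
  by rewrite lte_fin tpi_gt0 -EFinB -EFinM ltry.
rewrite /Rintegral (@FTC2_within R (fun u => h1 u w) (fun u => h u w) 0 tpi t0 (fun t _ => isd_derivable (D1 t w))
  (fun t _ => isd_derive1 (D1 t w)) (fun t _ => c1 t w)).
by rewrite per subrr.
Qed.

Lemma I2_dy0 (h h1 : R -> R -> R) : measurable_fun setT (fun z : R * R => h1 z.1 z.2) ->
  (forall x y, `|h1 x y| <= K * sI d y) ->
  (forall x y, 2 * d < `|y + 1| -> h x y = 0) ->
  (forall x y : R, is_derive y 1 (h x) (h1 x y)) ->
  (forall x y : R, {for y, continuous (h1 x)}) -> I2 (fun z => h1 z.1 z.2) = 0.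
Proof.
move=> m1 b1 s1 D1 c1.
have [ii _] := int2_strip (fun z => h1 z.1 z.2) K K0 m1 (fun z => b1 z.1 z.2).
have m1u u : measurable_fun setT (fun w => h1 u w).
  apply: (measurableT_comp (f := fun z : R * R => h1 z.1 z.2) (g := fun w : R => (u, w))) => //.
  by apply/measurable_fun_pairP; split; [exact: measurable_cst|exact: measurable_id].
have iu u : leb.-integrable setT (EFin \o h1 u).
  apply: (@integrable_le R setT _ (fun w => K * sI d w)) => //.
    by apply: measurable_funM => //; exact: measurable_sI.
  apply: le_lt_trans (ltry (K * (4 * d))).
  by apply: (int_scl setT (sI d) (4 * d) K measurableT (measurable_sI d) (sI_ge0 d) K0); rewrite integral_sI.
rewrite (I2_iter_u _ m1 ii iu).
rewrite (_ : (fun u => _) = (fun=> 0)); first by rewrite /Rintegral integral0_eq.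
apply/funext => u /=.
have out w : ~ (-3 <= w <= 1) -> h1 u w = 0.
  move=> hw; apply/eqP; rewrite -normr_le0; apply: (le_trans (b1 u w)).
  have [h2|h2] := leP `|w + 1| (2 * d); last by rewrite sI_out// mulr0.
  by exfalso; apply: hw; move: h2; rewrite ler_norml => /andP[? ?]; apply/andP; split; have := d4; lra.
(* Since 2 d <= 1/2, the strip lies inside []-3, 1[] and [h] vanishes at both ends. *)
have E : Rintegral leb setT (h1 u) = Rintegral leb `[(-3)%R, 1%R] (h1 u).
  rewrite /Rintegral [in RHS]integral_mkcond; congr fine; apply: eq_integral => w _.
  rewrite patchE; case: ifPn => //; rewrite notin_setE/= in_itv/= => hw.
  by rewrite out.
have l31 : -3 <= 1 :> R by lra.
rewrite E /Rintegral (@FTC2_within R (h1 u) (h u) (-3) 1 l31 (fun t _ => isd_derivable (D1 u t))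
  (fun t _ => isd_derive1 (D1 u t)) (fun t _ => c1 u t)).
have n1 : 2 * d < `|1 + 1 : R| by rewrite ger0_norm//; have := d4; lra.
have n3 : 2 * d < `|-3 + 1 : R| by rewrite ler0_norm; have := d4; lra.
by rewrite (s1 u 1 n1) (s1 u (-3) n3) subrr.
Qed.
End ZeroMean.

(** * Fourier coefficients and Sobolev norms *)

Section Fourier.
Context {R : realType}.
Local Notation leb := (@lebesgue_measure R).
Local Notation leb2 := (leb \x leb)%E.
Local Notation TRR := (@TR R).
Local Notation tpi := (2 * pi : R).
Local Notation I2 := (Rintegral leb2 TRR).
Local Notation int2 f := (leb2.-integrable TRR (EFin \o f)).

Lemma cos_int_period (t : R) (k : int) : cos (t + k%:~R * tpi) = cos t /\ sin (t + k%:~R * tpi) = sin t.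
Proof.
have P (n : nat) s : cos (s + n%:R * tpi) = cos s /\ sin (s + n%:R * tpi) = sin s.
  elim: n => [|n [IH1 IH2]]; first by rewrite mul0r addr0.
  by rewrite -natr1 mulrDl mul1r addrA cos_period sin_period.
case: k => n; first exact: P.
have [h1 h2] := P n.+1 (t + (Negz n)%:~R * tpi); rewrite -h1 -h2.
by rewrite NegzE mulrNz mulNr subrK.
Qed.

Definition spec_density (f : R -> R -> R) (k : int) (xi : R) : R := fourier_re f k xi ^+ 2 + fourier_im f k xi ^+ 2.

Lemma spec_density_ge0 f k xi : 0 <= spec_density f k xi. Proof. by rewrite addr_ge0 ?sqr_ge0. Qed.

Record C1s (d K : R) (f f1 f2 : R -> R -> R) : Prop := MkC1s {
  c1_m : measurable_fun setT (fun z : R * R => f z.1 z.2) ;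
  c1_m1 : measurable_fun setT (fun z : R * R => f1 z.1 z.2) ;
  c1_m2 : measurable_fun setT (fun z : R * R => f2 z.1 z.2) ;
  c1_per : periodic_x f ;
  c1_b : forall x y, `|f x y| <= K * sI d y ;
  c1_b1 : forall x y, `|f1 x y| <= K * sI d y ;
  c1_b2 : forall x y, `|f2 x y| <= K * sI d y ;
  c1_dx : forall x y : R, is_derive x 1 (fun t => f t y) (f1 x y) ;
  c1_dy : forall x y : R, is_derive y 1 (f x) (f2 x y) ;
  c1_c1 : forall x y : R, {for x, continuous (fun t => f1 t y)} ;
  c1_c2 : forall x y : R, {for y, continuous (f2 x)} }.

Variables (d K : R).
Hypothesis d0 : 0 < d.
Hypothesis d4 : 4 * d <= 1.
Hypothesis K0 : 0 <= K.

Lemma measurable_phase (p : R -> R) (k xi : R) (f : R -> R -> R) : measurable_fun setT p ->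
  measurable_fun setT (fun z : R * R => f z.1 z.2) ->
  measurable_fun setT (fun z : R * R => p (k * z.1 + xi * z.2) * f z.1 z.2).
Proof.
move=> mp mf; apply: measurable_funM => //; apply: (measurableT_comp mp); apply: measurable_funD.
  by apply: (measurable_fst1 (fun t => k * t)); exact: measurable_funM.
by apply: (measurable_snd1 (fun t => xi * t)); exact: measurable_funM.
Qed.

Lemma phase_bound (p : R -> R) (t x y : R) (f : R -> R -> R) : (forall t, `|p t| <= 1) ->
  (forall x y, `|f x y| <= K * sI d y) -> `|p t * f x y| <= K * sI d y.
Proof. by move=> hp hf; rewrite normrM -[leRHS]mul1r; apply: ler_pM. Qed.

Lemma int2_phase (p : R -> R) (k xi : R) (f : R -> R -> R) : measurable_fun setT p -> (forall t, `|p t| <= 1) ->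
  measurable_fun setT (fun z : R * R => f z.1 z.2) -> (forall x y, `|f x y| <= K * sI d y) ->
  int2 (fun z => p (k * z.1 + xi * z.2) * f z.1 z.2) /\
  `|I2 (fun z => p (k * z.1 + xi * z.2) * f z.1 z.2)| <= tpi * (4 * d * K).
Proof.
move=> mp hp mf hf.
apply: (int2_strip d d0 (fun z => p (k * z.1 + xi * z.2) * f z.1 z.2) K K0 (measurable_phase p k xi f mp mf)).
by move=> z; exact: phase_bound.
Qed.

Section Phase.
Variables (p q : R -> R) (c xi : R) (k : int).
Hypothesis mp : measurable_fun setT p.
Hypothesis mq : measurable_fun setT q.
Hypothesis bp : forall t, `|p t| <= 1.
Hypothesis bq : forall t, `|q t| <= 1.
Hypothesis dp : forall t : R, is_derive t 1 p (c * q t).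
Hypothesis cq : forall t : R, {for t, continuous q}.
Hypothesis pp : forall t, p (t + k%:~R * tpi) = p t.
Variables (f f1 f2 : R -> R -> R).
Hypothesis Hf : C1s d K f f1 f2.

Let cp (t : R) : {for t, continuous p}.
Proof. by apply: derivable_continuous; exact: isd_derivable (dp t). Qed.

(** Integration by parts. The pair ([p], [q]) is (cos, sin) with c = -1 or (sin, cos) with c = 1, so
    that one computation serves both parts of the Fourier coefficient; periodicity in x holds
    because k is an integer. *)
Lemma phase_x : I2 (fun z => p (k%:~R * z.1 + xi * z.2) * f1 z.1 z.2) =
  - (k%:~R * c) * I2 (fun z => q (k%:~R * z.1 + xi * z.2) * f z.1 z.2).
Proof.
have [mf mf1 mf2 pf bf bf1 bf2 dx1 dy1 cx1 cy1] := Hf.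
set kk := k%:~R; pose a := kk * c.
have [i1 _] := int2_phase p kk xi f1 mp bp mf1 bf1.
have [i2 _] := int2_phase q kk xi f mq bq mf bf.
pose h (x y : R) := p (kk * x + xi * y) * f x y.
pose h1 (x y : R) := a * (q (kk * x + xi * y) * f x y) + p (kk * x + xi * y) * f1 x y.
have B0 : 0 <= `|a| * K + K by rewrite addr_ge0// mulr_ge0.
have E : I2 (fun z => h1 z.1 z.2) = 0.
  apply: (I2_dx0 d (`|a| * K + K) d0 B0 h h1).
  - apply: measurable_funD; last exact: measurable_phase.
    by apply: measurable_funM => //; exact: measurable_phase.
  - move=> x y; apply: (le_trans (ler_normD _ _)); rewrite mulrDl; apply: lerD; last exact: phase_bound.
    by rewrite normrM -mulrA ler_wpM2l//; exact: phase_bound.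
  - move=> x y.
    have l1 : is_derive x 1 (fun t : R => kk * t + xi * y) kk.
      by apply: (isd_eq (isdD (isdZ kk (isd_id x)) (isd_cst (xi * y) x))); rewrite mulr1 addr0.
    apply: (isd_eq (isdM (isd_comp (f := p) (g := fun t => kk * t + xi * y) (dp _) l1) (dx1 x y))).
    by rewrite /h1 /a; ring.
  - move=> x y.
    have lc : {for x, continuous (fun t : R => kk * t + xi * y)}.
      by apply: derivable_continuous; exact: isd_derivable (isdD (isdZ kk (isd_id x)) (isd_cst (xi * y) x)).
    have qc : {for x, continuous (fun t : R => q (kk * t + xi * y))} by apply: continuous_comp => //; exact: cq.
    have pc : {for x, continuous (fun t : R => p (kk * t + xi * y))} by apply: continuous_comp => //; exact: cp.
    have fc : {for x, continuous (fun t : R => f t y)}.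
      by apply: derivable_continuous; exact: isd_derivable (dx1 x y).
    apply: (@continuousD _ _ _ (fun t : R => a * (q (kk * t + xi * y) * f t y)) (fun t => p (kk * t + xi * y) * f1 t y)).
      apply: (@continuousM _ _ (cst a) (fun t : R => q (kk * t + xi * y) * f t y)); first exact: cst_continuous.
      exact: (@continuousM _ _ (fun t : R => q (kk * t + xi * y)) (fun t => f t y)).
    exact: (@continuousM _ _ (fun t : R => p (kk * t + xi * y)) (fun t => f1 t y)).
  - move=> y; rewrite /h mulr0 add0r (addrC _ (xi * y)) pp; congr (_ * _).
    by rewrite -[tpi]add0r pf.
have : I2 (fun z => h1 z.1 z.2) = a * I2 (fun z => q (kk * z.1 + xi * z.2) * f z.1 z.2) +
   I2 (fun z => p (kk * z.1 + xi * z.2) * f1 z.1 z.2).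
  rewrite /h1 RintegralD//; [|exact: measurable_TR|exact: int2Z].
  by rewrite RintegralZl//; exact: measurable_TR.
rewrite E /a; lra.
Qed.

Lemma phase_y : I2 (fun z => p (k%:~R * z.1 + xi * z.2) * f2 z.1 z.2) =
  - (xi * c) * I2 (fun z => q (k%:~R * z.1 + xi * z.2) * f z.1 z.2).
Proof.
have [mf mf1 mf2 pf bf bf1 bf2 dx1 dy1 cx1 cy1] := Hf.
set kk := k%:~R; pose a := xi * c.
have [i1 _] := int2_phase p kk xi f2 mp bp mf2 bf2.
have [i2 _] := int2_phase q kk xi f mq bq mf bf.
pose h (x y : R) := p (kk * x + xi * y) * f x y.
pose h1 (x y : R) := a * (q (kk * x + xi * y) * f x y) + p (kk * x + xi * y) * f2 x y.
have B0 : 0 <= `|a| * K + K by rewrite addr_ge0// mulr_ge0.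
have E : I2 (fun z => h1 z.1 z.2) = 0.
  apply: (I2_dy0 d (`|a| * K + K) d0 d4 B0 h h1).
  - apply: measurable_funD; last exact: measurable_phase.
    by apply: measurable_funM => //; exact: measurable_phase.
  - move=> x y; apply: (le_trans (ler_normD _ _)); rewrite mulrDl; apply: lerD; last exact: phase_bound.
    by rewrite normrM -mulrA ler_wpM2l//; exact: phase_bound.
  - move=> x y hy; rewrite /h (_ : f x y = 0) ?mulr0//; apply/eqP; rewrite -normr_le0.
    by apply: (le_trans (bf x y)); rewrite sI_out// mulr0.
  - move=> x y.
    have l1 : is_derive y 1 (fun t : R => kk * x + xi * t) xi.
      by apply: (isd_eq (isdD (isd_cst (kk * x) y) (isdZ xi (isd_id y)))); rewrite mulr1 add0r.
    apply: (isd_eq (isdM (isd_comp (f := p) (g := fun t => kk * x + xi * t) (dp _) l1) (dy1 x y))).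
    by rewrite /h1 /a; ring.
  - move=> x y.
    have lc : {for y, continuous (fun t : R => kk * x + xi * t)}.
      by apply: derivable_continuous; exact: isd_derivable (isdD (isd_cst (kk * x) y) (isdZ xi (isd_id y))).
    have qc : {for y, continuous (fun t : R => q (kk * x + xi * t))} by apply: continuous_comp => //; exact: cq.
    have pc : {for y, continuous (fun t : R => p (kk * x + xi * t))} by apply: continuous_comp => //; exact: cp.
    have fc : {for y, continuous (fun t : R => f x t)}.
      by apply: derivable_continuous; exact: isd_derivable (dy1 x y).
    apply: (@continuousD _ _ _ (fun t : R => a * (q (kk * x + xi * t) * f x t)) (fun t => p (kk * x + xi * t) * f2 x t)).
      apply: (@continuousM _ _ (cst a) (fun t : R => q (kk * x + xi * t) * f x t)); first exact: cst_continuous.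
      exact: (@continuousM _ _ (fun t : R => q (kk * x + xi * t)) (fun t => f x t)).
    exact: (@continuousM _ _ (fun t : R => p (kk * x + xi * t)) (fun t => f2 x t)).
have : I2 (fun z => h1 z.1 z.2) = a * I2 (fun z => q (kk * z.1 + xi * z.2) * f z.1 z.2) +
   I2 (fun z => p (kk * z.1 + xi * z.2) * f2 z.1 z.2).
  rewrite /h1 RintegralD//; [|exact: measurable_TR|exact: int2Z].
  by rewrite RintegralZl//; exact: measurable_TR.
rewrite E /a; lra.
Qed.
End Phase.

Lemma isd_cos1 (t : R) : is_derive t 1 cos (-1 * sin t).
Proof. by apply: (isd_eq (is_derive_cos t)); rewrite mulN1r. Qed.
Lemma isd_sin1 (t : R) : is_derive t 1 sin (1 * cos t).
Proof. by apply: (isd_eq (is_derive_sin t)); rewrite mul1r. Qed.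

Lemma phase_sq (P a b c : R) : (P * (- (c * -1) * a)) ^+ 2 + (P * (- (c * 1) * b)) ^+ 2 =
  c ^+ 2 * ((P * b) ^+ 2 + (P * a) ^+ 2).
Proof. by ring. Qed.
Lemma scl_sq (P a b c : R) : (P * (c * a)) ^+ 2 + (P * (c * b)) ^+ 2 = c ^+ 2 * ((P * a) ^+ 2 + (P * b) ^+ 2).
Proof. by ring. Qed.

Lemma spec_density_dx f f1 f2 k xi : C1s d K f f1 f2 -> spec_density f1 k xi = k%:~R ^+ 2 * spec_density f k xi.
Proof.
move=> H.
have E1 := phase_x cos sin (-1) xi k measurable_cosR measurable_sinR norm_cos_le1 norm_sin_le1 isd_cos1
  (@continuous_sin R) (fun t => (cos_int_period t k).1) f f1 f2 H.
have E2 := phase_x sin cos 1 xi k measurable_sinR measurable_cosR norm_sin_le1 norm_cos_le1 isd_sin1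
  (@continuous_cos R) (fun t => (cos_int_period t k).2) f f1 f2 H.
rewrite /spec_density /fourier_re /fourier_im E1 E2; exact: phase_sq.
Qed.

Lemma spec_density_dy f f1 f2 k xi : C1s d K f f1 f2 -> spec_density f2 k xi = xi ^+ 2 * spec_density f k xi.
Proof.
move=> H.
have E1 := phase_y cos sin (-1) xi k measurable_cosR measurable_sinR norm_cos_le1 norm_sin_le1 isd_cos1
  (@continuous_sin R) f f1 f2 H.
have E2 := phase_y sin cos 1 xi k measurable_sinR measurable_cosR norm_sin_le1 norm_cos_le1 isd_sin1
  (@continuous_cos R) f f1 f2 H.
rewrite /spec_density /fourier_re /fourier_im E1 E2; exact: phase_sq.
Qed.

Lemma spec_density_bound (f : R -> R -> R) k xi : measurable_fun setT (fun z : R * R => f z.1 z.2) ->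
  (forall x y, `|f x y| <= K * sI d y) -> spec_density f k xi <= 2 * (4 * d * K) ^+ 2.
Proof.
move=> mf bf.
have t0 : 0 < tpi by exact: tpi_gt0.
have B0 : 0 <= 4 * d * K by rewrite !mulr_ge0// ltW.
have b (p : R -> R) : measurable_fun setT p -> (forall t, `|p t| <= 1) ->
    (tpi^-1 * I2 (fun z => p (k%:~R * z.1 + xi * z.2) * f z.1 z.2)) ^+ 2 <= (4 * d * K) ^+ 2.
  move=> mp bp; have [_ h] := int2_phase p k%:~R xi f mp bp mf bf.
  rewrite -[leLHS]real_normK ?num_real// ler_pXn2r ?nnegrE//.
  by rewrite normrM (gtr0_norm (x := _^-1)) ?invr_gt0// mulrC ler_pdivrMr// mulrC.
rewrite /spec_density mulr_natl mulr2n; apply: lerD.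
  exact: (b cos measurable_cosR norm_cos_le1).
exact: (b sin measurable_sinR norm_sin_le1).
Qed.

Lemma spec_density_scl (c : R) (f : R -> R -> R) k xi : measurable_fun setT (fun z : R * R => f z.1 z.2) ->
  (forall x y, `|f x y| <= K * sI d y) -> spec_density (fun x y => c * f x y) k xi = c ^+ 2 * spec_density f k xi.
Proof.
move=> mf bf.
have b (p : R -> R) : measurable_fun setT p -> (forall t, `|p t| <= 1) ->
    I2 (fun z => p (k%:~R * z.1 + xi * z.2) * (c * f z.1 z.2)) = c * I2 (fun z => p (k%:~R * z.1 + xi * z.2) * f z.1 z.2).
  move=> mp bp; have [h _] := int2_phase p k%:~R xi f mp bp mf bf.
  rewrite -RintegralZl//; last exact: measurable_TR.
  by apply: eq_Rintegral => z _; rewrite mulrCA.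
rewrite /spec_density /fourier_re /fourier_im (b cos measurable_cosR norm_cos_le1) (b sin measurable_sinR norm_sin_le1).
exact: scl_sq.
Qed.

Lemma measurable_spec_density (f : R -> R -> R) k : measurable_fun setT (fun z : R * R => f z.1 z.2) ->
  measurable_fun setT (spec_density f k).
Proof.
move=> mf.
have b (p : R -> R) : measurable_fun setT p ->
    measurable_fun setT (fun xi : R => I2 (fun z => p (k%:~R * z.1 + xi * z.2) * f z.1 z.2)).
  move=> mp.
  have h : measurable_fun setT (fun q : R * R => I2 (fun z => p (k%:~R * z.1 + q.1 * z.2) * f z.1 z.2)).
    apply: (measurable_param (fun qz => p (k%:~R * qz.2.1 + qz.1.1 * qz.2.2) * f qz.2.1 qz.2.2)).
    have s1 : measurable_fun setT (fun qz : (R * R) * (R * R) => qz.2.1).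
      exact: (measurableT_comp measurable_fst measurable_snd).
    have s2 : measurable_fun setT (fun qz : (R * R) * (R * R) => qz.2.2).
      exact: (measurableT_comp measurable_snd measurable_snd).
    have s3 : measurable_fun setT (fun qz : (R * R) * (R * R) => qz.1.1).
      exact: (measurableT_comp measurable_fst measurable_fst).
    apply: measurable_funM; last by apply: (measurableT_comp mf); exact: measurable_snd.
    apply: (measurableT_comp mp); apply: measurable_funD; exact: measurable_funM.
  apply: (measurableT_comp (f := fun q : R * R => I2 (fun z => p (k%:~R * z.1 + q.1 * z.2) * f z.1 z.2)) (g := fun xi : R => (xi, 0 : R)) h).
  by apply/measurable_fun_pairP; split; [exact: measurable_id|exact: measurable_cst].
apply: measurable_funD; apply: measurable_funX; apply: measurable_funM => //.
  exact: b measurable_cosR.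
exact: b measurable_sinR.
Qed.
End Fourier.

(** * Decay of the Fourier coefficients, uniformly in the width *)

Section Decay.
Context {R : realType} {I : Type}.
Variable dl : I -> R.
Hypothesis dl0 : forall i, 0 < dl i.
Hypothesis dl4 : forall i, 4 * dl i <= 1.
Implicit Types f g : I -> R -> R -> R.
Local Notation W := (W dl).
Local Notation supp := (supp dl).
Local Notation tpi := (2 * pi : R).

Definition Dx f : I -> R -> R -> R := fun i => dx (f i).
Definition Dy f : I -> R -> R -> R := fun i x y => dl i * dy (f i) x y.
Definition tame f := (forall n, W n f) /\ supp f.

Lemma tame_Dx f : tame f -> tame (Dx f).
Proof.
move=> [Wf sf]; split; last exact: supp_dx.
by move=> n; have [_ [_ []]] := Wf n.+1.
Qed.
Lemma tame_Dy f : tame f -> tame (Dy f).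
Proof.
move=> [Wf sf]; split; last by apply: supp_scl; exact: supp_dy.
by move=> n; have [_ [_ []]] := Wf n.+1.
Qed.

Lemma tame_C1s f i : tame f -> exists2 K : R, 0 <= K & C1s (dl i) K (f i) (dx (f i)) (dy (f i)).
Proof.
move=> tf; have [Wf sf] := tf; have [Wx sx] := tame_Dx f tf; have [Wy sy] := tame_Dy f tf.
have [h0 [df _]] := Wf 1%N; have [hx [dfx _]] := Wx 1%N; have [hy [dfy _]] := Wy 1%N.
have [K0 K00 HK0] := fixed_bound dl f (W0_slow _ _ h0) sf i.
have [K1 K10 HK1] := fixed_bound dl (Dx f) (W0_slow _ _ hx) sx i.
have [K2 K20 HK2] := fixed_bound dl (Dy f) (W0_slow _ _ hy) sy i.
have dn : dl i != 0 by rewrite gt_eqF.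
have iv : 0 <= (dl i)^-1 by rewrite invr_ge0 ltW.
have E2 : dy (f i) = (fun x y => (dl i)^-1 * Dy f i x y).
  by apply/funext => x; apply/funext => y; rewrite mulrA mulVf// mul1r.
have K30 : 0 <= (dl i)^-1 * K2 by exact: mulr_ge0.
have le a b (y : R) : a <= b -> a * sI (dl i) y <= b * sI (dl i) y by move=> h; rewrite ler_wpM2r ?sI_ge0.
exists (K0 + K1 + (dl i)^-1 * K2); first by rewrite !addr_ge0.
split.
- exact: W0_meas h0 i.
- exact: W0_meas hx i.
- by rewrite E2; apply: measurable_funM => //; exact: W0_meas hy i.
- exact: W0_per h0 i.
- by move=> x y; apply: (le_trans (HK0 x y)); apply: le; lra.
- by move=> x y; apply: (le_trans (HK1 x y)); apply: le; lra.
- move=> x y; rewrite E2 normrM (ger0_norm iv); apply: (le_trans (ler_wpM2l iv (HK2 x y))).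
  by rewrite mulrA; apply: le; lra.
- by move=> x y; exact: derivable_isd (df i x y).1.
- by move=> x y; exact: derivable_isd (df i x y).2.
- by move=> x y; apply: derivable_continuous; exact: (dfx i x y).1.
- move=> x y; rewrite E2; apply: derivable_continuous.
  exact: isd_derivable (isdZ (dl i)^-1 (derivable_isd (dfy i x y).2)).
Qed.

Lemma spec_density_Dx f i k xi : tame f -> spec_density (Dx f i) k xi = k%:~R ^+ 2 * spec_density (f i) k xi.
Proof. by move=> tf; have [K K0 H] := tame_C1s f i tf; exact: (spec_density_dx (dl i) K (dl0 i) K0 _ _ _ k xi H). Qed.

Lemma spec_density_Dy f i k xi : tame f -> spec_density (Dy f i) k xi = (dl i * xi) ^+ 2 * spec_density (f i) k xi.
Proof.
move=> tf; have [K K0 H] := tame_C1s f i tf.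
rewrite (spec_density_scl (dl i) K (dl0 i) K0 (dl i) (dy (f i)) k xi (c1_m2 _ _ _ _ _ H) (c1_b2 _ _ _ _ _ H)).
by rewrite (spec_density_dy (dl i) K (dl0 i) (dl4 i) K0 _ _ _ k xi H) exprMn mulrA.
Qed.

Lemma tame_spec_density f (e : R) : tame f -> 0 < e -> exists2 C : R, 0 <= C &
  forall i k xi, spec_density (f i) k xi <= C * (dl i ^+ 2 * dl i `^ (- e)).
Proof.
move=> [Wf sf] e0; have [h0 _] := Wf 0%N.
have e2 : 0 < e / 2 by rewrite divr_gt0.
have [C C0 HC] := supp_bound dl f (W0_slow _ _ h0) sf _ e2.
exists (32 * C ^+ 2); first by rewrite mulr_ge0// sqr_ge0.
move=> i k xi.
have K0 : 0 <= C * dl i `^ (- (e / 2)) by rewrite mulr_ge0// powR_ge0.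
apply: (le_trans (spec_density_bound (dl i) _ (dl0 i) K0 (f i) k xi (W0_meas _ _ h0 i) (HC i))).
have -> : dl i `^ (- e) = dl i `^ (- (e / 2)) * dl i `^ (- (e / 2)).
  rewrite -powRD; last by rewrite (gt_eqF (dl0 i)) implybT.
  by congr (_ `^ _); field.
by rewrite le_eqVlt; apply/orP; left; apply/eqP; move: (powR _ _) => P; ring.
Qed.

(** The four terms of the product are the spectral densities of f, Dx^3 f, Dy^2 f and Dy^2 Dx^3 f,
    all tame. Three x-derivatives cover the weight of order s <= 2 and leave (1 + k^2)^(-1) for the
    sum over k; two y-derivatives allow the power of 1 + xi^2 to reach 2. *)
Lemma tame_decay f (e : R) : tame f -> 0 < e -> exists2 C : R, 0 <= C &
  forall i k xi, (1 + k%:~R ^+ 6) * (1 + (dl i * xi) ^+ 4) * spec_density (f i) k xi <= C * (dl i ^+ 2 * dl i `^ (- e)).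
Proof.
move=> tf e0.
have t1 := tame_Dx _ tf; have t2 := tame_Dx _ t1; have t3 := tame_Dx _ t2.
have u1 := tame_Dy _ tf; have w1 := tame_Dy _ t3.
have [C1 C10 H1] := tame_spec_density f e tf e0.
have [C2 C20 H2] := tame_spec_density _ e t3 e0.
have [C3 C30 H3] := tame_spec_density _ e (tame_Dy _ u1) e0.
have [C4 C40 H4] := tame_spec_density _ e (tame_Dy _ w1) e0.
exists (C1 + C2 + C3 + C4); first by rewrite !addr_ge0.
move=> i k xi.
pose mk t := k%:~R ^+ 2 * t : R; pose mz t := (dl i * xi) ^+ 2 * t.
have X3 := etrans (spec_density_Dx _ i k xi t2) (congr1 mk (etrans (spec_density_Dx _ i k xi t1) (congr1 mk (spec_density_Dx _ i k xi tf)))).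
have Y2 := etrans (spec_density_Dy _ i k xi u1) (congr1 mz (spec_density_Dy _ i k xi tf)).
have Y5 := etrans (spec_density_Dy _ i k xi w1) (congr1 mz (etrans (spec_density_Dy _ i k xi t3) (congr1 mz X3))).
pose bnd C t := t <= C * (dl i ^+ 2 * dl i `^ (- e)).
have := H1 i k xi; have := eq_ind _ (bnd C2) (H2 i k xi) _ X3.
have := eq_ind _ (bnd C3) (H3 i k xi) _ Y2; have := eq_ind _ (bnd C4) (H4 i k xi) _ Y5.
rewrite /bnd /mk /mz.
move: (dl i ^+ 2 * _) (spec_density _ _ _) (k%:~R : R) (dl i * xi) => Q N kk z h4 h3 h2 h1.
have -> : (1 + kk ^+ 6) * (1 + z ^+ 4) * N = N + kk ^+ 2 * (kk ^+ 2 * (kk ^+ 2 * N)) + z ^+ 2 * (z ^+ 2 * N)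
   + z ^+ 2 * (z ^+ 2 * (kk ^+ 2 * (kk ^+ 2 * (kk ^+ 2 * N)))) by ring.
by rewrite !mulrDl; do ?apply: lerD.
Qed.
End Decay.

(** * Weights, and convergence of the integral in xi and of the sum over k *)

Section PowInt.
Context {R : realType}.
Local Notation leb := (@lebesgue_measure R).

Lemma int_half_pow (q : R) : 1 < q ->
  (\int[leb]_(t in `[0%R, +oo[) ((1 + t) `^ (- q))%:E <= ((q - 1)^-1)%:E)%E.
Proof.
move=> q1; have q0 : 0 < q - 1 by rewrite subr_gt0.
pose F (n : nat) : set R := `[0%R, n%:R]%classic.
have FU : \bigcup_n F n = `[0%R, +oo[%classic.
  apply/seteqP; split => [t [n _]|t]; rewrite /F /= !in_itv/= andbT; first by move=> /andP[].
  move=> t0; exists (Num.truncn t).+1 => //; rewrite /F/= in_itv/= t0/= ltW//.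
  by have /andP[_] := truncn_itv t0.
have mf : measurable_fun setT (fun t : R => (1 + t) `^ (- q)).
  by apply: (measurableT_comp (f := fun t : R => t `^ (- q))) => //; exact: measurable_funD.
have cv : (\int[leb]_(t in F n) ((1 + t) `^ (- q))%:E)%E @[n --> \oo] --> (\int[leb]_(t in \bigcup_n F n) ((1 + t) `^ (- q))%:E)%E.
  apply: ge0_nondecreasing_set_cvg_integral.
  - by move=> m n mn; apply/subsetPset => t; rewrite /F/= !in_itv/= => /andP[-> h]/=; rewrite (le_trans h)// ler_nat.
  - by move=> n; exact: measurable_itv.
  - by move=> n; apply/measurable_EFinP; exact: measurable_funTS.
  - by move=> n t _; rewrite lee_fin powR_ge0.
rewrite -FU -(cvg_lim _ cv)//; apply: lime_le; first exact: cvgP cv.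
apply: nearW => n.
have dp (t : R) : 0 <= t -> is_derive t 1 (fun t => - ((1 + t) `^ (1 - q) / (q - 1))) ((1 + t) `^ (- q)).
  move=> t0; have t1 : 0 < 1 + t by lra.
  have h1 : is_derive t 1 (fun s : R => 1 + s) 1 by apply: (isd_eq (isdD (isd_cst 1 t) (isd_id t))); rewrite add0r.
  have h := isd_comp (f := fun s => s `^ (1 - q)) (g := fun s => 1 + s) (is_derive1_powR (1 - q) t1) h1.
  apply: (isd_eq (isdN (isdZr (q - 1)^-1 h))).
  rewrite (_ : 1 - q - 1 = - q); last by ring.
  by move: (powR _ _) => P; field; rewrite gt_eqF.
rewrite /F (@FTC2_within R (fun t => (1 + t) `^ (- q)) (fun t => - ((1 + t) `^ (1 - q) / (q - 1))) 0 n%:R).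
- rewrite lee_fin addr0 powR1 opprK mul1r gerDr oppr_le0 divr_ge0 ?powR_ge0// ltW//.
- by [].
- by move=> t /andP[t0 _]; exact: isd_derivable (dp t t0).
- by move=> t /andP[t0 _]; exact: isd_derive1 (dp t t0).
- move=> t /andP[t0 _]; apply: derivable_continuous.
  have t1 : 0 < 1 + t by lra.
  have h1 : is_derive t 1 (fun s : R => 1 + s) 1 by apply: (isd_eq (isdD (isd_cst 1 t) (isd_id t))); rewrite add0r.
  exact: isd_derivable (isd_comp (f := fun s => s `^ (- q)) (g := fun s => 1 + s) (is_derive1_powR (- q) t1) h1).
Qed.

Lemma int_line_pow (q : R) : 1 < q ->
  (\int[leb]_t ((1 + `|t|) `^ (- q))%:E <= (2 * (q - 1)^-1)%:E)%E.
Proof.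
move=> q1; have H := int_half_pow q q1.
pose g (t : R) : R := (1 + t) `^ (- q) * \1_(`[0%R, +oo[) t.
have mg : measurable_fun setT g.
  apply: measurable_funM; last by apply: measurable_indic.
  by apply: (measurableT_comp (f := fun t : R => t `^ (- q))) => //; exact: measurable_funD.
have g0 t : 0 <= g t by rewrite mulr_ge0 ?powR_ge0// indicE.
have Hg : (\int[leb]_t (g t)%:E <= ((q - 1)^-1)%:E)%E.
  apply: le_trans H; rewrite [leRHS]integral_mkcond le_eqVlt; apply/orP; left; apply/eqP.
  apply: eq_integral => t _; rewrite /g patchE indicE; case: ifPn => _; by rewrite ?mulr1 ?mulr0.
have mEg : measurable_fun setT (fun t : R => (g t)%:E) by exact/measurable_EFinP.
have Hg' : (\int[leb]_t (g (0 - t)%R)%:E <= ((q - 1)^-1)%:E)%E.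
  by rewrite (@ge0_integral_flip _ 0 (fun t => (g t)%:E)).
apply: (@le_trans _ _ (\int[leb]_t ((g t)%:E + (g (0 - t)%R)%:E))%E).
  apply: ge0_le_integral => //.
  - apply/measurable_EFinP; apply: (measurableT_comp (f := fun t : R => t `^ (- q))) => //.
    by apply: measurable_funD => //; exact: measurableT_comp.
  - by apply: emeasurable_funD => //; apply: (measurableT_comp mEg); exact: measurable_funB.
  - move=> t _; rewrite lee_fin.
    have i1 (u : R) : 0 <= u -> g u = (1 + u) `^ (- q).
      by move=> u0; rewrite /g indicE mem_set ?mulr1//= in_itv/= u0.
    have [t0|t0] := leP 0 t.
      by rewrite (i1 t t0) (ger0_norm t0) lerDl.
    have n0 : 0 <= 0 - t by rewrite sub0r oppr_ge0 ltW.
    by rewrite (i1 _ n0) (ltr0_norm t0) sub0r lerDr.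
have mEg' : measurable_fun setT (fun t : R => (g (0 - t))%:E).
  by apply: (measurableT_comp mEg); exact: measurable_funB.
have p1 t : setT t -> (0 <= (g t)%:E)%E by rewrite lee_fin.
have p2 t : setT t -> (0 <= (g (0 - t)%R)%:E)%E by rewrite lee_fin.
rewrite (ge0_integralD leb measurableT p1 mEg p2 mEg').
by rewrite mulr_natl mulr2n EFinD; exact: leeD.
Qed.
End PowInt.

Section Weights.
Context {R : realType}.
Local Notation leb := (@lebesgue_measure R).

Lemma cube_le (t : R) : 0 <= t -> (1 + t) ^+ 3 <= 4 * (1 + t ^+ 3).
Proof.
move=> t0; rewrite -subr_ge0.
have -> : 4 * (1 + t ^+ 3) - (1 + t) ^+ 3 = 3 * ((1 - t) ^+ 2 * (1 + t)) by ring.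
by apply: mulr_ge0 => //; apply: mulr_ge0; [exact: sqr_ge0|exact: addr_ge0].
Qed.

Lemma powR_mono (a b r : R) : 0 <= r -> 0 <= a -> a <= b -> a `^ r <= b `^ r.
Proof. by move=> r0 a0 ab; apply: (ge0_ler_powR r0); rewrite ?nnegrE// (le_trans a0). Qed.

(** As d <= 1, d^2 (1 + xi^2) is at most 1 + (d xi)^2, a quantity above 1 whose power sg is at most
    its square. *)
Lemma weight_xi (d xi sg : R) : 0 < d <= 1 -> 0 <= sg <= 2 ->
  d `^ (2 * sg) * (1 + xi ^+ 2) `^ sg <= 2 * (1 + (d * xi) ^+ 4).
Proof.
move=> /andP[d0 d1] /andP[s0 s2].
have d2 : d ^+ 2 <= 1 by rewrite expr_le1// ltW.
have x2 : 0 <= xi ^+ 2 by rewrite sqr_ge0.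
rewrite powRrM (powR_mulrn 2 (ltW d0)) -powRM ?sqr_ge0 ?addr_ge0//.
have z2 : 0 <= (d * xi) ^+ 2 by rewrite sqr_ge0.
apply: (@le_trans _ _ ((1 + (d * xi) ^+ 2) `^ sg)).
  apply: powR_mono => //; first by apply: mulr_ge0; [exact: sqr_ge0|exact: addr_ge0].
  by rewrite mulrDr mulr1 exprMn lerD2r.
apply: (@le_trans _ _ ((1 + (d * xi) ^+ 2) `^ 2)).
  by apply: ler_powR => //; rewrite lerDl.
rewrite (powR_mulrn 2) ?addr_ge0//.
have -> : (d * xi) ^+ 4 = ((d * xi) ^+ 2) ^+ 2 by rewrite -exprM.
move: ((d * xi) ^+ 2) z2 => z z0.
have : 0 <= (1 - z) ^+ 2 by rewrite sqr_ge0.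
by rewrite !expr2; lra.
Qed.

(** The weight is split by 1 + k^2 + xi^2 <= (1 + k^2)(1 + xi^2). The surplus [tau] buys decay in xi
    for the integral and is paid for by the larger power d^(- 2 (s + tau)). *)
Lemma weight_pt (s d xi kk N B sg tau : R) : 0 <= s <= 2 -> sg = s + tau -> 0 <= tau -> sg <= 2 ->
  0 < d <= 1 -> 0 <= N -> (1 + kk ^+ 6) * (1 + (d * xi) ^+ 4) * N <= B ->
  (1 + kk ^+ 2 + xi ^+ 2) `^ s * N <= 8 * B * d `^ (- (2 * sg)) * (1 + kk ^+ 2)^-1 * (1 + xi ^+ 2) `^ (- tau).
Proof.
move=> /andP[s0 s2] sgE t0 sg2 d01 N0 HB; have /andP[d0 d1] := d01.
have x2 : 0 <= xi ^+ 2 by rewrite sqr_ge0.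
have k2 : 0 <= kk ^+ 2 by rewrite sqr_ge0.
set a := 1 + kk ^+ 2; set b := 1 + xi ^+ 2.
have a1 : 1 <= a by rewrite lerDl.
have b1 : 1 <= b by rewrite lerDl.
have a0 : 0 < a by lra.
have b0 : 0 < b by lra.
have h1 : (a + xi ^+ 2) `^ s <= a `^ s * b `^ s.
  rewrite -powRM ?(ltW a0) ?(ltW b0)//; apply: powR_mono => //; first by rewrite addr_ge0// ltW.
  by rewrite /b mulrDr mulr1 lerD2l ler_peMl.
have h2 : a `^ s * a <= 4 * (1 + kk ^+ 6).
  have -> : kk ^+ 6 = (kk ^+ 2) ^+ 3 by rewrite -exprM.
  apply: le_trans (cube_le _ k2); rewrite exprSr ler_pM2r//.
  by rewrite -(powR_mulrn 2 (ltW a0)); exact: ler_powR.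
have h3 : b `^ s * b `^ tau * d `^ (2 * sg) <= 2 * (1 + (d * xi) ^+ 4).
  rewrite -powRD; last by rewrite (gt_eqF b0) implybT.
  rewrite -sgE mulrC; apply: weight_xi => //.
  by rewrite sg2 andbT sgE addr_ge0.
have T0 : 0 < b `^ tau by exact: powR_gt0.
have D0 : 0 < d `^ (2 * sg) by exact: powR_gt0.
rewrite (powRN b) (powRN d).
have -> : 8 * B * (d `^ (2 * sg))^-1 * a^-1 * (b `^ tau)^-1 = 8 * B / (d `^ (2 * sg) * a * b `^ tau).
  by rewrite !invfM !mulrA.
rewrite ler_pdivlMr ?mulr_gt0//.
apply: (@le_trans _ _ ((a `^ s * b `^ s) * N * (d `^ (2 * sg) * a * b `^ tau))).
  by rewrite ler_pM2r ?mulr_gt0// ler_wpM2r.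
have -> : a `^ s * b `^ s * N * (d `^ (2 * sg) * a * b `^ tau) = (a `^ s * a) * (b `^ s * b `^ tau * d `^ (2 * sg)) * N.
  by move: (a `^ s) (b `^ s) (d `^ _) (b `^ tau) => *; ring.
have k6 : 0 <= 1 + kk ^+ 6 by rewrite addr_ge0// exprn_even_ge0.
apply: (@le_trans _ _ ((4 * (1 + kk ^+ 6)) * (2 * (1 + (d * xi) ^+ 4)) * N)).
  apply: ler_wpM2r => //; apply: ler_pM => //; rewrite ?mulr_ge0 ?powR_ge0 ?(ltW a0)//.
have -> : 4 * (1 + kk ^+ 6) * (2 * (1 + (d * xi) ^+ 4)) * N = 8 * ((1 + kk ^+ 6) * (1 + (d * xi) ^+ 4) * N) by ring.
by rewrite ler_pM2l.
Qed.

Lemma japanese (xi tau : R) : 0 <= tau ->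
  (1 + xi ^+ 2) `^ (- tau) <= 2 `^ tau * (1 + `|xi|) `^ (- (2 * tau)).
Proof.
move=> t0; have x2 : 0 <= xi ^+ 2 by rewrite sqr_ge0.
have b0 : 0 < 1 + xi ^+ 2 by rewrite ltr_pwDl.
have n0 : 0 < 1 + `|xi| by rewrite ltr_pwDl.
rewrite !powRN ler_pdivlMr ?powR_gt0// mulrC ler_pdivrMr ?powR_gt0//.
rewrite powRrM (powR_mulrn 2 (ltW n0)) -powRM ?(ltW b0)//.
apply: (powR_mono _ _ _ t0 (sqr_ge0 _)).
have : 0 <= (1 - `|xi|) ^+ 2 by rewrite sqr_ge0.
by rewrite -(real_normK (num_real xi)) !expr2; lra.
Qed.

(** Telescoping: 1 / (1 + n^2) is at most 4 (1 / (n + 1) - 1 / (n + 2)). *)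
Lemma sum_inv_sq (u : nat -> \bar R) (M : R) : 0 <= M -> (forall n, (0 <= u n)%E) ->
  (forall n, (u n <= (M * (1 + n%:R ^+ 2)^-1)%:E)%E) -> (\sum_(0 <= n <oo) u n <= (4 * M)%:E)%E.
Proof.
move=> M0 u0 uM.
have part n : (\sum_(0 <= i < n) u i <= (4 * M * (1 - (n.+1%:R)^-1))%:E)%E.
  elim: n => [|n IH]; first by rewrite big_geq// invr1 subrr mulr0.
  rewrite big_nat_recr//=; apply: (le_trans (leeD IH (uM n))); rewrite -EFinD lee_fin.
  have -> : n.+2%:R = n%:R + 2 :> R by rewrite -[n.+2]addn2 natrD.
  have -> : n.+1%:R = n%:R + 1 :> R by rewrite -natr1.
  have := ler0n R n; move: (n%:R : R) => x x0.
  have y1 : 0 < x + 1 by lra.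
  have y2 : 0 < x + 2 by lra.
  have y3 : 0 < 1 + x ^+ 2 by rewrite ltr_pwDl// sqr_ge0.
  rewrite -lerBrDl.
  have -> : 4 * M * (1 - (x + 2)^-1) - 4 * M * (1 - (x + 1)^-1) = M * (4 / ((x + 1) * (x + 2))).
    by field; rewrite !gt_eqF.
  apply: ler_wpM2l => //; rewrite ler_pdivlMr ?mulr_gt0// mulrC ler_pdivrMr//.
  rewrite expr2; have : 0 <= (x - 1 / 2) ^+ 2 by rewrite sqr_ge0.
  by rewrite expr2; lra.
apply: lime_le; first by apply: is_cvg_nneseries => n _ _; exact: u0.
apply: nearW => n; apply: (le_trans (part n)); rewrite lee_fin ler_piMr ?mulr_ge0// gerBl invr_ge0 ler0n//.
Qed.
End Weights.

(** * The Sobolev norm as a positive power of the width *)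

Section HsBound.
Context {R : realType} {I : Type}.
Variable dl : I -> R.
Hypothesis dl0 : forall i, 0 < dl i.
Hypothesis dl4 : forall i, 4 * dl i <= 1.
Local Notation leb := (@lebesgue_measure R).
Variable s : R.
Hypothesis s0 : 0 <= s.
Hypothesis s1 : s < 3 / 2.
Variables (v : I -> R -> R -> R) (c : I -> R).
Hypothesis tv : tame dl v.
Hypothesis c32 : forall i, `|c i| <= 32 * dl i.

Lemma Hs_small : exists C g : R, [/\ 0 <= C, 0 < g &
  forall i, (Hs_norm2 s (fun x y => (c i * v i x y)%R) <= (C * dl i `^ g)%:E)%E].
Proof.
(* The integral in xi needs tau > 1/2, the final power of d needs s + tau < 2; tau is the midpoint
   of 1/2 and 2 - s, an interval that is nonempty exactly when s < 3/2. The factor c^2 gives d^2,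
   the density d^(2 - eta) and the weight d^(- 2 sg), in all d^(4 - 2 sg - eta) = d^eta. *)
pose sg := s / 2 + 5 / 4; pose tau := 5 / 4 - s / 2; pose eta := 2 - sg.
have eta0 : 0 < eta by rewrite /eta /sg; have := s1; lra.
have tau0 : 0 < tau by rewrite /tau; have := s1; lra.
have q1 : 1 < 2 * tau by rewrite /tau; have := s1; lra.
have sg2 : sg <= 2 by rewrite /sg; have := s1; lra.
have sgE : sg = s + tau by rewrite /sg /tau; field.
have s2 : 0 <= s <= 2 by rewrite s0/=; have := s1; lra.
have [C C0 HC] := tame_decay dl dl0 dl4 v eta tv eta0.
pose J := (2 * tau - 1)^-1 : R.
have J0 : 0 <= J by rewrite invr_ge0 subr_ge0 ltW.
pose D := 8 * (32 * 32 * C) * 2 `^ tau * (2 * J).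
have D0 : 0 <= D by rewrite !mulr_ge0// powR_ge0.
exists (4 * D + 4 * D), eta; split=> //; first by rewrite addr_ge0// mulr_ge0.
move=> i; have d0 := dl0 i.
have d01 : 0 < dl i <= 1 by rewrite d0/=; have := dl4 i; lra.
have [K K0 H] := tame_C1s dl dl0 v i tv.
have mv := c1_m _ _ _ _ _ H; have bv := c1_b _ _ _ _ _ H.
have mode k : (0 <= Hs_mode s (fun x y => (c i * v i x y)%R) k <= (D * dl i `^ eta * (1 + k%:~R ^+ 2)^-1)%:E)%E.
  pose B := c i ^+ 2 * (C * (dl i ^+ 2 * dl i `^ (- eta))).
  have HN xi : spec_density (fun x y => c i * v i x y) k xi = c i ^+ 2 * spec_density (v i) k xi.
    exact: (spec_density_scl (dl i) K (dl0 i) K0).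
  have pt xi : (1 + k%:~R ^+ 2 + xi ^+ 2) `^ s * spec_density (fun x y => c i * v i x y) k xi <=
     (8 * B * dl i `^ (- (2 * sg)) * (1 + k%:~R ^+ 2)^-1 * 2 `^ tau) * (1 + `|xi|) `^ (- (2 * tau)).
    have HB : (1 + k%:~R ^+ 6) * (1 + (dl i * xi) ^+ 4) * spec_density (fun x y => c i * v i x y) k xi <= B.
      by rewrite HN mulrCA ler_wpM2l ?sqr_ge0.
    apply: (le_trans (weight_pt s (dl i) xi k%:~R _ B sg tau s2 sgE (ltW tau0) sg2 d01 (spec_density_ge0 _ _ _) HB)).
    rewrite -[leRHS]mulrA; apply: ler_wpM2l; last by apply: japanese; exact: ltW.
    have B0 : 0 <= B by rewrite mulr_ge0 ?sqr_ge0// mulr_ge0// mulr_ge0 ?sqr_ge0 ?powR_ge0.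
    by rewrite mulr_ge0 ?invr_ge0 ?addr_ge0 ?sqr_ge0// mulr_ge0 ?powR_ge0// mulr_ge0.
  have B0 : 0 <= B by rewrite mulr_ge0 ?sqr_ge0// mulr_ge0// mulr_ge0 ?sqr_ge0 ?powR_ge0.
  have Bd : B * dl i `^ (- (2 * sg)) <= (32 * 32 * C) * dl i `^ eta.
    have c2 : c i ^+ 2 <= (32 * dl i) ^+ 2.
      rewrite -[leLHS]real_normK ?num_real// ler_pXn2r ?nnegrE//.
      by rewrite mulr_ge0// ltW.
    apply: (@le_trans _ _ ((32 * dl i) ^+ 2 * (C * (dl i ^+ 2 * dl i `^ (- eta))) * dl i `^ (- (2 * sg)))).
      rewrite ler_wpM2r ?powR_ge0// ler_wpM2r// mulr_ge0// mulr_ge0 ?sqr_ge0 ?powR_ge0//.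
    have -> : dl i `^ eta = dl i `^ 2 * dl i `^ 2 * dl i `^ (- eta) * dl i `^ (- (2 * sg)).
      rewrite -!powRD ?(gt_eqF d0) ?implybT//; congr (_ `^ _); rewrite /eta; ring.
    rewrite (powR_mulrn 2 (ltW d0)) le_eqVlt; apply/orP; left; apply/eqP.
    by move: (powR _ _) (powR _ _) => P Q; ring.
  have a0 : 0 <= (1 + k%:~R ^+ 2 : R)^-1 by rewrite invr_ge0 addr_ge0// sqr_ge0.
  have e0 : 0 <= 8 * B * dl i `^ (- (2 * sg)) * (1 + k%:~R ^+ 2)^-1 * 2 `^ tau.
    by rewrite mulr_ge0 ?powR_ge0// mulr_ge0// mulr_ge0 ?powR_ge0// mulr_ge0.
  have mJ : measurable_fun setT (fun xi : R => (1 + `|xi|) `^ (- (2 * tau))).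
    apply: (measurableT_comp (f := fun t : R => t `^ (- (2 * tau)))) => //.
    by apply: measurable_funD => //; exact: measurableT_comp.
  have mL : measurable_fun setT (fun xi : R => (1 + k%:~R ^+ 2 + xi ^+ 2) `^ s * spec_density (fun x y => c i * v i x y) k xi).
    apply: measurable_funM.
      apply: (measurableT_comp (f := fun t : R => t `^ s)) => //.
      by apply: measurable_funD => //; exact: measurable_funX.
    by apply: measurable_spec_density; apply: measurable_funM.
  have L0 xi : 0 <= (1 + k%:~R ^+ 2 + xi ^+ 2) `^ s * spec_density (fun x y => c i * v i x y) k xi.
    by rewrite mulr_ge0 ?powR_ge0 ?spec_density_ge0.
  apply/andP; split; first by apply: integral_ge0 => xi _; rewrite lee_fin; exact: L0.
  apply: (@le_trans _ _ (\int[leb]_xi ((8 * B * dl i `^ (- (2 * sg)) * (1 + k%:~R ^+ 2)^-1 * 2 `^ tau) * (1 + `|xi|) `^ (- (2 * tau)))%:E)%E).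
    apply: ge0_le_integral => //.
    - by move=> xi _; rewrite lee_fin; exact: L0.
    - by apply/measurable_EFinP.
    - by apply/measurable_EFinP; exact: measurable_funM.
    - by move=> xi _; rewrite lee_fin; exact: pt.
  apply: (le_trans (int_scl setT _ _ _ measurableT mJ (fun t => powR_ge0 _ _) e0 (int_line_pow (2 * tau) q1))).
  rewrite lee_fin -/J.
  have -> : 8 * B * dl i `^ (- (2 * sg)) * (1 + k%:~R ^+ 2)^-1 * 2 `^ tau * (2 * J) =
     (B * dl i `^ (- (2 * sg))) * (8 * (1 + k%:~R ^+ 2)^-1 * 2 `^ tau * (2 * J)).
    by move: (powR _ _) (powR _ _) (_^-1) => P Q S; ring.
  apply: (le_trans (ler_wpM2r _ Bd)).
    by rewrite mulr_ge0 ?mulr_ge0 ?powR_ge0.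
  rewrite le_eqVlt; apply/orP; left; apply/eqP; rewrite /D.
  by move: (powR _ _) (powR _ _) (_^-1) => P Q S; ring.
have Dp : 0 <= D * dl i `^ eta by rewrite mulr_ge0// powR_ge0.
have -> : (4 * D + 4 * D) * dl i `^ eta = 4 * (D * dl i `^ eta) + 4 * (D * dl i `^ eta) by ring.
rewrite EFinD; apply: leeD.
  apply: sum_inv_sq => // n; first by have /andP[] := mode n.
  by have /andP[_] := mode n.
apply: sum_inv_sq => // n; first by have /andP[] := mode (- (n.+1)%:Z).
(* The index n stands for k = - (n + 1), and |k| >= n makes its bound at most the one for n. *)
have /andP[_ h] := mode (- (n.+1)%:Z); apply: (le_trans h); rewrite lee_fin; apply: ler_wpM2l => //.
rewrite lef_pV2 ?posrE ?ltr_pwDl ?sqr_ge0// lerD2l mulrNz sqrrN.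
by rewrite ler_pXn2r ?nnegrE ?ler0n// ler_nat.
Qed.
End HsBound.

(** * The Euler equation *)

Section Euler.
Context {R : realType}.
Local Notation leb := (@lebesgue_measure R).
Local Notation leb2 := (leb \x leb)%E.
Local Notation TRR := (@TR R).
Local Notation tpi := (2 * pi : R).
Local Notation I2 := (Rintegral leb2 TRR).
Local Notation int2 f := (leb2.-integrable TRR (EFin \o f)).

(** A translation in x is the product of two reflections, each covered by [flipx]. *)
Lemma I2_shift (tau : R) (f : R * R -> R) : measurable_fun setT f ->
  (forall u w, f (u + tpi, w) = f (u, w)) -> I2 (fun z => f (z.1 + tau, z.2)) = I2 f.
Proof.
move=> mf pf; pose f' (z : R * R) := f (- z.1, z.2).
have mf' : measurable_fun setT f'.
  apply: (measurableT_comp mf); apply/measurable_fun_pairP; split => /=; last exact: measurable_snd.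
  by apply: (measurable_fst1 (fun t => - t)); exact: measurableT_comp.
have pf' u w : f' (u + tpi, w) = f' (u, w).
  by rewrite /f'/= -(pf (- (u + tpi))); congr (f (_, _)); ring.
have E1 := flipx (- tau) f' mf' pf'; have E2 := flipx 0 f mf pf.
have -> : I2 (fun z => f (z.1 + tau, z.2)) = I2 (fun z => f' (- tau - z.1, z.2)).
  by apply: eq_Rintegral => z _; rewrite /f'/=; congr (f (_, _)); ring.
rewrite E1 -[RHS]E2; apply: eq_Rintegral => z _.
by rewrite /f' sub0r.
Qed.

Lemma stream_shift (w : R -> R -> R) (tau x y : R) : measurable_fun setT (fun z : R * R => w z.1 z.2) ->
  periodic_x w -> stream (fun a b => w (a + tau) b) x y = stream w (x + tau) y.
Proof.
move=> mw pw; rewrite /stream; congr (_ * _).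
pose f (z : R * R) := ln (cosh (y - z.2) - cos (x + tau - z.1)) * w z.1 z.2.
rewrite -[RHS](I2_shift tau f).
- apply: eq_Rintegral => z _; rewrite /f/=; congr (ln (_ - cos _) * _); ring.
- apply: measurable_funM => //; apply: (measurableT_comp (f := @ln R)) => //; apply: measurable_funB.
    apply: (measurable_snd1 (fun t => cosh (y - t))); apply: (measurableT_comp measurable_cosh).
    exact: measurable_funB.
  apply: (measurable_fst1 (fun t => cos (x + tau - t))); apply: (measurableT_comp measurable_cosR).
  exact: measurable_funB.
- move=> u b; rewrite /f/= pw; congr (ln (_ - _) * _).
  by rewrite -[LHS]cos_period; congr cos; ring.
Qed.

Variables (d al e0 : R) (v : R -> R -> R).
Hypothesis d0 : 0 < d.
Hypothesis d4 : 4 * d <= 1.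
Hypothesis Hv : profile d v al e0.
Local Notation P := (fun x y => al * (d^-1 * conv v x y) + e0 + par d y).
Hypothesis dPx : forall x y : R, derivable (fun t => P t y) x 1.
Hypothesis dPy : forall x y : R, derivable (P x) y 1.
Let c : R := - (al * d).
Let Om : R -> R -> R := fun x y => c * v x y.

Let vK x y : `|v x y| <= 1 * sI d y.
Proof.
have [h|h] := leP `|y + 1| (2 * d); last by rewrite (pf_out _ _ _ _ Hv)// normr0 sI_out// mulr0.
by rewrite sI_in// mulr1 (pf_eq _ _ _ _ Hv) ger0_norm ?ff_ge0 ?ff_le1.
Qed.

(** The minus sign in [Om] cancels that of [kap], so the stream function is al d times the
    convolution up to a constant; the quadratic term undoes the parabola in [P]. The ln 2 of [kap]
    and [e0] enter only the constant, which the velocity does not see. *)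
Lemma stream_profile : exists c1 : R, forall x y, stream Om x y = d ^+ 2 * P x y + (y + 1) ^+ 2 / 2 + c1.
Proof.
exists ((4 * pi)^-1 * (al * d * ln 2 * I2 (fun z => v z.1 z.2)) - d ^+ 2 * e0 - d ^+ 2) => x y.
have mv := pf_meas _ _ _ _ Hv.
have [A A0 HA] := sinp_bound (R := R) 2^-1 half01.
have HL w : `|w + 1| <= 2 * d -> `|y - w| <= `|y| + 2.
  by move=> hw; have := dist_loc d y w `|y| d4 (lexx _) hw; rewrite normr_id.
have [ik _] := conv_bound d d0 v 1 mv ler01 vK x y _ A HA HL.
have [iv _] := int2_strip d d0 (fun z => v z.1 z.2) 1 ler01 mv (fun z => vK z.1 z.2).
have pn : pi != 0 :> R by rewrite gt_eqF// pi_gt0.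
have E : I2 (fun z => ln (cosh (y - z.2) - cos (x - z.1)) * Om z.1 z.2) =
   4 * pi * (al * d) * conv v x y + al * d * ln 2 * I2 (fun z => v z.1 z.2).
  have -> : (fun z : R * R => ln (cosh (y - z.2) - cos (x - z.1)) * Om z.1 z.2) =
     (fun z => 4 * pi * (al * d) * (kap (x - z.1) (y - z.2) * v z.1 z.2) + al * d * ln 2 * v z.1 z.2).
    apply/funext => z; rewrite /Om /c /kap.
    move: (ln _) (v _ _) (ln 2) (pi : R) pn => L V T Q Qn.
    by field.
  rewrite RintegralD//; [|exact: measurable_TR|exact: int2Z|exact: int2Z].
  by rewrite !RintegralZl//; exact: measurable_TR.
rewrite /stream E /par.
have dn : d != 0 by rewrite gt_eqF.
move: (conv v x y) (I2 _) (ln 2) (pi : R) pn => V J T Q Qn.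
by field; rewrite Qn dn.
Qed.

(** Speed 1 gives the transport term (y + 1) d/dx, which cancels the summand y + 1 of the
    y-derivative of the stream function. What remains is d^2 times the Jacobian of [P] and a
    function of [P], which is zero. *)
Lemma euler_profile : euler_couette_solution (traveling Om 1).
Proof.
have [c1 Hs] := stream_profile.
have mv := pf_meas _ _ _ _ Hv; have pv := pf_per _ _ _ _ Hv.
have mO : measurable_fun setT (fun z : R * R => Om z.1 z.2) by exact: measurable_funM.
have pO : periodic_x Om by move=> x y; rewrite /Om pv.
pose Px (x y : R) : R := derive1 (fun t => P t y) x.
pose Py (x y : R) : R := derive1 (P x) y.
pose F' (x y : R) : R := - 0%:R * ff 1 (P x y) + ff 2 (P x y).
have Ox (x y : R) : is_derive x 1 (fun t => Om t y) (c * (F' x y * Px x y)).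
  have h := isdZ c (isd_comp (g := fun t => P t y) (isd_ff 0 (P x y)) (derivable_isd (dPx x y))).
  have E : (fun t => Om t y) = (fun t => c * ff 0 (P t y)).
    by apply/funext => t; rewrite /Om (pf_eq _ _ _ _ Hv).
  by rewrite E; exact: h.
have Oy (x y : R) : is_derive y 1 (Om x) (c * (F' x y * Py x y)).
  have h := isdZ c (isd_comp (g := P x) (isd_ff 0 (P x y)) (derivable_isd (dPy x y))).
  have E : Om x = (fun t => c * ff 0 (P x t)).
    by apply/funext => t; rewrite /Om (pf_eq _ _ _ _ Hv).
  by rewrite E; exact: h.
have Sx (x y : R) : is_derive x 1 (fun t => stream Om t y) (d ^+ 2 * Px x y).
  have E : (fun t => stream Om t y) = (fun t => d ^+ 2 * P t y + ((y + 1) ^+ 2 / 2 + c1)).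
    by apply/funext => t; rewrite Hs; symmetry; exact: addrA.
  have h := isdD (isdZ (d ^+ 2) (derivable_isd (dPx x y))) (isd_cst ((y + 1) ^+ 2 / 2 + c1) x).
  by rewrite E; apply: (isd_eq h); rewrite addr0.
have Sy (x y : R) : is_derive y 1 (stream Om x) (d ^+ 2 * Py x y + (y + 1)).
  have E : stream Om x = (fun t => d ^+ 2 * P x t + ((t + 1) * (t + 1) * 2^-1 + c1)).
    by apply/funext => t; rewrite Hs (expr2 (t + 1)); symmetry; exact: addrA.
  have h1 : is_derive y 1 (fun y : R => y + 1) 1 by apply: (isd_eq (isdD (isd_id y) (isd_cst 1 y))); rewrite addr0.
  have h := isdD (isdZ (d ^+ 2) (derivable_isd (dPy x y))) (isdD (isdZr 2^-1 (isdM h1 h1)) (isd_cst c1 y)).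
  by rewrite E; apply: (isd_eq h); congr (_ + _); field.
have sh (x t : R) : is_derive x 1 (fun s : R => s + 1 * t) 1.
  by apply: (isd_eq (isdD (isd_id x) (isd_cst (1 * t) x))); rewrite addr0.
have sh2 (x t : R) : is_derive t 1 (fun s : R => x + 1 * s) 1.
  by apply: (isd_eq (isdD (isd_cst x t) (isdZ 1 (isd_id t)))); rewrite add0r mulr1.
move=> x y t.
have psiE : stream (traveling Om 1 t) = (fun a b => stream Om (a + 1 * t) b).
  by apply/funext => a; apply/funext => b; exact: stream_shift.
have D1 := isd_comp (f := fun a => Om a y) (g := fun s => x + 1 * s) (Ox (x + 1 * t) y) (sh2 x t).
have D2 := isd_comp (f := fun a => Om a y) (g := fun s => s + 1 * t) (Ox (x + 1 * t) y) (sh x t).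
have D3 := Oy (x + 1 * t) y.
have D4 := isd_comp (f := fun a => stream Om a y) (g := fun s => s + 1 * t) (Sx (x + 1 * t) y) (sh x t).
have D5 := Sy (x + 1 * t) y.
rewrite psiE.
split; first exact: isd_derivable D1.
split; first exact: isd_derivable D2.
split; first exact: isd_derivable D3.
split; first exact: isd_derivable D4.
split; first exact: isd_derivable D5.
have -> : derive1 (fun s => traveling Om 1 s x y) t = _ := isd_derive1 D1.
have -> : dx (traveling Om 1 t) x y = _ := isd_derive1 D2.
have -> : dy (traveling Om 1 t) x y = _ := isd_derive1 D3.
have -> : dx (fun a b => stream Om (a + 1 * t) b) x y = _ := isd_derive1 D4.
have -> : dy (fun a b => stream Om (a + 1 * t) b) x y = _ := isd_derive1 D5.
by move: (Px _ _) (Py _ _) (F' _ _) => a b e; ring.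
Qed.
End Euler.

(** * Choice of the width for a given eps *)

Theorem theorem1p1 (R : realType) (s : R) (hs0 : 0 <= s) (hs1 : s < 3 / 2) :
  exists c C : R, 0 < c /\ c <= C /\
  forall eps : R, 0 < eps ->
  exists (Om : R -> R -> R) (lam : R),
    periodic_x Om /\ smooth2 Om /\ compact_support_y Om /\
    (exists x1 x2 y, Om x1 y <> Om x2 y) /\
    euler_couette_solution (traveling Om lam) /\
    (Hs_norm2 s Om < (eps ^+ 2)%:E)%E /\
    c <= `|lam| <= C.
Proof.
exists 1, 1; split; first exact: ltr01; split; first exact: lexx.
move=> eps eps0.
have [d1 [/andP[d10 d14] Hp]] := @exists_profile R.
(* One profile is chosen for every admissible width at once: the constants of [Hs_small] belong to
   the whole family, and eps selects a member only afterwards. *)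
pose I := {d : R | 0 < d <= d1}.
pose dl (i : I) : R := sval i.
have dl0 i : 0 < dl i by case: i => d /= /andP[].
have dl4 i : 4 * dl i <= 1 by case: i => d /= /andP[_ h]; lra.
have ex (i : I) : exists p : (R -> R -> R) * R * R, profile (dl i) p.1.1 p.1.2 p.2.
  by have [v [al [e0 h]]] := Hp (dl i) (svalP i); exists (v, al, e0).
have [p Hpp] := choice ex.
pose v i := (p i).1.1; pose al i := (p i).1.2; pose e0 i := (p i).2.
have prof i : profile (dl i) (v i) (al i) (e0 i) by exact: Hpp.
have PW := profile_W dl dl0 dl4 v al e0 prof.
have tv : tame dl v by split; [move=> n; exact: (PW n).1|exact: (supp_v dl v al e0 prof)].
pose c i := - (al i * dl i).
have c32 i : `|c i| <= 32 * dl i.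
  have /andP[a1 a2] := pf_al _ _ _ _ (prof i).
  by rewrite /c normrN normrM !gtr0_norm// ler_pM2r.
have [C [g [C0 g0 HC]]] := Hs_small dl dl0 dl4 s hs0 hs1 v c tv c32.
pose z := eps ^+ 2 / (C + 1).
have C1 : 0 < C + 1 by rewrite ltr_wpDl.
have e2 : 0 < eps ^+ 2 by rewrite exprn_gt0.
have z0 : 0 < z by rewrite divr_gt0.
(* Then C d^g <= C z = C eps^2 / (C + 1) < eps^2; the denominator C + 1 covers the case C = 0. *)
pose d := Num.min d1 (z `^ g^-1).
have dd : 0 < d <= d1 by rewrite /d lt_min d10 powR_gt0//= ge_min lexx.
pose i : I := exist _ d dd.
have [_ [dP _]] := (PW 1%N).2.
have Wc n := W_scl dl dl0 dl4 n v (c i) ((PW n).1).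
have dlE : dl i = d by [].
have /andP[a1 a2] := pf_al _ _ _ _ (prof i).
exists (fun x y => c i * v i x y), 1.
split; first by move=> x y; rewrite (pf_per _ _ _ _ (prof i)).
split; first exact: (smooth2_W dl dl0 dl4 (fun j x y => c i * v j x y) i Wc).
split.
  exists 3 => x y hy; rewrite (pf_out _ _ _ _ (prof i)) ?mulr0//.
  have h1 := ler_normB (y + 1) 1; rewrite addrK normr1 in h1.
  by have := dl4 i; lra.
split.
  exists 0, pi, (-1) => /mulfI h; apply: (pf_nt _ _ _ _ (prof i)); apply: h.
  by rewrite /c oppr_eq0 mulf_neq0// gt_eqF.
split.
  apply: (euler_profile (dl i) (al i) (e0 i) (v i) (dl0 i) (dl4 i) (prof i)) => x y.
    exact: (dP i x y).1.
  exact: (dP i x y).2.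
split; last by rewrite normr1 lexx.
apply: (le_lt_trans (HC i)); rewrite lte_fin dlE.
have dz : d `^ g <= z.
  apply: (@le_trans _ _ ((z `^ g^-1) `^ g)).
    apply: powR_mono; [exact: ltW|by have /andP[/ltW] := dd|by rewrite /d ge_min lexx orbT].
  by rewrite -powRrM mulVf ?gt_eqF// powRr1// ltW.
apply: (le_lt_trans (ler_wpM2l C0 dz)).
rewrite /z mulrA ltr_pdivrMr// mulrC ltr_pM2l//; lra.
Qed.
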